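(* Let $T$ be a map from $[0,1]$ to $[0,1]$ preserving a probability $\mu$ on $[0,1]$. If $T$ is $BV$-contracting and if $f$ belongs to $BV\cup\mathcal L$, then, with $\sigma\ge0$ given by $$\sigma^2=\sigma^2(f)=\mu\big((f-\mu(f))^2\big)+2\sum_{n>0}\mu\big(f\circ T^n\cdot(f-\mu(f))\big),$$ for every sequence $(a_n)$ of positive numbers with $a_n\to0$ and $na_n\to\infty$, the processes $$W_n(t)=n^{-1/2}\sum_{i=1}^{[nt]}\big(f\circ T^{\,n-i+1}-\mu(f)\big),\qquad t\in[0,1],$$ considered as random elements on the probability space $([0,1],\mu)$, satisfy the moderate deviation principle in $D([0,1])$ with speed $a_n$ and good rate function $I_\sigma$.
   Context: $\mu(g)=\int g\,d\mu$. The Perron-Frobenius operator $K:L^2([0,1],\mu)\to L^2([0,1],\mu)$ of $T$ is defined by $\int_0^1(Kh)(x)f(x)\,\mu(dx)=\int_0^1h(x)(f\circ T)(x)\,\mu(dx)$. $BV$ is the class of bounded variation functions from $[0,1]$ to $\mathbf R$, and for $f\in BV$, $\|df\|=\sup\{\int g\,df:\|g\|_\infty\le1\}$ is the total variation norm of the measure $df$. $T$ is $BV$-contracting if there exist $\kappa>0$ and $\rho\in[0,1[$ such that $\|dK^n(f)\|\le\kappa\rho^n\|df\|$ for all $f\in BV$ and all $n$. $\mathcal L$ is the class of functions $f:\mathbf R\to\mathbf R$ such that $|f(x)-f(y)|\le c(|x-y|)$ for some concave and non-decreasing function $c$ satisfying $\int_0^1\frac{c(t)}{t\sqrt{|\log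 t|}}\,dt<\infty$. $D([0,1])$ is the space of right-continuous functions on $[0,1]$ with left-hand limits, with the Skorohod topology. $(W_n)$ satisfies the moderate deviation principle (MDP) in $D([0,1])$ with speed $a_n$ and good rate function $I$ if $\{x: I(x)\le\alpha\}$ is compact for every $\alpha<\infty$ and, for every Borel set $\Gamma\subseteq D([0,1])$ with interior $\Gamma^0$ and closure $\bar\Gamma$ (here $\mathbf P=\mu$), $$-\inf_{x\in\Gamma^0}I(x)\le\liminf_n a_n\log\mathbf P(\sqrt{a_n}\,W_n\in\Gamma)\le\limsup_n a_n\log\mathbf P(\sqrt{a_n}\,W_n\in\Gamma)\le-\inf_{x\in\bar\Gamma}I(x).$$ The function $I_\sigma$ is defined by $I_\sigma(h)=\frac1{2\sigma^2}\int_0^1(h'(u))^2\,du$ if simultaneously $\sigma>0$, $h(0)=0$ and $h$ is absolutely continuous, and $I_\sigma(h)=\infty$ otherwise. $[\cdot]$ denotes the integer part.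
   Formalization: For σ=0 the rate function I_0 is taken to be 0 at the null path and ∞ elsewhere, instead of ∞ everywhere: with the latter the upper bound fails for Γ=D([0,1]), for example when f is constant. *)

(* Defs.v *)
From HB Require Import structures.
From mathcomp Require Import all_boot all_order all_algebra.
From mathcomp Require Import all_classical all_reals all_analysis.
Set Implicit Arguments.
Unset Strict Implicit.
Unset Printing Implicit Defensive.
Import Order.TTheory GRing.Theory Num.Theory.
Import numFieldNormedType.Exports.
Local Open Scope classical_set_scope.
Local Open Scope ring_scope.

Section UnitInterval.
Variable R : realType.

Lemma zero_in01 : (0 : R) \in (`[0, 1]%classic : set R).
Proof. by rewrite inE/= in_itv/= lexx ler01. Qed.

Definition carrier01 : Type := set_type (`[0, 1]%classic : set R).
HB.instance Definition _ := Choice.on carrier01.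
HB.instance Definition _ := isPointed.Build carrier01 (exist _ 0 zero_in01).

Definition val01 (x : carrier01) : measurableTypeR R := set_val x.

(* [0, 1] with its Borel sets: the traces on [0, 1] of the Borel sets of R *)
Definition I01 := g_sigma_algebra_preimageType val01.

End UnitInterval.

Definition on01 (R : realType) (f : R -> R) (x : I01 R) : R := f (val01 x).

Section Skorohod.
Variable R : realType.

Definition cadlag01 (x : R -> R) : Prop :=
  (forall t, 0 <= t < 1 -> x s @[s --> t^'+] --> x t) /\
  (forall t, 0 < t <= 1 -> cvg (x s @[s --> t^'-])).

(* D([0, 1]). The values of a path outside [0, 1] are irrelevant; they are
   pinned to 0 so that equality of paths is equality on [0, 1]. *)
Record skorohod := Skorohod {
  path :> R -> R;
  path_cadlag : cadlag01 path;
  path_out : forall t, t \notin `[0, 1] -> path t = 0 }.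

Lemma zero_cadlag : cadlag01 (fun=> 0 : R).
Proof. by split=> t _; [exact: cvg_cst|exact: is_cvg_cst]. Qed.

Definition skorohod0 : skorohod :=
  @Skorohod (fun=> 0) zero_cadlag (fun _ _ => erefl).

HB.instance Definition _ := gen_eqMixin skorohod.
HB.instance Definition _ := gen_choiceMixin skorohod.
HB.instance Definition _ := isPointed.Build skorohod skorohod0.

(* Increasing bijections of [0, 1]; continuity is automatic *)
Definition time_change (lam : R -> R) : Prop :=
  {in `[0, 1] &, {homo lam : s t / s < t}} /\
  lam @` `[0, 1]%classic = `[0, 1]%classic.

(* y lies at Skorohod distance < e from x, where the distance is the infimum of
   the d such that |lam t - t| <= d and |x t - y (lam t)| <= d on [0, 1] for
   some time change lam *)
Definition skorohod_ball (x : skorohod) (e : R) (y : skorohod) : Prop :=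
  exists lam d, [/\ time_change lam, d < e &
    forall t, t \in `[0, 1] -> `|lam t - t| <= d /\ `|x t - y (lam t)| <= d].

Lemma time_change_in lam t : time_change lam -> t \in `[0, 1] ->
  lam t \in `[0, 1].
Proof.
move=> [_ E] t01; have : (lam @` `[0, 1]%classic) (lam t) by exists t.
by rewrite E.
Qed.

Lemma skorohod_ball_center x (e : R) : 0 < e -> skorohod_ball x e x.
Proof.
move=> e0; exists id, 0; split => //.
  by split => //; rewrite image_id.
by move=> t _; rewrite !subrr normr0.
Qed.

Lemma skorohod_ball_sym x y (e : R) :
  skorohod_ball x e y -> skorohod_ball y e x.
Proof.
move=> [lam [d [tc de H]]]; have [inc E] := tc.
have /choice[mu Hmu] : forall t, exists s, t \in `[0, 1] ->
    s \in `[0, 1] /\ lam s = t.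
  move=> t; have [t01|_] := boolP (t \in `[0, 1]); last by exists 0.
  have : (lam @` `[0, 1]%classic) t by rewrite E.
  by move=> [s s01 <-]; exists s.
exists mu, d; split => //; last first.
  move=> t t01; have [m01 lm] := Hmu t t01; have [H1 H2] := H _ m01.
  by rewrite lm in H1 H2; rewrite distrC; split => //; rewrite distrC.
split.
  move=> s t s01 t01 st; have [ms ls] := Hmu s s01; have [mt lt_] := Hmu t t01.
  rewrite ltNge le_eqVlt; apply/negP => /orP[/eqP e1|/(inc _ _ mt ms)].
    by move: st; rewrite -ls -lt_ e1 ltxx.
  by rewrite ls lt_ => /(lt_trans st); rewrite ltxx.
apply/seteqP; split => [_ [t t01 <-]|t t01].
  by have [] := Hmu t t01.
have l01 := time_change_in tc t01.
exists (lam t) => //; have [m01 lm] := Hmu _ l01.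
apply/eqP; rewrite eq_le !leNgt; apply/andP; split; apply/negP.
- by move=> /(inc _ _ t01 m01); rewrite lm ltxx.
- by move=> /(inc _ _ m01 t01); rewrite lm ltxx.
Qed.

Lemma skorohod_ball_triangle x y z (e1 e2 : R) :
  skorohod_ball x e1 y -> skorohod_ball y e2 z -> skorohod_ball x (e1 + e2) z.
Proof.
move=> [l1 [d1 [tc1 de1 H1]]] [l2 [d2 [tc2 de2 H2]]].
exists (l2 \o l1), (d1 + d2); split; last 2 first.
- exact: ltrD.
- move=> t t01; have l01 := time_change_in tc1 t01.
  have [A1 B1] := H1 _ t01; have [A2 B2] := H2 _ l01; split => /=.
    by rewrite (addrC d1) (le_trans (ler_distD (l1 t) _ _))// lerD.
  by rewrite (le_trans (ler_distD (y (l1 t)) _ _))// lerD.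
split.
  move=> s t s01 t01 st; apply: tc2.1; [exact: time_change_in..|].
  exact: tc1.1.
by rewrite -image_comp tc1.2 tc2.2.
Qed.

Definition skorohod_ent : set_system (skorohod * skorohod) :=
  entourage_ skorohod_ball.

HB.instance Definition _ := hasNbhs.Build skorohod (nbhs_ skorohod_ent).
HB.instance Definition _ := @Nbhs_isPseudoMetric.Build R skorohod
  skorohod_ent erefl skorohod_ball skorohod_ball_center skorohod_ball_sym
  skorohod_ball_triangle erefl.

Lemma scale_cadlag (c : R) (x : skorohod) : cadlag01 (fun t => c * x t).
Proof.
have [rc ll] := path_cadlag x; split=> t t01.
  by apply: cvgMr => //; exact: rc.
by apply: is_cvgMr; exact: ll.
Qed.

Lemma scale_out (c : R) (x : skorohod) t : t \notin `[0, 1] -> c * x t = 0.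
Proof. by move=> t01; rewrite path_out// mulr0. Qed.

Definition skorohod_scale (c : R) (x : skorohod) : skorohod :=
  Skorohod (scale_cadlag c x) (@scale_out c x).

(* t |-> u [nt] on [0, 1] *)
Definition step_fun (u : nat -> R) (n : nat) (t : R) : R :=
  if t \in `[0, 1] then u (Num.truncn (n%:R * t)) else 0.

Lemma step_cadlag (u : nat -> R) n : cadlag01 (step_fun u n).
Proof.
pose N : R := n%:R; have N0 : 0 <= N by exact: ler0n.
have N1 : 0 < N + 1 by rewrite ltr_wpDl.
have slack (d : R) : 0 < d -> N * (d / (N + 1)) < d.
  by move=> d0; rewrite mulrCA gtr_pMr// ltr_pdivrMr// mul1r ltrDl.
split=> t /andP[t0 t1].
  apply: cvg_near_cst; pose k := Num.truncn (N * t).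
  have /andP[kt tk] := truncn_itv (mulr_ge0 N0 t0); rewrite -/k in kt tk.
  have d0 : 0 < k.+1%:R - N * t by rewrite subr_gt0.
  near=> s.
  have ts : t < s by near: s; exact: nbhs_right_gt.
  have s1 : s < 1 by near: s; exact: nbhs_right_lt.
  have sd : s < t + (k.+1%:R - N * t) / (N + 1).
    by near: s; apply: nbhs_right_lt; rewrite ltrDl divr_gt0.
  rewrite /step_fun !in_itv/= t0 (ltW t1) (ltW s1) (le_trans t0 (ltW ts))/=.
  congr (u _); apply: truncn_def; rewrite -/k.
  rewrite (le_trans kt) ?ler_wpM2l ?(ltW ts)//=.
  apply: (le_lt_trans (ler_wpM2l N0 (ltW sd))).
  by rewrite mulrDr -ltrBrDl; exact: slack.
have [m mtm] : exists m : nat, N != 0 -> m%:R < N * t /\ N * t <= m.+1%:R.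
  have [N_0|NN0] := eqVneq N 0; first by exists 0%N.
  have Nt0 : 0 < N * t by rewrite mulr_gt0// lt_neqAle eq_sym NN0.
  have /andP[kt tk] := truncn_itv (ltW Nt0).
  move: kt; rewrite le_eqVlt => /orP[/eqP e|kt]; last first.
    by exists (Num.truncn (N * t)) => _; rewrite kt (ltW tk).
  case: (Num.truncn _) e => [e|k e]; first by move: Nt0; rewrite -e ltxx.
  by exists k => _; rewrite -e ltr_nat ltnSn lexx.
have [N_0|NN0] := eqVneq N 0.
  apply: (cvgP (u 0%N)); apply: cvg_near_cst; near=> s.
  have st : s < t by near: s; exact: nbhs_left_lt.
  have s0 : 0 < s by near: s; exact: nbhs_left_gt.
  rewrite /step_fun in_itv/= (ltW s0) (le_trans (ltW st) t1)/=.
  by rewrite -/N N_0 mul0r truncn0.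
have [mt tm] := mtm NN0.
apply: (cvgP (u m)); apply: cvg_near_cst; near=> s.
have st : s < t by near: s; exact: nbhs_left_lt.
have s0 : 0 < s by near: s; exact: nbhs_left_gt.
rewrite /step_fun in_itv/= (ltW s0) (le_trans (ltW st) t1)/=; congr (u _).
apply: truncn_def; apply/andP; split; last first.
  by apply: lt_le_trans tm; rewrite ltr_pM2l// lt_neqAle eq_sym NN0.
have sd : t - (N * t - m%:R) / (N + 1) < s.
  near: s; apply: nbhs_left_gt.
  by rewrite ltrBlDr ltrDl divr_gt0// subr_gt0.
apply: le_trans (ler_wpM2l N0 (ltW sd)).
by rewrite mulrBr lerBrDr addrC -lerBrDr ltW// slack// subr_gt0.
Unshelve. all: by end_near. Qed.

Lemma step_out (u : nat -> R) n t : t \notin `[0, 1] -> step_fun u n t = 0.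
Proof. by rewrite /step_fun => /negbTE ->. Qed.

Definition step_path (u : nat -> R) n : skorohod :=
  Skorohod (@step_cadlag u n) (@step_out u n).

End Skorohod.

Section ModerateDeviations.
Variable R : realType.
Local Open Scope ereal_scope.

(* Finite families of pairwise disjoint intervals ](ab i).1, (ab i).2[ *)
Definition abs_continuous01 (h : R -> R) : Prop :=
  forall e : R, (0 < e)%R -> exists2 delta : R, (0 < delta)%R &
    forall (n : nat) (ab : 'I_n -> R * R),
      (forall i, (0 <= (ab i).1 <= (ab i).2)%R /\ ((ab i).2 <= 1)%R) ->
      trivIset setT (fun i => `](ab i).1, (ab i).2[%classic) ->
      (\sum_i ((ab i).2 - (ab i).1) < delta)%R ->
      (\sum_i `|h (ab i).2 - h (ab i).1| < e)%R.

(* For sigma = 0 the rate is the degenerate one, 0 at the null path and +oo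
   elsewhere: with +oo everywhere, the upper bound would fail for the
   whole space. *)
Definition rate (sigma : R) (h : skorohod R) : \bar R :=
  if `[< [/\ (0 < sigma)%R, h 0%R = 0%R & abs_continuous01 h] >] then
    ((2 * sigma ^+ 2)^-1)%:E *
      \int[lebesgue_measure]_(u in `[0%R, 1%R]) (derive1 h u ^+ 2)%:E
  else if `[< sigma = 0%R /\ h = skorohod0 R >] then 0
  else +oo.

Definition MDP d (Omega : measurableType d) (P : probability Omega R)
    (W : nat -> Omega -> skorohod R) (a : nat -> R)
    (I : skorohod R -> \bar R) : Prop :=
  (forall alpha : R, compact [set x | I x <= alpha%:E]) /\
  forall Gamma : set (skorohod R), <<s open >> Gamma ->
    let p n := (a n)%:E *
      lne (P [set w | Gamma (skorohod_scale (Num.sqrt (a n)) (W n w))]) in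
    [/\ - ereal_inf [set I x | x in Gamma°] <= limn_einf p,
        limn_einf p <= limn_esup p &
        limn_esup p <= - ereal_inf [set I x | x in closure Gamma]].

End ModerateDeviations.

Section Dynamics.
Variable R : realType.
Implicit Types (f : R -> R) (T : I01 R -> I01 R) (mu : probability (I01 R) R).

Definition preserves mu T : Prop :=
  measurable_fun setT T /\
  forall A, measurable A -> mu (T @^-1` A) = mu A.

(* K acts on representatives; K h is thereby determined mu-almost everywhere *)
Definition Perron_Frobenius mu T (K : (I01 R -> R) -> (I01 R -> R)) : Prop :=
  forall h, h \in Lfun mu 2%:E ->
    K h \in Lfun mu 2%:E /\
    forall g, g \in Lfun mu 2%:E ->
      \int[mu]_x (K h x * g x) = \int[mu]_x (h x * g (T x)).

(* As K^n f is only defined mu-almost everywhere, the bound is on a version g.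
   ||df|| is the total variation of f, i.e., the norm of the additive interval
   function ]s, t] |-> f t - f s, equal to the norm of the Stieltjes measure df
   for right-continuous f. *)
Definition BV_contracting mu T : Prop :=
  exists2 K, Perron_Frobenius mu T K &
  exists kappa rho : R, [/\ 0 < kappa, 0 <= rho < 1 &
    forall f n, bounded_variation 0 1 f ->
      exists g : R -> R, [/\ bounded_variation 0 1 g,
        {ae mu, forall x, iter n K (on01 f) x = on01 g x} &
        (total_variation 0 1 g
          <= (kappa * rho ^+ n)%:E * total_variation 0 1 f)%E]].

Definition class_L f : Prop :=
  exists c : R -> R,
    [/\ convex_function (`[0, +oo[%classic : set R) (fun t => - c t),
        {in `[0, +oo[ &, {homo c : s t / s <= t}},
        (\int[lebesgue_measure]_(t in `]0%R, 1%R[)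
           (c t / (t * Num.sqrt `|ln t|))%:E < +oo)%E &
        forall x y, `|f x - f y| <= c `|x - y|].

Definition mean mu f : R := \int[mu]_x on01 f x.

Definition autocov mu T f (k : nat) : R :=
  \int[mu]_x (on01 f (iter k T x) * (on01 f x - mean mu f)).

Definition var_partial mu T f (N : nat) : R :=
  (\int[mu]_x ((on01 f x - mean mu f) ^+ 2)) +
  2 * \sum_(1 <= k < N.+1) autocov mu T f k.

Definition Wproc mu T f (n : nat) (x : I01 R) : skorohod R :=
  step_path (fun m => (Num.sqrt n%:R)^-1 *
    \sum_(1 <= i < m.+1) (on01 f (iter (n - i).+1 T x) - mean mu f)) n.

End Dynamics.

(* Main.v *)
From HB Require Import structures.
Require Import Defs.
From mathcomp Require Import all_boot all_order all_algebra.
From mathcomp Require Import all_classical all_reals all_analysis.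
From mathcomp Require Import measurable_realfun.
From mathcomp Require Import ring lra.

(** The map is analysed through duality alone. Write K for the Perron-Frobenius
operator, phi for the centered observable and u_i for bounded versions of
K^i phi. Since f is, at every scale r^i, uniformly close to a function whose
variation is at most 2 r^-i times the error, contraction of the variation makes
u_i uniformly small, and the integrability condition on the modulus of
continuity gives sum delta_i / sqrt i < oo for the bounds delta_i of u_i, in
dyadic form sum 2^(i/2) delta_(2^i) < oo
([scale_approximable], [condensation]).

Two estimates follow. First, phi is a sum of reversed martingale differences of
steps 2^i, up to a small rest; Jensen's inequality turns this into the
subgaussian bound E exp (l S_n) <= exp (1 + C l^2 n) for all l and n
([subgaussian]). Applied to u_M instead of phi it gives a constant that tends to
0 with M. Second, phi - u_M = g - K g with g = u_0 + ... + u_(M-1), and the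
conditional variance K (g^2) - (K g)^2 of the martingale part is a limit of
functions of bounded variation, hence its images converge uniformly to its mean
([BV_limit_mixing]) and the Poisson equation for it can be solved up to a small
error. Perturbing the weight exp (l g) by the solution makes the weighted
transfer operator almost a scalar, so that the exponential moments of phi - u_M
grow like exp (l^2 s_M^2 n / 2) up to cubic errors ([laplace_step]). Hoelder's
inequality combines both estimates into Laplace asymptotics for phi itself, on
several time blocks at once ([laplace_upper], [laplace_lower]); they determine
the variance, so the s_M^2 converge, and expanding s_M^2 identifies the limit
with the variance series ([partial_var_cvg], [partial_cov_cvg]).

The deviation principle is then a question about the increments of the process
over a grid of m cells. A maximal inequality deduced from the subgaussian bound
by dyadic doubling shows that the oscillation inside the cells is negligible at
any given exponential rate when m is large ([oscillation_negligible]). For the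
upper bound, the path is near the polygon through its grid values, and the
energy of this polygon exceeds a level with small probability: finitely many
half-spaces cover the outside of a ball, and each is controlled by the Laplace
asymptotics ([energy_tail], [walk_upper]). For the lower bound the measure is
tilted so that the increments concentrate near those of a given path
([tube_lower], [walk_lower]).

Finally the rate function is made accessible to finitely many values of the
path: it is at most alpha exactly when
(sum c_i (h b_i - h a_i))^2 <= 2 sigma^2 alpha sum c_i^2 (b_i - a_i)
for all finite disjoint families of intervals and all weights ([rate_leP]).
One direction is Cauchy-Schwarz and needs that an absolutely continuous function
is the integral of its derivative, the other one is Fatou's lemma for difference
quotients. This form passes to pointwise limits, which gives the compactness of
the level sets, and it is the form compared with polygons and grid values. When
sigma = 0 the upper bound at the null path replaces the tilting argument. *)

Set Implicit Arguments.
Unset Strict Implicit.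
Unset Printing Implicit Defensive.
Import Order.TTheory GRing.Theory Num.Theory.
Import numFieldNormedType.Exports.
Local Open Scope classical_set_scope.
Local Open Scope ring_scope.

(** * Absolutely continuous functions *)

Section AbsoluteContinuity.
Variable R : realType.
Implicit Types (h W : R -> R) (I : finType).

Definition clamp (x : R) : R := Num.max 0 (Num.min x 1).

Lemma clamp_ge0 x : 0 <= clamp x.
Proof. by rewrite /clamp le_max lexx. Qed.

Lemma clamp_le1 x : clamp x <= 1.
Proof. by rewrite /clamp ge_max ler01 ge_min lexx orbT. Qed.

Lemma clamp_id x : 0 <= x <= 1 -> clamp x = x.
Proof. by case/andP=> x0 x1; rewrite /clamp min_l// max_r. Qed.

Lemma clampP x : [\/ x <= 0 /\ clamp x = 0, 1 <= x /\ clamp x = 1 |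
  0 <= x <= 1 /\ clamp x = x].
Proof.
case: (lerP x 0) => x0.
  constructor 1; split=> //; rewrite /clamp min_l ?max_l//.
  by rewrite (le_trans x0).
case: (lerP 1 x) => x1.
  by constructor 2; split=> //; rewrite /clamp min_r// max_r.
by constructor 3; rewrite (ltW x0) (ltW x1); split=> //; rewrite clamp_id ?(ltW x0) ?(ltW x1).
Qed.

Lemma clamp_mono x y : x <= y -> clamp x <= clamp y.
Proof.
by move=> xy; case: (clampP x) => -[hx ->]; case: (clampP y) => -[hy ->]; lra.
Qed.

Lemma clamp_contract x y : x <= y -> clamp y - clamp x <= y - x.
Proof.
by move=> xy; case: (clampP x) => -[hx ->]; case: (clampP y) => -[hy ->]; lra.
Qed.

Lemma clamp_itv a b x : `]clamp a, clamp b[%classic x -> `]a, b[%classic x.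
Proof.
rewrite /= !in_itv/= => /andP[ax xb]; apply/andP; split.
  by case: (clampP a) ax xb => -[ha ->]; case: (clampP b) => -[hb ->]; lra.
by case: (clampP a) ax xb => -[ha ->]; case: (clampP b) => -[hb ->]; lra.
Qed.

(** Absolute continuity on the whole line with arbitrary finite index types;
composing with clamp reduces a path on the unit interval to it, and avoids
side conditions on endpoints. *)
Definition abs_continuous h : Prop :=
  forall e : R, 0 < e -> exists2 delta : R, 0 < delta &
    forall I (a b : I -> R), (forall i, a i <= b i) ->
      trivIset setT (fun i => `]a i, b i[%classic) ->
      \sum_i (b i - a i) < delta ->
      \sum_i `|h (b i) - h (a i)| < e.

Lemma abs_continuous01_clamp h : abs_continuous01 h ->
  abs_continuous (h \o clamp).
Proof.
move=> ach e e0; have [d d0 H] := ach e e0; exists d => // I a b ab tab sab.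
pose f (i : 'I_#|I|) : R * R :=
  (clamp (a (enum_val i)), clamp (b (enum_val i))).
have /= := H _ f.
rewrite (reindex (@enum_val I predT)) /=; last first.
  by apply: onW_bij; exact: enum_val_bij.
apply.
- move=> i; split; last exact: clamp_le1.
  by rewrite clamp_ge0 clamp_mono.
- apply/trivIsetP => i j _ _ ij; apply/seteqP; split => // x [xi xj].
  have /trivIsetP/(_ (enum_val i) (enum_val j) Logic.I Logic.I) := tab.
  move=> /(_ _)/seteqP[] //.
    by apply: contra ij => /eqP/enum_val_inj ->.
  by move=> + _ => /(_ x); apply; split; exact: clamp_itv.
- apply: le_lt_trans sab; rewrite [leRHS](reindex (@enum_val I predT)) /=.
    by apply: ler_sum => i _; exact: clamp_contract.
  by apply: onW_bij; exact: enum_val_bij.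
Qed.

Lemma abs_continuousD h g : abs_continuous h -> abs_continuous g ->
  abs_continuous (fun x => h x + g x).
Proof.
move=> ah ag e e0; have e20 : 0 < e / 2 by rewrite divr_gt0.
have [d d0 Hd] := ah _ e20; have [d' d'0 Hd'] := ag _ e20.
exists (Num.min d d'); first by rewrite lt_min d0.
move=> I a b ab tab; rewrite lt_min => /andP[s1 s2].
have := Hd I a b ab tab s1; have := Hd' I a b ab tab s2 => h1 h2.
rewrite (splitr e); apply: le_lt_trans (ltrD h2 h1).
rewrite -big_split; apply: ler_sum => i _ /=.
by rewrite opprD addrACA ler_normD.
Qed.

Lemma abs_continuousN h : abs_continuous h -> abs_continuous (fun x => - h x).
Proof.
move=> ah e e0; have [d d0 Hd] := ah _ e0; exists d => // I a b ab tab s.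
apply: le_lt_trans (Hd I a b ab tab s); apply: ler_sum => i _.
by rewrite -opprD normrN.
Qed.

(** The subintervals cut out by a partition of each of finitely many disjoint
intervals form again a disjoint family: absolute continuity therefore bounds
the sum of the variations, not only the sum of the increments. *)
Lemma abs_continuous_variation h (e : R) : abs_continuous h -> 0 < e ->
  exists2 delta : R, 0 < delta &
  forall I (a b : I -> R) (s : I -> seq R),
    (forall i, itv_partition (a i) (b i) (s i)) ->
    trivIset setT (fun i => `]a i, b i[%classic) ->
    \sum_i (b i - a i) < delta ->
    \sum_i variation (a i) (b i) h (s i) < e.
Proof.
move=> ah e0; have [d d0 Hd] := ah e e0; exists d => // I a b s abs tab sab.
pose J i : finType := 'I_(size (s i)).
pose A (p : {i : I & J i}) := nth (b (tag p)) (a (tag p) :: s (tag p)) (tagged p).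
pose B (p : {i : I & J i}) := nth (b (tag p)) (s (tag p)) (tagged p).
have varE (F : R -> R) i : variation (a i) (b i) F (s i) =
    \sum_(j : J i) `|F (nth (b i) (s i) j) - F (nth (b i) (a i :: s i) j)|.
  by rewrite /variation big_mkord.
have lei i (k : nat) : (k < (size (s i)).+1)%N ->
   a i <= nth (b i) (a i :: s i) k /\ nth (b i) (a i :: s i) k <= b i.
  by move=> ki; split; [exact: itv_partition_nth_ge|exact: itv_partition_nth_le].
have mono i (k l : nat) : (k <= l)%N -> (l < (size (s i)).+1)%N ->
   nth (b i) (a i :: s i) k <= nth (b i) (a i :: s i) l.
  move=> kl ls; have [sab' _] := abs i.
  apply: (@sorted_leq_nth _ <=%R) => //; first exact: le_trans.
    by apply: (sub_sorted (e := <%R)) => // x y /ltW.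
  by rewrite inE (leq_ltn_trans kl).
have AB p : A p <= B p.
  rewrite /A /B; apply: (mono _ (tagged p) (tagged p).+1) => //.
  by rewrite ltnS.
under eq_bigr do rewrite varE.
rewrite (@sig_big_dep _ _ _ _ (fun i => J i) xpredT (fun _ => xpredT)
  (fun i (j : J i) => `|h (nth (b i) (s i) j) - h (nth (b i) (a i :: s i) j)|)) /=.
apply: (Hd _ A B) => //.
- apply/trivIsetP => -[i j] [i' j'] _ _ ij; apply/seteqP; split => // x [].
  rewrite /A /B /= !in_itv/= => /andP[x1 x2] /andP[x3 x4].
  have [ii'|ii'] := eqVneq i i'; last first.
    have /trivIsetP/(_ i i' Logic.I Logic.I ii')/seteqP[] := tab.
    move=> /(_ x) + _; apply; rewrite /= !in_itv/=; split; apply/andP; split.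
    - by apply: le_lt_trans x1; apply: (lei i _ _).1; rewrite ltnS ltnW.
    - by apply: lt_le_trans x2 _; apply: (lei i j.+1 _).2; rewrite ltnS.
    - by apply: le_lt_trans x3; apply: (lei i' _ _).1; rewrite ltnS ltnW.
    - by apply: lt_le_trans x4 _; apply: (lei i' j'.+1 _).2; rewrite ltnS.
  subst i'; have jj' : j != j' by apply: contra ij => /eqP ->.
  have [jj|jj] : (j < j')%N \/ (j' < j)%N.
  + by move: jj'; rewrite -val_eqE/= neq_ltn => /orP[]; [left|right].
  + have : nth (b i) (s i) j <= nth (b i) (a i :: s i) j'.
      by apply: (mono i j.+1 j') => //; rewrite ltnS ltnW.
    by move=> /(lt_le_trans x2)/(lt_trans x3); rewrite ltxx.
  + have : nth (b i) (s i) j' <= nth (b i) (a i :: s i) j.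
      by apply: (mono i j'.+1 j) => //; rewrite ltnS ltnW.
    by move=> /(lt_le_trans x4)/(lt_trans x1); rewrite ltxx.
- apply: le_lt_trans sab.
  rewrite -(@sig_big_dep _ _ _ _ (fun i => J i) xpredT (fun _ => xpredT)
    (fun i (j : J i) => nth (b i) (s i) j - nth (b i) (a i :: s i) j)) /=.
  apply: ler_sum => i _.
  have := @nondecreasing_variation _ (a i) (b i) id (s i) _ (abs i).
  by rewrite varE => <-//; apply: ler_sum => j _; exact: ler_norm.
Qed.

End AbsoluteContinuity.

(** * Densities of monotone absolutely continuous functions *)

Section VariationDensity.
Variable R : realType.
Implicit Types (h W : R -> R) (I : finType).

Lemma abs_continuous_BV h (a b : R) : abs_continuous h -> a <= b ->
  bounded_variation a b h.
Proof.
move=> ah; have [d d0 Hd] := abs_continuous_variation ah ltr01.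
have small x y : x <= y -> y - x < d -> bounded_variation x y h.
  move=> xy xyd; exists 1 => _ [s xys <-]; apply: ltW.
  have := Hd (unit : finType) (fun=> x) (fun=> y) (fun=> s).
  rewrite !big_const !card_unit /= !addr0; apply => //.
  by apply/trivIsetP => -[] [].
have d20 : 0 < d / 2 by rewrite divr_gt0.
have step n x : bounded_variation x (x + d / 2 *+ n) h.
  elim: n x => [|n IH] x; first by rewrite addr0; exact: bounded_variationxx.
  have l1 : x <= x + d / 2 by rewrite lerDl ltW.
  have l2 : x + d / 2 <= x + d / 2 *+ n.+1.
    by rewrite (mulrS (d / 2)) addrA lerDl mulrn_wge0// ltW.
  apply/bounded_variationP; first exact: le_trans l2.
  rewrite (total_variationD _ l1 l2) fin_numD.
  apply/andP; split; apply/bounded_variationP => //.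
    by apply: small => //; rewrite addrAC subrr add0r ltr_pdivrMr// ltr_pMr// ltr1n.
  by rewrite (mulrS (d / 2)) addrA; exact: IH.
move=> ab; have [n nab] : exists n : nat, b <= a + d / 2 *+ n.
  have := archi_boundP (_ : 0 <= (b - a) / (d / 2)).
  rewrite divr_ge0 ?subr_ge0//; last exact: ltW.
  move=> /(_ isT) H.
  exists (Num.bound ((b - a) / (d / 2))); rewrite -lerBlDl -mulr_natl.
  by rewrite -ler_pdivrMr// ltW.
by apply: bounded_variationl nab (step n a).
Qed.

(** The variation function inherits absolute continuity, so that a path is a
difference of two monotone absolutely continuous functions, each of which has
a Stieltjes measure. *)
Lemma abs_continuous_TV h : abs_continuous h ->
  abs_continuous (fun x => fine (total_variation 0 (clamp x) h)).
Proof.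
move=> ah e e0; have e20 : 0 < e / 2 by rewrite divr_gt0.
have [d d0 Hd] := abs_continuous_variation ah e20; exists d => // I a b ab tab sab.
have fin x y : x <= y -> total_variation x y h \is a fin_num.
  by move=> xy; apply/bounded_variationP => //; exact: abs_continuous_BV.
pose eta := e / 2 / #|I|.+1%:R.
have eta0 : 0 < eta by rewrite divr_gt0.
have /choice[s Hs] i : exists s, itv_partition (clamp (a i)) (clamp (b i)) s /\
    fine (total_variation (clamp (a i)) (clamp (b i)) h) <=
    variation (clamp (a i)) (clamp (b i)) h s + eta.
  have := fin _ _ (clamp_mono (ab i)).
  move=> /(ub_ereal_sup_adherent eta0)[_ [_ [s abs <-] <-]] H.
  exists s; split => //; rewrite -lerBlDr -lee_fin EFinB fineK ?ltW//.
  exact/fin/clamp_mono.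
have [sab1 sab2] : (forall i, itv_partition (clamp (a i)) (clamp (b i)) (s i)) /\
    forall i, fine (total_variation (clamp (a i)) (clamp (b i)) h) <=
    variation (clamp (a i)) (clamp (b i)) h (s i) + eta.
  by split=> i; have [] := Hs i.
apply: le_lt_trans (_ : \sum_i (variation (clamp (a i)) (clamp (b i)) h (s i) + eta) < e).
  apply: ler_sum => i _; apply: le_trans (sab2 i).
  have c1 := clamp_mono (ab i).
  rewrite (total_variationD _ (clamp_ge0 (a i)) c1) fineD ?fin ?clamp_ge0//.
  by rewrite addrAC subrr add0r ger0_norm// fine_ge0// total_variation_ge0.
rewrite big_split/= (splitr e); apply: ltr_leD.
  apply: Hd => //.
    apply/trivIsetP => i j _ _ ij; apply/seteqP; split => // x [xi xj].
    have /trivIsetP/(_ i j Logic.I Logic.I ij)/seteqP[] := tab.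
    by move=> + _ => /(_ x); apply; split; exact: clamp_itv.
  apply: le_lt_trans sab; apply: ler_sum => i _; exact: clamp_contract.
rewrite sumr_const -[leLHS]mulr_natr /eta mulrAC ler_pdivrMr// ler_pM2l//.
by rewrite ler_nat ltnW.
Qed.

Lemma abs_continuous_continuous W : abs_continuous W -> continuous W.
Proof.
move=> aW x; apply/cvgrPdist_lt => e e0; have [d d0 Hd] := aW e e0.
have key y z : y <= z -> z - y < d -> `|W z - W y| < e.
  move=> yz yzd; have := Hd (unit : finType) (fun=> y) (fun=> z).
  rewrite !big_const !card_unit /= !addr0; apply => //.
  by apply/trivIsetP => -[] [].
near=> y; have yd : `|x - y| < d by near: y; exact: cvgr_dist_lt.
have [xy|/ltW yx] := lerP x y.
  by rewrite distrC; apply: key => //; rewrite -[ltLHS]ger0_norm ?subr_ge0// distrC.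
by apply: key => //; rewrite -[ltLHS]ger0_norm ?subr_ge0.
Unshelve. all: by end_near. Qed.

(** The Stieltjes measure of W charges no Lebesgue-null set: by outer
regularity such a set is covered by countably many disjoint open intervals of
small total length, over which W increases little. *)
Lemma abs_continuous_density W : {homo W : x y / x <= y} -> abs_continuous W ->
  exists2 phi : R -> R, lebesgue_measure.-integrable setT (EFin \o phi) &
  forall a b, 0 <= a -> a <= b -> b <= 1 ->
    W b - W a = \int[lebesgue_measure]_(x in `]a, b]) phi x.
Proof.
move=> ndW aW.
have rcW := right_continuousW (abs_continuous_continuous aW).
pose f : cumulative R R := HB.pack W (isCumulative.Build R _ R W ndW rcW).
pose D : set (measurableTypeR R) := `]-1, 1]%classic.
pose nu0 : {measure set (measurableTypeR R) -> \bar R} := lebesgue_stieltjes_measure f.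
have nu0E a b : a <= b -> nu0 `]a, b]%classic = (W b - W a)%:E.
  move=> ab; rewrite /nu0 /= /lebesgue_stieltjes_measure /measure_extension.
  by rewrite measurable_mu_extE/=; [rewrite wlength_itv_bnd|exact: is_ocitv].
have mD : measurable D by exact: measurable_itv.
have nuD : (nu0 D < +oo)%E by rewrite /D nu0E ?ltry//; lra.
pose nu : {finite_measure set _ -> \bar R} := mfrestr mD nuD.
have numu : nu `<< (lebesgue_measure : set (measurableTypeR R) -> \bar R).
  apply/null_content_dominatesP => N mN lN0; apply/eqP; rewrite eq_le measure_ge0 andbT.
  apply/lee_addgt0Pr => e e0; rewrite add0e.
  have [d d0 Hd] := aW e e0.
  have mND : measurable (N `&` D) by exact: measurableI.
  pose la : {measure set (measurableTypeR R) -> \bar R} := lebesgue_measure.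
  have lND : la (N `&` D) = 0%E.
    by apply: subset_measure0 lN0.
  have [//|//|U [oU NU lU]] := @lebesgue_regularity_outer R (N `&` D) d _ _ d0.
    exact: (eq_ind_r (fun z => z < +oo)%E (ltry 0) lND).
  pose U' := U `&` `](-1 : R), 2[%classic.
  have oU' : open U' by apply: openI => //; exact: itv_open.
  have NU' : N `&` D `<=` U'.
    move=> x NDx; split; first exact: NU.
    by case: NDx => _; apply: subset_itvl; rewrite bnd_simp ltr1n.
  have mU' : measurable U' by exact: open_measurable.
  have lU' : (lebesgue_measure U' < d%:E)%E.
    apply: le_lt_trans lU; rewrite -[leRHS]adde0.
    rewrite -[X in (_ <= _ + X)%E](lND : la _ = 0%E) -measureU//; last 2 first.
    - by apply: measurableD => //; exact: open_measurable.
    - by apply/seteqP; split => // x [[_ nx]].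
    apply: le_measure; rewrite ?inE//.
      by apply: measurableU => //; apply: measurableD => //; exact: open_measurable.
    by move=> x [Ux _]; have [Nx|Nx] := pselect ((N `&` D) x); [right|left].
  pose O := open_disjoint_itv oU'.
  pose a q := inf (O q); pose b q := sup (O q).
  have OU q : O q `<=` U' by rewrite (open_disjoint_itv_bigcup oU'); exact: bigcup_sup.
  have OE q : O q = `]a q, b q[%classic.
    have <- : (O q)° = O q by apply/interior_id; exact: open_disjoint_itv_open.
    rewrite interval_bounded_interior//; last 3 first.
    - exact: open_disjoint_itv_is_interval.
    - by exists (-1) => x /OU[_] /=; rewrite in_itv/= => /andP[/ltW].
    - by exists 2 => x /OU[_] /=; rewrite in_itv/= => /andP[_ /ltW].
  have ab q : a q <= b q.
    rewrite /a /b; have [->|/set0P[x Ox]] := eqVneq (O q) set0; first by rewrite inf0 sup0.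
    by move: Ox; rewrite -/(a q) -/(b q) OE /= in_itv/= => /andP[ax xb]; exact/ltW/(lt_trans ax).
  have mO q : measurable (O q) by rewrite OE; exact: measurable_itv.
  have tO : trivIset setT O by exact: open_disjoint_itv_trivIset.
  apply: (@le_trans _ _ (nu0 U')).
    rewrite /nu /= /mfrestr /mrestr; apply: le_measure; rewrite ?inE//.
  rewrite {1}(open_disjoint_itv_bigcup oU') measure_bigcup//; last by move=> q _; exact: mO.
  apply: lime_le; first exact: is_cvg_nneseries.
  apply: nearW => n; rewrite big_mkord.
  apply: (@le_trans _ _ (\sum_(q < n) (`|W (b q) - W (a q)|)%:E)%E).
    rewrite (eq_bigl xpredT); last by move=> q; rewrite in_setT.
    apply: lee_sum => q _.
    rewrite -/(O q) ger0_norm ?subr_ge0 ?ndW// -nu0E//.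
    apply: (@le_measure _ _ _ nu0); rewrite ?inE; [exact: mO|exact: measurable_itv|].
    by rewrite OE; apply: subset_itvl; rewrite bnd_simp.
  rewrite sumEFin lee_fin ltW//.
  apply: (Hd _ (fun q : 'I_n => a q) (fun q : 'I_n => b q)) => //.
    apply/trivIsetP => i j _ _ ij; rewrite -!OE.
    by move/trivIsetP : tO; apply => //.
  rewrite -lte_fin; apply: le_lt_trans lU'.
  rewrite -sumEFin.
  have -> : (\sum_(q < n) (b q - a q)%:E)%E = (\sum_(q < n) lebesgue_measure (O q))%E.
    apply: eq_bigr => q _; rewrite OE lebesgue_measure_itv/= lte_fin.
    by have := ab q; rewrite le_eqVlt => /orP[/eqP ->|->//]; rewrite ltxx subrr.
  rewrite -measure_bigsetU//; apply: le_measure; rewrite ?inE//.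
    by apply: bigsetU_measurable => q _; exact: mO.
  rewrite [X in _ `<=` X](open_disjoint_itv_bigcup oU').
  exact: bigsetU_bigcup.
have [phi [phi0 phifin iphi phiE]] := radon_nikodym_sigma_finite numu.
exists (fine \o phi).
  by apply: eq_integrable iphi => // x _ /=; rewrite fineK.
move=> a b a0 ab b1; apply: EFin_inj; rewrite -nu0E//.
have -> : nu0 `]a, b]%classic = nu `]a, b]%classic.
  rewrite /nu /= /mfrestr /mrestr setIidl//.
  by apply: subset_itv; rewrite bnd_simp// (le_trans _ a0)// lerN10.
rewrite phiE// /Rintegral fineK.
  by apply: eq_integral => x _ /=; rewrite fineK.
have iab : lebesgue_measure.-integrable (`]a, b]%classic : set (measurableTypeR R)) phi.
  by apply: integrableS iphi => //; exact: measurable_itv.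
have -> : (\int[lebesgue_measure]_(x in `]a, b]) (fine (phi x))%:E =
  \int[lebesgue_measure]_(x in `]a, b]) phi x)%E.
  by apply: eq_integral => x _ /=; rewrite fineK.
by apply: integrable_fin_num => //; exact: measurable_itv.
Qed.
End VariationDensity.

(** * The energy of a path *)

Section NonnegIntegral.
Context d (T : measurableType d) (R : realType) (m : {measure set T -> \bar R}).
Local Open Scope ereal_scope.

(** The integral of a nonnegative function is a supremum over the simple
functions below it, hence monotone even where measurability of the derivative
of a path is not at hand. *)
Lemma ge0_le_integral_nomeas (D : set T) (f g : T -> \bar R) :
  (forall x, D x -> 0 <= f x) -> (forall x, D x -> f x <= g x) ->
  \int[m]_(x in D) f x <= \int[m]_(x in D) g x.
Proof.
move=> f0 fg; rewrite !ge0_integralE//; last first.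
  by move=> x Dx; apply: le_trans (fg x Dx); exact: f0.
apply: le_ereal_sup => _ [h hf <-]; exists h => // x.
apply: le_trans (hf x) _; rewrite /patch; case: ifPn => // /set_mem; exact: fg.
Qed.

End NonnegIntegral.

Section Energy.
Variable R : realType.
Implicit Types (h : R -> R) (I : finType).

(** Radon-Nikodym for the two monotone parts, then the Lebesgue differentiation
theorem identifies the density with the derivative. *)
Lemma abs_continuous01_density h : abs_continuous01 h ->
  exists2 phi : R -> R, lebesgue_measure.-integrable setT (EFin \o phi) &
  (forall a b, 0 <= a -> a <= b -> b <= 1 ->
    h b - h a = \int[lebesgue_measure]_(x in `]a, b]) phi x) /\
  {ae lebesgue_measure, forall x : R, 0 < x < 1 -> derive1 h x = phi x}.
Proof.
move=> ach; have ah := abs_continuous01_clamp ach.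
pose V x := fine (total_variation 0 (clamp x) (h \o @clamp R)).
have aV : abs_continuous V by exact: abs_continuous_TV.
have fin x y : x <= y -> total_variation x y (h \o @clamp R) \is a fin_num.
  by move=> xy; apply/bounded_variationP => //; exact: abs_continuous_BV.
have cK x : clamp (clamp x) = clamp x by apply: clamp_id; rewrite clamp_ge0 clamp_le1.
have incV x y : x <= y -> `|h (clamp y) - h (clamp x)| <= V y - V x.
  move=> xy; have c1 := clamp_mono xy.
  rewrite /V (total_variationD _ (clamp_ge0 x) c1) fineD ?fin ?clamp_ge0//.
  rewrite addrAC subrr add0r -lee_fin fineK ?fin//.
  by have := total_variation_ge (h \o @clamp R) c1; rewrite /= !cK.
have [|phi1 i1 E1] := abs_continuous_density _ aV.
  by move=> x y xy; rewrite -subr_ge0; exact: le_trans (incV _ _ xy).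
have aW := abs_continuousD aV (abs_continuousN ah).
have [|phi2 i2 E2] := abs_continuous_density _ aW.
  move=> x y xy /=; have := incV _ _ xy; rewrite ler_norml => /andP[_].
  move: (V x) (V y) (h _) (h _) => ? ? ? ?; lra.
pose phi x := phi1 x - phi2 x.
have iphi : lebesgue_measure.-integrable setT (EFin \o phi).
  by apply: eq_integrable (integrableB measurableT i1 i2).
have hE a b : 0 <= a -> a <= b -> b <= 1 ->
    h b - h a = \int[lebesgue_measure]_(x in `]a, b]) phi x.
  move=> a0 ab b1; rewrite RintegralB; last 3 first.
  - exact: measurable_itv.
  - by apply: integrableS i1 => //; exact: measurable_itv.
  - by apply: integrableS i2 => //; exact: measurable_itv.
  rewrite -E1// -E2// /= !clamp_id ?a0 ?(le_trans a0)// ?(le_trans ab)//.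
  ring.
exists phi => //; split => //.
have [||] := @FTC1 R phi (BRight 0).
- by move=> y; apply: integrableS iphi => //; exact: measurable_itv.
- have := @integrable_locally R phi setT measurableT iphi.
  by rewrite patch_setT.
move=> N [mN N0 NN]; exists N; split => // x /= Px; apply: NN => /= Q.
apply: Px => /andP[x0 x1].
have [|dF FE] := Q; first by rewrite lte_fin.
rewrite -FE !derive1E.
have -> : 'D_1 h x = 'D_1 (fun y => h y - h 0) x.
  rewrite /derive; set p := (fun t => _); set q := (fun t => _).
  suff -> : p = q by [].
  by apply/funext => t; rewrite /p /q /= opprB addrA subrK.
apply: near_eq_derive; near=> y; apply: hE => //.
  by apply: ltW; near: y; exact: lt_nbhsr.
by apply: ltW; near: y; exact: lt_nbhsl.
Unshelve. all: by end_near. Qed.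

(** The dual form of the bound [int h'^2 <= beta]: it only involves the values
of h at finitely many points, and is thus stable under pointwise limits. *)
Definition energy_le (beta : R) h : Prop :=
  forall I (a b c : I -> R), (forall i, 0 <= a i /\ a i <= b i /\ b i <= 1) ->
    trivIset setT (fun i => `]a i, b i[%classic) ->
    (\sum_i c i * (h (b i) - h (a i))) ^+ 2 <=
    beta * \sum_i c i ^+ 2 * (b i - a i).

(** Optimization over l: a product bound follows from a family of bounds by sums.
This is how Cauchy-Schwarz is used throughout without square roots. *)
Lemma young_opt (x Q beta : R) : 0 <= Q -> 0 <= beta ->
  (forall l, 0 < l -> `|x| <= l / 2 * Q + (2 * l)^-1 * beta) ->
  x ^+ 2 <= beta * Q.
Proof.
move=> Q0 b0 H; rewrite -(real_normK (num_real x)).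
move: (normr_ge0 x) H; set y := `|x| => y0 H.
rewrite le_eqVlt in y0; case/predU1P: y0 => [<-|y0].
  by rewrite expr0n/= mulr_ge0.
have [Qz|Qn] := eqVneq Q 0.
  have l0 : 0 < (beta + 1) / y by rewrite divr_gt0// ltr_wpDl.
  have := H _ l0; rewrite Qz mulr0 add0r mulr0 => H1; exfalso.
  move: H1; rewrite leNgt => /negP; apply.
  rewrite invfM invf_div mulrCA mulrAC -mulrA gtr_pMr// mulrA.
  rewrite ltr_pdivrMr ?ltr_wpDl// mul1r; lra.
have Qp : 0 < Q by rewrite lt_neqAle eq_sym Qn.
have l0 : 0 < y / Q by rewrite divr_gt0.
have := H _ l0; have -> : y / Q / 2 * Q = y / 2 by field.
have -> : (2 * (y / Q))^-1 * beta = beta * Q / (2 * y).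
  by field; rewrite Qn gt_eqF.
rewrite -lerBlDl => H1.
have : y - y / 2 = y / 2 by field.
move=> E; move: H1; rewrite E ler_pdivlMr ?mulr_gt0// => H1.
by apply: le_trans H1; rewrite le_eqVlt; apply/orP; left; apply/eqP; field.
Qed.

(** Cauchy-Schwarz for the step function with value c i on the i-th interval. *)
Lemma energy_le_of_integral h (beta : R) : 0 <= beta -> abs_continuous01 h ->
  (\int[lebesgue_measure]_(u in `[0%R, 1%R]) (derive1 h u ^+ 2)%:E <=
    beta%:E)%E ->
  energy_le beta h.
Proof.
move=> beta0 ach hb; have [phi iphi [hE [N [mN N0 NN]]]] := abs_continuous01_density ach.
have mphi : measurable_fun setT phi.
  by apply/measurable_EFinP; exact: measurable_int iphi.
pose psi x : R := phi x * \1_(~` N) x.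
have mpsi : measurable_fun setT psi.
  apply: measurable_funM => //; apply: measurable_indic; exact: measurableC.
have psiE x : 0 < x < 1 -> psi x ^+ 2 <= derive1 h x ^+ 2.
  move=> x01; rewrite /psi indicE; have [xN|xN] := boolP (x \in ~` N).
    rewrite mulr1 -(_ : derive1 h x = phi x)//.
    by apply: contrapT => H; move: xN; rewrite inE; apply; apply: NN; apply/not_implyP.
  by rewrite mulr0 expr0n/= sqr_ge0.
have psib : (\int[lebesgue_measure]_(x in `]0%R, 1%R[) (psi x ^+ 2)%:E <= beta%:E)%E.
  apply: le_trans hb; rewrite integral_mkcond [leRHS]integral_mkcond.
  apply: ge0_le_integral_nomeas => x _; rewrite /patch; case: ifPn => //.
    by move=> _; rewrite lee_fin sqr_ge0.
  - rewrite inE/= in_itv/= => x01; rewrite mem_set ?lee_fin ?psiE//=.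
    by rewrite in_itv/=; case/andP: x01 => /ltW -> /ltW ->.
  - by move=> _; case: ifPn => // _; rewrite lee_fin sqr_ge0.
have mpsi2 (A : set R) : measurable_fun A (fun x => (psi x ^+ 2)%:E).
  by apply/measurable_EFinP; apply: measurable_funTS; exact: measurable_funX.
move=> I a b c ab tab.
have sub01 i : `]a i, b i[%classic `<=` `]0 : R, 1[%classic.
  by have [a0 [_ b1]] := ab i; apply: subset_itv; rewrite bnd_simp.
have ipsi2 i : lebesgue_measure.-integrable (`]a i, b i[%classic : set (measurableTypeR R))
    (fun x => (psi x ^+ 2)%:E).
  have m01 : measurable (`]0, 1[%classic : set (measurableTypeR R)) by exact: measurable_itv.
  apply: (integrableS m01 _ (sub01 i)); first exact: measurable_itv.
  apply/integrableP; split; first exact: mpsi2.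
  apply: le_lt_trans (ltry beta); apply: le_trans psib.
  rewrite le_eqVlt; apply/orP; left; apply/eqP; apply: eq_integral => x _ /=.
  by rewrite ger0_norm// sqr_ge0.
have iab i (k : R -> R) : lebesgue_measure.-integrable setT (EFin \o k) ->
    lebesgue_measure.-integrable (`]a i, b i[%classic : set (measurableTypeR R)) (EFin \o k).
  by move=> ik; apply: integrableS ik => //; exact: measurable_itv.
have ipsi : lebesgue_measure.-integrable setT (EFin \o psi).
  apply: (le_integrable _ _ _ iphi) => //; first exact/measurable_EFinP.
  move=> x _ /=; rewrite lee_fin /psi normrM indicE ler_piMr//.
  by case: (_ \in _); rewrite ?normr1 ?normr0.
have hpsi i : h (b i) - h (a i) = \int[lebesgue_measure]_(x in `]a i, b i[) psi x.
  have [a0 [le1 b1]] := ab i; rewrite hE// -Rintegral_itv_bndo_bndc; last exact: iab.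
  rewrite /Rintegral; congr fine; apply: ae_eq_integral.
  - exact: measurable_itv.
  - by apply/measurable_EFinP; exact: measurable_funTS.
  - by apply/measurable_EFinP; exact: measurable_funTS.
  exists N; split => // x /= H; apply: contrapT => nN; apply: H => _.
  by rewrite /psi indicE mem_set// mulr1.
have lebE i : lebesgue_measure `]a i, b i[%classic = (b i - a i)%:E.
  have [_ [le1 _]] := ab i; rewrite lebesgue_measure_itv/= lte_fin.
  case: ltP => // h1; suff -> : a i = b i by rewrite subrr.
  by apply/eqP; rewrite eq_le le1.
pose J i := \int[lebesgue_measure]_(x in `]a i, b i[) (psi x ^+ 2).
have sJ : \sum_i J i <= beta.
  rewrite -lee_fin; apply: le_trans psib; rewrite -sumEFin.
  have -> : (\sum_i (J i)%:E =
      \sum_i \int[lebesgue_measure]_(x in `]a i, b i[) (psi x ^+ 2)%:E)%E.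
    apply: eq_bigr => i _; rewrite /J /Rintegral fineK//.
    by apply: integrable_fin_num => //; exact: measurable_itv.
  rewrite -ge0_integral_bigsetU//=.
  - apply: ge0_subset_integral => //=.
    + by apply: bigsetU_measurable => i _; exact: measurable_itv.
    + exact: mpsi2.
    + by move=> x _; rewrite lee_fin sqr_ge0.
    + by move=> x; rewrite -bigcup_seq => -[i _]; exact: sub01.
  - exact: index_enum_uniq.
  - exact: sub_trivIset tab.
  - exact: mpsi2.
  - by move=> x _; rewrite lee_fin sqr_ge0.
have key (e : I -> R) l : 0 < l ->
  \sum_i e i * (h (b i) - h (a i)) <=
  l / 2 * (\sum_i e i ^+ 2 * (b i - a i)) + (2 * l)^-1 * beta.
  move=> l0; apply: (@le_trans _ _ (\sum_i (l / 2 * (e i ^+ 2 * (b i - a i)) + (2 * l)^-1 * J i))).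
    apply: ler_sum => i _; have [a0 [le1 b1]] := ab i.
    rewrite hpsi -RintegralZl; [|exact: measurable_itv|exact: iab].
    have -> : l / 2 * (e i ^+ 2 * (b i - a i)) =
      \int[lebesgue_measure]_(x in `]a i, b i[) (l / 2 * e i ^+ 2).
      rewrite Rintegral_cst; last exact: measurable_itv.
      rewrite [fine _](_ : _ = b i - a i) ?mulrA//.
      by rewrite [X in fine X]lebE.
    rewrite /J -RintegralZl; [|exact: measurable_itv|exact: ipsi2].
    have icst (k : R) : lebesgue_measure.-integrable
        (`]a i, b i[%classic : set (measurableTypeR R)) (EFin \o (fun=> k)).
      apply/integrableP; split; first exact: measurable_cst.
      rewrite integral_cst; last exact: measurable_itv.
      by rewrite [X in (_ * X)%E]lebE -EFinM ltry.
    have iZ (k : R) (g : R -> R) : lebesgue_measure.-integrable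
        (`]a i, b i[%classic : set (measurableTypeR R)) (EFin \o g) ->
        lebesgue_measure.-integrable
        (`]a i, b i[%classic : set (measurableTypeR R)) (EFin \o (fun x => k * g x)).
      move=> ig; apply: eq_integrable (integrableZl _ k ig) => //; exact: measurable_itv.
    rewrite -RintegralD; [|exact: measurable_itv|exact: icst|exact: iZ (ipsi2 i)].
    apply: le_Rintegral; [exact: measurable_itv|exact: iZ (iab _ _ ipsi)| |].
      have := integrableD _ (icst (l / 2 * e i ^+ 2)) (iZ (2 * l)^-1 _ (ipsi2 i)).
      by move=> /(_ (measurable_itv _)); exact: eq_integrable.
    move=> x _; rewrite -subr_ge0.
    have -> : l / 2 * e i ^+ 2 + (2 * l)^-1 * psi x ^+ 2 - e i * psi x =
      (2 * l)^-1 * (l * e i - psi x) ^+ 2 by field; rewrite gt_eqF.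
    by rewrite mulr_ge0 ?sqr_ge0// invr_ge0 mulr_ge0// ltW.
  rewrite big_split/= -!mulr_sumr lerD2l ler_wpM2l//.
  by rewrite invr_ge0 mulr_ge0// ltW.
apply: young_opt => // [|l l0].
  by apply: sumr_ge0 => i _; rewrite mulr_ge0 ?sqr_ge0// subr_ge0; have [_ []] := ab i.
rewrite ler_norml; apply/andP; split; last exact: key.
have := key (fun i => - c i) l l0; rewrite lerNl.
under eq_bigr do rewrite mulNr; rewrite sumrN.
by under [in leRHS]eq_bigr do rewrite sqrrN.
Qed.
End Energy.

(** * Upper and lower limits *)

Section LimInfSup.
Variable R : realType.
Implicit Types u : (\bar R)^nat.
Local Open Scope ereal_scope.

Lemma limn_esup_le u x : (\forall n \near \oo, u n <= x) -> limn_esup u <= x.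
Proof.
move=> ux; apply: (@le_trans _ _ (ereal_sup (u @` [set n | u n <= x]))).
  by apply: ereal_inf_lbound; exists [set n | u n <= x].
by apply: ge_ereal_sup => _ [n un <-].
Qed.

Lemma limn_einf_ge u x : (\forall n \near \oo, x <= u n) -> x <= limn_einf u.
Proof.
move=> xu; rewrite leeNr; apply: limn_esup_le.
by apply: filterS xu => n; rewrite leeN2.
Qed.

End LimInfSup.

(** * The rate function through finitely many values of the path *)

Section EnergyConverse.
Variable R : realType.
Implicit Types (h : R -> R) (I : finType).

(** Test the dual bound against the signs of the increments. *)
Lemma energy_le_abs_continuous01 h (beta : R) : 0 <= beta -> energy_le beta h ->
  abs_continuous01 h.
Proof.
move=> beta0 eh e e0; exists (e ^+ 2 / (beta + 1)).
  by rewrite divr_gt0 ?exprn_gt0 ?ltr_wpDl.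
move=> n ab ab01 tab sab.
pose c i : R := Num.sg (h (ab i).2 - h (ab i).1).
have := eh 'I_n (fun i => (ab i).1) (fun i => (ab i).2) c.
have -> : \sum_i c i * (h (ab i).2 - h (ab i).1) = \sum_i `|h (ab i).2 - h (ab i).1|.
  by apply: eq_bigr => i _; rewrite /c -normrEsg.
move=> H; have {}H : (\sum_i `|h (ab i).2 - h (ab i).1|) ^+ 2 <= beta * \sum_i ((ab i).2 - (ab i).1).
  apply: le_trans (H _ tab) _.
    by move=> i; have [/andP[? ?] ?] := ab01 i.
  rewrite ler_wpM2l//; apply: ler_sum => i _.
  have [/andP[_ le1] _] := ab01 i; rewrite ler_piMl ?subr_ge0//.
  by rewrite /c; case: sgrP => _; rewrite ?expr0n ?sqrrN ?expr1n ?ler01.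
rewrite -(@ltr_pXn2r _ 2) ?nnegrE//; last 2 first.
- by apply: sumr_ge0 => i _; exact: normr_ge0.
- exact: ltW.
apply: le_lt_trans H _.
have [->|bn] := eqVneq beta 0; first by rewrite mul0r exprn_gt0.
have bp : 0 < beta by rewrite lt_neqAle eq_sym bn.
apply: (@lt_le_trans _ _ (beta * (e ^+ 2 / (beta + 1)))); first by rewrite ltr_pM2l.
have e20 : 0 <= e ^+ 2 by exact: sqr_ge0.
have -> : beta * (e ^+ 2 / (beta + 1)) = e ^+ 2 * (beta / (beta + 1)).
  by rewrite mulrCA.
by rewrite ler_piMr// ler_pdivrMr ?ltr_wpDl// mul1r lerDl.
Qed.

(** Difference quotients over intervals shrinking to a point, but containing
it, converge to the derivative at that point. *)
Lemma straddle_cvg h (u : R) (a b : nat -> R) : derivable h u 1 ->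
  (forall n, a n <= u <= b n) -> (forall n, a n < b n) ->
  b n - a n @[n --> \oo] --> 0 ->
  (h (b n) - h (a n)) / (b n - a n) @[n --> \oo] --> derive1 h u.
Proof.
move=> dh aub ab ab0; apply/cvgrPdist_le => e e0.
have : (t^-1 * (h (t + u) - h u)) @[t --> 0^'] --> derive1 h u.
  have /cvg_ex[l hl] : cvg ((t^-1 *: (h (t *: 1 + u) - h u)) @[t --> 0^']) by exact: dh.
  have hl' : (t^-1 * (h (t + u) - h u)) @[t --> 0^'] --> l.
    by apply: cvg_trans hl; apply: near_eq_cvg; near=> t; rewrite /= [t *: 1]mulr1.
  by have -> : derive1 h u = l by exact: cvg_lim hl'.
move=> /cvgrPdist_le/(_ e e0); rewrite near_withinE => -[d /= d0 Hd].
have H t : `|t| < d -> `|h (t + u) - h u - derive1 h u * t| <= e * `|t|.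
  move=> td; have [->|t0] := eqVneq t 0; first by rewrite add0r subrr mulr0 subrr !normr0 mulr0.
  have := Hd t; rewrite /ball_ /= sub0r normrN => /(_ td t0).
  move=> H1; rewrite -ler_pdivrMr ?normr_gt0// -normf_div.
  by rewrite distrC in H1; rewrite mulrBl mulfK// mulrC.
near=> n; have abn : b n - a n < d.
  by near: n; move/cvgrPdist_lt : ab0 => /(_ d d0); apply: filterS => n; rewrite sub0r normrN; apply: le_lt_trans (ler_norm _).
have /andP[au ub] := aub n; have bap : 0 < b n - a n by rewrite subr_gt0.
have H1 := H (b n - u); have H2 := H (a n - u).
rewrite !subrK in H1 H2; rewrite distrC -[derive1 h u](mulfK (lt0r_neq0 bap)).
rewrite -mulrBl normf_div (gtr0_norm bap) ler_pdivrMr//.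
have -> : h (b n) - h (a n) - derive1 h u * (b n - a n) =
  (h (b n) - h u - derive1 h u * (b n - u)) - (h (a n) - h u - derive1 h u * (a n - u)) by ring.
apply: le_trans (ler_normB _ _) _.
have ubn : `|b n - u| = b n - u by rewrite ger0_norm ?subr_ge0.
have aun : `|a n - u| = u - a n by rewrite ler0_norm ?subr_le0// opprB.
have -> : e * (b n - a n) = e * (b n - u) + e * (u - a n) by ring.
rewrite ubn in H1; rewrite aun in H2.
by apply: lerD; [apply: H1|apply: H2]; lra.
Unshelve. all: by end_near. Qed.

Let grid (n k : nat) : R := k%:R / n.+1%:R.

Let grid_lt n k : grid n k < grid n k.+1.
Proof. by rewrite /grid ltr_pM2r ?invr_gt0// ltr_nat. Qed.

Let grid_mono n k l : (k <= l)%N -> grid n k <= grid n l.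
Proof. by move=> kl; rewrite /grid ler_pM2r ?invr_gt0// ler_nat. Qed.

Let grid_diff n k : grid n k.+1 - grid n k = n.+1%:R^-1.
Proof. by rewrite /grid -mulrBl -natrB// subSnn mul1r. Qed.

Let grid_triv n :
  trivIset setT (fun k : 'I_n.+1 => `]grid n k, grid n k.+1[%classic).
Proof.
apply/trivIsetP => i j _ _ ij; apply/seteqP; split => // x [] /=.
rewrite !in_itv/= => /andP[x1 x2] /andP[x3 x4].
have [ji|ji] : (i < j)%N \/ (j < i)%N.
- by move: ij; rewrite -val_eqE/= neq_ltn => /orP[]; [left|right].
- by have := lt_trans x3 x2; rewrite ltNge grid_mono.
- by have := lt_trans x1 x4; rewrite ltNge grid_mono.
Qed.

Lemma energy_le_grid h beta n : 0 <= beta -> energy_le beta h ->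
  n.+1%:R * \sum_(k < n.+1) (h (grid n k.+1) - h (grid n k)) ^+ 2 <= beta.
Proof.
move=> beta0 eh; have := eh 'I_n.+1 (fun k => grid n k) (fun k => grid n k.+1)
  (fun k => h (grid n k.+1) - h (grid n k)) _ (@grid_triv n).
have gp (k : 'I_n.+1) : 0 <= grid n k /\ grid n k <= grid n k.+1 /\ grid n k.+1 <= 1.
  split; first by rewrite divr_ge0.
  by rewrite ltW//; split => //; rewrite /grid ler_pdivrMr// mul1r ler_nat.
move=> /(_ gp); set S := \sum_(k < n.+1) _ ^+ 2.
under eq_bigr do rewrite grid_diff; rewrite -mulr_suml -/S.
have S0 : 0 <= S by apply: sumr_ge0 => k _; exact: sqr_ge0.
have [->|Sn] := eqVneq S 0.
  by move=> _; rewrite mulr0.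
have Sp : 0 < S by rewrite lt_neqAle eq_sym Sn.
rewrite expr2 mulrA (mulrAC beta) ler_pM2r//.
by rewrite ler_pdivlMr// mulrC.
Qed.

(** Fatou for the squared difference quotients on the regular grids. At a point
where the path is not differentiable derive1 is 0, so that nothing is to be
shown there. *)
Lemma energy_le_integral h (beta : R) : 0 <= beta -> energy_le beta h ->
  (\int[lebesgue_measure]_(u in `[0%R, 1%R]) (derive1 h u ^+ 2)%:E <=
    beta%:E)%E.
Proof.
move=> beta0 eh.
pose D n k := h (grid n k.+1) - h (grid n k).
pose A n (k : nat) : set R := `[grid n k, grid n k.+1]%classic.
pose g (n : nat) (u : R) : \bar R :=
  (\sum_(k < n.+1) ((n.+1%:R * D n k) ^+ 2)%:E * (\1_(A n k) u)%:E)%E.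
have mA n k : measurable (A n k) by exact: measurable_itv.
have mg0 n k : measurable_fun setT (fun u : R => ((n.+1%:R * D n k) ^+ 2)%:E * (\1_(A n k) u)%:E)%E.
  by apply: measurable_funeM; apply/measurable_EFinP; exact: measurable_indic.
have g00 n k u : (0 <= ((n.+1%:R * D n k) ^+ 2)%:E * (\1_(A n k) u)%:E)%E.
  by rewrite -EFinM lee_fin mulr_ge0// sqr_ge0.
have mI n k : measurable_fun setT (fun u : R => (\1_(A n k) u : R)%:E).
  by apply/measurable_EFinP; exact: measurable_indic.
have mg n : measurable_fun setT (g n).
  by apply: emeasurable_sum => k; exact: mg0.
have g0 n u : (0 <= g n u)%E by exact: sume_ge0.
have ig n : (\int[lebesgue_measure]_(u in `[0%R, 1%R]) g n u <= beta%:E)%E.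
  rewrite /g ge0_integral_sum//; last first.
    by move=> k; apply: measurable_funTS; exact: mg0.
  apply: (@le_trans _ _ (\sum_(k < n.+1) ((n.+1%:R * D n k) ^+ 2 / n.+1%:R)%:E)%E); last first.
    rewrite sumEFin lee_fin; apply: le_trans (energy_le_grid n beta0 eh).
    rewrite mulr_sumr; apply: ler_sum => k _.
    rewrite -/(D n k) le_eqVlt; apply/orP; left; apply/eqP.
    have : n.+1%:R != 0 :> R by [].
    by move: (D n k) (n.+1%:R : R) => ? ? ?; field.
  apply: lee_sum => k _; rewrite ge0_integralZl_EFin ?sqr_ge0//; last first.
    exact: measurable_funTS (mI n k).
  rewrite [X in (_ <= X)%E]EFinM; apply: lee_wpmul2l; rewrite ?lee_fin ?sqr_ge0//.
  rewrite integral_indic//; last exact: measurable_itv.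
  rewrite setIidl; last first.
    apply: subset_itv; rewrite bnd_simp.
      by rewrite divr_ge0.
    by rewrite /grid ler_pdivrMr// mul1r ler_nat.
  have E : lebesgue_measure (A n k) = (n.+1%:R^-1)%:E.
    by rewrite /A lebesgue_measure_itv/= lte_fin grid_lt -EFinD grid_diff.
  by rewrite [X in (X <= _)%E]E.
have lim u : 0 <= u <= 1 -> ((derive1 h u ^+ 2)%:E <= limn_einf (g^~ u))%E.
  move=> /andP[u0 u1].
  have [dh|ndh] := pselect (derivable h u 1); last first.
    have -> : derive1 h u = 0.
      rewrite derive1E /derive; exact: dvgP.
    by rewrite expr0n/=; apply: limn_einf_ge; apply: nearW => n; exact: g0.
  have /choice[k Hk] n : exists k : nat, (k < n.+1)%N /\ grid n k <= u <= grid n k.+1.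
    have nu0 : 0 <= n.+1%:R * u by rewrite mulr_ge0.
    have /andP[t1 t2] := truncn_itv nu0.
    have [u1'|u1'] := eqVneq u 1.
      exists n; split => //; rewrite u1' /grid divff// lexx andbT.
      by rewrite ler_pdivrMr// mul1r ler_nat.
    have ul1 : u < 1 by rewrite lt_neqAle u1'.
    exists (Num.truncn (n.+1%:R * u)); split.
      rewrite -(ltr_nat R); apply: le_lt_trans t1 _.
      by rewrite gtr_pMr.
    rewrite /grid ler_pdivrMr// ler_pdivlMr//.
    by rewrite [u * _]mulrC t1 ltW.
  have := @straddle_cvg h u (fun n => grid n (k n)) (fun n => grid n (k n).+1) dh.
  have -> : (fun n => grid n (k n).+1 - grid n (k n)) = (fun n => n.+1%:R^-1).
    by apply/funext => n; rewrite grid_diff.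
  move=> /(_ (fun n => (Hk n).2) (fun n => grid_lt n _) _).
  have h0 : n.+1%:R^-1 @[n --> \oo] --> (0 : R) by exact: cvg_harmonic.
  move=> /(_ h0) hq.
  have hq2 : ((h (grid n (k n).+1) - h (grid n (k n))) / (grid n (k n).+1 - grid n (k n))) ^+ 2
    @[n --> \oo] --> derive1 h u ^+ 2 by exact: (cvgM hq hq).
  apply/lee_addgt0Pr => e e0; rewrite addeC -leeBlDl// -EFinB.
  apply: limn_einf_ge.
  move/cvgrPdist_le : hq2 => /(_ e e0); apply: filterS => n.
  rewrite ler_norml => /andP[_]; rewrite lerBlDl -lerBlDr.
  rewrite -lee_fin => /le_trans; apply.
  rewrite /g (bigD1 (Ordinal (Hk n).1))//= indicE mem_set; last first.
    by rewrite /A /= in_itv/= (Hk n).2.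
  rewrite mule1 grid_diff invrK mulrC -/(D n (k n)) leeDl//.
  exact: sume_ge0.
apply: (@le_trans _ _ (\int[lebesgue_measure]_(u in `[0%R, 1%R]) limn_einf (g^~ u)))%E.
  by apply: ge0_le_integral_nomeas => u; rewrite /= in_itv/= => u01; [rewrite lee_fin sqr_ge0|exact: lim].
apply: le_trans (fatou _ _ _ _) _ => //.
  by move=> n; exact: measurable_funTS (mg n).
apply: le_trans (limn_einf_sup _) _; apply: limn_esup_le; apply: nearW => n; exact: ig.
Qed.

(** The only form of the rate function used below: the upper bound compares it
with polygons, the lower bound with grid values, the compactness of its level
sets with pointwise limits. *)
Lemma rate_leP (sigma alpha : R) (x : skorohod R) : 0 < sigma -> 0 <= alpha ->
  (rate sigma x <= alpha%:E)%E <->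
  x 0 = 0 /\ energy_le (2 * sigma ^+ 2 * alpha) x.
Proof.
move=> s0 a0; have s2 : 0 < 2 * sigma ^+ 2 by rewrite mulr_gt0 ?exprn_gt0.
have sa0 : 0 <= 2 * sigma ^+ 2 * alpha by rewrite mulr_ge0// ltW.
have intE (z : \bar R) : ((2 * sigma ^+ 2)^-1%:E * z <= alpha%:E)%E =
    (z <= (2 * sigma ^+ 2 * alpha)%:E)%E.
  by rewrite EFinM lee_pdivrMl.
rewrite /rate; split.
  case: asboolP => [[_ x0 acx]|_]; last first.
    by rewrite asboolF ?leye_eq// => -[s00]; rewrite s00 ltxx in s0.
  by rewrite intE => H; split => //; exact: energy_le_of_integral.
move=> [x0 ex]; rewrite asboolT; last first.
  by split => //; exact: energy_le_abs_continuous01 ex.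
by rewrite intE; exact: energy_le_integral.
Qed.

End EnergyConverse.

(** * Bounds on the exponential *)

Section ExpBounds.
Variable R : realType.
Implicit Types x y : R.

Lemma fact_ge_pow2 n : (2 ^ n.+2 <= n.+3`!)%N.
Proof.
elim: n => // n IH; rewrite expnS factS.
by apply: leq_mul.
Qed.

Lemma expR_taylor2 y : `|y| <= 1 ->
  `|expR y - (1 + y + y ^+ 2 / 2)| <= `|y| ^+ 3 / 2.
Proof.
move=> y1; pose P := 1 + y + y ^+ 2 / 2.
have S3 : series (exp_coeff y) 3 = P.
  rewrite /series /= !big_nat_recr//= big_nil /exp_coeff /=.
  by rewrite add0r !expr0 expr1 !divr1.
have key n : `|series (exp_coeff y) n.+3 - P| <= `|y| ^+ 3 * (2^-1 - 2^-1 ^+ n.+1).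
  elim: n => [|n IH]; first by rewrite S3 subrr normr0 expr1 subrr mulr0.
  rewrite seriesSr addrAC; apply: le_trans (ler_normD _ _) _.
  apply: le_trans (lerD IH (_ : _ <= `|y| ^+ 3 * 2^-1 ^+ n.+2)) _; last first.
    rewrite -mulrDr ler_wpM2l// ?exprn_ge0//.
    by rewrite (exprS _ n.+1); move: (2^-1 ^+ n.+1) => z; lra.
  rewrite /exp_coeff /= normrM normrX (_ : n.+3 = 3 + n)%N// exprD -mulrA.
  rewrite ler_wpM2l ?exprn_ge0// normfV.
  rewrite -[leRHS]mul1r; apply: ler_pM; rewrite ?exprn_ge0 ?invr_ge0 ?exprn_ile1//.
  rewrite ger0_norm// exprVn lef_pV2 ?posrE ?ltr0n ?fact_gt0// ?exprn_gt0//.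
  by rewrite -natrX ler_nat fact_ge_pow2.
have cv : `|series (exp_coeff y) n.+3 - P| @[n --> \oo] --> `|expR y - P|.
  apply: cvg_norm; apply: cvgB; last exact: cvg_cst.
  have /(cvg_comp _ _ (cvg_addnr 3)) : series (exp_coeff y) @ \oo --> expR y.
    exact: is_cvg_series_exp_coeff.
  by apply: cvg_trans; apply: near_eq_cvg; near=> n; rewrite /= addn3.
rewrite -(cvg_lim _ cv)//; apply: limr_le; first exact: cvgP cv.
apply: nearW => n; apply: le_trans (key n) _.
by rewrite ler_wpM2l ?exprn_ge0// lerBlDr lerDl exprn_ge0.
Unshelve. all: by end_near. Qed.

Lemma expR_le_quad y : `|y| <= 1 -> expR y <= 1 + y + y ^+ 2.
Proof.
move=> y1; have := expR_taylor2 y1; rewrite ler_norml => /andP[_].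
have : `|y| ^+ 3 <= y ^+ 2.
  by rewrite exprS -normrX (ger0_norm (sqr_ge0 y)) ler_piMl ?sqr_ge0.
move: (`|y| ^+ 3) (y ^+ 2) => u v; lra.
Qed.

(** The linear term integrates to 0 for a centered variable, which leaves a
Gaussian bound without constant factor: such bounds can be multiplied along n
steps. *)
Lemma expR_le_gauss y : expR y <= y + expR (y ^+ 2).
Proof.
have e2 := expR_ge1Dx (y ^+ 2).
have [y1|y1] := lerP `|y| 1.
  by apply: le_trans (expR_le_quad y1) _; rewrite addrAC addrC lerD2l.
have [y0|y0] := lerP 0 y.
  rewrite ger0_norm// in y1; apply: ler_wpDl => //.
  by rewrite ler_expR expr2 ler_peMl// ltW.
rewrite ltr0_norm// in y1.
have : expR y <= 1 by rewrite expR_le1 ltW.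
have : 0 <= y + y ^+ 2 by rewrite expr2 -{1}[y]mulr1 -mulrDr mulr_le0// ltW// -ltrBrDl sub0r ltrNr.
move: (expR y) (expR (y ^+ 2)) (y ^+ 2) e2 => a b c; lra.
Qed.

(** Jensen's inequality for exp and a finite weighting. *)
Lemma expR_jensen (I : Type) (r : seq I) (w y : I -> R) :
  (forall i, 0 <= w i) -> \sum_(i <- r) w i = 1 ->
  expR (\sum_(i <- r) w i * y i) <= \sum_(i <- r) w i * expR (y i).
Proof.
move=> w0 w1; set m := \sum_(i <- r) _.
have : \sum_(i <- r) w i * (expR m * (1 + (y i - m))) <= \sum_(i <- r) w i * expR (y i).
  apply: ler_sum => i _; rewrite ler_wpM2l// -[y i in leRHS](subrK m) addrC expRD.
  by rewrite mulrC ler_wpM2r ?expR_ge0// addrC expR_ge1Dx.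
apply: le_trans; rewrite le_eqVlt; apply/orP; left; apply/eqP.
have -> : \sum_(i <- r) w i * (expR m * (1 + (y i - m))) =
   expR m * (\sum_(i <- r) w i * y i + (1 - m) * \sum_(i <- r) w i).
  rewrite mulr_sumr -big_split/= mulr_sumr; apply: eq_bigr => i _; ring.
by rewrite w1 -/m; ring.
Qed.

Lemma expR_le_1Dz (z : R) : `|z| <= 2^-1 -> expR (z - 2 * z ^+ 2) <= 1 + z.
Proof.
rewrite ler_norml => /andP[z1 z2]; have z3 : 0 < 1 + z by lra.
have := expR_ge1Dx (- (z - 2 * z ^+ 2)); rewrite expRN => H.
rewrite -[leLHS]invrK -[leRHS]invrK lef_pV2 ?posrE ?invr_gt0 ?expR_gt0//.
apply: le_trans H; rewrite -[leLHS]mul1r ler_pdivrMr//.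
have : 0 <= z ^+ 2 * (1 + 2 * z) by rewrite mulr_ge0 ?sqr_ge0//; lra.
nra.
Qed.

End ExpBounds.

(** * Transfer operators on bounded functions *)

Section BoundedMeasurable.
Context d (Om : measurableType d) (R : realType) (mu : probability Om R).
Implicit Types (h k g psi phi : Om -> R).

(** Bounded measurable functions: closed under all operations that are needed,
integrable, and test functions for the duality. Working with everywhere
bounded representatives avoids almost-everywhere statements. *)
Definition bmeas h : Prop :=
  measurable_fun setT h /\ exists c : R, forall x, `|h x| <= c.

Notation Ex h := (\int[mu]_x (h x : R)).

Lemma bmeas_bound h (c : R) : measurable_fun setT h -> (forall x, `|h x| <= c) ->
  bmeas h.
Proof. by move=> mh hc; split => //; exists c. Qed.

Lemma bmeas_cst (c : R) : bmeas (fun=> c).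
Proof. by split; [exact: measurable_cst|exists `|c|]. Qed.

Lemma bmeasD h k : bmeas h -> bmeas k -> bmeas (fun x => h x + k x).
Proof.
move=> [mh [c hc]] [mk [e ke]]; split; first exact: measurable_funD.
by exists (c + e) => x; apply: le_trans (ler_normD _ _) (lerD _ _).
Qed.

Lemma bmeasM h k : bmeas h -> bmeas k -> bmeas (fun x => h x * k x).
Proof.
move=> [mh [c hc]] [mk [e ke]]; split; first exact: measurable_funM.
by exists (c * e) => x; rewrite normrM ler_pM.
Qed.

Lemma bmeasN h : bmeas h -> bmeas (fun x => - h x).
Proof.
move=> [mh [c hc]]; split; last by exists c => x; rewrite normrN.
exact: measurable_funN.
Qed.

Lemma bmeasB h k : bmeas h -> bmeas k -> bmeas (fun x => h x - k x).
Proof. by move=> bh bk; apply: bmeasD => //; exact: bmeasN. Qed.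

Lemma bmeasZ (c : R) h : bmeas h -> bmeas (fun x => c * h x).
Proof. exact/bmeasM/bmeas_cst. Qed.

Lemma bmeas_sqr h : bmeas h -> bmeas (fun x => h x ^+ 2).
Proof. by move=> bh; have := bmeasM bh bh. Qed.

Lemma bmeas_exp h : bmeas h -> bmeas (fun x => expR (h x)).
Proof.
move=> [mh [c hc]]; split.
  by apply: (measurableT_comp (f := @expR R)) => //; exact: measurable_expR.
exists (expR c) => x; rewrite ger0_norm ?expR_ge0// ler_expR.
exact: le_trans (ler_norm _) (hc x).
Qed.

Lemma bmeas_norm h : bmeas h -> bmeas (fun x => `|h x|).
Proof.
move=> [mh [c hc]]; split; last by exists c => x; rewrite normr_id.
exact: (measurableT_comp (@normr_measurable R setT) mh).
Qed.

Lemma bmeas_sum (I : Type) (r : seq I) (F : I -> Om -> R) :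
  (forall i, bmeas (F i)) -> bmeas (fun x => \sum_(i <- r) F i x).
Proof.
move=> bF; elim: r => [|i r IH].
  by under eq_fun do rewrite big_nil; exact: bmeas_cst.
by under eq_fun do rewrite big_cons; exact: bmeasD.
Qed.

Lemma bmeas_int h : bmeas h -> mu.-integrable setT (EFin \o h).
Proof.
move=> [mh [c hc]]; apply: measurable_bounded_integrable => //.
  by rewrite [X in (X < _)%E]probability_setT ltry.
exists c; split; first exact: num_real.
by move=> M cM x _; apply: le_trans (hc x) (ltW cM).
Qed.
Hint Resolve bmeas_int : core.

Lemma ExD h k : bmeas h -> bmeas k -> Ex (fun x => h x + k x) = Ex h + Ex k.
Proof. by move=> bh bk; rewrite RintegralD//; exact: bmeas_int. Qed.

Lemma ExB h k : bmeas h -> bmeas k -> Ex (fun x => h x - k x) = Ex h - Ex k.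
Proof. by move=> bh bk; rewrite RintegralB//; exact: bmeas_int. Qed.

Lemma ExZ (c : R) h : bmeas h -> Ex (fun x => c * h x) = c * Ex h.
Proof. by move=> bh; rewrite RintegralZl//; exact: bmeas_int. Qed.

Lemma ExN h : bmeas h -> Ex (fun x => - h x) = - Ex h.
Proof.
by move=> bh; rewrite -mulN1r -ExZ//; apply: eq_Rintegral => x _; rewrite mulN1r.
Qed.

Lemma Ex_cst (c : R) : Ex (fun=> c) = c.
Proof. by rewrite Rintegral_cst// [X in fine X]probability_setT mulr1. Qed.

Lemma Ex_le h k : bmeas h -> bmeas k -> (forall x, h x <= k x) -> Ex h <= Ex k.
Proof. by move=> bh bk hk; apply: le_Rintegral => //; exact: bmeas_int. Qed.

Lemma eq_Ex h k : h =1 k -> Ex h = Ex k.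
Proof. by move=> hk; apply: eq_Rintegral => x _; exact: hk. Qed.

Lemma Ex_sum (I : Type) (r : seq I) (F : I -> Om -> R) :
  (forall i, bmeas (F i)) -> Ex (fun x => \sum_(i <- r) F i x) = \sum_(i <- r) Ex (F i).
Proof.
move=> bF; elim: r => [|i r IH].
  by rewrite big_nil -[RHS](Ex_cst 0); apply: eq_Ex => x; rewrite big_nil.
rewrite big_cons -IH -ExD//; last exact: bmeas_sum.
by apply: eq_Ex => x; rewrite big_cons.
Qed.

Lemma Ex_norm_le h (c : R) : bmeas h -> (forall x, `|h x| <= c) -> `|Ex h| <= c.
Proof.
move=> bh hc; rewrite -[leRHS]Ex_cst.
apply: (@le_trans _ _ (Ex (fun x => `|h x|))).
  by apply: le_normr_Rintegral => //; exact: bmeas_int.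
by apply: Ex_le => //; [exact: bmeas_norm|exact: bmeas_cst].
Qed.

Variable T : Om -> Om.
Hypothesis mT : measurable_fun setT T.
Hypothesis pT : forall A, measurable A -> mu (T @^-1` A) = mu A.

Lemma bmeas_comp h : bmeas h -> bmeas (fun x => h (T x)).
Proof.
by move=> [mh [c hc]]; split; [exact: measurableT_comp|exists c => x; exact: hc].
Qed.

Lemma bmeas_iter n h : bmeas h -> bmeas (fun x => h (iter n T x)).
Proof.
move=> bh; elim: n => // n IH; have := bmeas_comp IH.
by under eq_fun do rewrite -iterSr.
Qed.

Lemma Ex_comp h : bmeas h -> Ex (fun x => h (T x)) = Ex h.
Proof.
move=> bh.
rewrite /Rintegral; congr fine.
transitivity (\int[pushforward mu T]_x (h x)%:E)%E.
  rewrite integral_pushforward ?preimage_setT//.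
    by apply/measurable_EFinP; exact: bh.1.
  exact: bmeas_int (bmeas_comp bh).
by apply: eq_measure_integral => A mA _; exact: pT.
Qed.

Lemma Ex_iter n h : bmeas h -> Ex (fun x => h (iter n T x)) = Ex h.
Proof.
move=> bh; elim: n => // n IH.
rewrite -[RHS]IH -(Ex_comp (bmeas_iter n bh)).
by apply: eq_Ex => x; rewrite -iterSr.
Qed.

(** k is a bounded version of the image of h under the n-th power of the
Perron-Frobenius operator. *)
Definition PFn (n : nat) h k : Prop :=
  [/\ bmeas h, bmeas k & forall psi, bmeas psi ->
    Ex (fun x => k x * psi x) = Ex (fun x => h x * psi (iter n T x))].

Lemma PFn0 h : bmeas h -> PFn 0 h h.
Proof. by move=> bh; split. Qed.

Lemma PFnD n h k h' k' : PFn n h k -> PFn n h' k' ->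
  PFn n (fun x => h x + h' x) (fun x => k x + k' x).
Proof.
move=> [bh bk E] [bh' bk' E']; split; [exact: bmeasD|exact: bmeasD|] => psi bpsi.
have bp := bmeas_iter n bpsi.
transitivity (Ex (fun x => k x * psi x) + Ex (fun x => k' x * psi x)).
  by rewrite -ExD; [apply: eq_Ex => x; rewrite mulrDl|exact: bmeasM|exact: bmeasM].
rewrite E// E'// -ExD; [|exact: bmeasM|exact: bmeasM].
by apply: eq_Ex => x; rewrite mulrDl.
Qed.

Lemma PFn_cst n (c : R) : PFn n (fun=> c) (fun=> c).
Proof.
split; [exact: bmeas_cst|exact: bmeas_cst|] => psi bpsi.
by rewrite !ExZ ?Ex_iter//; exact: bmeas_iter.
Qed.

(** The defining duality lets functions of the image point be pulled out. *)
Lemma PFnM n h k phi : PFn n h k -> bmeas phi ->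
  PFn n (fun x => h x * phi (iter n T x)) (fun x => k x * phi x).
Proof.
move=> [bh bk E] bphi; have bp := bmeas_iter n bphi.
split; [exact: bmeasM|exact: bmeasM|] => psi bpsi.
transitivity (Ex (fun x => k x * (phi x * psi x))).
  by apply: eq_Ex => x; rewrite mulrA.
rewrite E; last exact: bmeasM.
by apply: eq_Ex => x; rewrite mulrA.
Qed.

Lemma PFnZ n (c : R) h k : PFn n h k -> PFn n (fun x => c * h x) (fun x => c * k x).
Proof.
move=> hk; have := PFnM hk (bmeas_cst c).
have -> : (fun x => h x * (fun=> c) (iter n T x)) = (fun x => c * h x).
  by apply/funext => x; rewrite mulrC.
by have -> : (fun x => k x * c) = (fun x => c * k x) by apply/funext => x; rewrite mulrC.
Qed.

Lemma PFnB n h k h' k' : PFn n h k -> PFn n h' k' ->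
  PFn n (fun x => h x - h' x) (fun x => k x - k' x).
Proof.
move=> hk hk'; have := PFnD hk (PFnZ (-1) hk').
have E (u u' : Om -> R) : (fun x => u x + -1 * u' x) = (fun x => u x - u' x).
  by apply/funext => x; rewrite mulN1r.
by rewrite !E.
Qed.

Lemma PFn_sum n N (F G : nat -> Om -> R) : (forall i, PFn n (F i) (G i)) ->
  PFn n (fun x => \sum_(i < N) F i x) (fun x => \sum_(i < N) G i x).
Proof.
move=> FG; elim: N => [|N IH].
  by under eq_fun do rewrite big_ord0; under [X in PFn _ _ X]eq_fun do rewrite big_ord0; exact: PFn_cst.
under eq_fun do rewrite big_ord_recr; under [X in PFn _ _ X]eq_fun do rewrite big_ord_recr.
exact: PFnD.
Qed.

Lemma PFn_mean n h k : PFn n h k -> Ex k = Ex h.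
Proof.
move=> [bh bk E]; have := E _ (bmeas_cst 1).
have e1 (u : Om -> R) : Ex (fun x => u x * 1) = Ex u by apply: eq_Ex => x; rewrite mulr1.
by rewrite !e1.
Qed.

(** The semigroup law read backwards: the image at a later time is also an image
of any earlier one. *)
Lemma PFn_step m j h k k' : PFn m h k -> PFn (m + j) h k' -> PFn j k k'.
Proof.
move=> [bh bk E] [_ bk' E']; split => // psi bpsi.
rewrite E'// E; last exact: bmeas_iter.
by apply: eq_Ex => x; rewrite addnC iterD.
Qed.

Definition clip (c t : R) : R := Num.max (- c) (Num.min t c).

Lemma clip_le (c t : R) : 0 <= c -> `|clip c t| <= c.
Proof.
move=> c0; rewrite ler_norml /clip le_max lexx /=.
by rewrite ge_max ge_min lexx orbT andbT; lra.
Qed.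

Lemma clip_id (c t : R) : `|t| <= c -> clip c t = t.
Proof.
by rewrite ler_norml /clip => /andP[t1 t2]; rewrite min_l// max_r.
Qed.

Lemma measurable_clip (c : R) h : measurable_fun setT h ->
  measurable_fun setT (fun x => clip c (h x)).
Proof.
move=> mh; apply: measurable_maxr; first exact: measurable_cst.
by apply: measurable_minr => //; exact: measurable_cst.
Qed.

Lemma bmeas_clip (c : R) h : 0 <= c -> measurable_fun setT h ->
  bmeas (fun x => clip c (h x)).
Proof.
move=> c0 mh; apply: (@bmeas_bound _ c) => [|x]; first exact: measurable_clip.
exact: clip_le.
Qed.

Lemma integrable_bmeasM k psi : mu.-integrable setT (EFin \o k) -> bmeas psi ->
  mu.-integrable setT (EFin \o (fun x => k x * psi x)).
Proof.
move=> ik [mpsi [c hc]].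
have := @integrableMl _ _ _ mu setT measurableT (EFin \o k) psi ik mpsi.
move=> /(_ _)/=; apply; exists c; split; first exact: num_real.
by move=> M cM x _; apply: le_trans (hc x) (ltW cM).
Qed.

(** An upper bound for h is an almost everywhere upper bound for its images:
test the duality against the indicator of the excess. *)
Lemma PFn_ae_le n h k (c : R) : bmeas h -> (forall x, h x <= c) ->
  mu.-integrable setT (EFin \o k) ->
  (forall psi, bmeas psi ->
    Ex (fun x => k x * psi x) = Ex (fun x => h x * psi (iter n T x))) ->
  {ae mu, forall x, k x <= c}.
Proof.
move=> bh hc ik E.
have mk : measurable_fun setT k by apply/measurable_EFinP; exact: measurable_int ik.
pose A := [set x | c < k x].
have mA : measurable A.
  have -> : A = setT `&` (fun x => c < k x) @^-1` [set true].
    by rewrite setTI; apply/seteqP; split => x.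
  by apply: (measurable_fun_ltr (measurable_cst c) mk measurableT).
pose s : Om -> R := \1_A.
have bs : bmeas s.
  apply: (@bmeas_bound _ 1); first exact: measurable_indic.
  by move=> x; rewrite /s indicE; case: (_ \in _); rewrite ?normr1 ?normr0.
have iks := integrable_bmeasM ik bs.
have ibs := bmeas_int (bmeasZ c bs).
pose e x := k x * s x - c * s x.
have e0 x : 0 <= e x.
  rewrite /e /s indicE; case: (boolP (x \in A)) => [|_]; last by rewrite !mulr0 subrr.
  by rewrite inE /A /= => ?; rewrite !mulr1 subr_ge0 ltW.
have Ee : Ex e <= 0.
  rewrite RintegralB// E// -(Ex_iter n (bmeasZ c bs)) subr_le0.
  have bsn := bmeas_iter n bs.
  apply: Ex_le; [exact: bmeasM|exact: bmeasZ|] => x.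
  by apply: ler_wpM2r => //; rewrite /s indicE.
have ie : mu.-integrable setT (EFin \o e).
  by apply: eq_integrable (integrableB measurableT iks ibs).
have Ie : (\int[mu]_x `|(e x)%:E| = 0)%E.
  transitivity (\int[mu]_x (e x)%:E)%E.
    by apply: eq_integral => x _; rewrite gee0_abs// lee_fin.
  rewrite -[LHS]fineK; last exact: integrable_fin_num.
  by congr EFin; apply/eqP; rewrite eq_le Ee/= fine_ge0// integral_ge0// => x _; rewrite lee_fin.
have me : measurable_fun setT (EFin \o e) by exact: measurable_int ie.
have := (ae_eq_integral_abs mu measurableT me).1 Ie.
move=> [N [mN N0 NN]]; exists N; split => // x /= kx; apply: NN => /= H.
have cx : c < k x by rewrite ltNge; apply/negP.
have := H Logic.I; rewrite /e /s indicE mem_set// !mulr1 => -[] /eqP.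
by rewrite subr_eq0 => /eqP ck; rewrite ck ltxx in cx.
Qed.

Lemma ae_eq_Ex h k : measurable_fun setT h -> measurable_fun setT k ->
  {ae mu, forall x, h x = k x} -> Ex h = Ex k.
Proof.
move=> mh mk [N [mN N0 NN]]; rewrite /Rintegral; congr fine.
apply: ae_eq_integral => //; [exact/measurable_EFinP|exact/measurable_EFinP|].
exists N; split => // x /= H; apply: NN => /= hk; apply: H => _; by rewrite hk.
Qed.

(** Hence truncating an integrable image of a bounded function gives a bounded
version of it. *)
Lemma PFn_clip n h k (c : R) : 0 <= c -> bmeas h -> (forall x, `|h x| <= c) ->
  mu.-integrable setT (EFin \o k) ->
  (forall psi, bmeas psi ->
    Ex (fun x => k x * psi x) = Ex (fun x => h x * psi (iter n T x))) ->
  PFn n h (fun x => clip c (k x)) /\ {ae mu, forall x, clip c (k x) = k x}.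
Proof.
move=> c0 bh hc ik E.
have mk : measurable_fun setT k by apply/measurable_EFinP; exact: measurable_int ik.
have H1 : {ae mu, forall x, k x <= c}.
  apply: (PFn_ae_le bh _ ik E) => x; exact: le_trans (ler_norm _) (hc x).
have H2 : {ae mu, forall x, - k x <= c}.
  apply: (@PFn_ae_le n (fun x => - h x) (fun x => - k x)).
  - exact: bmeasN.
  - by move=> x; rewrite (le_trans (ler_norm _))// normrN.
  - by apply: eq_integrable (integrableN ik).
  move=> psi bpsi; have bp := bmeas_iter n bpsi.
  have ikp := integrable_bmeasM ik bpsi.
  transitivity (- Ex (fun x => k x * psi x)).
    rewrite -mulN1r -RintegralZl//; apply: eq_Rintegral => x _; ring.
  rewrite E// -ExN; last exact: bmeasM.
  by apply: eq_Ex => x; ring.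
have H : {ae mu, forall x, clip c (k x) = k x}.
  by apply: filterS2 H1 H2 => x h1 h2; rewrite clip_id// ler_norml h1 lerNl h2.
split => //; split => //; first exact: bmeas_clip.
move=> psi bpsi; rewrite -E//; apply: ae_eq_Ex.
- by apply: measurable_funM; [exact: measurable_clip|exact: bpsi.1].
- by apply: measurable_funM => //; exact: bpsi.1.
by apply: filterS H => x ->.
Qed.

Lemma PFn_uniq n h k k' : PFn n h k -> PFn n h k' -> {ae mu, forall x, k x = k' x}.
Proof.
move=> [bh bk E] [_ bk' E'].
have aux u u' : bmeas u -> bmeas u' -> (forall psi, bmeas psi ->
    Ex (fun x => u x * psi x) = Ex (fun x => u' x * psi x)) ->
    {ae mu, forall x, u x - u' x <= 0}.
  move=> bu bu' uu'; apply: (@PFn_ae_le 0 (fun=> 0) (fun x => u x - u' x)) => //.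
  - exact: bmeas_cst.
  - exact: bmeas_int (bmeasB bu bu').
  move=> psi bpsi; transitivity (0 : R).
    have -> : Ex (fun x => (u x - u' x) * psi x) =
      Ex (fun x => u x * psi x) - Ex (fun x => u' x * psi x).
      rewrite -ExB; [|exact: bmeasM|exact: bmeasM].
      by apply: eq_Ex => x; rewrite mulrBl.
    by rewrite uu' ?subrr.
  by rewrite -[LHS](Ex_cst 0); apply: eq_Ex => x; rewrite mul0r.
have h1 := aux k k' bk bk' (fun psi b => etrans (E psi b) (esym (E' psi b))).
have h2 := aux k' k bk' bk (fun psi b => etrans (E' psi b) (esym (E psi b))).
apply: filterS2 h1 h2 => x; rewrite !subr_le0 => a b.
by apply/eqP; rewrite eq_le a b.
Qed.

Lemma PFn_ae n h h' k : PFn n h k -> bmeas h' -> {ae mu, forall x, h x = h' x} ->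
  PFn n h' k.
Proof.
move=> [bh bk E] bh' hh'; split => // psi bpsi; rewrite E//.
have bp := bmeas_iter n bpsi.
apply: ae_eq_Ex; [exact: (bmeasM bh bp).1|exact: (bmeasM bh' bp).1|].
by apply: filterS hh' => x ->.
Qed.

End BoundedMeasurable.

(** * Subgaussian bounds from reversed martingales *)

Section SubGaussian.
Context d (Om : measurableType d) (R : realType) (mu : probability Om R).
Implicit Types (h k g psi phi : Om -> R).
Notation Ex h := (\int[mu]_x (h x : R)).
Variable T : Om -> Om.
Hypothesis mT : measurable_fun setT T.
Hypothesis pT : forall A, measurable A -> mu (T @^-1` A) = mu A.

Let bit n h : bmeas h -> bmeas (fun x => h (iter n T x)).
Proof. exact: bmeas_iter. Qed.

(** One step of a reversed martingale: conditionally on T^p, the difference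
h - k o T^p is centered, whence the Gaussian bound from e^y <= y + e^(y^2). *)
Lemma reversed_step p h k (c l : R) psi : PFn mu T p h k ->
  (forall x, `|h x - k (iter p T x)| <= c) -> bmeas psi -> (forall x, 0 <= psi x) ->
  Ex (fun x => expR (l * (h x - k (iter p T x))) * psi (iter p T x)) <=
  expR (l ^+ 2 * c ^+ 2) * Ex psi.
Proof.
move=> [bh bk E] hc bpsi psi0.
have bG : bmeas (fun x => h x - k (iter p T x)) by apply: bmeasB => //; exact: bit.
have bp := bit p bpsi.
pose K := expR (l ^+ 2 * c ^+ 2).
apply: (@le_trans _ _ (Ex (fun x => l * ((h x - k (iter p T x)) * psi (iter p T x)) +
    K * psi (iter p T x)))).
  apply: Ex_le.
  - by apply: bmeasM => //; apply: bmeas_exp; exact: bmeasZ.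
  - by apply: bmeasD; [apply: bmeasZ; exact: bmeasM|exact: bmeasZ].
  move=> x; rewrite mulrA -mulrDl ler_wpM2r//; apply: le_trans (expR_le_gauss _) _.
  rewrite lerD2l ler_expR exprMn ler_wpM2l ?sqr_ge0//.
  by rewrite -[leLHS]real_normK ?num_real// ler_pXn2r ?nnegrE// (le_trans _ (hc x)).
rewrite ExD; [|by apply: bmeasZ; exact: bmeasM|exact: bmeasZ].
rewrite !ExZ//; last exact: bmeasM.
rewrite Ex_iter//.
have -> : Ex (fun x => (h x - k (iter p T x)) * psi (iter p T x)) =
    Ex (fun x => h x * psi (iter p T x)) - Ex (fun x => k (iter p T x) * psi (iter p T x)).
  rewrite -ExB; [|exact: bmeasM|by apply: bmeasM => //; exact: bit].
  by apply: eq_Ex => x; rewrite mulrBl.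
by rewrite -E// (Ex_iter mT pT p (bmeasM bk bpsi)) subrr mulr0 add0r.
Qed.

(** The step peels off the first term: what remains is a function of T^p x. *)
Lemma reversed_sum p h k G (c : R) N (l : nat -> R) psi : PFn mu T p h k ->
  (forall x, G x = h x - k (iter p T x)) ->
  (forall x, `|G x| <= c) -> bmeas psi -> (forall x, 0 <= psi x) ->
  Ex (fun x => expR (\sum_(i < N) l i * G (iter (p * i) T x)) *
    psi (iter (p * N) T x)) <=
  expR (c ^+ 2 * \sum_(i < N) l i ^+ 2) * Ex psi.
Proof.
move=> hk GE hc bpsi psi0; have [bh bk _] := hk.
have bG : bmeas G by rewrite (funext GE); apply: bmeasB => //; exact: bit.
have bS M (l' : nat -> R) : bmeas (fun x => expR (\sum_(i < M) l' i * G (iter (p * i) T x)) *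
    psi (iter (p * M) T x)).
  apply: bmeasM; last exact: bit.
  by apply: bmeas_exp; apply: bmeas_sum => i; apply: bmeasZ; exact: bit.
elim: N l => [|N IH] l.
  rewrite big_ord0 mulr0 expR0 mul1r le_eqVlt; apply/orP; left; apply/eqP.
  by apply: eq_Ex => x; rewrite big_ord0 expR0 mul1r muln0.
have {}IH := IH (fun i => l i.+1).
pose Psi x := expR (\sum_(i < N) l i.+1 * G (iter (p * i) T x)) * psi (iter (p * N) T x).
have -> : Ex (fun x => expR (\sum_(i < N.+1) l i * G (iter (p * i) T x)) *
    psi (iter (p * N.+1) T x)) =
    Ex (fun x => expR (l 0%N * G x) * Psi (iter p T x)).
  apply: eq_Ex => x; rewrite big_ord_recl muln0 /= expRD -mulrA /Psi.
  congr (_ * (expR _ * psi _)).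
    by apply: eq_bigr => i _; rewrite /bump add1n mulnSr iterD.
  by rewrite mulnSr iterD.
under eq_Rintegral => x _ do rewrite GE.
apply: le_trans (reversed_step (l 0%N) hk (c := c) _ _ _) _.
- by move=> x; rewrite -GE.
- exact: (bS N (fun i => l i.+1)).
- by move=> x; rewrite mulr_ge0 ?expR_ge0.
rewrite big_ord_recl mulrDr expRD -mulrA [l 0%N ^+ 2 * _]mulrC ler_wpM2l ?expR_ge0//.
Qed.

Lemma sum_blocks (F : nat -> R) p N :
  \sum_(j < p * N) F j = \sum_(r < p) \sum_(i < N) F (p * i + r)%N.
Proof.
elim: N => [|N IH].
  rewrite muln0 big_ord0 big1// => r _; exact: big_ord0.
rewrite mulnSr big_split_ord/= IH -big_split/=; apply: eq_bigr => r _.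
by rewrite big_ord_recr.
Qed.

(** Along each residue class modulo p the terms are reversed martingale
differences; Jensen's inequality recombines the p classes. *)
Lemma reversed_blocks p h k G (c : R) n (l : R) : PFn mu T p h k ->
  (forall x, G x = h x - k (iter p T x)) ->
  (forall x, `|G x| <= c) -> (0 < p)%N -> (p <= n)%N ->
  Ex (fun x => expR (\sum_(j < n) l * G (iter j T x))) <=
  expR (2 * l ^+ 2 * (n * p)%:R * c ^+ 2).
Proof.
move=> hk GE hc p0 pn; have [bh bk _] := hk.
have bG : bmeas G by rewrite (funext GE); apply: bmeasB => //; exact: bit.
pose N := (n %/ p).+1.
have nN : (n <= p * N)%N by rewrite mulnC ltnW// ltn_ceil.
have Nn : (p * N <= 2 * n)%N by rewrite mulnS mulnC mul2n -addnn leq_add// leq_trunc_div.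
(* Padding the sum with zeros to a multiple of p at most doubles its length. *)
pose lj j : R := if (j < n)%N then l else 0.
have lj2 j : lj j ^+ 2 <= l ^+ 2.
  by rewrite /lj; case: ifP => // _; rewrite expr0n sqr_ge0.
have pR : 0 < p%:R :> R by rewrite ltr0n.
have pN0 : p%:R != 0 :> R by rewrite gt_eqF.
pose Y r x := \sum_(i < N) p%:R * lj (p * i + r)%N * G (iter (p * i + r) T x).
have bY r : bmeas (Y r) by apply: bmeas_sum => i; apply: bmeasZ; exact: bit.
have SE x : \sum_(j < n) l * G (iter j T x) = \sum_(r < p) p%:R^-1 * Y r x.
  transitivity (\sum_(j < p * N) lj j * G (iter j T x)).
    rewrite (big_ord_widen_cond _ xpredT (fun j => l * G (iter j T x)) nN).
    rewrite big_mkcond/=; apply: eq_bigr => j _.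
    by rewrite /lj; case: ifP => // _; rewrite mul0r.
  rewrite (sum_blocks (fun j => lj j * G (iter j T x))); apply: eq_bigr => r _.
  rewrite /Y mulr_sumr; apply: eq_bigr => i _.
  by rewrite !mulrA mulVf// mul1r.
apply: (@le_trans _ _ (Ex (fun x => \sum_(r < p) p%:R^-1 * expR (Y r x)))).
  apply: Ex_le.
  - by apply: bmeas_exp; apply: bmeas_sum => j; apply: bmeasZ; exact: bit.
  - by apply: bmeas_sum => r; apply: bmeasZ; exact: bmeas_exp.
  move=> x; rewrite SE; apply: expR_jensen; first by move=> r; rewrite invr_ge0.
  by rewrite sumr_const card_ord -[LHS]mulr_natr mulVf.
rewrite Ex_sum; last by move=> r; apply: bmeasZ; exact: bmeas_exp.
apply: (@le_trans _ _ (\sum_(r < p) p%:R^-1 * expR (2 * l ^+ 2 * (n * p)%:R * c ^+ 2))); last first.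
  by rewrite -mulr_suml sumr_const card_ord -[X in X * _]mulr_natr mulVf// mul1r.
apply: ler_sum => r _; rewrite ExZ; last exact: bmeas_exp.
rewrite ler_wpM2l ?invr_ge0//.
have := @reversed_sum p h k G c N (fun i => p%:R * lj (p * i + r)%N) (fun=> 1) hk GE hc
  (bmeas_cst _ _) (fun=> ler01).
rewrite Ex_cst mulr1.
pose Z x := expR (\sum_(i < N) p%:R * lj (p * i + r)%N * G (iter (p * i) T x)).
have bZ : bmeas Z.
  by apply: bmeas_exp; apply: bmeas_sum => i; apply: bmeasZ; exact: bit.
have -> : Ex (fun x => expR (\sum_(i < N) p%:R * lj (p * i + r)%N * G (iter (p * i) T x)) * 1) = Ex Z.
  by apply: eq_Ex => x; rewrite mulr1.
rewrite -(Ex_iter mT pT r bZ) => H.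
apply: le_trans (le_trans H _).
  rewrite le_eqVlt; apply/orP; left; apply/eqP; apply: eq_Ex => x.
  by rewrite /Z /Y; congr expR; apply: eq_bigr => i _; rewrite iterD.
rewrite ler_expR mulrC ler_wpM2r ?sqr_ge0//.
apply: (@le_trans _ _ (\sum_(i < N) p%:R ^+ 2 * l ^+ 2)).
  by apply: ler_sum => i _; rewrite exprMn ler_wpM2l ?sqr_ge0.
rewrite sumr_const card_ord -[leLHS]mulr_natr.
have -> : 2 * l ^+ 2 * (n * p)%:R = l ^+ 2 * (2 * (n * p))%:R by rewrite (natrM _ 2); ring.
rewrite mulrAC mulrC ler_wpM2l ?sqr_ge0// -natrX -natrM ler_nat.
by rewrite expnS expn1 -mulnA [(2 * _)%N]mulnA [leqRHS]mulnC leq_mul2l Nn orbT.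
Qed.

(** Dyadic decomposition of a function into reversed martingale differences of
step 2^k: if the bounds of its images are such that 2^(k/2) delta(2^k) is
summable, then the Birkhoff sums are subgaussian, uniformly in l and n. *)
Lemma subgaussian (u : nat -> Om -> R) (del : nat -> R) (e0 : R) (e : nat -> R)
    (D : R) n (l : R) :
  (forall i : nat, PFn mu T i (u 0%N) (u i)) ->
  (forall (i : nat) x, `|u i x| <= del i) ->
  0 < e0 -> (forall i : nat, 0 < e i) -> del 0%N <= e0 ->
  (forall i : nat, del i.+1 <= del i) ->
  (forall i : nat, del (2 ^ i)%N ^+ 2 * (2 ^ i)%:R <= e i ^+ 2) ->
  (forall m, e0 + \sum_(k < m) e k <= D) ->
  Ex (fun x => expR (l * \sum_(j < n) u 0%N (iter j T x))) <=
  expR (1 + 8 * l ^+ 2 * n%:R * D ^+ 2).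
Proof.
move=> Hu hdel e00 ep de0 dmono He HD.
have bu (i : nat) : bmeas (u i) by have [] := Hu i.
have step a b : (a <= b)%N -> PFn mu T (b - a) (u a) (u b).
  by move=> ab; have := Hu b; rewrite -{1}(subnKC ab); exact: PFn_step.
have dmon a b : (a <= b)%N -> del b <= del a.
  by move=> /subnKC <-; elim: (b - a)%N => [|c IH]; rewrite ?addn0// addnS (le_trans (dmono _)).
have del0 (i : nat) : 0 <= del i by apply: le_trans (hdel i point).
case: n => [|n'].
  under eq_Rintegral => x _ do rewrite big_ord0 mulr0 expR0.
  by rewrite Ex_cst mulr0 mul0r addr0 ltW// expR_gt1.
set n := n'.+1; pose m := trunc_log 2 n.
have m1 : (2 ^ m <= n)%N by exact: trunc_logP.
have m2 : (n < 2 * 2 ^ m)%N by rewrite -expnS; exact: trunc_log_ltn.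
pose DD := e0 + \sum_(k < m.+1) e k.
have DD0 : 0 < DD by rewrite ltr_pwDl// sumr_ge0// => k _; exact: ltW.
(* Jensen weights proportional to the subgaussian constants of the dyadic
   parts. *)
pose w i := (if i is k.+1 then e k else e0) / DD.
have w0 i : 0 < w i by rewrite divr_gt0//; case: i.
have w1 : \sum_(i < m.+2) w i = 1.
  rewrite big_ord_recl /= /w -mulr_suml -mulrDl [X in X / _](_ : _ = DD) ?divff ?gt_eqF//.
pose G i x : R := if i is k.+1 then
    if k == m then u (2 ^ m)%N (iter (2 ^ m) T x)
    else u (2 ^ k)%N (iter (2 ^ k) T x) - u (2 ^ k.+1)%N (iter (2 ^ k.+1) T x)
  else u 0%N x - u 1%N (T x).
have bG i : bmeas (G i).
  case: i => [|k]; first by apply: bmeasB => //; exact: (bit 1).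
  by rewrite /G; case: (k == m); [exact: bit|apply: bmeasB; exact: bit].
have Gsum x : \sum_(i < m.+2) G i x = u 0%N x.
  have tel M : (M <= m)%N -> \sum_(i < M.+1) G i x = u 0%N x - u (2 ^ M)%N (iter (2 ^ M) T x).
    elim: M => [|M IH] Mm; first by rewrite big_ord_recl big_ord0 addr0.
    rewrite big_ord_recr /= IH ?(ltnW Mm)// ltn_eqF//.
    by rewrite addrA subrK.
  by rewrite big_ord_recr /= tel// eqxx subrK.
pose Y i x := \sum_(j < n) (l / w i) * G i (iter j T x).
have bY i : bmeas (Y i) by apply: bmeas_sum => j; apply: bmeasZ; exact: bit.
have SE x : l * \sum_(j < n) u 0%N (iter j T x) = \sum_(i < m.+2) w i * Y i x.
  under [in RHS]eq_bigr do rewrite mulr_sumr.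
  rewrite exchange_big/= mulr_sumr; apply: eq_bigr => j _.
  rewrite -Gsum mulr_sumr; apply: eq_bigr => i _.
  by rewrite mulrA (mulrC (w i)) divfK ?gt_eqF.
have DD_D : DD <= D by exact: HD.
have DDD : DD ^+ 2 <= D ^+ 2 by rewrite ler_pXn2r ?nnegrE// ?(le_trans (ltW DD0))// ltW.
have B0 : 0 <= 8 * l ^+ 2 * n%:R by apply: mulr_ge0 => //; apply: mulr_ge0 => //; exact: sqr_ge0.
apply: (@le_trans _ _ (Ex (fun x => \sum_(i < m.+2) w i * expR (Y i x)))).
  apply: Ex_le.
  - by apply: bmeas_exp; apply: bmeasZ; apply: bmeas_sum => j; exact: bit.
  - by apply: bmeas_sum => r; apply: bmeasZ; exact: bmeas_exp.
  by move=> x; rewrite SE; apply: expR_jensen => // i; exact: ltW.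
rewrite Ex_sum; last by move=> r; apply: bmeasZ; exact: bmeas_exp.
rewrite -[leRHS]mul1r -[X in _ <= X * _]w1 mulr_suml; apply: ler_sum => i _.
rewrite ExZ; last exact: bmeas_exp.
rewrite ler_wpM2l ?(ltW (w0 _))//.
apply: (@le_trans _ _ (expR (1 + 8 * l ^+ 2 * n%:R * DD ^+ 2))); last first.
  by rewrite ler_expR lerD2l ler_wpM2l.
have blk p a b Gi (c ei : R) : PFn mu T p (u a) (u b) -> (0 < p)%N -> (p <= n)%N ->
    (forall x, Gi x = u a x - u b (iter p T x)) -> (forall x, `|Gi x| <= 2 * c) ->
    0 < ei -> 0 <= c -> c ^+ 2 * p%:R <= ei ^+ 2 ->
    Ex (fun x => expR (\sum_(j < n) (l / (ei / DD)) * Gi (iter j T x))) <=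
    expR (1 + 8 * l ^+ 2 * n%:R * DD ^+ 2).
  move=> hP p0 pn GE Gc ei0 c0 ce.
  apply: le_trans (reversed_blocks _ hP GE Gc p0 pn) _.
  rewrite ler_expR; apply: (@le_trans _ _ (8 * l ^+ 2 * n%:R * DD ^+ 2)); last by rewrite lerDr.
  have -> : 2 * (l / (ei / DD)) ^+ 2 * (n * p)%:R * (2 * c) ^+ 2 =
     8 * l ^+ 2 * n%:R * DD ^+ 2 * (c ^+ 2 * p%:R / ei ^+ 2).
    by rewrite natrM; field; rewrite !gt_eqF.
  rewrite ler_piMr//; first by rewrite mulr_ge0// sqr_ge0.
  by rewrite ler_pdivrMr ?exprn_gt0// mul1r.
case: i => -[|k] /= ki.
  apply: (@blk 1%N 0%N 1%N _ (del 0%N)) => //.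
  - move=> x; apply: le_trans (ler_normB _ _) _; rewrite mulr2n mulrDl mul1r.
    by apply: lerD => //; apply: le_trans (hdel _ _) _; exact: dmon.
  - by rewrite mulr1 ler_pXn2r ?nnegrE//; exact: ltW.
rewrite /Y /G /w; have [km|km] := eqVneq k m.
  subst k.
  apply: (@le_trans _ _ (Ex (fun=> expR (1 + 8 * l ^+ 2 * n%:R * DD ^+ 2)))); last by rewrite Ex_cst.
  apply: Ex_le; [|exact: bmeas_cst|].
    by apply: bmeas_exp; apply: bmeas_sum => j; apply: bmeasZ; exact: (bit j (bit (2 ^ m) (bu _))).
  move=> x; rewrite ler_expR.
  (* The last part is small enough for the trivial bound of the sum by n times
     the supremum. *)
  set L := `|l| / (e m / DD) * (n%:R * del (2 ^ m)%N).
  apply: (@le_trans _ _ L).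
    apply: le_trans (ler_norm _) _; apply: le_trans (ler_norm_sum _ _ _) _.
    rewrite /L mulrCA.
    apply: (@le_trans _ _ (\sum_(j < n) `|l| / (e m / DD) * del (2 ^ m)%N)).
      apply: ler_sum => j _; rewrite normrM normf_div (gtr0_norm (_ : 0 < e m / DD)) ?divr_gt0//.
      by rewrite ler_wpM2l ?divr_ge0// ltW// divr_gt0.
    by rewrite sumr_const card_ord -[leLHS]mulr_natl.
  have L1 : L <= 1 + L ^+ 2.
    by have := sqr_ge0 (L - 2^-1); nra.
  apply: le_trans L1 _; rewrite lerD2l.
  have -> : L ^+ 2 = l ^+ 2 * n%:R * DD ^+ 2 * (del (2 ^ m)%N ^+ 2 * n%:R / e m ^+ 2).
    by rewrite /L !exprMn real_normK ?num_real//; field; rewrite !gt_eqF.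
  have -> : 8 * l ^+ 2 * n%:R * DD ^+ 2 = l ^+ 2 * n%:R * DD ^+ 2 * 8 by ring.
  have B1 : 0 <= l ^+ 2 * n%:R * DD ^+ 2.
    by apply: mulr_ge0; rewrite ?sqr_ge0//; apply: mulr_ge0; rewrite ?sqr_ge0.
  rewrite ler_wpM2l// ler_pdivrMr ?exprn_gt0//.
  apply: (@le_trans _ _ (del (2 ^ m)%N ^+ 2 * (2 * (2 ^ m)%:R))).
    by rewrite ler_wpM2l ?sqr_ge0// -natrM ler_nat ltnW.
  rewrite mulrCA; apply: (@le_trans _ _ (2 * e m ^+ 2)); first by rewrite ler_wpM2l.
  by rewrite ler_wpM2r ?sqr_ge0// ler_nat.
have km' : (k < m)%N by rewrite ltn_neqAle km -ltnS.
pose Gi x := u (2 ^ k)%N x - u (2 ^ k.+1)%N (iter (2 ^ k) T x).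
have bGi : bmeas Gi by apply: bmeasB => //; exact: bit.
have bZ : bmeas (fun x => expR (\sum_(j < n) l / (e k / DD) * Gi (iter j T x))).
  by apply: bmeas_exp; apply: bmeas_sum => j; apply: bmeasZ; exact: bit.
have k12 : (2 ^ k <= 2 ^ k.+1)%N by rewrite leq_exp2l.
have k12' : (2 ^ k.+1 - 2 ^ k = 2 ^ k)%N by rewrite expnS mul2n -addnn addnK.
have := @blk (2 ^ k)%N (2 ^ k)%N (2 ^ k.+1)%N Gi (del (2 ^ k)%N) (e k).
rewrite -(Ex_iter mT pT (2 ^ k) bZ).
move=> H; apply: le_trans (H _ _ _ _ _ _ _ _) => //.
- rewrite le_eqVlt; apply/orP; left; apply/eqP; apply: eq_Ex => x.
  congr expR; apply: eq_bigr => j _; congr (_ * _); rewrite /Gi -!iterD.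
  by rewrite (addnC j) addnA addnn -mul2n -expnS.
- by rewrite -[X in PFn _ _ X]k12'; exact: step.
- by rewrite expn_gt0.
- by apply: leq_trans m1; rewrite leq_exp2l// ltnW.
- move=> x; apply: le_trans (ler_normB _ _) _; rewrite mulr2n mulrDl mul1r.
  by apply: lerD => //; apply: le_trans (hdel _ _) _; exact: dmon.
Qed.

End SubGaussian.

(** * Exponential moments of coboundary-type observables *)

Section CubicBounds.
Variable R : realType.
Implicit Types l D w B : R.

(** Expansion to second order in l; as the term l^2 w / 2 already counts as
quadratic, the error is cubic. *)
Lemma step_taylor l D w B : 1 <= B -> `|D| <= 2 * B -> `|w| <= B ->
  `|l| * (4 * B) <= 3^-1 ->
  `|expR (l * D + l ^+ 2 / 2 * w) - (1 + l * D + l ^+ 2 / 2 * (D ^+ 2 + w))| <=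
  2 * (`|l| * (4 * B)) ^+ 3.
Proof.
move=> B1 hD hw; set M := 4 * B => lM.
have l0 : 0 <= `|l| by exact: normr_ge0.
have M0 : 0 < M by rewrite /M; lra.
have l1 : `|l| <= 1.
  have : `|l| * 1 <= `|l| * M by rewrite ler_wpM2l// /M; lra.
  by rewrite mulr1; lra.
set y := l * D + _.
have yB : `|y| <= `|l| * M.
  apply: le_trans (ler_normD _ _) _; rewrite normrM.
  have h1 : `|l| * `|D| <= `|l| * (2 * B) by rewrite ler_wpM2l.
  have h2 : `|l ^+ 2 / 2 * w| <= `|l| * B.
    rewrite normrM; apply: ler_pM => //.
    rewrite normrM normrX (ger0_norm (_ : 0 <= 2^-1))//.
    have : `|l| ^+ 2 <= `|l| by rewrite expr2 ler_piMl.
    by move: (`|l| ^+ 2) => z ?; lra.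
  have h3 : 0 <= `|l| * B by rewrite mulr_ge0//; lra.
  by move: (`|l| * `|D|) (`|_ * w|) h1 h2 => a b h1 h2; rewrite /M; lra.
have y1 : `|y| <= 1 by apply: le_trans yB _; lra.
have h4 := expR_taylor2 y1.
have h3 : `|y| ^+ 3 / 2 <= (`|l| * M) ^+ 3 / 2.
  rewrite ler_wpM2r// ler_pXn2r ?nnegrE//.
  by rewrite mulr_ge0// ltW.
have {h3}h4 := le_trans h4 h3.
have E : expR y - (1 + l * D + l ^+ 2 / 2 * (D ^+ 2 + w)) = (expR y - (1 + y + y ^+ 2 / 2)) +
   (l ^+ 3 * (D * w / 2) + l ^+ 4 * (w ^+ 2 / 8)).
  by rewrite /y; field.
rewrite {}E; apply: le_trans (ler_normD _ _) _.
have B20 : 0 <= B ^+ 2 by exact: sqr_ge0.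
have BB : B ^+ 2 <= B ^+ 3 by rewrite [leRHS]exprS ler_peMl.
have ME : M ^+ 3 = 64 * B ^+ 3 by rewrite /M; ring.
have h5 : `|l ^+ 3 * (D * w / 2)| <= `|l| ^+ 3 * (M ^+ 3 / 2).
  rewrite normrM normrX ler_wpM2l ?exprn_ge0// normrM (ger0_norm (_ : 0 <= 2^-1))//.
  have : `|D * w| <= (2 * B) * B by rewrite normrM; exact: ler_pM.
  have -> : 2 * B * B = 2 * B ^+ 2 by ring.
  by rewrite ME; move: (`|_|) (B ^+ 2) (B ^+ 3) BB B20 => a b c; lra.
have h6 : `|l ^+ 4 * (w ^+ 2 / 8)| <= `|l| ^+ 3 * (M ^+ 3 / 2).
  rewrite normrM normrX ler_pM// ?exprn_ge0//.
    by rewrite exprS ler_piMl// exprn_ge0.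
  rewrite normrM normrX (ger0_norm (_ : 0 <= 8^-1))//.
  have : `|w| ^+ 2 <= B ^+ 2 by rewrite ler_pXn2r ?nnegrE//; lra.
  by rewrite ME; move: (`|w| ^+ 2) (B ^+ 2) (B ^+ 3) BB B20 => a b c; lra.
have h7 := ler_normD (l ^+ 3 * (D * w / 2)) (l ^+ 4 * (w ^+ 2 / 8)).
have h8 : 0 <= (`|l| * M) ^+ 3 by rewrite exprn_ge0// mulr_ge0// ltW.
have h9 : (`|l| * M) ^+ 3 = `|l| ^+ 3 * M ^+ 3 by rewrite exprMn.
move: h4 h5 h6 h7 h8; rewrite h9.
move: (`|expR y - _|) (`|l ^+ 3 * _|) (`|l ^+ 4 * _|) (`|_ + _|) => a1 a2 a3 a4.
have -> : `|l| ^+ 3 * (M ^+ 3 / 2) = `|l| ^+ 3 * M ^+ 3 / 2 by rewrite mulrA.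
move: (`|l| ^+ 3 * M ^+ 3) => a5; lra.
Qed.

Lemma step_lower l w B s2 eps : 1 <= B -> `|w| <= B -> 0 <= s2 -> s2 <= B ->
  0 <= eps -> eps <= 1 -> `|l| * (4 * B) <= 3^-1 ->
  expR (l ^+ 2 / 2 * (w + s2 - eps) - 20 * (`|l| * (4 * B)) ^+ 3) <=
  1 + (l ^+ 2 / 2 * (w + s2 - eps) - 2 * (`|l| * (4 * B)) ^+ 3).
Proof.
move=> B1 hw s20 s2B e0 e1; set M := 4 * B => lM.
have l0 : 0 <= `|l| by exact: normr_ge0.
have M0 : 0 < M by rewrite /M; lra.
set L := `|l| * M in lM *.
have L0 : 0 <= L by rewrite mulr_ge0// ltW.
have L2 : L ^+ 2 <= 3^-1 * L by rewrite expr2 ler_wpM2r.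
have L3 : L ^+ 3 <= 3^-1 * L ^+ 2 by rewrite exprS ler_wpM2r ?sqr_ge0.
have L30 : 0 <= L ^+ 3 by rewrite exprn_ge0.
have l22 : 0 <= l ^+ 2 / 2 by rewrite mulr_ge0 ?sqr_ge0.
have L20 : 0 <= L ^+ 2 by exact: sqr_ge0.
set z := l ^+ 2 / 2 * (w + s2 - eps) - 2 * L ^+ 3.
have zB : `|z| <= 3 * L ^+ 2.
  have h1 : `|w + s2 - eps| <= M.
    move: hw; rewrite ler_norml => /andP[? ?].
    by rewrite ler_norml /M; apply/andP; split; lra.
  have h2 : `|l ^+ 2 / 2 * (w + s2 - eps)| <= l ^+ 2 / 2 * M.
    by rewrite normrM (ger0_norm l22) ler_wpM2l.
  have h3 : l ^+ 2 * M <= L ^+ 2.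
    rewrite /L exprMn real_normK ?num_real// ler_wpM2l ?sqr_ge0// expr2 ler_peMl//; rewrite /M; lra.
  have h5 := ler_normB (l ^+ 2 / 2 * (w + s2 - eps)) (2 * L ^+ 3).
  rewrite -/z (ger0_norm (_ : 0 <= 2 * L ^+ 3)) in h5; last by rewrite mulr_ge0.
  have E : l ^+ 2 / 2 * M = l ^+ 2 * M / 2 by field.
  rewrite E in h2; move: (l ^+ 2 * M) (`|l ^+ 2 / 2 * _|) h2 h3 h5 => a b; lra.
have z2 : `|z| <= 2^-1 by apply: le_trans zB _; lra.
apply: le_trans (expR_le_1Dz z2); rewrite ler_expR.
have zz : z ^+ 2 <= 9 * L ^+ 3.
  rewrite -(real_normK (num_real z)); apply: (@le_trans _ _ ((3 * L ^+ 2) ^+ 2)).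
    by rewrite ler_pXn2r ?nnegrE// mulr_ge0.
  have -> : (3 * L ^+ 2) ^+ 2 = 9 * (L * L ^+ 3) by ring.
  by rewrite ler_wpM2l// ler_piMl//; lra.
move: zz; rewrite {2}/z; move: (z ^+ 2) (l ^+ 2 / 2 * _) => a b; lra.
Qed.

End CubicBounds.

Section LaplaceMartingale.
Context d (Om : measurableType d) (R : realType) (mu : probability Om R).
Implicit Types (h psi phi : Om -> R).
Notation Ex h := (\int[mu]_x (h x : R)).

Lemma Ex_lincomb7 (a b : R) (f1 f2 f3 f4 f5 f6 f7 : Om -> R) :
  bmeas f1 -> bmeas f2 -> bmeas f3 -> bmeas f4 -> bmeas f5 -> bmeas f6 -> bmeas f7 ->
  Ex (fun x => f1 x + a * (f2 x - f3 x) + b * (f4 x - 2 * f5 x + f6 x + f7 x)) =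
  Ex f1 + a * (Ex f2 - Ex f3) + b * (Ex f4 - 2 * Ex f5 + Ex f6 + Ex f7).
Proof.
move=> b1 b2 b3 b4 b5 b6 b7.
have c1 := bmeasB b2 b3; have c2 := bmeasZ a c1; have c3 := bmeasD b1 c2.
have c4 := bmeasZ 2 b5; have c5 := bmeasB b4 c4; have c6 := bmeasD c5 b6.
have c7 := bmeasD c6 b7; have c8 := bmeasZ b c7.
rewrite (ExD mu c3 c8) (ExD mu b1 c2) (ExZ mu a c1) (ExB mu b2 b3) (ExZ mu b c7).
by rewrite (ExD mu c6 b7) (ExD mu c5 b6) (ExB mu b4 c4) (ExZ mu 2 b5).
Qed.

Lemma Ex_lincomb4 (b c : R) (f1 f2 f3 f4 : Om -> R) :
  bmeas f1 -> bmeas f2 -> bmeas f3 -> bmeas f4 ->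
  Ex (fun x => (1 + b * (f2 x - f3 x + f4 x) + c) * f1 x) =
  Ex f1 + b * (Ex (fun x => f2 x * f1 x) - Ex (fun x => f3 x * f1 x) + Ex (fun x => f4 x * f1 x)) + c * Ex f1.
Proof.
move=> b1 b2 b3 b4.
have c2 := bmeasM b2 b1; have c3 := bmeasM b3 b1; have c4 := bmeasM b4 b1.
have c5 := bmeasB c2 c3; have c6 := bmeasD c5 c4; have c7 := bmeasZ b c6.
have c8 := bmeasD b1 c7; have c9 := bmeasZ c b1.
rewrite -(ExB mu c2 c3) -(ExD mu c5 c4) -(ExZ mu b c6) -(ExD mu b1 c7) -(ExZ mu c b1).
by rewrite -(ExD mu c8 c9); apply: eq_Ex => x; ring.
Qed.

Variable T : Om -> Om.
Hypothesis mT : measurable_fun setT T.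
Hypothesis pT : forall A, measurable A -> mu (T @^-1` A) = mu A.

(** The first term is taken at T x: with the time reversal of the process, the
sum of its first k terms is then birkhoff n - birkhoff (n - k). *)
Definition birkhoff h (n : nat) (x : Om) : R := \sum_(j < n) h (iter j.+1 T x).

Lemma birkhoffD h m n x :
  birkhoff h (m + n) x = birkhoff h m x + birkhoff h n (iter m T x).
Proof.
rewrite /birkhoff big_split_ord/=; congr (_ + _); apply: eq_bigr => j _.
by rewrite -iterD addnC.
Qed.

Lemma bmeas_birkhoff h n : bmeas h -> bmeas (birkhoff h n).
Proof. by move=> bh; apply: bmeas_sum => j; exact: bmeas_iter. Qed.

(** kg, w2, kw are images of g, g^2, w; so w2 - kg^2 is the conditional
variance of the martingale part of g - kg, and w solves its Poisson equation up
to eps. *)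
Record corrector (g kg w2 w kw : Om -> R) (B s2 eps : R) : Prop := Corrector {
  corr_g : PFn mu T 1 g kg;
  corr_g2 : PFn mu T 1 (fun x => g x ^+ 2) w2;
  corr_w : PFn mu T 1 w kw;
  corr_B : 1 <= B;
  corr_gB : forall x, `|g x| <= B;
  corr_kgB : forall x, `|kg x| <= B;
  corr_wB : forall x, `|w x| <= B;
  corr_s20 : 0 <= s2;
  corr_s2B : s2 <= B;
  corr_e0 : 0 <= eps;
  corr_e1 : eps <= 1;
  corr_poisson : forall x, `|w2 x - kg x ^+ 2 + kw x - (w x + s2)| <= eps }.

Definition cubic_cst (B : R) : R := 20 * (4 * B) ^+ 3.

(** The linear term disappears because kg is the image of g, and the image of (g
- kg o T)^2 is w2 - kg^2. *)
Lemma laplace_quadratic g kg w2 w kw (l : R) phi :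
  PFn mu T 1 g kg -> PFn mu T 1 (fun x => g x ^+ 2) w2 -> PFn mu T 1 w kw ->
  bmeas phi ->
  Ex (fun x => (1 + l * (g x - kg (T x)) +
    l ^+ 2 / 2 * ((g x - kg (T x)) ^+ 2 + w x)) * phi (T x)) =
  Ex phi + l ^+ 2 / 2 * (Ex (fun x => w2 x * phi x) - Ex (fun x => kg x ^+ 2 * phi x) +
    Ex (fun x => kw x * phi x)).
Proof.
move=> [bg bk E1] [bg2 bw2 E2] [bw bkw E3] bp.
have bpT : bmeas (fun x => phi (T x)) by exact: bmeas_comp.
have bkp := bmeasM bk bp; have bk2p := bmeasM (bmeas_sqr bk) bp.
have b3 : bmeas (fun x => kg (T x) * phi (T x)) by exact: bmeas_comp bkp.
have b6 : bmeas (fun x => kg (T x) ^+ 2 * phi (T x)) by exact: bmeas_comp bk2p.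
have b2 := bmeasM bg bpT; have b4 := bmeasM bg2 bpT; have b5 := bmeasM bg b3.
have b7 := bmeasM bw bpT.
have := Ex_lincomb7 l (l ^+ 2 / 2) bpT b2 b3 b4 b5 b6 b7.
rewrite (Ex_comp mT pT bp) -(E1 _ bp) (Ex_comp mT pT bkp) -(E2 _ bp) -(E1 _ bkp).
rewrite (Ex_comp mT pT bk2p) -(E3 _ bp).
have -> : Ex (fun x => kg x * (kg x * phi x)) = Ex (fun x => kg x ^+ 2 * phi x).
  by apply: eq_Ex => x; rewrite mulrA expr2.
move=> H; transitivity (Ex (fun x => phi (T x) + l * (g x * phi (T x) - kg (T x) * phi (T x)) +
    l ^+ 2 / 2 * (g x ^+ 2 * phi (T x) - 2 * (g x * (kg (T x) * phi (T x))) +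
      kg (T x) ^+ 2 * phi (T x) + w x * phi (T x)))).
  by apply: eq_Ex => x; ring.
by rewrite H; ring.
Qed.

(** A corrector for exponentials: with the potential l g + l^2 w / 2 the
weighted transfer operator acts almost as the scalar exp (l^2 s2 / 2). *)
Lemma laplace_step g kg w2 w kw B s2 eps (l : R) psi :
  corrector g kg w2 w kw B s2 eps -> `|l| * (4 * B) <= 3^-1 ->
  bmeas psi -> (forall x, 0 <= psi x) ->
  let G x := l * g x + l ^+ 2 / 2 * w x in
  let I1 := Ex (fun x => expR (G x) * (expR (l * (g (T x) - kg (T x))) * psi (T x))) in
  let I0 := Ex (fun x => expR (G x) * psi x) in
  (I1 <= expR (l ^+ 2 / 2 * (s2 + eps) + cubic_cst B * `|l| ^+ 3) * I0) /\
  (expR (l ^+ 2 / 2 * (s2 - eps) - cubic_cst B * `|l| ^+ 3) * I0 <= I1).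
Proof.
move=> [gK g2K wK B1 gB kgB wB s20 s2B e0 e1 poi] lB bpsi psi0 G I1 I0.
have [bg bk _] := gK; have [_ bw2 _] := g2K; have [bw bkw _] := wK.
pose Phi x := expR (l * g x) * psi x.
have bPhi : bmeas Phi by exact: bmeasM (bmeas_exp (bmeasZ l bg)) bpsi.
have Phi0 x : 0 <= Phi x by rewrite mulr_ge0 ?expR_ge0.
have bPT : bmeas (fun x => Phi (T x)) by exact: bmeas_comp.
have bkT : bmeas (fun x => kg (T x)) by exact: bmeas_comp.
pose D x := g x - kg (T x); have bD : bmeas D := bmeasB bg bkT.
pose y x := l * D x + l ^+ 2 / 2 * w x.
have by_ : bmeas y := bmeasD (bmeasZ l bD) (bmeasZ (l ^+ 2 / 2) bw).
pose P x := 1 + l * D x + l ^+ 2 / 2 * (D x ^+ 2 + w x).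
have bP : bmeas P := bmeasD (bmeasD (bmeas_cst Om 1) (bmeasZ l bD))
  (bmeasZ (l ^+ 2 / 2) (bmeasD (bmeas_sqr bD) bw)).
pose V x := w2 x - kg x ^+ 2 + kw x.
have I1E : I1 = Ex (fun x => expR (y x) * Phi (T x)).
  apply: eq_Ex => x; rewrite /Phi !mulrA -!expRD; congr (expR _ * _).
  by rewrite /G /y /D; ring.
pose E3 := 2 * (`|l| * (4 * B)) ^+ 3.
have EP c : Ex (fun x => (P x + c) * Phi (T x)) =
    Ex (fun x => (1 + l ^+ 2 / 2 * V x + c) * Phi x).
  rewrite (Ex_lincomb4 _ c bPhi bw2 (bmeas_sqr bk) bkw) -(laplace_quadratic l gK g2K wK bPhi).
  rewrite -(Ex_comp mT pT bPhi) -(ExZ mu c bPT) -(ExD mu (bmeasM bP bPT) (bmeasZ c bPT)).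
  by apply: eq_Ex => x; rewrite mulrDl.
have ty x : P x - E3 <= expR (y x) /\ expR (y x) <= P x + E3.
  have hD : `|D x| <= 2 * B by rewrite mulrDl mul1r; exact: le_trans (ler_normB _ _) (lerD (gB _) (kgB _)).
  have := step_taylor B1 hD (wB x) lB; rewrite -/(y x) -/(P x) -/E3 ler_norml => /andP[].
  by move: (expR _) (P x) E3 => a b c h1 h2; split; lra.
have pp x : w x + s2 - eps <= V x /\ V x <= w x + s2 + eps.
  have := poi x; rewrite -/(V x) ler_norml => /andP[].
  by move: (V x) (w x) => a b h1 h2; split; lra.
have l22 : 0 <= l ^+ 2 / 2 by rewrite mulr_ge0 ?sqr_ge0.
have cubE : cubic_cst B * `|l| ^+ 3 = 20 * (`|l| * (4 * B)) ^+ 3.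
  by rewrite /cubic_cst; ring.
have L30 : 0 <= (`|l| * (4 * B)) ^+ 3.
  by rewrite exprn_ge0// mulr_ge0//; lra.
have I0E c : expR c * I0 = Ex (fun x => expR (l ^+ 2 / 2 * w x + c) * Phi x).
  rewrite -ExZ; last exact: bmeasM (bmeas_exp (bmeasD (bmeasZ l bg) (bmeasZ (l ^+ 2 / 2) bw))) bpsi.
  by apply: eq_Ex => x; rewrite /Phi !mulrA -!expRD; congr (expR _ * _); rewrite /G; ring.
have bexp c : bmeas (fun x => expR (l ^+ 2 / 2 * w x + c) * Phi x) :=
  bmeasM (bmeas_exp (bmeasD (bmeasZ (l ^+ 2 / 2) bw) (bmeas_cst Om c))) bPhi.
have bVc c : bmeas (fun x => (1 + l ^+ 2 / 2 * V x + c) * Phi x) :=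
  bmeasM (bmeasD (bmeasD (bmeas_cst Om 1) (bmeasZ (l ^+ 2 / 2)
    (bmeasD (bmeasB bw2 (bmeas_sqr bk)) bkw))) (bmeas_cst Om c)) bPhi.
have bPc c : bmeas (fun x => (P x + c) * Phi (T x)) :=
  bmeasM (bmeasD bP (bmeas_cst Om c)) bPT.
have byP : bmeas (fun x => expR (y x) * Phi (T x)) := bmeasM (bmeas_exp by_) bPT.
rewrite I1E !I0E cubE; split.
  apply: (@le_trans _ _ (Ex (fun x => (P x + E3) * Phi (T x)))).
    by apply: Ex_le => // x; rewrite ler_wpM2r//; have [] := ty x.
  rewrite EP; apply: Ex_le => // x; rewrite ler_wpM2r// -addrA.
  apply: le_trans (expR_ge1Dx _) _; rewrite ler_expR.
  have [_ h] := pp x; have h1 := ler_wpM2l l22 h.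
  have h2 : l ^+ 2 / 2 * (w x + s2 + eps) = l ^+ 2 / 2 * w x + l ^+ 2 / 2 * (s2 + eps) by ring.
  have h3 : E3 <= 20 * (`|l| * (4 * B)) ^+ 3 by rewrite /E3 ler_wpM2r// ler_nat.
  by rewrite addrA -h2; apply: lerD.
apply: (@le_trans _ _ (Ex (fun x => (P x - E3) * Phi (T x)))); last first.
  by apply: Ex_le => // x; rewrite ler_wpM2r//; have [] := ty x.
rewrite EP; apply: Ex_le => // x; rewrite ler_wpM2r//.
have h2 := step_lower B1 (wB x) s20 s2B e0 e1 lB.
have [h _] := pp x; have h1 := ler_wpM2l l22 h.
have -> : l ^+ 2 / 2 * w x + (l ^+ 2 / 2 * (s2 - eps) - 20 * (`|l| * (4 * B)) ^+ 3) =
  l ^+ 2 / 2 * (w x + s2 - eps) - 20 * (`|l| * (4 * B)) ^+ 3 by ring.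
by apply: le_trans h2 _; rewrite addrA lerD2r lerD2l.
Qed.

(** Iterating the step over a block of length n, the potential contributes only
at the two ends. *)
Lemma laplace_block g kg w2 w kw B s2 eps (l : R) n psi :
  corrector g kg w2 w kw B s2 eps -> `|l| * (4 * B) <= 3^-1 ->
  bmeas psi -> (forall x, 0 <= psi x) ->
  let I := Ex (fun x => expR (l * birkhoff (fun x => g x - kg x) n x) * psi (iter n T x)) in
  (I <= expR (2 + n%:R * (l ^+ 2 / 2 * (s2 + eps) + cubic_cst B * `|l| ^+ 3)) * Ex psi) /\
  (expR (- 2 + n%:R * (l ^+ 2 / 2 * (s2 - eps) - cubic_cst B * `|l| ^+ 3)) * Ex psi <= I).
Proof.
move=> C lB bpsi psi0.
have [bg bk _] := corr_g C; have [bw _ _] := corr_w C.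
pose q x := g x - kg x; have bq : bmeas q := bmeasB bg bk.
pose G x := l * g x + l ^+ 2 / 2 * w x.
have bG : bmeas G := bmeasD (bmeasZ l bg) (bmeasZ (l ^+ 2 / 2) bw).

pose Psi j x := expR (l * birkhoff q j x) * psi (iter j T x).
have bPsi j : bmeas (Psi j) := bmeasM (bmeas_exp (bmeasZ l (bmeas_birkhoff j bq))) (bmeas_iter mT j bpsi).
have Psi0 j x : 0 <= Psi j x by rewrite mulr_ge0 ?expR_ge0.
pose F j := Ex (fun x => expR (G x) * Psi j x).
have FS j : F j.+1 = Ex (fun x => expR (G x) * (expR (l * (g (T x) - kg (T x))) * Psi j (T x))).
  apply: eq_Ex => x; congr (_ * _); rewrite /Psi mulrA -expRD -iterSr; congr (expR _ * _).
  by rewrite -addn1 addnC birkhoffD mulrDr /birkhoff big_ord1.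
have SE k (c : R) : k.+1%:R * c = c + k%:R * c by rewrite -nat1r mulrDl mul1r.
have up : F n <= expR (n%:R * (l ^+ 2 / 2 * (s2 + eps) + cubic_cst B * `|l| ^+ 3)) * F 0%N.
  elim: n => [|n IH]; first by rewrite mul0r expR0 mul1r.
  have [h _] := laplace_step C lB (bPsi n) (Psi0 n).
  rewrite FS; apply: le_trans h _; rewrite SE expRD -(mulrA (expR _)).
  by rewrite ler_wpM2l ?expR_ge0.
have lo : expR (n%:R * (l ^+ 2 / 2 * (s2 - eps) - cubic_cst B * `|l| ^+ 3)) * F 0%N <= F n.
  elim: n {up} => [|n IH]; first by rewrite mul0r expR0 mul1r.
  have [_ h] := laplace_step C lB (bPsi n) (Psi0 n).
  rewrite FS; apply: le_trans h; rewrite SE expRD -(mulrA (expR _)).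
  by rewrite ler_wpM2l ?expR_ge0.
have GB x : `|G x| <= 1.
  have B1 := corr_B C; have l0 : 0 <= `|l| by exact: normr_ge0.
  have h1 : `|l * g x| <= `|l| * B by rewrite normrM ler_wpM2l// (corr_gB C).
  have h2 : `|l| * 1 <= `|l| * B by rewrite ler_wpM2l.
  have h3 : `|l ^+ 2 / 2 * w x| <= `|l| * B.
    rewrite normrM; apply: ler_pM => //; last exact: (corr_wB C).
    rewrite normrM normrX (ger0_norm (_ : 0 <= 2^-1))//.
    have : `|l| ^+ 2 <= `|l| by rewrite expr2 ler_piMl//; lra.
    by move: (`|l| ^+ 2) => z ?; lra.
  apply: le_trans (ler_normD _ _) _.
  by move: h1 h3 lB; rewrite mulrCA; move: (`|_ * g x|) (`|_ * w x|) (`|l| * B) => a b c; lra.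
have bP := bmeas_exp bG.
have F0up : F 0%N <= expR 1 * Ex psi.
  rewrite -ExZ//; apply: Ex_le; [exact: bmeasM|exact: bmeasZ|] => x.
  rewrite /Psi /birkhoff big_ord0 mulr0 expR0 mul1r ler_wpM2r// ler_expR.
  exact: le_trans (ler_norm _) (GB x).
have F0lo : expR (- 1) * Ex psi <= F 0%N.
  rewrite -ExZ//; apply: Ex_le; [exact: bmeasZ|exact: bmeasM|] => x.
  rewrite /Psi /birkhoff big_ord0 mulr0 expR0 mul1r ler_wpM2r// ler_expR.
  by have := GB x; rewrite ler_norml => /andP[].
move=> I.
have Iup : I <= expR 1 * F n.
  rewrite -ExZ; last exact: bmeasM.
  apply: Ex_le; [exact: bPsi|by apply: bmeasZ; exact: bmeasM|] => x.
  rewrite [leRHS]mulrA -expRD.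
  change (Psi n x <= expR (1 + G x) * Psi n x).
  rewrite ler_peMl// -[leLHS]expR0 ler_expR.
  by have := GB x; rewrite ler_norml => /andP[? ?]; lra.
have Ilo : expR (- 1) * F n <= I.
  rewrite -ExZ; last exact: bmeasM.
  apply: Ex_le; [by apply: bmeasZ; exact: bmeasM|exact: bPsi|] => x.
  rewrite [leLHS]mulrA -expRD.
  change (expR (- 1 + G x) * Psi n x <= Psi n x).
  rewrite ler_piMl// -[leRHS]expR0 ler_expR.
  by have := GB x; rewrite ler_norml => /andP[? ?]; lra.
split.
  apply: le_trans Iup _; rewrite (_ : 2 = 1 + 1)// -addrA expRD -(mulrA (expR _)) ler_wpM2l ?expR_ge0//.
  apply: le_trans up _; rewrite addrC expRD -(mulrA (expR _)) ler_wpM2l ?expR_ge0//.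
apply: le_trans Ilo; rewrite (_ : - 2 = - 1 + - 1 :> R); last by ring.
rewrite -addrA expRD -(mulrA (expR _)) ler_wpM2l ?expR_ge0//.
by apply: le_trans lo; rewrite addrC expRD -(mulrA (expR _)) ler_wpM2l ?expR_ge0.
Qed.

(** The first block is peeled off: the others are functions of the point reached
at its end. *)
Lemma laplace_blocks g kg w2 w kw B s2 eps m (t : nat -> R) (e : nat -> nat) :
  corrector g kg w2 w kw B s2 eps -> (forall i, `|t i| * (4 * B) <= 3^-1) ->
  (forall i, (e i <= e i.+1)%N) ->
  let q x := g x - kg x in
  let I := Ex (fun x => expR (\sum_(i < m) t i * (birkhoff q (e i.+1) x - birkhoff q (e i) x))) in
  (I <= expR (\sum_(i < m) (2 + (e i.+1 - e i)%N%:R *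
      (t i ^+ 2 / 2 * (s2 + eps) + cubic_cst B * `|t i| ^+ 3)))) /\
  (expR (\sum_(i < m) (- 2 + (e i.+1 - e i)%N%:R *
      (t i ^+ 2 / 2 * (s2 - eps) - cubic_cst B * `|t i| ^+ 3))) <= I).
Proof.
move=> C; have [bg bk _] := corr_g C.
pose q x := g x - kg x; have bq : bmeas q := bmeasB bg bk.
pose Y (t : nat -> R) (e : nat -> nat) m x :=
  \sum_(i < m) t i * (birkhoff q (e i.+1) x - birkhoff q (e i) x).
have bY t' e' n : bmeas (Y t' e' n).
  apply: bmeas_sum => i; apply: bmeasZ; apply: bmeasB; exact: bmeas_birkhoff.
elim: m t e => [|m IH] t e lt he.
  rewrite /= !big_ord0 expR0.
  have -> : Ex (fun x => expR (\sum_(i < 0) t i * (birkhoff q (e i.+1) x - birkhoff q (e i) x))) = 1.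
    by rewrite -[RHS](Ex_cst mu 1); apply: eq_Ex => x; rewrite big_ord0 expR0.
  by rewrite lexx.
pose t' i := t i.+1; pose e' i := (e i.+1 - e 1%N)%N.
have mono i : (e 1%N <= e i.+1)%N by elim: i => // i IHi; exact: leq_trans IHi (he _).
have he' i : (e' i <= e' i.+1)%N by rewrite leq_sub2r.
have [up lo] := IH t' e' (fun i => lt i.+1) he'.
have d' i : (e' i.+1 - e' i = e i.+2 - e i.+1)%N.
  by rewrite /e' subnBA ?subnK//.
have YE x : Y t e m.+1 x = t 0%N * birkhoff q (e 1%N - e 0%N) (iter (e 0%N) T x) + Y t' e' m (iter (e 1%N - e 0%N) T (iter (e 0%N) T x)).
  rewrite /Y big_ord_recl/=; congr (t _ * _ + _).
    by rewrite -{1}(subnKC (he 0%N)) birkhoffD addrC addKr.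
  apply: eq_bigr => i _; congr (_ * _); rewrite -iterD subnK//.
  have E2 k : birkhoff q (e' k) (iter (e 1%N) T x) = birkhoff q (e k.+1) x - birkhoff q (e 1%N) x.
    by have := birkhoffD q (e 1%N) (e' k) x; rewrite subnKC// => ->; ring.
  by rewrite -/q !E2 /bump/= add1n; ring.
pose psi x := expR (Y t' e' m x); have bpsi : bmeas psi := bmeas_exp (bY _ _ _).
have psi0 x : 0 <= psi x by exact: expR_ge0.
move=> q' I; have IE : I = Ex (fun x => expR (t 0%N * birkhoff q (e 1%N - e 0%N) x) * psi (iter (e 1%N - e 0%N) T x)).
  have bb := bmeasM (bmeas_exp (bmeasZ (t 0%N) (bmeas_birkhoff (e 1%N - e 0%N) bq))) (bmeas_iter mT (e 1%N - e 0%N) bpsi).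
  rewrite -(Ex_iter mT pT (e 0%N) bb); apply: eq_Ex => x.
  by rewrite -/q -/(Y t e m.+1 x) YE expRD.
have [U L] := laplace_block (e 1%N - e 0%N) C (lt 0%N) bpsi psi0.
rewrite -/q -IE in U L; split.
  apply: le_trans U _; rewrite big_ord_recl [leRHS]expRD ler_wpM2l ?expR_ge0//.
  by apply: le_trans up _; rewrite ler_expR; under eq_bigr do rewrite d'.
apply: le_trans L; rewrite big_ord_recl [leLHS]expRD ler_wpM2l ?expR_ge0//.
by apply: le_trans lo; rewrite ler_expR; under [leRHS]eq_bigr do rewrite d'.
Qed.

End LaplaceMartingale.

(** * Laplace asymptotics for approximable observables *)

Section LaplaceApproximation.
Context d (Om : measurableType d) (R : realType) (mu : probability Om R).
Implicit Types (h psi phi : Om -> R).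
Notation Ex h := (\int[mu]_x (h x : R)).

(** Hoelder's inequality for exponentials, by pointwise convexity after
normalizing both exponential moments to 1. *)
Lemma Ex_expR_convex (a b A B : R) h k : bmeas h -> bmeas k ->
  0 <= a -> 0 <= b -> a + b = 1 ->
  Ex (fun x => expR (h x)) <= expR A -> Ex (fun x => expR (k x)) <= expR B ->
  Ex (fun x => expR (a * h x + b * k x)) <= expR (a * A + b * B).
Proof.
move=> bh bk a0 b0 ab1 hA kB.
have convE (x y : R) : expR (a * x + b * y) <= a * expR x + b * expR y.
  set z := a * x + b * y.
  have t u : expR z * (1 + (u - z)) <= expR u.
    rewrite (_ : expR u = expR z * expR (u - z)); last by rewrite -expRD; congr expR; ring.
    by rewrite ler_wpM2l ?expR_ge0// expR_ge1Dx.
  have -> : expR z = a * (expR z * (1 + (x - z))) + b * (expR z * (1 + (y - z))).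
    transitivity (expR z * (a + b + (z - (a + b) * z))); first by rewrite ab1; ring.
    by rewrite /z; ring.
  by apply: lerD; apply: ler_wpM2l.
have bh1 : bmeas (fun x => expR (h x - A)) := bmeas_exp (bmeasB bh (bmeas_cst Om A)).
have bk1 : bmeas (fun x => expR (k x - B)) := bmeas_exp (bmeasB bk (bmeas_cst Om B)).
have small u C : bmeas u -> Ex (fun x => expR (u x)) <= expR C ->
    Ex (fun x => expR (u x - C)) <= 1.
  move=> bu uC.
  have -> : Ex (fun x => expR (u x - C)) = expR (- C) * Ex (fun x => expR (u x)).
    rewrite -ExZ; last exact: bmeas_exp.
    by apply: eq_Ex => x; rewrite -expRD addrC.
  by rewrite -(expRxMexpNx_1 C) mulrC ler_wpM2r ?expR_ge0.
pose s := expR (a * A + b * B).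
apply: (@le_trans _ _ (Ex (fun x => s * (a * expR (h x - A) + b * expR (k x - B))))).
  apply: Ex_le => [||x].
  - exact: bmeas_exp (bmeasD (bmeasZ a bh) (bmeasZ b bk)).
  - exact: bmeasZ (bmeasD (bmeasZ a bh1) (bmeasZ b bk1)).
  have -> : a * h x + b * k x = (a * A + b * B) + (a * (h x - A) + b * (k x - B)) by ring.
  by rewrite (expRD (a * A + b * B)) ler_wpM2l ?expR_ge0.
rewrite (ExZ mu s (bmeasD (bmeasZ a bh1) (bmeasZ b bk1))).
rewrite (ExD mu (bmeasZ a bh1) (bmeasZ b bk1)) (ExZ mu a bh1) (ExZ mu b bk1).
rewrite -[leRHS]mulr1 ler_wpM2l ?expR_ge0// -ab1.
by apply: lerD; rewrite -[leRHS]mulr1 ler_wpM2l// small.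
Qed.

Lemma Ex_expR_jensen m (Y : nat -> Om -> R) (c : R) : (forall i, bmeas (Y i)) -> 0 <= c ->
  (forall i, (i < m)%N -> Ex (fun x => expR (m%:R * Y i x)) <= expR c) ->
  Ex (fun x => expR (\sum_(i < m) Y i x)) <= expR c.
Proof.
move=> bY c0 hY; case: m hY => [|m] hY.
  apply: (@le_trans _ _ 1); last by rewrite -expR0 ler_expR.
  by rewrite -[leRHS](Ex_cst mu 1) le_eqVlt; apply/orP; left; apply/eqP/eq_Ex => x; rewrite big_ord0 expR0.
have m0 : m.+1%:R != 0 :> R by rewrite pnatr_eq0.
have bE i : bmeas (fun x => expR (m.+1%:R * Y i x)) := bmeas_exp (bmeasZ _ (bY i)).
apply: (@le_trans _ _ (Ex (fun x => \sum_(i < m.+1) m.+1%:R^-1 * expR (m.+1%:R * Y i x)))).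
  apply: Ex_le => [||x].
  - by apply: bmeas_exp; apply: bmeas_sum => i.
  - by apply: bmeas_sum => i; exact: bmeasZ.
  have -> : \sum_(i < m.+1) Y i x = \sum_(i < m.+1) m.+1%:R^-1 * (m.+1%:R * Y i x).
    by apply: eq_bigr => i _; rewrite mulKf.
  apply: (@expR_jensen _ _ _ (fun=> m.+1%:R^-1) (fun i : 'I_m.+1 => m.+1%:R * Y i x)); first by move=> r; rewrite invr_ge0.
  by rewrite sumr_const card_ord -[LHS]mulr_natr mulVf.
rewrite (Ex_sum mu (index_enum 'I_m.+1) (F := fun i x => m.+1%:R^-1 * expR (m.+1%:R * Y i x))); last first.
  by move=> i; exact: bmeasZ.
apply: (@le_trans _ _ (\sum_(i < m.+1) m.+1%:R^-1 * expR c)).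
  by apply: ler_sum => i _; rewrite ExZ// ler_wpM2l// hY.
by rewrite sumr_const card_ord -[leLHS]mulr_natl mulrA mulfV// mul1r.
Qed.

Variable T : Om -> Om.
Hypothesis mT : measurable_fun setT T.
Hypothesis pT : forall A, measurable A -> mu (T @^-1` A) = mu A.

(** phi is a function with an almost exact corrector, up to a remainder whose
Birkhoff sums have small subgaussian constant. *)
Definition approximable phi (s2 : R) : Prop := forall del : R, 0 < del -> del <= 1 ->
  exists g kg w2 w kw : Om -> R, exists B s : R,
    [/\ corrector mu T g kg w2 w kw B s del, `|s - s2| <= del &
      forall n l, Ex (fun x => expR (l * birkhoff T (fun x => phi x - (g x - kg x)) n x)) <=
        expR (1 + l ^+ 2 * n%:R * del)].

Definition weighted_birkhoff phi m (t : nat -> R) (e : nat -> nat) x :=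
  \sum_(i < m) t i * (birkhoff T phi (e i.+1) x - birkhoff T phi (e i) x).

Lemma bmeas_weighted_birkhoff phi m t e : bmeas phi -> bmeas (weighted_birkhoff phi m t e).
Proof.
by move=> bphi; apply: bmeas_sum => i; apply: bmeasZ; apply: bmeasB; exact: bmeas_birkhoff.
Qed.

Lemma weighted_birkhoff_subgaussian u (D tau : R) m t e : bmeas u -> 0 <= D ->
  (forall n l, Ex (fun x => expR (l * birkhoff T u n x)) <= expR (1 + l ^+ 2 * n%:R * D)) ->
  (forall i, `|t i| <= tau) -> (forall i, (e i <= e i.+1)%N) ->
  Ex (fun x => expR (weighted_birkhoff u m t e x)) <=
  expR (1 + m%:R ^+ 2 * tau ^+ 2 * D * \sum_(i < m) (e i.+1 - e i)%N%:R).
Proof.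
move=> bu D0 sg ttau he.
have S0 : 0 <= \sum_(i < m) (e i.+1 - e i)%N%:R :> R by apply: sumr_ge0.
have mt0 : 0 <= m%:R ^+ 2 * tau ^+ 2 * D by apply: mulr_ge0 => //; apply: mulr_ge0; exact: sqr_ge0.
apply: (Ex_expR_jensen (Y := fun i x => t i * (birkhoff T u (e i.+1) x - birkhoff T u (e i) x))).
- by move=> i; apply: bmeasZ; apply: bmeasB; exact: bmeas_birkhoff.
- by rewrite addr_ge0// mulr_ge0.
move=> i im.
have E x : birkhoff T u (e i.+1) x - birkhoff T u (e i) x = birkhoff T u (e i.+1 - e i) (iter (e i) T x).
  by rewrite -{1}(subnKC (he i)) birkhoffD addrC addKr.
have bb := bmeas_exp (bmeasZ (m%:R * t i) (bmeas_birkhoff mT (e i.+1 - e i) bu)).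
have -> : Ex (fun x => expR (m%:R * (t i * (birkhoff T u (e i.+1) x - birkhoff T u (e i) x)))) =
    Ex (fun x => expR (m%:R * t i * birkhoff T u (e i.+1 - e i) x)).
  by rewrite -(Ex_iter mT pT (e i) bb); apply: eq_Ex => x; rewrite E mulrA.
apply: le_trans (sg _ _) _; rewrite ler_expR lerD2l exprMn.
have -> : m%:R ^+ 2 * t i ^+ 2 * (e i.+1 - e i)%:R * D = m%:R ^+ 2 * D * (t i ^+ 2 * (e i.+1 - e i)%:R) by ring.
have -> : m%:R ^+ 2 * tau ^+ 2 * D * \sum_(i < m) (e i.+1 - e i)%:R =
  m%:R ^+ 2 * D * (tau ^+ 2 * \sum_(i < m) (e i.+1 - e i)%:R) by ring.
rewrite ler_wpM2l ?mulr_ge0 ?sqr_ge0// ler_pM ?sqr_ge0//.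
  by rewrite -(real_normK (num_real (t i))) ler_pXn2r ?nnegrE// (le_trans _ (ttau i)).
by rewrite (bigD1 (Ordinal im))//= lerDl sumr_ge0.
Qed.

Lemma small_factor (a c : R) : 0 <= a -> 0 < c ->
  exists x : R, [/\ 0 < x, x <= 1 & forall y, 0 <= y -> y <= x -> a * y <= c].
Proof.
move=> a0 c0; have a1 : 0 < a + 1 by rewrite ltr_wpDl.
exists (Num.min 1 (c / (a + 1))); rewrite lt_min ltr01 divr_gt0//= ge_min lexx; split => // y y0.
rewrite le_min => /andP[_]; rewrite ler_pdivlMr// mulrDr mulr1 mulrC => h.
by apply: le_trans h; rewrite lerDl.
Qed.

(** Here r is the excess over 1 of the Hoelder exponent and del the quality of
the approximation: first r is small, then del is small compared with r. *)
Lemma laplace_constants (tau s2 eps M : R) : 0 <= tau -> 0 <= s2 -> 0 < eps -> 0 <= M ->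
  exists r del : R, [/\ 0 < r, r <= 1, 0 < del, del <= 1 &
    r * (tau ^+ 2 / 2 * s2) <= eps / 4 /\
    (2 * tau ^+ 2 + (1 + r) / r * M) * del <= eps / 4].
Proof.
move=> tau0 s20 eps0 M0; have t2 : 0 <= tau ^+ 2 by exact: sqr_ge0.
have t20 : 0 <= tau ^+ 2 / 2 * s2 by rewrite mulr_ge0// mulr_ge0.
have e4 : 0 < eps / 4 by rewrite divr_gt0.
have [r [r0 r1 hr]] := small_factor t20 e4.
have a0 : 0 <= 2 * tau ^+ 2 + (1 + r) / r * M.
  by apply: addr_ge0; [rewrite mulr_ge0|rewrite mulr_ge0// divr_ge0 ?addr_ge0// ltW].
have [del [d0 d1 hd]] := small_factor a0 e4.
exists r, del; split => //; split; first by rewrite mulrC hr// ltW.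
by rewrite hd// ltW.
Qed.

Let sum_upper (A1 A2 A3 A4 A5 A6 A7 A8 A9 A10 : R) :
  A1 <= A8 -> A2 <= A9 + A4 + A6 -> A4 <= A5 -> A6 <= A7 -> A5 <= A10 ->
  A7 + A3 <= A10 -> A8 <= A10 -> 0 <= A10 ->
  A2 + A1 + A3 <= A9 + A10 + A10 + A10 + A10.
Proof. by move=> *; lra. Qed.

Let sum_lower (A1 A2 A3 B3 A4 A5 B6 A6 A7 A8 A9 A10 : R) :
  A1 <= A8 -> B6 - A6 <= A2 -> A4 <= A5 -> A6 <= A7 -> A9 - A4 <= B6 -> A3 <= B3 -> 0 <= A7 ->
  A5 <= A10 -> 2 * A7 + B3 <= A10 -> A8 <= A10 -> 0 <= A10 ->
  A9 - A10 - A10 - A10 - A10 <= A2 - A1 - A3.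
Proof. by move=> *; lra. Qed.

Let sum_split_upper (A B C r m : R) : A + B <= 2 * m + C -> r <= 1 ->
  A + (r + B) <= 2 * m + 1 + C.
Proof. by move=> *; lra. Qed.

Let sum_split_lower (C m : R) : - (4 * m + 1) + C <= - 4 * m + C - 1.
Proof. by lra. Qed.

Lemma laplace_coef_upper (r del s s2 t tau eps kap l M : R) :
  0 < r -> r <= 1 -> 0 < del -> 0 <= s2 -> `|s - s2| <= del -> `|t| <= tau ->
  0 <= kap -> 0 <= l ->
  r * (tau ^+ 2 / 2 * s2) <= eps / 4 -> (2 * tau ^+ 2 + (1 + r) / r * M) * del <= eps / 4 ->
  4 * kap * tau ^+ 3 * l <= eps / 4 ->
  (1 + r) * (t ^+ 2 / 2) * (s + del) + kap * (1 + r) ^+ 2 * l * `|t| ^+ 3 +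
    (1 + r) / r * M * del <= t ^+ 2 / 2 * s2 + eps.
Proof.
move=> r0 r1 d0 s20 sd tt k0 l0 h1 h2 h3.
have tau0 : 0 <= tau by exact: le_trans tt.
have t2 : t ^+ 2 <= tau ^+ 2 by rewrite -(real_normK (num_real t)) ler_pXn2r.
have t20 : 0 <= t ^+ 2 by exact: sqr_ge0.
have th0 : 0 <= t ^+ 2 / 2 by rewrite mulr_ge0.
have r10 : 0 <= 1 + r by rewrite addr_ge0// ltW.
have t3 : `|t| ^+ 3 <= tau ^+ 3 by rewrite ler_pXn2r.
have g1 : kap * (1 + r) ^+ 2 * l * `|t| ^+ 3 <= 4 * kap * tau ^+ 3 * l.
  have -> : 4 * kap * tau ^+ 3 * l = kap * 4 * l * tau ^+ 3 by ring.
  have rr : r ^+ 2 <= 1 by rewrite exprn_ile1// ltW.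
  have p4 : (1 + r) ^+ 2 <= 4 by rewrite (_ : (1 + r) ^+ 2 = 1 + 2 * r + r ^+ 2); [lra|ring].
  have p5 : 0 <= (1 + r) ^+ 2 by exact: sqr_ge0.
  apply: ler_pM => //; first by apply: mulr_ge0 => //; exact: mulr_ge0.
  by rewrite ler_wpM2r// ler_wpM2l.
have g2 : (1 + r) * (t ^+ 2 / 2) * (s + del) <= (1 + r) * (t ^+ 2 / 2) * (s2 + 2 * del).
  apply: ler_wpM2l; first exact: mulr_ge0.
  by move: sd; rewrite ler_norml => /andP[_]; lra.
have g3 : r * (t ^+ 2 / 2 * s2) <= r * (tau ^+ 2 / 2 * s2).
  by apply: ler_wpM2l; [lra|apply: ler_wpM2r => //; lra].
have g4 : (1 + r) * (t ^+ 2 * del) <= 2 * (tau ^+ 2 * del).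
  apply: ler_pM; [lra|by rewrite mulr_ge0// ltW|lra|by rewrite ler_wpM2r// ltW].
have -> : t ^+ 2 / 2 * s2 + eps = t ^+ 2 / 2 * s2 + eps / 4 + eps / 4 + eps / 4 + eps / 4 by field.
have E : (1 + r) * (t ^+ 2 / 2) * (s2 + 2 * del) = t ^+ 2 / 2 * s2 + r * (t ^+ 2 / 2 * s2) + (1 + r) * (t ^+ 2 * del) by field.
rewrite mulrDl in h2; rewrite -mulrA in h2; rewrite E in g2.
have e4 : 0 <= eps / 4 by apply: le_trans h1; rewrite !mulr_ge0 ?sqr_ge0// ltW.
move: g1 g2 g3 g4 h1 h2 h3 e4.
move: (kap * (1 + r) ^+ 2 * l * `|t| ^+ 3) ((1 + r) * (t ^+ 2 / 2) * (s + del)) => A1 A2.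
move: ((1 + r) / r * M * del) (r * (t ^+ 2 / 2 * s2)) (r * (tau ^+ 2 / 2 * s2)) => A3 A4 A5.
move: ((1 + r) * (t ^+ 2 * del)) (2 * (tau ^+ 2 * del)) (4 * kap * tau ^+ 3 * l) => A6 A7 A8.
by move: (t ^+ 2 / 2 * s2) (eps / 4) => A9 A10; exact: sum_upper.
Qed.

Lemma laplace_coef_lower (r del s s2 t tau eps kap l M : R) :
  0 < r -> r <= 1 -> 0 < del -> 0 <= s2 -> `|s - s2| <= del -> `|t| <= tau ->
  0 <= kap -> 0 <= l -> 0 <= M ->
  r * (tau ^+ 2 / 2 * s2) <= eps / 4 -> (2 * tau ^+ 2 + (1 + r) / r * M) * del <= eps / 4 ->
  4 * kap * tau ^+ 3 * l <= eps / 4 ->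
  t ^+ 2 / 2 * s2 - eps <= (1 + r)^-1 * (t ^+ 2 / 2) * (s - del) -
    kap / (1 + r) ^+ 2 * l * `|t| ^+ 3 - r^-1 * M * del.
Proof.
move=> r0 r1 d0 s20 sd tt k0 l0 M0 h1 h2 h3.
have tau0 : 0 <= tau by exact: le_trans tt.
have t2 : t ^+ 2 <= tau ^+ 2 by rewrite -(real_normK (num_real t)) ler_pXn2r.
have t20 : 0 <= t ^+ 2 by exact: sqr_ge0.
have th0 : 0 <= t ^+ 2 / 2 by rewrite mulr_ge0.
have r10 : 0 <= 1 + r by rewrite addr_ge0// ltW.
have t3 : `|t| ^+ 3 <= tau ^+ 3 by rewrite ler_pXn2r.
have p1 : (1 + r)^-1 <= 1 by rewrite invf_le1; lra.
have p2 : 1 - r <= (1 + r)^-1.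
  rewrite -[leRHS]mul1r ler_pdivlMr; last lra.
  by rewrite -subr_ge0 (_ : 1 - _ = r ^+ 2) ?sqr_ge0//; ring.
have p3 : 0 <= (1 + r)^-1 by rewrite invr_ge0; lra.
have g1 : kap / (1 + r) ^+ 2 * l * `|t| ^+ 3 <= 4 * kap * tau ^+ 3 * l.
  have -> : 4 * kap * tau ^+ 3 * l = kap * 4 * l * tau ^+ 3 by ring.
  have p4 : ((1 + r) ^+ 2)^-1 <= 4.
    apply: (@le_trans _ _ 1); last by rewrite ler1n.
    by rewrite invf_le1 ?exprn_gt0// ?exprn_ege1//; lra.
  have p5 : 0 <= ((1 + r) ^+ 2)^-1 by rewrite invr_ge0 sqr_ge0.
  apply: ler_pM => //; first by apply: mulr_ge0 => //; exact: mulr_ge0.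
  by rewrite ler_wpM2r// ler_wpM2l.
have g2 : (1 + r)^-1 * (t ^+ 2 / 2) * (s2 - 2 * del) <= (1 + r)^-1 * (t ^+ 2 / 2) * (s - del).
  apply: ler_wpM2l; first exact: mulr_ge0.
  by move: sd; rewrite ler_norml => /andP[]; lra.
have g3 : r * (t ^+ 2 / 2 * s2) <= r * (tau ^+ 2 / 2 * s2).
  by apply: ler_wpM2l; [lra|apply: ler_wpM2r => //; lra].
have g5 : (1 - r) * (t ^+ 2 / 2 * s2) <= (1 + r)^-1 * (t ^+ 2 / 2 * s2).
  by apply: ler_wpM2r => //; rewrite mulr_ge0.
have g4 : (1 + r)^-1 * (t ^+ 2 * del) <= 1 * (tau ^+ 2 * del).
  by apply: ler_pM => //; [by rewrite mulr_ge0// ltW|by rewrite ler_wpM2r// ltW].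
have g6 : r^-1 * M * del <= (1 + r) / r * M * del.
  have q1 : r^-1 <= (1 + r) / r by rewrite -[leLHS]mul1r ler_wpM2r ?invr_ge0 ?(ltW r0)// lerDl ltW.
  by rewrite ler_wpM2r ?(ltW d0)// ler_wpM2r.
have g7 : 0 <= tau ^+ 2 * del by rewrite mulr_ge0 ?sqr_ge0// ltW.
have E : (1 + r)^-1 * (t ^+ 2 / 2) * (s2 - 2 * del) = (1 + r)^-1 * (t ^+ 2 / 2 * s2) - (1 + r)^-1 * (t ^+ 2 * del).
  by move: (1 + r)^-1 => z; field.
rewrite E mulrBl mul1r in g2 g5.
rewrite mulrDl -mulrA in h2; rewrite mul1r in g4.
have -> : t ^+ 2 / 2 * s2 - eps = t ^+ 2 / 2 * s2 - eps / 4 - eps / 4 - eps / 4 - eps / 4 by field.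
have e4 : 0 <= eps / 4 by apply: le_trans h1; rewrite !mulr_ge0 ?sqr_ge0// ltW.
move: g1 g2 g3 g4 g5 g6 g7 h1 h2 h3 e4.
move: (kap / (1 + r) ^+ 2 * l * `|t| ^+ 3) ((1 + r)^-1 * (t ^+ 2 / 2) * (s - del)) => A1 A2.
move: (r^-1 * M * del) ((1 + r) / r * M * del) (r * (t ^+ 2 / 2 * s2)) (r * (tau ^+ 2 / 2 * s2)) => A3 B3 A4 A5.
move: ((1 + r)^-1 * (t ^+ 2 / 2 * s2)) ((1 + r)^-1 * (t ^+ 2 * del)) (tau ^+ 2 * del) (4 * kap * tau ^+ 3 * l) => B6 A6 A7 A8.
by move: (t ^+ 2 / 2 * s2) (eps / 4) => A9 A10; exact: sum_lower.
Qed.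

Lemma weighted_birkhoffD phi psi m t e x :
  weighted_birkhoff (fun x => phi x + psi x) m t e x =
  weighted_birkhoff phi m t e x + weighted_birkhoff psi m t e x.
Proof.
rewrite /weighted_birkhoff -big_split; apply: eq_bigr => i _ /=.
have E n : birkhoff T (fun x => phi x + psi x) n x = birkhoff T phi n x + birkhoff T psi n x.
  by rewrite /birkhoff -big_split.
by rewrite !E; ring.
Qed.

Lemma weighted_birkhoffZ phi m (c : R) t e x :
  weighted_birkhoff phi m (fun i => c * t i) e x = c * weighted_birkhoff phi m t e x.
Proof. by rewrite /weighted_birkhoff mulr_sumr; apply: eq_bigr => i _; rewrite mulrA. Qed.

Section Bounds.
Variables (phi : Om -> R) (s2 tau eps : R) (m : nat) (t : nat -> R).
Hypothesis bphi : bmeas phi.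
Hypothesis app : approximable phi s2.
Hypothesis s20 : 0 <= s2.
Hypothesis ttau : forall i, `|t i| <= tau.
Hypothesis eps0 : 0 < eps.

(** Hoelder separates the observable with a corrector from the remainder; as l
tends to 0 with l^2 n fixed the cubic errors vanish. *)
Lemma laplace_upper : 
  exists l0 C : R, 0 < l0 /\ forall l e, 0 <= l -> l <= l0 -> (forall i, (e i <= e i.+1)%N) ->
    Ex (fun x => expR (l * weighted_birkhoff phi m t e x)) <=
    expR (C + l ^+ 2 * \sum_(i < m) (e i.+1 - e i)%N%:R * (t i ^+ 2 / 2 * s2 + eps)).
Proof.
have tau0 : 0 <= tau by apply: le_trans (ttau 0%N).
pose M : R := m%:R ^+ 2 * tau ^+ 2; have M0 : 0 <= M by apply: mulr_ge0; exact: sqr_ge0.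
have [r [del [r0 r1 d0 d1 [hr hd]]]] := laplace_constants tau0 s20 eps0 M0.
have [g [kg [w2 [w [kw [B [s [C sd sg]]]]]]]] := app d0 d1.
have [bg bk _] := corr_g C; have B1 := corr_B C; have B0 : 0 <= B by lra.
pose q x := g x - kg x; have bq : bmeas q := bmeasB bg bk.
pose u x := phi x - q x; have bu : bmeas u := bmeasB bphi bq.
pose kap := cubic_cst B; have k0 : 0 <= kap by rewrite /kap /cubic_cst mulr_ge0// exprn_ge0//; lra.
pose p := 1 + r; have p0 : 0 < p by rewrite ltr_wpDl.
have t30 : 0 <= tau ^+ 3 by rewrite exprn_ge0.
have a1 : 0 <= p * tau * (4 * B) by rewrite !mulr_ge0// ltW.
have a2 : 0 <= 4 * kap * tau ^+ 3 by rewrite !mulr_ge0.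
have e4 : 0 < eps / 4 by rewrite divr_gt0.
have i3 : 0 < 3^-1 :> R by rewrite invr_gt0.
have [x1 [x10 _ hx1]] := small_factor a1 i3.
have [x2 [x20 _ hx2]] := small_factor a2 e4.
exists (Num.min x1 x2), (2 * m%:R + 1); split => [|l e l0]; first by rewrite lt_min x10.
rewrite le_min => /andP[/(hx1 l l0) l3 /(hx2 l l0) l4] he.
(* Hoelder with exponents p = 1 + r and (1 + r) / r *)
pose n i : R := (e i.+1 - e i)%N%:R.
have n0 i : 0 <= n i by exact: ler0n.
pose S := \sum_(i < m) n i.
have pl0 : 0 <= p * l by rewrite mulr_ge0// ltW.
have pr0 : 0 <= p / r * l by rewrite mulr_ge0//; exact: divr_ge0 (ltW p0) (ltW r0).
have lt1 i : `|p * l * t i| * (4 * B) <= 3^-1.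
  apply: le_trans l3; rewrite normrM (ger0_norm pl0).
  have -> : p * tau * (4 * B) * l = p * l * tau * (4 * B) by ring.
  by rewrite ler_wpM2r ?mulr_ge0// ler_wpM2l.
have [up _] := laplace_blocks mT pT m C lt1 he.
have lt2 i : `|p / r * l * t i| <= p / r * l * tau.
  by rewrite normrM (ger0_norm pr0) ler_wpM2l.
have ub := weighted_birkhoff_subgaussian m bu (ltW d0) sg lt2 he.
have bWq := bmeas_weighted_birkhoff m (fun i => p * l * t i) e bq.
have bWu := bmeas_weighted_birkhoff m (fun i => p / r * l * t i) e bu.
have pi0 : 0 <= p^-1 by rewrite invr_ge0 ltW.
have rp0 : 0 <= r / p by exact: divr_ge0 (ltW r0) (ltW p0).
have pr1 : p^-1 + r / p = 1 by rewrite -[X in X + _]mul1r -mulrDl divff// gt_eqF.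
have := Ex_expR_convex bWq bWu pi0 rp0 pr1 up ub.
have -> : Ex (fun x => expR (p^-1 * weighted_birkhoff q m (fun i => p * l * t i) e x +
    r / p * weighted_birkhoff u m (fun i => p / r * l * t i) e x)) =
    Ex (fun x => expR (l * weighted_birkhoff phi m t e x)).
  apply: eq_Ex => x; congr expR; rewrite !weighted_birkhoffZ.
  have -> : phi = (fun x => q x + u x) by apply/funext => y; rewrite /u addrC subrK.
  rewrite weighted_birkhoffD.
  by move: (weighted_birkhoff q _ _ _ _) (weighted_birkhoff u _ _ _ _) => a b; field; rewrite !gt_eqF.
move=> H; apply: le_trans H _; rewrite ler_expR.
have pi1 : p^-1 <= 1 by rewrite invf_le1// lerDl ltW.
have rp1 : r / p <= 1 by rewrite -pr1 lerDr.
have E2 : l ^+ 2 * \sum_(i < m) n i * (t i ^+ 2 / 2 * s2 + eps) =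
    \sum_(i < m) l ^+ 2 * n i * (t i ^+ 2 / 2 * s2 + eps).
  by rewrite mulr_sumr; apply: eq_bigr => i _; rewrite mulrA.
have E3 : r / p * (m%:R ^+ 2 * (p / r * l * tau) ^+ 2 * del * S) = \sum_(i < m) l ^+ 2 * n i * (p / r * M * del).
  rewrite -mulr_suml -mulr_sumr -/S /M; field; rewrite !gt_eqF//.
rewrite mulrDr mulr1 E3 E2 mulr_sumr.
suff K : \sum_(i < m) (p^-1 * (2 + n i * ((p * l * t i) ^+ 2 / 2 * (s + del) + cubic_cst B * `|p * l * t i| ^+ 3)) +
    l ^+ 2 * n i * (p / r * M * del)) <= \sum_(i < m) (2 + l ^+ 2 * n i * (t i ^+ 2 / 2 * s2 + eps)).
  rewrite 2!big_split/= sumr_const card_ord -[2 *+ m]mulr_natr in K; move: K rp1.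
  move: (\sum_(i < m) p^-1 * _) (\sum_(i < m) _ * (p / r * M * del)) (\sum_(i < m) _ * (_ + eps)) (r / p) m%:R.
  exact: sum_split_upper.
apply: ler_sum => i _.
have -> : p^-1 * (2 + n i * ((p * l * t i) ^+ 2 / 2 * (s + del) + cubic_cst B * `|p * l * t i| ^+ 3)) =
    2 * p^-1 + l ^+ 2 * n i * (p * (t i ^+ 2 / 2) * (s + del) + kap * p ^+ 2 * l * `|t i| ^+ 3).
  by rewrite normrM (ger0_norm pl0) -/kap; field; rewrite gt_eqF.
rewrite -addrA -mulrDr; apply: lerD; first by rewrite ger_pMr.
rewrite ler_wpM2l//; first by rewrite mulr_ge0// sqr_ge0.
by apply: laplace_coef_upper hr hd l4.
Qed.

(** The same with the roles exchanged: the observable with a corrector is split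
into phi and minus the remainder, and the inequality solved for phi. *)
Lemma laplace_lower : 
  exists l0 C : R, 0 < l0 /\ forall l e, 0 <= l -> l <= l0 -> (forall i, (e i <= e i.+1)%N) ->
    expR (- C + l ^+ 2 * \sum_(i < m) (e i.+1 - e i)%N%:R * (t i ^+ 2 / 2 * s2 - eps)) <=
    Ex (fun x => expR (l * weighted_birkhoff phi m t e x)).
Proof.
have tau0 : 0 <= tau by apply: le_trans (ttau 0%N).
pose M : R := m%:R ^+ 2 * tau ^+ 2; have M0 : 0 <= M by apply: mulr_ge0; exact: sqr_ge0.
have [r [del [r0 r1 d0 d1 [hr hd]]]] := laplace_constants tau0 s20 eps0 M0.
have [g [kg [w2 [w [kw [B [s [C sd sg]]]]]]]] := app d0 d1.
have [bg bk _] := corr_g C; have B1 := corr_B C; have B0 : 0 <= B by lra.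
pose q x := g x - kg x; have bq : bmeas q := bmeasB bg bk.
pose u x := phi x - q x; have bu : bmeas u := bmeasB bphi bq.
pose kap := cubic_cst B; have k0 : 0 <= kap by rewrite /kap /cubic_cst mulr_ge0// exprn_ge0//; lra.
pose p := 1 + r; have p0 : 0 < p by rewrite ltr_wpDl.
have t30 : 0 <= tau ^+ 3 by rewrite exprn_ge0.
have a1 : 0 <= tau * (4 * B) by rewrite !mulr_ge0// ltW.
have a2 : 0 <= 4 * kap * tau ^+ 3 by rewrite !mulr_ge0.
have e4 : 0 < eps / 4 by rewrite divr_gt0.
have i3 : 0 < 3^-1 :> R by rewrite invr_gt0.
have [x1 [x10 _ hx1]] := small_factor a1 i3.
have [x2 [x20 _ hx2]] := small_factor a2 e4.
exists (Num.min x1 x2), (4 * m%:R + 1); split => [|l e l0]; first by rewrite lt_min x10.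
rewrite le_min => /andP[/(hx1 l l0) l3 /(hx2 l l0) l4] he.
pose n i : R := (e i.+1 - e i)%N%:R.
have n0 i : 0 <= n i by exact: ler0n.
pose S := \sum_(i < m) n i.
have pi1 : p^-1 <= 1 by rewrite invf_le1// lerDl ltW.
have pi0 : 0 <= p^-1 by rewrite invr_ge0 ltW.
have pl0 : 0 <= l / p by rewrite divr_ge0// ltW.
have pr0 : 0 <= r^-1 * l by rewrite mulr_ge0// invr_ge0 ltW.
(* Here q is the part with a corrector: q / p is a convex combination of phi
   and - u / r. *)
have lt1 i : `|l / p * t i| * (4 * B) <= 3^-1.
  apply: le_trans l3; rewrite normrM (ger0_norm pl0).
  have -> : tau * (4 * B) * l = l * 1 * tau * (4 * B) by ring.
  rewrite ler_wpM2r ?mulr_ge0// ler_pM//.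
  by rewrite ler_wpM2l.
have [_ lo] := laplace_blocks mT pT m C lt1 he.
have lt2 i : `|- (r^-1 * l) * t i| <= r^-1 * l * tau.
  by rewrite normrM normrN (ger0_norm pr0) ler_wpM2l.
have ub := weighted_birkhoff_subgaussian m bu (ltW d0) sg lt2 he.
have bWp := bmeas_weighted_birkhoff m t e bphi.
have bWu := bmeas_weighted_birkhoff m (fun i => - (r^-1 * l) * t i) e bu.
have rp0 : 0 <= r / p by exact: divr_ge0 (ltW r0) (ltW p0).
have pr1 : p^-1 + r / p = 1 by rewrite -[X in X + _]mul1r -mulrDl divff// gt_eqF.
set L := (X in _ <= X).
have L0 : 0 < L.
  have [_ [c hc]] := bmeasZ l bWp.
  apply: (@lt_le_trans _ _ (expR (- c))); first exact: expR_gt0.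
  rewrite -[leLHS](Ex_cst mu); apply: Ex_le; [exact: bmeas_cst|exact: bmeas_exp (bmeasZ l bWp)|].
  by move=> x; rewrite ler_expR; have := hc x; rewrite ler_norml => /andP[].
have LE : L <= expR (ln L) by rewrite lnK.
have := Ex_expR_convex (bmeasZ l bWp) bWu pi0 rp0 pr1 LE ub.
have -> : Ex (fun x => expR (p^-1 * (l * weighted_birkhoff phi m t e x) +
    r / p * weighted_birkhoff u m (fun i => - (r^-1 * l) * t i) e x)) =
    Ex (fun x => expR (weighted_birkhoff q m (fun i => l / p * t i) e x)).
  apply: eq_Ex => x; congr expR; rewrite !weighted_birkhoffZ.
  have -> : phi = (fun x => q x + u x) by apply/funext => y; rewrite /u addrC subrK.
  rewrite weighted_birkhoffD.
  by move: (weighted_birkhoff q _ _ _ _) (weighted_birkhoff u _ _ _ _) => a b; field; rewrite !gt_eqF.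
move=> /(le_trans lo); rewrite ler_expR => H.
rewrite -[leRHS]lnK// ler_expR.
have E2 : l ^+ 2 * \sum_(i < m) n i * (t i ^+ 2 / 2 * s2 - eps) =
    \sum_(i < m) l ^+ 2 * n i * (t i ^+ 2 / 2 * s2 - eps).
  by rewrite mulr_sumr; apply: eq_bigr => i _; rewrite mulrA.
have E3 : r * (m%:R ^+ 2 * (r^-1 * l * tau) ^+ 2 * del * S) = \sum_(i < m) l ^+ 2 * n i * (r^-1 * M * del).
  rewrite -mulr_suml -mulr_sumr -/S /M; field; rewrite !gt_eqF//.
have E4 : p * (p^-1 * ln L + r / p * (1 + m%:R ^+ 2 * (r^-1 * l * tau) ^+ 2 * del * S)) =
    ln L + r + r * (m%:R ^+ 2 * (r^-1 * l * tau) ^+ 2 * del * S).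
  by field; rewrite !gt_eqF.
have := ler_wpM2l (ltW p0) H; rewrite E4 E3 E2 mulr_sumr => {}H.
rewrite -lerBlDr in H; rewrite -sumrB in H.
apply: (@le_trans _ _ (\sum_(i < m) (- 4 + l ^+ 2 * n i * (t i ^+ 2 / 2 * s2 - eps)) - 1)).
  by rewrite big_split/= sumr_const card_ord -(mulr_natr (- 4)); exact: sum_split_lower.
suff K : \sum_(i < m) (- 4 + l ^+ 2 * n i * (t i ^+ 2 / 2 * s2 - eps)) <= ln L + r by lra.
apply: le_trans H; apply: ler_sum => i _.
have -> : p * (- 2 + n i * ((l / p * t i) ^+ 2 / 2 * (s - del) - cubic_cst B * `|l / p * t i| ^+ 3)) - l ^+ 2 * n i * (r^-1 * M * del) =
    - (2 * p) + l ^+ 2 * n i * (p^-1 * (t i ^+ 2 / 2) * (s - del) - kap / p ^+ 2 * l * `|t i| ^+ 3 - r^-1 * M * del).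
  by rewrite normrM (ger0_norm pl0) -/kap; field; rewrite !gt_eqF.
apply: lerD; first by rewrite lerN2 /p; lra.
rewrite ler_wpM2l//; first by rewrite mulr_ge0// sqr_ge0.
by apply: laplace_coef_lower hr hd l4.
Qed.

End Bounds.

End LaplaceApproximation.

(** * Truncated Poisson series and the limit variance *)

Section Decay.
Context d (Om : measurableType d) (R : realType) (mu : probability Om R).
Implicit Types (h g psi phi v : Om -> R).
Notation Ex h := (\int[mu]_x (h x : R)).

(** Growth rates are compared by this: exponential bounds with constants that do
not depend on n compare their coefficients of n. *)
Lemma le0_of_bounded_multiples (y C : R) : (forall n : nat, n%:R * y <= C) -> y <= 0.
Proof.
move=> H; rewrite leNgt; apply/negP => y0.
have := H (Num.bound (`|C / y|)); apply/negP; rewrite -ltNge -ltr_pdivrMr//.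
by apply: le_lt_trans (ler_norm _) _; have /archi_boundP := normr_ge0 (C / y).
Qed.

Variable T : Om -> Om.
Hypothesis mT : measurable_fun setT T.
Hypothesis pT : forall A, measurable A -> mu (T @^-1` A) = mu A.

Definition uniformly_mixing v : Prop := forall eta : R, 0 < eta ->
  exists n (F : nat -> Om -> R), [/\ F 0%N = v, forall k, PFn mu T k v (F k) &
    forall x, `|F n x - Ex v| <= eta].

(** w is the partial sum of the series solving the Poisson equation for the
conditional variance w2 - kg^2. *)
Lemma corrector_exists g kg w2 (del : R) :
  PFn mu T 1 g kg -> PFn mu T 1 (fun x => g x ^+ 2) w2 ->
  uniformly_mixing (fun x => w2 x - kg x ^+ 2) -> 0 < del -> del <= 1 ->
  exists w kw B, corrector mu T g kg w2 w kw B
    (Ex (fun x => g x ^+ 2) - Ex (fun x => kg x ^+ 2)) del.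
Proof.
move=> gK g2K mix d0 d1; have [bg bk EK] := gK; have [bg2 bw2 _] := g2K.
set s := _ - _.
have bk2 := bmeas_sqr bk.
have vs : Ex (fun x => w2 x - kg x ^+ 2) = s by rewrite (ExB mu bw2 bk2) (PFn_mean g2K).
have s0 : 0 <= s.
  have bkT : bmeas (fun x => kg (T x)) := bmeas_comp mT bk.
  have b1 := bmeasM bg bkT; have b2 := bmeasZ 2 b1; have b3 := bmeasB bg2 b2.
  have b4 := bmeas_sqr bkT.
  have := @Ex_le _ _ _ mu _ _ (bmeas_cst Om 0) (bmeas_sqr (bmeasB bg bkT)) (fun x => sqr_ge0 _).
  rewrite Ex_cst.
  have -> : Ex (fun x => (g x - kg (T x)) ^+ 2) = Ex (fun x => g x ^+ 2 - 2 * (g x * kg (T x)) + kg (T x) ^+ 2).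
    by apply: eq_Ex => x; ring.
  rewrite (ExD mu b3 b4) (ExB mu bg2 b2) (ExZ mu 2 b1) (Ex_comp mT pT bk2).
  rewrite -(EK kg bk).
  have -> : Ex (fun x => kg x * kg x) = Ex (fun x => kg x ^+ 2) by apply: eq_Ex => x; rewrite expr2.
  by rewrite /s; move: (\int[mu]_x g x ^+ 2) (\int[mu]_x kg x ^+ 2) => a b; lra.
have [n [F [F0 FK Fn]]] := mix del d0.
have bF k : bmeas (F k) by case: (FK k).
have FS k : PFn mu T 1 (F k) (F k.+1).
  by apply: PFn_step (FK k) _ => //; rewrite addn1; exact: FK.
pose w x := \sum_(j < n) (F j x - s); pose kw x := \sum_(j < n) (F j.+1 x - s).
have wK : PFn mu T 1 w kw.
  apply: (@PFn_sum _ _ _ _ _ mT pT 1 n (fun j x => F j x - s) (fun j x => F j.+1 x - s)) => j.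
  apply: PFnB => //; exact: PFn_cst.
have [bw _ _] := wK.
have [[_ [cg hg]] [_ [ck hk]] [_ [cw hw]]] := And3 bg bk bw.
pose B := 1 + `|cg| + `|ck| + `|cw| + s.
exists w, kw, B; split => //.
- by rewrite /B -!addrA lerDl; do 3 (apply: addr_ge0; first exact: normr_ge0).
- move=> x; apply: le_trans (hg x) (le_trans (ler_norm _) _); rewrite /B.
  have := normr_ge0 ck; have := normr_ge0 cw; move: (`|ck|) (`|cw|) (`|cg|) s0; move=> *; lra.
- move=> x; apply: le_trans (hk x) (le_trans (ler_norm _) _); rewrite /B.
  have := normr_ge0 cg; have := normr_ge0 cw; move: (`|ck|) (`|cw|) (`|cg|) s0; move=> *; lra.
- move=> x; apply: le_trans (hw x) (le_trans (ler_norm _) _); rewrite /B.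
  have := normr_ge0 cg; have := normr_ge0 ck; move: (`|ck|) (`|cw|) (`|cg|) s0; move=> *; lra.
- by rewrite /B lerDr; do 3 (apply: addr_ge0; last exact: normr_ge0).
- exact: ltW.
move=> x; rewrite -vs; apply: le_trans (Fn x); rewrite le_eqVlt; apply/orP; left; apply/eqP.
congr (`| _ |); rewrite vs.
have E : kw x - w x = F n x - F 0%N x.
  rewrite /kw /w -sumrB -(telescope_sumr (fun i => F i x) (leq0n n)) big_mkord.
  by apply: eq_bigr => i _; ring.
by move: E; rewrite F0; move: (kw x) (w x) (F n x) => a b c; lra.
Qed.

(** The images u i of u 0 decay like the bounds del i, fast enough for the dyadic
sum of the subgaussian bound to converge. *)
Record decaying (u : nat -> Om -> R) (del e : nat -> R) (D : R) : Prop := Decaying {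
  dec_PF : forall i, PFn mu T i (u 0%N) (u i);
  dec_le : forall i x, `|u i x| <= del i;
  dec_ge0 : forall i, 0 <= del i;
  dec_gt0 : forall i, 0 < e i;
  dec_mono : forall i, del i.+1 <= del i;
  dec_dyad : forall i, del (2 ^ i)%N ^+ 2 * (2 ^ i)%:R <= e i ^+ 2;
  dec_sum : forall m, \sum_(k < m) e k <= D }.

Lemma decaying_subgaussian u del e D n l : decaying u del e D ->
  Ex (fun x => expR (l * birkhoff T (u 0%N) n x)) <=
  expR (1 + 8 * l ^+ 2 * n%:R * (del 0%N + 1 + D) ^+ 2).
Proof.
move=> [PF le ge0 gt0 mono dyad sum]; have d0 := ge0 0%N.
have b0 : bmeas (u 0%N) by case: (PF 0%N).
have bS : bmeas (fun x => \sum_(j < n) u 0%N (iter j T x)).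
  by apply: bmeas_sum => j; exact: (bmeas_iter mT j b0).
have <- : Ex (fun x => expR (l * \sum_(j < n) u 0%N (iter j T x))) = Ex (fun x => expR (l * birkhoff T (u 0%N) n x)); last first.
  have e01 : 0 < del 0%N + 1 by rewrite ltr_wpDl.
  have e02 : del 0%N <= del 0%N + 1 by rewrite lerDl.
  have e03 m : del 0%N + 1 + \sum_(k < m) e k <= del 0%N + 1 + D by rewrite lerD2l.
  exact: (subgaussian mT pT n l PF le e01 gt0 e02 mono dyad e03).
rewrite -(Ex_comp mT pT (bmeas_exp (bmeasZ l bS))); apply: eq_Ex => x.
by congr (expR (_ * _)); apply: eq_bigr => j _; rewrite -iterSr.
Qed.

Lemma decaying_homo u del e D i j : decaying u del e D -> (i <= j)%N -> del j <= del i.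
Proof. by move=> [_ _ _ _ mono _ _] ij; exact: ((nonincreasing_seqP del).1 mono). Qed.

Lemma decaying_shift u del e D M : decaying u del e D ->
  decaying (fun k => u (M + k)%N) (fun k => del (M + k)%N) e D.
Proof.
move=> dec; have [PF le ge0 gt0 mono dyad sum] := dec; split => //.
- by move=> i; rewrite addn0; exact: (PFn_step mT (PF M) (PF _)).
- by move=> i; rewrite addnS.
move=> i; apply: le_trans (dyad i); rewrite ler_wpM2r// ler_pXn2r ?nnegrE//.
by apply: (decaying_homo dec); exact: leq_addl.
Qed.

Lemma decaying_cvg0 u del e D (c : R) : decaying u del e D -> 0 < c ->
  exists M0, forall M, (M0 <= M)%N -> del M <= c.
Proof.
move=> dec c0; have [PF le ge0 gt0 mono dyad sum] := dec.
have D0 : 0 <= D by have := sum 0%N; rewrite big_ord0.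
pose i := Num.bound (D ^+ 2 / c ^+ 2).
have hi : D ^+ 2 <= c ^+ 2 * i%:R.
  rewrite mulrC -ler_pdivrMr ?exprn_gt0//; apply/ltW/archi_boundP.
  by rewrite divr_ge0// sqr_ge0.
exists (2 ^ i)%N => M iM; apply: le_trans (decaying_homo dec iM) _.
have ei : e i <= D.
  apply: le_trans (sum i.+1); rewrite big_ord_recr lerDr sumr_ge0// => k _; exact: ltW.
have h := dyad i; rewrite -(@ler_pXn2r _ 2)// ?nnegrE ?(ltW c0)//.
have p0 : 0 < (2 ^ i)%:R :> R by rewrite ltr0n expn_gt0.
rewrite -(ler_pM2r p0); apply: le_trans h _; apply: (@le_trans _ _ (D ^+ 2)).
  by rewrite ler_pXn2r ?nnegrE// ltW.
by apply: le_trans hi _; rewrite ler_wpM2l ?sqr_ge0// ler_nat ltnW// ltn_expl.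
Qed.

Lemma bounded_sum_tail (e : nat -> R) (D eta : R) : (forall i, 0 < e i) ->
  (forall m, \sum_(k < m) e k <= D) -> 0 < eta ->
  exists m0, forall m, \sum_(m0 <= k < m) e k <= eta.
Proof.
move=> e0 eD eta0; pose E : set R := range (fun m => \sum_(k < m) e k).
have hE : has_sup E.
  by split; [exists (\sum_(k < 0) e k), 0%N|exists D => _ [m _ <-]; exact: eD].
have [_ [m0 _ <-] h] := sup_adherent eta0 hE; exists m0 => m.
have [mm|mm] := leqP m m0; first by rewrite big_geq// ltW.
have : \sum_(k < m) e k <= sup E.
  by apply: sup_upper_bound => //; exists m.
rewrite -(big_mkord xpredT e) (big_cat_nat (n := m0)) ?(ltnW mm)//= big_mkord.
by move: h; move: (\sum_(k < m0) e k) (\sum_(m0 <= k < m) e k) (sup E) => a b c; lra.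
Qed.

(** The dyadic weights e below a fixed level may be replaced by arbitrarily small
ones once del M is small; the others have a small sum. *)
Lemma decaying_remainder u del e D (eta : R) : decaying u del e D -> 0 < eta ->
  exists M0, forall M, (M0 <= M)%N -> forall n l,
    Ex (fun x => expR (l * birkhoff T (u M) n x)) <=
    expR (1 + 8 * l ^+ 2 * n%:R * (3 * eta) ^+ 2).
Proof.
move=> dec eta0; have [PF le ge0 gt0 mono dyad sum] := dec.
have [m0 hm0] := bounded_sum_tail gt0 sum eta0.
pose c := eta / (m0.+1%:R * (2 ^ m0)%:R).
have p1 : 0 < m0.+1%:R :> R by rewrite ltr0n.
have p2 k : 0 < (2 ^ k)%:R :> R by rewrite ltr0n expn_gt0.
have c0 : 0 < c by rewrite divr_gt0// mulr_gt0.
have [M0 hM0] := decaying_cvg0 dec c0.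
exists M0 => M /hM0 dM n l.
have shift := decaying_shift M dec; have [PF' le' ge0' gt0' mono' dyad' sum'] := shift.
(* Below level m0 the dyadic weights are replaced by a total of at most eta. *)
pose e' i := if (i < m0)%N then eta / m0.+1%:R else e i.
have e'0 i : 0 < e' i by rewrite /e'; case: ifP => // _; rewrite divr_gt0.
have ceta : c <= eta.
  rewrite ler_pdivrMr ?mulr_gt0// ler_peMr ?(ltW eta0)// -natrM ler1n muln_gt0/= expn_gt0//.
have sum3 m : eta + \sum_(k < m) e' k <= 3 * eta.
  have : \sum_(k < m) e' k <= eta + eta.
    rewrite -(big_mkord xpredT e').
    apply: (@le_trans _ _ (\sum_(0 <= k < m0 + m) e' k)).
      rewrite [leRHS](big_cat_nat (n := m)) ?leq_addl//= lerDl.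
      by apply: sumr_ge0 => k _; exact: ltW.
    rewrite (big_cat_nat (n := m0)) ?leq_addr//=; apply: lerD.
      rewrite big_nat_cond (eq_bigr (fun=> eta / m0.+1%:R)); last first.
        by move=> k /andP[/andP[_ km] _]; rewrite /e' km.
      rewrite -big_nat_cond sumr_const_nat subn0 -[leLHS]mulr_natr mulrAC ler_pdivrMr//.
      by rewrite ler_wpM2l ?(ltW eta0)// ler_nat.
    apply: le_trans (hm0 (m0 + m)%N); rewrite big_nat_cond [leRHS]big_nat_cond.
    by apply: ler_sum => k /andP[/andP[mk _] _]; rewrite /e' ltnNge mk.
  by move: (\sum_(k < m) _) => z; lra.
have dyad2 i : del (M + 2 ^ i)%N ^+ 2 * (2 ^ i)%:R <= e' i ^+ 2.
  rewrite /e'; case: ltnP => im; last exact: dyad'.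
  have h1 : del (M + 2 ^ i)%N <= c by apply: le_trans dM; apply: (decaying_homo dec); exact: leq_addr.
  apply: (@le_trans _ _ (c ^+ 2 * (2 ^ m0)%:R)).
    apply: ler_pM; rewrite ?sqr_ge0// ?ler_pXn2r ?nnegrE ?(ltW c0)//.
    by rewrite ler_nat leq_exp2l// ltnW.
  rewrite /c invfM mulrA exprMn -mulrA ler_piMr ?sqr_ge0//.
  rewrite exprVn expr2 invfM mulrAC -mulrA mulfV ?gt_eqF// mulr1.
  by rewrite invf_le1// ler1n expn_gt0.
have b0 : bmeas (u M) by case: (PF' 0%N); rewrite addn0.
have bS : bmeas (fun x => \sum_(j < n) u M (iter j T x)).
  by apply: bmeas_sum => j; exact: (bmeas_iter mT j b0).
have <- : Ex (fun x => expR (l * \sum_(j < n) u M (iter j T x))) = Ex (fun x => expR (l * birkhoff T (u M) n x)).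
  rewrite -(Ex_comp mT pT (bmeas_exp (bmeasZ l bS))); apply: eq_Ex => x.
  by congr (expR (_ * _)); apply: eq_bigr => j _; rewrite -iterSr.
have d0 : del (M + 0)%N <= eta by rewrite addn0; exact: le_trans ceta.
have := subgaussian mT pT n l PF' le' eta0 e'0 d0 mono' dyad2 sum3.
by rewrite addn0.
Qed.

Section Variance.
Variables (u : nat -> Om -> R) (del e : nat -> R) (D : R).
Hypothesis dec : decaying u del e D.

(** The series of the u i need not converge, but its truncation solves the
Poisson equation for u 0 up to u M. *)
Definition partial_g M x := \sum_(i < M) u i x.
Definition partial_kg M x := \sum_(i < M) u i.+1 x.

Lemma bmeas_decaying i : bmeas (u i).
Proof. by case: (dec_PF dec i). Qed.

Lemma partial_PFn M : PFn mu T 1 (partial_g M) (partial_kg M).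
Proof.
apply: (@PFn_sum _ _ _ _ _ mT pT 1 M u (fun i => u i.+1)) => i.
by apply: (PFn_step mT (dec_PF dec i)); rewrite addn1; exact: (dec_PF dec).
Qed.

Lemma partial_diff M x : partial_g M x - partial_kg M x = u 0%N x - u M x.
Proof.
rewrite /partial_g /partial_kg -sumrB -[RHS]opprB.
rewrite -(telescope_sumr (fun i => u i x) (leq0n M)) big_mkord -sumrN.
by apply: eq_bigr => i _; rewrite opprB.
Qed.

Definition partial_var M : R :=
  Ex (fun x => partial_g M x ^+ 2) - Ex (fun x => partial_kg M x ^+ 2).

Hypothesis mix : forall M, exists2 w2, PFn mu T 1 (fun x => partial_g M x ^+ 2) w2 &
  uniformly_mixing (fun x => w2 x - partial_kg M x ^+ 2).

Lemma partial_corrector M (eps : R) : 0 < eps -> eps <= 1 -> exists w2 w kw B,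
  corrector mu T (partial_g M) (partial_kg M) w2 w kw B (partial_var M) eps.
Proof.
move=> e0 e1; have [w2 g2K mx] := mix M.
have [w [kw [B C]]] := corrector_exists (partial_PFn M) g2K mx e0 e1.
by exists w2, w, kw, B.
Qed.

Lemma partial_var_ge0 M : 0 <= partial_var M.
Proof. by have [w2 [w [kw [B C]]]] := partial_corrector M ltr01 (lexx 1); exact: corr_s20 C. Qed.

(** The exponential moments of the differences u_0 - u_M grow at rate at least
partial_var M, and are uniformly subgaussian. *)
Lemma partial_var_bounded : exists Bd, forall M, partial_var M <= Bd.
Proof.
pose D' := del 0%N + 1 + D; exists (64 * D' ^+ 2 + 3) => M.
have [w2 [w [kw [B C]]]] := partial_corrector M ltr01 (lexx 1).
pose kap := cubic_cst B; have B1 := corr_B C.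
have k0 : 0 <= kap by rewrite /kap /cubic_cst mulr_ge0// exprn_ge0//; lra.
have B40 : 0 <= 4 * B by lra.
have i3 : 0 < 3^-1 :> R by rewrite invr_gt0.
have [l1 [l10 _ hl1]] := small_factor B40 i3.
have [l2 [l20 _ hl2]] := small_factor k0 (@ltr01 R).
pose l := Num.min l1 l2; have l0 : 0 < l by rewrite lt_min l10.
have lB : `|l| * (4 * B) <= 3^-1.
  by rewrite gtr0_norm// mulrC hl1 ?(ltW l0)// /l ge_min lexx.
have lk : kap * l <= 1 by rewrite hl2 ?(ltW l0)// /l ge_min lexx orbT.
(* Hoelder with exponents 2, 2 bounds the exponential moments of u_0 - u_M by
   those of u_0 and u_M. *)
have key n : n%:R * (l ^+ 2 * ((partial_var M - 1) / 2 - kap * l - 32 * D' ^+ 2)) <= 3.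
  have bu0 := bmeas_decaying 0; have buM := bmeas_decaying M.
  have [_ lo] := laplace_block mT pT n C lB (bmeas_cst Om 1) (fun=> ler01).
  rewrite Ex_cst mulr1 in lo.
  have Xu := decaying_subgaussian n (2 * l) dec.
  have Yu := decaying_subgaussian n (- (2 * l)) (decaying_shift M dec).
  rewrite addn0 in Yu.
  have h0 : 0 <= 2^-1 :> R by [].
  have h1 : 2^-1 + 2^-1 = 1 :> R by field.
  have bX := bmeasZ (2 * l) (bmeas_birkhoff mT n bu0).
  have bY := bmeasZ (- (2 * l)) (bmeas_birkhoff mT n buM).
  have DM : expR (1 + 8 * (- (2 * l)) ^+ 2 * n%:R * (del M + 1 + D) ^+ 2) <=
      expR (1 + 8 * (2 * l) ^+ 2 * n%:R * D' ^+ 2).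
    rewrite ler_expR lerD2l sqrrN; apply: ler_wpM2l; first by apply: mulr_ge0 => //; apply: mulr_ge0 => //; exact: sqr_ge0.
    have D0 : 0 <= D by have := dec_sum dec 0%N; rewrite big_ord0.
    have dM := dec_ge0 dec M; have dM0 := decaying_homo dec (leq0n M).
    by rewrite ler_pXn2r ?nnegrE /D' ?addr_ge0 ?lerD2r// (dec_ge0 dec).
  have := Ex_expR_convex bX bY h0 h0 h1 Xu (le_trans Yu DM).
  have <- : Ex (fun x => expR (l * birkhoff T (fun x => partial_g M x - partial_kg M x) n x) * 1) =
     Ex (fun x => expR (2^-1 * (2 * l * birkhoff T (u 0%N) n x) + 2^-1 * (- (2 * l) * birkhoff T (u M) n x))).
    apply: eq_Ex => x; rewrite mulr1; congr expR.
    have -> : birkhoff T (fun x => partial_g M x - partial_kg M x) n x = birkhoff T (u 0%N) n x - birkhoff T (u M) n x.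
      by rewrite /birkhoff -sumrB; apply: eq_bigr => j _; exact: partial_diff.
    by field.
  move=> /(le_trans lo); rewrite ler_expR.
  have -> : n%:R * (l ^+ 2 / 2 * (partial_var M - 1) - cubic_cst B * `|l| ^+ 3) =
    n%:R * (l ^+ 2 * ((partial_var M - 1) / 2 - kap * l)).
    by rewrite (gtr0_norm l0) -/kap; field.
  have -> : 2^-1 * (1 + 8 * (2 * l) ^+ 2 * n%:R * D' ^+ 2) + 2^-1 * (1 + 8 * (2 * l) ^+ 2 * n%:R * D' ^+ 2) = 1 + n%:R * (l ^+ 2 * (32 * D' ^+ 2)) by field.
  rewrite [l ^+ 2 * (_ - 32 * D' ^+ 2)]mulrBr [n%:R * (_ - l ^+ 2 * (32 * _))]mulrBr.
  move: (n%:R * (l ^+ 2 * (32 * _))) (n%:R * (l ^+ 2 * _)) => a b; lra.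
have := le0_of_bounded_multiples key; rewrite pmulr_rle0 ?exprn_gt0//.
by move: lk; move: (kap * l) (partial_var M) (D' ^+ 2) => a b c; lra.
Qed.

Lemma approximable_cluster (s2 : R) :
  (forall eps M0, 0 < eps -> exists2 M, (M0 <= M)%N & `|partial_var M - s2| <= eps) ->
  approximable mu T (u 0%N) s2.
Proof.
move=> H del0 d0 d1.
pose eta := del0 / 72; have eta0 : 0 < eta by rewrite divr_gt0.
have [M0 hM0] := decaying_remainder dec eta0.
have [M /hM0 hM sM] := H del0 M0 d0.
have [w2 [w [kw [B C]]]] := partial_corrector M d0 d1.
exists (partial_g M), (partial_kg M), w2, w, kw, B, (partial_var M); split => // n l.
have -> : (fun x => u 0%N x - (partial_g M x - partial_kg M x)) = u M.
  by apply/funext => x; rewrite partial_diff opprB addrCA subrr addr0.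
apply: le_trans (hM n l) _; rewrite ler_expR lerD2l.
have -> : 8 * l ^+ 2 * n%:R * (3 * eta) ^+ 2 = l ^+ 2 * n%:R * (72 * eta ^+ 2) by ring.
have E : 72 * eta ^+ 2 = del0 * eta by rewrite /eta; field.
apply: ler_wpM2l; first by apply: mulr_ge0 => //; exact: sqr_ge0.
rewrite E; apply: ler_piMr; first exact: ltW.
by rewrite /eta; move: d1; lra.
Qed.

End Variance.

Let lin1 (C1 C2 x y : R) : - C1 + x <= C2 + y -> x - y <= C1 + C2.
Proof. by move=> *; lra. Qed.

Let lin2 (a b eps : R) : a / 2 - b / 2 - eps / 2 <= 0 -> a <= b + eps.
Proof. by move=> *; lra. Qed.

Lemma approximable_le phi (a b : R) : bmeas phi -> 0 <= a -> 0 <= b ->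
  approximable mu T phi a -> approximable mu T phi b -> a <= b.
Proof.
move=> bphi a0 b0 appa appb; apply/ler_addgt0Pr => eps eps0.
have e4 : 0 < eps / 4 by rewrite divr_gt0.
have t1 (i : nat) : `|1 : R| <= 1 by rewrite normr1.
have [l1 [C1 [l10 H1]]] := laplace_lower mT pT 1 (t := fun=> 1) bphi appa a0 t1 e4.
have [l2 [C2 [l20 H2]]] := laplace_upper mT pT 1 (t := fun=> 1) bphi appb b0 t1 e4.
pose l := Num.min l1 l2; have l0 : 0 < l by rewrite lt_min l10.
have ll1 : l <= l1 by rewrite ge_min lexx.
have ll2 : l <= l2 by rewrite ge_min lexx orbT.
have key n : n%:R * (l ^+ 2 * (a / 2 - b / 2 - eps / 2)) <= C1 + C2.
  pose e (i : nat) := if i is 0%N then 0%N else n.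
  have he i : (e i <= e i.+1)%N by case: i.
  have h1 := H1 l e (ltW l0) ll1 he; have h2 := H2 l e (ltW l0) ll2 he.
  have := le_trans h1 h2; rewrite ler_expR !big_ord1 /= subn0 expr1n.
  have -> : l ^+ 2 * (n%:R * (1 / 2 * a - eps / 4)) = n%:R * (l ^+ 2 * (1 / 2 * a - eps / 4)) by ring.
  have -> : l ^+ 2 * (n%:R * (1 / 2 * b + eps / 4)) = n%:R * (l ^+ 2 * (1 / 2 * b + eps / 4)) by ring.
  have -> : n%:R * (l ^+ 2 * (a / 2 - b / 2 - eps / 2)) = n%:R * (l ^+ 2 * (1 / 2 * a - eps / 4)) - n%:R * (l ^+ 2 * (1 / 2 * b + eps / 4)) by field.
  exact: lin1.
have := le0_of_bounded_multiples key; rewrite pmulr_rle0 ?exprn_gt0//.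
exact: lin2.
Qed.

Lemma approximable_uniq phi (a b : R) : bmeas phi -> 0 <= a -> 0 <= b ->
  approximable mu T phi a -> approximable mu T phi b -> a = b.
Proof.
move=> bphi a0 b0 ha hb; apply/eqP; rewrite eq_le.
by rewrite (approximable_le bphi a0 b0 ha hb) (approximable_le bphi b0 a0 hb ha).
Qed.

Section Limit.
Variables (u : nat -> Om -> R) (del e : nat -> R) (D : R).
Hypothesis dec : decaying u del e D.
Hypothesis mix : forall M, exists2 w2, PFn mu T 1 (fun x => partial_g u M x ^+ 2) w2 &
  uniformly_mixing (fun x => w2 x - partial_kg u M x ^+ 2).

(** The Laplace asymptotics determine the variance, so that the bounded
sequence partial_var has a single cluster point. *)
Lemma partial_var_cvg : exists s2 : R, [/\ 0 <= s2, approximable mu T (u 0%N) s2 &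
  partial_var u M @[M --> \oo] --> s2].
Proof.
have [Bd hBd] := partial_var_bounded dec mix.
have V0 M := partial_var_ge0 dec mix M.
have b0 := bmeas_decaying dec 0.
pose F := partial_var u @ \oo.
have cK : compact (`[(-1 : R), Bd + 1]%classic) by exact: segment_compact.
have FK : F (`[(-1 : R), Bd + 1]%classic).
  exists 0%N => // M _ /=; rewrite in_itv/= (le_trans (hBd M)) ?lerDl// andbT.
  by apply: le_trans (V0 M).
have app (s2 : R) : cluster F s2 -> 0 <= s2 /\ approximable mu T (u 0%N) s2.
  move=> cl; have freq eps M0 : 0 < eps -> exists2 M, (M0 <= M)%N & `|partial_var u M - s2| <= eps.
    move=> eps0; have [||x [[M /= M0M <-] /=]] := cl (partial_var u @` [set M | (M0 <= M)%N]) (ball s2 eps).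
    - by exists M0 => // M /= h; exists M.
    - exact: nbhsx_ballx.
    by rewrite -ball_normE /ball_ /= distrC => h; exists M => //; exact: ltW.
  split; last exact: approximable_cluster dec mix _ freq.
  rewrite leNgt; apply/negP => s20.
  have [|M _] := freq (- s2 / 2) 0%N; first by rewrite divr_gt0 ?oppr_gt0.
  rewrite ler_norml => /andP[_]; have := V0 M; move: s20; move: (partial_var u M) => z.
  by move=> *; lra.
have [s2 cl] : exists s2 : R, cluster F s2.
  by have [s2 [_ cl]] := cK F _ FK; exists s2.
have [s20 sapp] := app _ cl.
exists s2; split => //.
apply: (@compact_cluster_set1 _ _ _ `[(-1 : R), Bd + 1]%classic) => //.
- have sB : s2 <= Bd.
    rewrite leNgt; apply/negP => h.
    have [||x [[M /= _ <-] /=]] := cl (partial_var u @` setT) (ball s2 (s2 - Bd)).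
    + by exists 0%N => // M _; exists M.
    + by apply: nbhsx_ballx; rewrite subr_gt0.
    by rewrite -ball_normE /ball_ /= ltr_norml => /andP[_]; have := hBd M; move: (partial_var u M) => z; lra.
  exists 1 => //= y; rewrite /ball_ /= in_itv/= ltr_norml => /andP[].
  by move: s20 sB; move=> *; apply/andP; split; lra.
apply/seteqP; split => [t ct|_ ->//].
have [t0 tapp] := app _ ct; exact: approximable_uniq b0 t0 s20 tapp sapp.
Qed.

Definition partial_cov N : R :=
  Ex (fun x => u 0%N x ^+ 2) + 2 * \sum_(1 <= k < N.+1) Ex (fun x => u 0%N x * u k x).

(** Expanding (u_0 - u_M) (2 g - u_0 + u_M). *)
Lemma partial_var_cov M : partial_var u M.+1 = partial_cov M +
  (2 * Ex (fun x => u 0%N x * u M.+1 x) - 2 * Ex (fun x => u M.+1 x * partial_g u M.+1 x)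
   - Ex (fun x => u M.+1 x ^+ 2)).
Proof.
have b0 := bmeas_decaying dec; have bg : bmeas (partial_g u M.+1) by exact: bmeas_sum.
have bkg : bmeas (partial_kg u M.+1) by apply: bmeas_sum => i; exact: b0.
have c1 := bmeasM (b0 0%N) bg; have c2 := bmeas_sqr (b0 0%N).
have c3 := bmeasM (b0 0%N) (b0 M.+1); have c4 := bmeasM (b0 M.+1) bg.
have c5 := bmeas_sqr (b0 M.+1).
have E0 : Ex (fun x => u 0%N x * partial_g u M.+1 x) =
    Ex (fun x => u 0%N x ^+ 2) + \sum_(1 <= k < M.+1) Ex (fun x => u 0%N x * u k x).
  transitivity (\sum_(k < M.+1) Ex (fun x => u 0%N x * u k x)).
    rewrite -(Ex_sum mu (index_enum 'I_M.+1) (F := fun k x => u 0%N x * u k x)); last first.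
      by move=> i; exact: bmeasM.
    by apply: eq_Ex => x; rewrite /partial_g mulr_sumr.
  rewrite -(big_mkord xpredT (fun k => Ex (fun x => u 0%N x * u k x))) big_ltn//; congr (_ + _).
rewrite /partial_var -(ExB mu (bmeas_sqr bg) (bmeas_sqr bkg)).
transitivity (Ex (fun x => 2 * (u 0%N x * partial_g u M.+1 x) - u 0%N x ^+ 2 + 2 * (u 0%N x * u M.+1 x)
   - 2 * (u M.+1 x * partial_g u M.+1 x) - u M.+1 x ^+ 2)).
  apply: eq_Ex => x; have := partial_diff u M.+1 x.
  move: (partial_g _ _ _) (partial_kg _ _ _) (u 0%N x) (u M.+1 x) => g k a b h.
  by rewrite (_ : k = g - (a - b)); [ring|rewrite -h; ring].
have d1 := bmeasZ 2 c1; have d2 := bmeasB d1 c2; have d3 := bmeasZ 2 c3; have d4 := bmeasD d2 d3.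
have d5 := bmeasZ 2 c4; have d6 := bmeasB d4 d5.
rewrite (ExB mu d6 c5) (ExB mu d4 d5) (ExD mu d2 d3) (ExB mu d1 c2) (ExZ mu 2 c1) (ExZ mu 2 c3) (ExZ mu 2 c4).
by rewrite E0 /partial_cov; ring.
Qed.

(** The tail terms of the previous expansion are small because the partial sums
of del grow at most like sqrt M while del M is o(1 / sqrt M). *)
Lemma cross_term_small (eps : R) : 0 < eps -> exists M0, forall M, (M0 <= M)%N ->
  del M * \sum_(i < M) del i <= eps.
Proof.
move=> eps0; have [PF le ge0 gt0 mono dyad sum] := dec.
have D0 : 0 <= D by have := sum 0%N; rewrite big_ord0.
pose r k : R := Num.sqrt (2 ^ k)%:R.
have p2 k : 0 < (2 ^ k)%:R :> R by rewrite ltr0n expn_gt0.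
have r0 k : 0 < r k by rewrite sqrtr_gt0.
have rr k : r k * r k = (2 ^ k)%:R by rewrite -expr2 sqr_sqrtr// ltW.
have dr k : del (2 ^ k)%N * r k <= e k.
  rewrite -(@ler_pXn2r _ 2)// ?nnegrE ?mulr_ge0// ?(ltW (r0 k)) ?(ltW (gt0 k))//.
  by rewrite exprMn [r k ^+ 2]expr2 rr.
have rmono k j : (k <= j)%N -> r k <= r j.
  by move=> kj; rewrite ler_wsqrtr// ler_nat leq_exp2l.
have S2 k : \sum_(i < 2 ^ k) del i <= del 0%N + \sum_(j < k) r j * e j.
  elim: k => [|k IH]; first by rewrite big_ord1 big_ord0 addr0.
  rewrite big_ord_recr addrA -(big_mkord xpredT del) (big_cat_nat (n := (2 ^ k)%N))//; last by rewrite leq_exp2l.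
  rewrite big_mkord; apply: lerD => //.
  rewrite big_nat_cond (@le_trans _ _ (\sum_(2 ^ k <= i < 2 ^ k.+1) del (2 ^ k)%N))//.
    rewrite -big_nat_cond big_nat_cond [leRHS]big_nat_cond; apply: ler_sum => i /andP[/andP[ki _] _].
    exact: (decaying_homo dec ki).
  rewrite sumr_const_nat expnS mul2n -addnn addnK -mulr_natr -rr mulrA [leRHS]mulrC.
  by rewrite ler_wpM2r ?(ltW (r0 k)).
pose K := del 0%N + D + 1; have K0 : 0 < K by rewrite ltr_wpDl// addr_ge0.
have S3 k : \sum_(i < 2 ^ k) del i <= r k * K.
  apply: le_trans (S2 k) _; apply: (@le_trans _ _ (r k * del 0%N + r k * D)).
    apply: lerD.
      by rewrite ler_peMl// -[leLHS]sqrtr1 ler_wsqrtr// ler1n expn_gt0.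
    apply: (@le_trans _ _ (\sum_(j < k) r k * e j)).
      by apply: ler_sum => j _; rewrite ler_wpM2r ?(ltW (gt0 j))// rmono// ltnW.
    by rewrite -mulr_sumr ler_wpM2l// ltW.
  by rewrite /K !mulrDr lerDl mulr1 ltW.
have tail0 : 0 < eps / (2 * K) by rewrite divr_gt0// mulr_gt0.
have [m0 hm0] := bounded_sum_tail gt0 sum tail0.
exists (2 ^ m0)%N => M mM.
have M0 : (0 < M)%N by apply: leq_trans mM; rewrite expn_gt0.
pose k := trunc_log 2 M.
have /andP[kM Mk] := trunc_log_bounds (ltnSn 1) M0; rewrite -/k in kM Mk.
have m0k : (m0 <= k)%N by exact: trunc_log_max.
have ek : e k <= eps / (2 * K).
  apply: le_trans (hm0 k.+1); rewrite big_nat_recr//= lerDr.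
  by apply: sumr_ge0 => j _; exact: ltW.
apply: (@le_trans _ _ (del (2 ^ k)%N * (r k.+1 * K))).
  apply: ler_pM => //; first exact: sumr_ge0.
    exact: (decaying_homo dec kM).
  apply: le_trans (S3 k.+1); rewrite -!(big_mkord xpredT del).
  by rewrite [leRHS](big_cat_nat (n := M)) ?(ltnW Mk)//= lerDl sumr_ge0.
have r2 : r k.+1 <= 2 * r k.
  rewrite -(@ler_pXn2r _ 2) ?nnegrE ?mulr_ge0 ?(ltW (r0 _))//.
  rewrite exprMn !expr2 !rr expnS natrM ler_wpM2r ?(ltW (p2 k))//.
  by rewrite -natrM ler_nat.
apply: (@le_trans _ _ (del (2 ^ k)%N * (2 * r k * K))).
  by rewrite ler_wpM2l// ler_wpM2r// ltW.
have -> : del (2 ^ k)%N * (2 * r k * K) = del (2 ^ k)%N * r k * (2 * K) by ring.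
by rewrite -ler_pdivlMr ?mulr_gt0//; exact: le_trans (dr k) ek.
Qed.

Lemma partial_cov_cvg (s2 : R) : partial_var u M @[M --> \oo] --> s2 ->
  partial_cov N @[N --> \oo] --> s2.
Proof.
move=> cv; have b0 := bmeas_decaying dec.
pose err M := 2 * Ex (fun x => u 0%N x * u M.+1 x) - 2 * Ex (fun x => u M.+1 x * partial_g u M.+1 x)
   - Ex (fun x => u M.+1 x ^+ 2).
have -> : partial_cov = (fun N => partial_var u N.+1 - err N).
  by apply/funext => N; rewrite partial_var_cov addrK.
rewrite -[X in _ --> X]subr0; apply: cvgB; first by rewrite (cvg_shiftS (partial_var u)).
apply/cvgrPdist_le => eps eps0; have e5 : 0 < eps / 5 by rewrite divr_gt0.
have [M0 hM0] := cross_term_small e5; exists M0.+1 => //= M M0M.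
have [_ le ge0 _ mono _ _] := dec.
have hM := hM0 M.+1 (leq_trans (ltnW M0M) (leqnSn M)).
have h1 : `|Ex (fun x => u 0%N x * u M.+1 x)| <= eps / 5.
  apply: Ex_norm_le => [|x]; first exact: bmeasM.
  apply: le_trans hM; rewrite normrM mulrC; apply: ler_pM => //.
  apply: le_trans (le 0%N x) _; rewrite big_ord_recl lerDl; exact: sumr_ge0.
have h2 : `|Ex (fun x => u M.+1 x * partial_g u M.+1 x)| <= eps / 5.
  apply: Ex_norm_le => [|x]; first by apply: bmeasM => //; exact: bmeas_sum.
  apply: le_trans hM; rewrite normrM; apply: ler_pM => //.
  by apply: le_trans (ler_norm_sum _ _ _) _; exact: ler_sum.
have h3 : `|Ex (fun x => u M.+1 x ^+ 2)| <= eps / 5.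
  apply: Ex_norm_le => [|x]; first exact: bmeas_sqr.
  apply: le_trans hM; rewrite expr2 normrM; apply: ler_pM => //.
  apply: le_trans (le _ x) _; apply: le_trans (decaying_homo dec (leq0n M.+1)) _.
  by rewrite big_ord_recl lerDl; exact: sumr_ge0.
rewrite sub0r normrN /err.
move: h1 h2 h3 eps0.
move: (\int[mu]_x (u 0%N x * u M.+1 x)) (\int[mu]_x (u M.+1 x * partial_g u M.+1 x)) (\int[mu]_x (u M.+1 x ^+ 2)) => x y z.
rewrite !ler_norml => /andP[? ?] /andP[? ?] /andP[? ?] ?; apply/andP; split; lra.
Qed.

End Limit.
End Decay.

(** * Functions of bounded variation and their images *)

Section Dominated.
Variable R : realType.
Implicit Types (f g P Q : R -> R).

(** P controls the increments of f on [0, 1]; such a P exists exactly for f of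
bounded variation. *)
Definition dominated f P : Prop := forall x y, 0 <= x -> x <= y -> y <= 1 ->
  `|f y - f x| <= P y - P x.

Lemma dominated_homo f P x y : dominated f P -> 0 <= x -> x <= y -> y <= 1 -> P x <= P y.
Proof. by move=> fP x0 xy y1; rewrite -subr_ge0; exact: le_trans (fP x y x0 xy y1). Qed.

Lemma dominated_osc f P x y : dominated f P -> 0 <= x -> x <= 1 -> 0 <= y -> y <= 1 ->
  `|f y - f x| <= P 1 - P 0.
Proof.
move=> fP; wlog xy : x y / x <= y => [H|] x0 x1 y0 y1.
  by have [xy|/ltW xy] := leP x y; [exact: H|rewrite distrC; exact: H].
apply: le_trans (fP x y x0 xy y1) _; apply: lerB; exact: (dominated_homo fP).
Qed.

Lemma dominated_BV f P : dominated f P ->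
  bounded_variation 0 1 f /\ (total_variation 0 1 f <= (P 1 - P 0)%:E)%E.
Proof.
move=> fP; have key s : itv_partition 0 1 s -> variation 0 1 f s <= P 1 - P 0.
  move=> ps; have ndP : {in `[0, 1] &, nondecreasing_fun P}.
    move=> x y; rewrite !in_itv/= => /andP[x0 x1] /andP[y0 y1] xy; exact: (dominated_homo fP).
  rewrite -(nondecreasing_variation ndP ps) /variation !big_nat; apply: ler_sum => i /= im.
  apply: le_trans (ler_norm _); apply: fP.
  - by apply: itv_partition_nth_ge => //; rewrite ltnS ltnW.
  - case: ps => ps _; have := (pathP 1 ps) i im; rewrite /= => /ltW.
    by case: i im.
  - exact: (@itv_partition_nth_le _ _ 0 1 s i.+1).
split; first by exists (P 1 - P 0) => _ [s ps <-]; exact: key.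
by apply: ge_ereal_sup => _ [_ [s ps <-] <-]; rewrite lee_fin key.
Qed.

(** Take for P the variation function from 0. *)
Lemma BV_dominated f : bounded_variation 0 1 f ->
  exists P, dominated f P /\ (P 1 - P 0)%:E = total_variation 0 1 f.
Proof.
move=> bf; pose P x := fine (total_variation 0 x f); exists P.
have fin x y : 0 <= x -> x <= y -> y <= 1 -> total_variation x y f \is a fin_num.
  move=> x0 xy y1; apply/bounded_variationP => //.
  by apply: (bounded_variationl xy y1); apply: (bounded_variationr x0 (le_trans xy y1)).
split.
  move=> x y x0 xy y1.
  rewrite /P (total_variationD f x0 xy) fineD ?fin// ?(le_trans xy)// addrAC subrr add0r.
  rewrite -lee_fin fineK ?fin//; exact: total_variation_ge.
by rewrite /P total_variationxx subr0 fineK// fin.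
Qed.

Lemma dominatedD f g P Q : dominated f P -> dominated g Q ->
  dominated (fun x => f x + g x) (fun x => P x + Q x).
Proof.
move=> fP gQ x y x0 xy y1; have := lerD (fP x y x0 xy y1) (gQ x y x0 xy y1).
move=> h; rewrite (_ : f y + g y - (f x + g x) = (f y - f x) + (g y - g x)); last by ring.
by apply: le_trans (ler_normD _ _) _; apply: le_trans h _; rewrite le_eqVlt; apply/orP; left; apply/eqP; ring.
Qed.

Lemma dominated_cst (c : R) : dominated (fun=> c) (fun=> 0).
Proof. by move=> x y _ _ _; rewrite !subrr normr0. Qed.

Lemma dominated_bounded f P x : dominated f P -> 0 <= x -> x <= 1 ->
  `|f x| <= `|f 0| + (P 1 - P 0).
Proof.
move=> fP x0 x1; have := dominated_osc fP (lexx 0) ler01 x0 x1.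
have := ler_normD (f 0) (f x - f 0); rewrite addrC subrK => h1 h2.
by apply: le_trans h1 _; rewrite lerD2l.
Qed.

Lemma dominatedM f g P Q : dominated f P -> dominated g Q ->
  exists S, dominated (fun x => f x * g x) S.
Proof.
move=> fP gQ; pose A := `|f 0| + (P 1 - P 0); pose B := `|g 0| + (Q 1 - Q 0).
exists (fun x => A * Q x + B * P x) => x y x0 xy y1.
have x1 := le_trans xy y1; have y0 := le_trans x0 xy.
have -> : f y * g y - f x * g x = f y * (g y - g x) + g x * (f y - f x) by ring.
have -> : A * Q y + B * P y - (A * Q x + B * P x) = A * (Q y - Q x) + B * (P y - P x) by ring.
apply: le_trans (ler_normD _ _) _; rewrite !normrM.
by apply: lerD; apply: ler_pM => //; [exact: (dominated_bounded fP)|exact: gQ|exact: (dominated_bounded gQ)|exact: fP].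
Qed.

Lemma measurable_val01 : measurable_fun [set: I01 R] (@val01 R : I01 R -> measurableTypeR R).
Proof. by move=> _ Y mY; rewrite setTI; exists Y => //; rewrite setTI. Qed.

Lemma val01_itv (x : I01 R) : 0 <= val01 x /\ val01 x <= 1.
Proof.
have : (`[0, 1]%classic : set R) (val01 x) by rewrite /val01; exact: set_valP.
by rewrite /= in_itv/= => /andP[].
Qed.

Lemma bmeas_dominated f P : dominated f P -> bmeas (on01 f : I01 R -> R).
Proof.
move=> fP.
have mono h : (forall x y, 0 <= x -> x <= y -> y <= 1 -> h x <= h y) ->
    measurable_fun setT (on01 h : I01 R -> R).
  move=> hh; have -> : (on01 h : I01 R -> R) = (h \o @clamp R) \o @val01 R.
    apply/funext => x; have [x0 x1] := val01_itv x.
    by rewrite /on01 /= clamp_id// x0 x1.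
  apply: (measurableT_comp _ measurable_val01).
  apply: nondecreasing_measurable => // x y xy /=.
  by apply: hh; [exact: clamp_ge0|exact: clamp_mono|exact: clamp_le1].
apply: (@bmeas_bound _ _ _ _ (`|f 0| + (P 1 - P 0))); last first.
  by move=> x; have [x0 x1] := val01_itv x; exact: dominated_bounded.
have -> : (on01 f : I01 R -> R) = (fun x => on01 (fun y => f y + P y) x - on01 P x).
  by apply/funext => x; rewrite /on01 addrK.
apply: measurable_funB; apply: mono => x y x0 xy y1.
  have := fP x y x0 xy y1; rewrite ler_norml => /andP[h _]; lra.
exact: (dominated_homo fP).
Qed.

End Dominated.

Section BVContracting.
Variables (R : realType) (mu : probability (I01 R) R) (T : I01 R -> I01 R).
Implicit Types (f g P Q : R -> R) (h k psi : I01 R -> R).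
Notation Ex h := (\int[mu]_x (h x : R)).
Hypothesis mT : measurable_fun setT T.
Hypothesis pT : forall A, measurable A -> mu (T @^-1` A) = mu A.

Lemma Lfun2_bmeas h : bmeas h -> h \in Lfun mu 2%:E.
Proof.
move=> bh; rewrite inE/=; apply/andP; split; rewrite inE/=; first exact: bh.1.
rewrite /finite_norm unlock; apply: poweR_lty.
under eq_integral => x _ do rewrite /= powR_mulrn// real_normK ?num_real//.
by apply: integrable_lty => //; exact: bmeas_int (bmeas_sqr bh).
Qed.

Variable K : (I01 R -> R) -> (I01 R -> R).
Hypothesis PF : Perron_Frobenius mu T K.

Lemma Perron_Frobenius_iter n h : h \in Lfun mu 2%:E ->
  iter n K h \in Lfun mu 2%:E /\ forall psi, bmeas psi ->
    Ex (fun x => iter n K h x * psi x) = Ex (fun x => h x * psi (iter n T x)).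
Proof.
move=> hL; elim: n => [|n [IH1 IH2]]; first by split.
have [L E] := PF IH1; split => // psi bpsi.
rewrite iterS E; last exact: Lfun2_bmeas.
rewrite (IH2 (fun x => psi (T x))); last exact: bmeas_comp.
by apply: eq_Ex => x; rewrite iterS.
Qed.

(** The iterates of K are only square integrable representatives; truncation
turns them into bounded versions. *)
Lemma PFn_exists n h (c : R) : 0 <= c -> bmeas h -> (forall x, `|h x| <= c) ->
  exists k, [/\ PFn mu T n h k, forall x, `|k x| <= c &
    {ae mu, forall x, k x = iter n K h x}].
Proof.
move=> c0 bh hc; have [L E] := Perron_Frobenius_iter n (Lfun2_bmeas bh).
have iK : mu.-integrable setT (EFin \o iter n K h).
  by apply/Lfun1_integrable; apply: Lfun_subset12 L; exact: fin_num_measure.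
have [PK aeK] := PFn_clip mT pT c0 bh hc iK E.
by exists (fun x => clip c (iter n K h x)); split => // x; exact: clip_le.
Qed.

Lemma PFn_ae_image n h k k' : PFn mu T n h k -> bmeas k' ->
  {ae mu, forall x, k x = k' x} -> PFn mu T n h k'.
Proof.
move=> [bh bk E] bk' kk'; split => // psi bpsi; rewrite -E//.
apply: ae_eq_Ex; [exact: (bmeasM bk' bpsi).1|exact: (bmeasM bk bpsi).1|].
by apply: filterS kk' => x ->.
Qed.

Variables (kappa rho : R).
Hypothesis kappa0 : 0 < kappa.
Hypothesis rho01 : 0 <= rho < 1.
Hypothesis contr : forall f n, bounded_variation 0 1 f ->
  exists g : R -> R, [/\ bounded_variation 0 1 g,
    {ae mu, forall x, iter n K (on01 f) x = on01 g x} &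
    (total_variation 0 1 g <= (kappa * rho ^+ n)%:E * total_variation 0 1 f)%E].

Lemma dominated_image f P n : dominated f P -> exists g Q,
  [/\ dominated g Q, Q 1 - Q 0 <= kappa * rho ^+ n * (P 1 - P 0) &
      PFn mu T n (on01 f) (on01 g)].
Proof.
move=> fP; have [bf tvf] := dominated_BV fP.
have [g [bg gae tvg]] := contr n bf; have [Q [gQ QE]] := BV_dominated bg.
exists g, Q; split => //.
  rewrite -lee_fin QE; apply: le_trans tvg _; rewrite [leRHS]EFinM; apply: lee_pmul => //.
    by rewrite lee_fin mulr_ge0// ?exprn_ge0// ?(ltW kappa0)//; case/andP: rho01.
  exact: total_variation_ge0.
have bof := bmeas_dominated fP; have bog := bmeas_dominated gQ.
have [_ [c hc]] := bof.
have c0 : 0 <= `|c| by [].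
have [k [PK _ kae]] := PFn_exists n c0 bof (fun x => le_trans (hc x) (ler_norm _)).
apply: (PFn_ae_image PK bog).
by apply: filterS2 kae gae => x -> ->.
Qed.

Lemma dominated_mean g Q x : dominated g Q ->
  `|on01 g x - Ex (on01 g)| <= Q 1 - Q 0.
Proof.
move=> gQ; have bg := bmeas_dominated gQ.
have -> : on01 g x - Ex (on01 g) = Ex (fun y => on01 g x - on01 g y).
  by rewrite (ExB mu (bmeas_cst _ (on01 g x)) bg) Ex_cst.
apply: Ex_norm_le => [|y]; first exact: bmeasB (bmeas_cst _ _) bg.
have [x0 x1] := val01_itv x; have [y0 y1] := val01_itv y; exact: (dominated_osc gQ).
Qed.

(** The centered function f is carried to a small function: the part that is
approximated by f' shrinks with the variation of f', the rest keeps its size. *)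
Lemma centered_image f f' P n (eta : R) : bmeas (on01 f : I01 R -> R) ->
  dominated f' P -> (forall x : I01 R, `|on01 f x - on01 f' x| <= eta) ->
  exists2 k, PFn mu T n (fun x => on01 f x - Ex (on01 f)) k &
    forall x, `|k x| <= 2 * eta + kappa * rho ^+ n * (P 1 - P 0).
Proof.
move=> bf fP feta; have bf' := bmeas_dominated fP.
have [g [Q [gQ QP gK]]] := dominated_image n fP.
have bd : bmeas (fun x : I01 R => on01 f x - on01 f' x) := bmeasB bf bf'.
have eta0 : 0 <= eta by apply: le_trans (feta point).
have [k1 [k1K k1e _]] := PFn_exists n eta0 bd feta.
exists (fun x => k1 x + (on01 g x - Ex (on01 f))).
  have := PFnD mT k1K (PFnB mT gK (PFn_cst mT pT n (Ex (on01 f)))).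
  have -> // : (fun x => on01 f x - on01 f' x + (on01 f' x - Ex (on01 f))) = (fun x => on01 f x - Ex (on01 f)).
  by apply/funext => x; ring.
move=> x; have -> : k1 x + (on01 g x - Ex (on01 f)) = k1 x + ((on01 g x - Ex (on01 g)) - Ex (fun x => on01 f x - on01 f' x)).
  by rewrite (PFn_mean gK) (ExB mu bf bf'); ring.
apply: le_trans (ler_normD _ _) _; have h1 := ler_normB (on01 g x - Ex (on01 g)) (Ex (fun x => on01 f x - on01 f' x)).
have h2 := dominated_mean x gQ; have h3 := @Ex_norm_le _ _ _ mu _ _ bd feta; have h4 := k1e x.
apply: le_trans (lerD h4 (le_trans h1 (lerD (le_trans h2 QP) h3))) _.
by rewrite le_eqVlt; apply/orP; left; apply/eqP; ring.
Qed.

(** Functions that are almost everywhere uniform limits of functions of bounded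
variation: this class is stable under sums, products and images, and its members
mix uniformly. *)
Definition BV_limit h : Prop := bmeas h /\ forall eta : R, 0 < eta ->
  exists f P, dominated f P /\ {ae mu, forall x, `|h x - on01 f x| <= eta}.

Lemma BV_limit_dominated f P : dominated f P -> BV_limit (on01 f).
Proof.
move=> fP; split; first exact: (bmeas_dominated fP).
by move=> eta eta0; exists f, P; split => //; apply: aeW => x; rewrite subrr normr0 ltW.
Qed.

Lemma BV_limitD h k : BV_limit h -> BV_limit k -> BV_limit (fun x => h x + k x).
Proof.
move=> [bh ah] [bk ak]; split; first exact: bmeasD.
move=> eta eta0; have e2 : 0 < eta / 2 by rewrite divr_gt0.
have [f [P [fP hf]]] := ah _ e2; have [g [Q [gQ kg]]] := ak _ e2.
exists (fun x => f x + g x), (fun x => P x + Q x); split; first exact: dominatedD.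
apply: filterS2 hf kg => x h1 h2; rewrite /on01.
rewrite (_ : _ - _ = (h x - on01 f x) + (k x - on01 g x)); last by rewrite /on01; ring.
by apply: le_trans (ler_normD _ _) _; move: h1 h2; move: (`|_|) (`|_|) => a b *; lra.
Qed.

Lemma BV_limitM h k : BV_limit h -> BV_limit k -> BV_limit (fun x => h x * k x).
Proof.
move=> [bh ah] [bk ak]; split; first exact: bmeasM.
have [_ [c hc]] := bh; have [_ [e ke]] := bk.
move=> eta eta0; pose A := `|c| + 1; pose B := `|e| + 1.
have A0 : 0 < A by rewrite ltr_wpDl.
have B0 : 0 < B by rewrite ltr_wpDl.
have [g [Q [gQ kg]]] := ak (eta / (2 * A)) (divr_gt0 eta0 (mulr_gt0 (ltr0n _ 2) A0)).
pose C := B + `|eta / (2 * A)|; have C0 : 0 < C by rewrite ltr_wpDr.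
have [f [P [fP hf]]] := ah (eta / (2 * C)) (divr_gt0 eta0 (mulr_gt0 (ltr0n _ 2) C0)).
have [S hS] := dominatedM fP gQ.
exists (fun x => f x * g x), S; split => //.
apply: filterS2 hf kg => x h1 h2.
rewrite (_ : _ - _ = h x * (k x - on01 g x) + on01 g x * (h x - on01 f x)); last by rewrite /on01; ring.
apply: le_trans (ler_normD _ _) _; rewrite !normrM.
have gC : `|on01 g x| <= C.
  have := ler_normB (k x) (k x - on01 g x); rewrite subKr => h3; apply: le_trans h3 _.
  apply: lerD; last exact: le_trans (ler_norm _).
  by apply: le_trans (ke x) (le_trans (ler_norm _) _); rewrite lerDl.
have hA : `|h x| <= A by apply: le_trans (hc x) (le_trans (ler_norm _) _); rewrite lerDl.
have e1 : `|h x| * `|k x - on01 g x| <= A * (eta / (2 * A)) by exact: ler_pM.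
have e2 : `|on01 g x| * `|h x - on01 f x| <= C * (eta / (2 * C)) by exact: ler_pM.
apply: le_trans (lerD e1 e2) _; rewrite le_eqVlt; apply/orP; left; apply/eqP.
by field; rewrite !gt_eqF.
Qed.

Lemma ae_clip h (c : R) : {ae mu, forall x, `|h x| <= c} -> {ae mu, forall x, h x = clip c (h x)}.
Proof. by apply: filterS => x hx; rewrite clip_id. Qed.

Lemma PFn_ae_bound n h k (c : R) : 0 <= c -> PFn mu T n h k ->
  {ae mu, forall x, `|h x| <= c} -> {ae mu, forall x, `|k x| <= c}.
Proof.
move=> c0 hk hc; have [bh bk _] := hk.
have bc : bmeas (fun x => clip c (h x)) := bmeas_clip c0 bh.1.
have ck : PFn mu T n (fun x => clip c (h x)) k.
  by apply: (PFn_ae mT hk bc); exact: ae_clip.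
have [k' [k'K k'c _]] := PFn_exists n c0 bc (fun x => clip_le (h x) c0).
by apply: filterS (PFn_uniq mT pT ck k'K) => x ->.
Qed.

Lemma BV_limit_image n h k : BV_limit h -> PFn mu T n h k -> BV_limit k.
Proof.
move=> [bh ah] hk; have [_ bk _] := hk; split => // eta eta0.
have [f [P [fP hf]]] := ah _ eta0.
have [g [Q [gQ _ gK]]] := dominated_image n fP.
exists g, Q; split => //.
exact: (PFn_ae_bound (ltW eta0) (PFnB mT hk gK) hf).
Qed.

Lemma BV_limit_sum N (F : nat -> I01 R -> R) : (forall i, BV_limit (F i)) ->
  BV_limit (fun x => \sum_(i < N) F i x).
Proof.
move=> FB; elim: N => [|N IH].
  by under eq_fun do rewrite big_ord0; exact: (BV_limit_dominated (@dominated_cst R 0)).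
by under eq_fun do rewrite big_ord_recr; exact: BV_limitD.
Qed.

Lemma expr_small (c eta : R) : 0 <= c -> 0 < eta -> exists n, (0 < n)%N /\ c * rho ^+ n <= eta.
Proof.
move=> c0 eta0; have /andP[r0 r1] := rho01.
have c1 : 0 < c + 1 by rewrite ltr_wpDl.
have /cvgrPdist_le/(_ (eta / (c + 1)) (divr_gt0 eta0 c1))[N _ HN] : rho ^+ n @[n --> \oo] --> (0 : R).
  by apply: cvg_expr; rewrite ger0_norm.
exists N.+1; split => //; have := HN N.+1 (leqnSn N); rewrite /= sub0r normrN ger0_norm ?exprn_ge0// => h.
apply: (@le_trans _ _ ((c + 1) * (eta / (c + 1)))); last by rewrite mulrC divfK ?gt_eqF.
by apply: ler_pM => //; [rewrite exprn_ge0|rewrite lerDl].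
Qed.

(** Contraction of the variation brings the image of a function of bounded
variation uniformly close to its mean. The estimate holds almost everywhere;
truncating the n-th image around the mean makes it hold everywhere. *)
Lemma BV_limit_mixing v : BV_limit v -> uniformly_mixing mu T v.
Proof.
move=> [bv av] eta eta0; have e3 : 0 < eta / 3 by rewrite divr_gt0.
have [f [P [fP vf]]] := av _ e3; have bf := bmeas_dominated fP.
have P0 : 0 <= kappa * (P 1 - P 0).
  by rewrite mulr_ge0 ?(ltW kappa0)// subr_ge0; exact: (dominated_homo fP).
have [n [n0 hn]] := expr_small P0 e3.
have [_ [c hc]] := bv.
have exF (k : nat) : exists F, PFn mu T k v F.
  by have [F [FK _ _]] := PFn_exists k (normr_ge0 c) bv (fun x => le_trans (hc x) (ler_norm _)); exists F.
have [F0 F0K] := exF n; have [bF0 _] : bmeas F0 /\ True by case: F0K.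
have [g [Q [gQ QP gK]]] := dominated_image n fP.
have mvf : `|Ex v - Ex (on01 f)| <= eta / 3.
  rewrite -(ExB mu bv bf).
  have -> : Ex (fun x => v x - on01 f x) = Ex (fun x => clip (eta / 3) (v x - on01 f x)).
    apply: ae_eq_Ex; [exact: (bmeasB bv bf).1|exact: (measurable_clip _ (bmeasB bv bf).1)|].
    exact: ae_clip.
  apply: Ex_norm_le => [|x]; [exact: bmeas_clip (ltW e3) (bmeasB bv bf).1|exact: clip_le (ltW e3)].
have F0g : {ae mu, forall x, `|F0 x - on01 g x| <= eta / 3}.
  exact: (PFn_ae_bound (ltW e3) (PFnB mT F0K gK)).
have F0c : {ae mu, forall x, `|F0 x - Ex v| <= eta}.
  apply: filterS F0g => x h1.
  have h2 := dominated_mean x gQ; rewrite (PFn_mean gK) in h2.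
  have -> : F0 x - Ex v = (F0 x - on01 g x) + ((on01 g x - Ex (on01 f)) - (Ex v - Ex (on01 f))) by ring.
  have h3 := ler_normB (on01 g x - Ex (on01 f)) (Ex v - Ex (on01 f)).
  apply: le_trans (ler_normD _ _) _.
  have h4 : Q 1 - Q 0 <= eta / 3 by apply: le_trans QP _; rewrite mulrAC.
  by move: h1 h2 h3 h4 mvf; move: (`|_|) (`|_|) (`|_|) (`|_|) (Q 1 - Q 0) => *; lra.
pose Fn x := Ex v + clip eta (F0 x - Ex v).
have bFn : bmeas Fn.
  apply: bmeasD; first exact: bmeas_cst.
  exact: bmeas_clip (ltW eta0) (bmeasB bF0 (bmeas_cst _ _)).1.
have FnK : PFn mu T n v Fn.
  apply: (PFn_ae_image F0K bFn); apply: filterS (ae_clip F0c) => x E.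
  by rewrite /Fn -E addrC subrK.
have /choice[G GK] := exF.
exists n, (fun k : nat => if k == 0%N then v else if k == n then Fn else G k); split => //.
  move=> k; have [->|k0] := eqVneq k 0%N; first exact: PFn0.
  by have [->|] := eqVneq k n.
move=> x; rewrite (gtn_eqF n0) eqxx /Fn addrAC subrr add0r; exact: clip_le (ltW eta0).
Qed.

End BVContracting.

(** * The two classes of observables *)

Section Condensation.
Variable R : realType.

Lemma geometric_sum_le (r : R) n : 0 <= r -> r < 1 -> \sum_(j < n) r ^+ j <= (1 - r)^-1.
Proof.
move=> r0 r1; have r10 : 0 < 1 - r by rewrite subr_gt0.
rewrite -[leRHS]mul1r ler_pdivlMr// mulrC.
have := subrX1 r n; rewrite -opprB -[r - 1]opprB mulNr => /oppr_inj <-.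
by rewrite gerBl exprn_ge0.
Qed.

Variables (c : nat -> R) (C : R).
Hypothesis c0 : forall i, 0 <= c i.
Hypothesis mono : forall i, c i.+1 <= c i.
Hypothesis sumC : forall n, \sum_(j < n) c j / Num.sqrt j.+1%:R <= C.

Let homo i j : (i <= j)%N -> c j <= c i.
Proof. exact: ((nonincreasing_seqP c).1 mono). Qed.

(** Cauchy condensation, with a geometric sequence added to make the terms
positive. *)
Lemma condensation : exists (e : nat -> R) (D : R),
  [/\ forall i, 0 < e i, forall i, c (2 ^ i)%N ^+ 2 * (2 ^ i)%:R <= e i ^+ 2 &
      forall m, \sum_(k < m) e k <= D].
Proof.
pose r k : R := Num.sqrt (2 ^ k)%:R.
have p2 k : 0 < (2 ^ k)%:R :> R by rewrite ltr0n expn_gt0.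
have r0 k : 0 < r k by rewrite sqrtr_gt0.
have rr k : r k ^+ 2 = (2 ^ k)%:R by rewrite sqr_sqrtr// ltW.
have h0 : 0 <= 2^-1 :> R by [].
have h1 : 2^-1 < 1 :> R by rewrite invf_lt1// ltr1n.
have E m : \sum_(i < m) c (2 ^ i.+1)%N * r i.+1 <= 2 * \sum_(j < 2 ^ m) c j / Num.sqrt j.+1%:R.
  elim: m => [|m IH].
    by rewrite big_ord0 mulr_ge0// sumr_ge0// => i _; rewrite divr_ge0.
  rewrite big_ord_recr -(big_mkord xpredT (fun j => c j / Num.sqrt j.+1%:R)).
  rewrite (big_cat_nat (n := (2 ^ m)%N))//=; last by rewrite leq_exp2l.
  rewrite big_mkord mulrDr; apply: lerD => //.
  apply: (@le_trans _ _ (2 * \sum_(2 ^ m <= i < 2 ^ m.+1) (c (2 ^ m.+1)%N / r m.+1))).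
    rewrite sumr_const_nat expnS mul2n -addnn addnK addnn -mul2n -expnS /= -[X in _ <= _ * X]mulr_natr.
    have -> : 2 * (c (2 ^ m.+1)%N / r m.+1 * (2 ^ m)%:R) = c (2 ^ m.+1)%N / r m.+1 * (2 ^ m.+1)%:R.
      by rewrite expnS natrM; ring.
    by rewrite -rr expr2 mulrA divfK// gt_eqF.
  rewrite ler_wpM2l//; apply: ler_sum_nat => j /andP[mj jm].
  apply: ler_pM => //; first by rewrite invr_ge0 ltW.
    by apply: homo; exact: ltnW.
  by rewrite lef_pV2 ?posrE ?sqrtr_gt0// ler_wsqrtr// ler_nat.
exists (fun i => c (2 ^ i)%N * r i + 2^-1 ^+ i), (3 * C + 2); split.
- by move=> i; rewrite ltr_wpDl ?exprn_gt0// mulr_ge0// ltW.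
- move=> i; rewrite -rr -exprMn ler_pXn2r ?nnegrE ?lerDl ?exprn_ge0//.
    by rewrite mulr_ge0// ltW.
  by rewrite addr_ge0 ?exprn_ge0// mulr_ge0// ltW.
have cC : c 0%N <= C by have := sumC 1; rewrite big_ord1 sqrtr1 divr1.
case=> [|m].
  by rewrite big_ord0; have := c0 0%N; lra.
rewrite big_split/=; apply: lerD; last first.
  by apply: le_trans (geometric_sum_le _ h0 h1) _; rewrite (_ : 1 - 2^-1 = 2^-1) ?invrK//; field.
rewrite big_ord_recl /r expn0 sqrtr1 mulr1 (_ : 3 * C = C + 2 * C); last by ring.
apply: lerD; first exact: le_trans (homo (leqnSn 0)) cC.
by apply: le_trans (E m) _; rewrite ler_wpM2l.
Qed.

Lemma weighted_sum_small (eta : R) : 0 < eta -> exists k, c k <= eta.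
Proof.
move=> eta0; apply: contrapT => H.
have H' k : eta < c k by rewrite ltNge; apply/negP => h; apply: H; exists k.
have /le0_of_bounded_multiples : forall n : nat, n%:R * (eta ^+ 2) <= C ^+ 2.
  case=> [|n]; first by rewrite mul0r sqr_ge0.
  have s0 : 0 < Num.sqrt n.+1%:R :> R by rewrite sqrtr_gt0.
  have h : Num.sqrt n.+1%:R * eta <= C.
    apply: le_trans (sumC n.+1); apply: (@le_trans _ _ (\sum_(j < n.+1) eta / Num.sqrt n.+1%:R)).
      have s2 : Num.sqrt n.+1%:R ^+ 2 = n.+1%:R :> R by rewrite sqr_sqrtr.
      by rewrite sumr_const card_ord -[leRHS]mulr_natr -[X in _ <= _ * X]s2 expr2 mulrA divfK ?gt_eqF// mulrC.
    apply: ler_sum => j _; apply: ler_pM => //; first exact: ltW.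
    - exact: ltW.
    - by rewrite lef_pV2 ?posrE ?sqrtr_gt0// ler_wsqrtr// ler_nat.
  have Cp : 0 <= C by apply: le_trans h; rewrite mulr_ge0 ?ltW.
  rewrite -[X in X * _]sqr_sqrtr// -exprMn ler_pXn2r ?nnegrE// mulr_ge0 ?ltW//.
by rewrite leNgt exprn_gt0.
Qed.

End Condensation.

Section ClassL.
Variables (R : realType) (f c : R -> R).
Hypothesis cmono : {in `[0, +oo[ &, {homo c : s t / s <= t}}.
Hypothesis cint : (\int[lebesgue_measure]_(t in `]0%R, 1%R[)
  (c t / (t * Num.sqrt `|ln t|))%:E < +oo)%E.
Hypothesis fc : forall x y, `|f x - f y| <= c `|x - y|.

Lemma modulus_homo s t : 0 <= s -> s <= t -> c s <= c t.
Proof. by move=> s0 st; apply: cmono; rewrite ?in_itv/= ?andbT ?(le_trans s0). Qed.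

Lemma modulus_ge0 t : 0 <= t -> 0 <= c t.
Proof.
move=> t0; apply: le_trans (modulus_homo (lexx 0) t0).
by have := fc 0 0; rewrite !subrr normr0.
Qed.

Variable r : R.
Hypothesis r0 : 0 < r.
Hypothesis r1 : r < 1.

(** The integral dominates the step function equal to its lower bound on each
interval ]r^(j+1), r^j[. *)
Lemma modulus_sum : exists C, forall n, \sum_(j < n) c (r ^+ j) / Num.sqrt j.+1%:R <= C.
Proof.
pose L := Num.sqrt `|ln r|.
have lr00 : 0 < `|ln r| by rewrite normr_gt0 lt_eqF// ln_lt0// r0.
have L0 : 0 < L by rewrite sqrtr_gt0.
have rj j : 0 < r ^+ j by rewrite exprn_gt0.
pose a j := c (r ^+ j.+1) / (r ^+ j * (Num.sqrt j.+1%:R * L)).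
have s0 j : 0 < Num.sqrt j.+1%:R :> R by rewrite sqrtr_gt0.
have a0 j : 0 <= a j by rewrite divr_ge0 ?modulus_ge0 ?(ltW (rj _))// !mulr_ge0// ltW.
pose A j : set R := `]r ^+ j.+1, r ^+ j[%classic.
have cI := cint; set I := (\int[_]_(_ in _) _)%E in cI.
have rS j : r ^+ j.+1 < r ^+ j by rewrite exprS gtr_pMl.
have key n : \sum_(j < n) c (r ^+ j.+1) / Num.sqrt j.+1%:R * ((1 - r) / L) <= fine I.
  have I0 : (0 <= I)%E.
    apply: integral_ge0 => t; rewrite /= in_itv/= => /andP[t0 _].
    by rewrite lee_fin divr_ge0 ?modulus_ge0 ?mulr_ge0 ?sqrtr_ge0// ltW.
  rewrite -lee_fin fineK ?ge0_fin_numE//.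
  apply: (@le_trans _ _ (\int[lebesgue_measure]_(t in `]0%R, 1%R[) (\sum_(j < n) (a j * \1_(A j) t))%:E)%E); last first.
    apply: ge0_le_integral_nomeas => t; rewrite /= in_itv/= => /andP[t0 t1].
      by rewrite lee_fin sumr_ge0// => j _; rewrite mulr_ge0// indicE.
    rewrite lee_fin.
    have g0 : 0 <= c t / (t * Num.sqrt `|ln t|).
      by rewrite divr_ge0 ?modulus_ge0 ?mulr_ge0 ?sqrtr_ge0// ltW.
    have [[j jA]|nA] := pselect (exists j : 'I_n, A j t); last first.
      rewrite big1// => j _; rewrite indicE memNset ?mulr0// => h; apply: nA; by exists j.
    rewrite (bigD1 j)//= big1 ?addr0; last first.
      move=> i ij; rewrite indicE memNset ?mulr0//= => iA.
      move: jA iA; rewrite /A /= !in_itv/= => /andP[j1 j2] /andP[i1 i2].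
      have [ltij|ltji] : (i < j)%N \/ (j < i)%N by apply/orP; rewrite -neq_ltn.
        have : r ^+ j <= r ^+ i.+1 by rewrite ler_iXn2l// ltW.
        by rewrite leNgt (lt_trans i1 j2).
      have : r ^+ i <= r ^+ j.+1 by rewrite ler_iXn2l// ltW.
      by rewrite leNgt (lt_trans j1 i2).
    rewrite indicE mem_set// mulr1; move: jA; rewrite /A /= in_itv/= => /andP[j1 j2].
    (* On the j-th interval the logarithm is at most (j + 1) |ln r|. *)
    have lnt : `|ln t| <= j.+1%:R * `|ln r|.
      have lt0 : ln t <= 0 by rewrite ln_le0// ltW.
      have lr0 : ln r <= 0 by rewrite ln_le0// ltW.
      rewrite !ler0_norm// mulrN lerN2 -[leLHS]mulrC mulr_natr -lnXn//.
      by rewrite ler_ln ?posrE// ltW.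
    apply: ler_pM.
    - by rewrite modulus_ge0// ltW.
    - by rewrite invr_ge0 !mulr_ge0// ltW.
    - by apply: modulus_homo; exact: ltW.
    have lt00 : 0 < `|ln t| by rewrite normr_gt0 lt_eqF// ln_lt0// t0.
    rewrite lef_pV2 ?posrE ?mulr_gt0 ?sqrtr_gt0//.
    apply: ler_pM; rewrite ?(ltW t0) ?sqrtr_ge0 ?(ltW j2)//.
    by rewrite /L -sqrtrM// ler_wsqrtr.
  under eq_integral => t _ do rewrite -sumEFin.
  rewrite ge0_integral_sum//; last 2 first.
  - move=> j; apply/measurable_EFinP; apply: measurable_funM => //.
    by apply: measurable_indic; exact: measurable_itv.
  - by move=> j t _; rewrite lee_fin mulr_ge0// indicE.
  rewrite -sumEFin; apply: lee_sum => j _.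
  under eq_integral => t _ do rewrite EFinM.
  rewrite ge0_integralZl//; last 2 first.
  - apply/measurable_EFinP; apply: measurable_indic; exact: measurable_itv.
  - by rewrite lee_fin.
  rewrite integral_indic//; last exact: measurable_itv.
  have -> : A j `&` `]0%R, 1%R[%classic = A j.
    apply/setIidPl => t; rewrite /A /= !in_itv/= => /andP[j1 j2].
    by rewrite (lt_trans (rj _) j1) (lt_le_trans j2)// exprn_ile1// ltW.
  rewrite [X in (_ * X)%E](_ : _ = (r ^+ j - r ^+ j.+1)%:E); last first.
    rewrite /A; have := lebesgue_measure_itv `]r ^+ j.+1, r ^+ j[; rewrite /= lte_fin rS -EFinB; exact.
  rewrite -EFinM lee_fin /a le_eqVlt; apply/orP; left; apply/eqP.
  by rewrite exprS; field; rewrite !gt_eqF.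
pose B := (1 - r) / L; have B0 : 0 < B by rewrite divr_gt0// subr_gt0.
have C1 : 0 <= fine I / B by have := key 0%N; rewrite big_ord0 => h; rewrite divr_ge0// ltW.
exists (c 1 + fine I / B); case=> [|n].
  by rewrite big_ord0 addr_ge0// modulus_ge0.
rewrite big_ord_recl expr0 sqrtr1 divr1 lerD2l ler_pdivlMr// mulr_suml.
apply: le_trans (key n); apply: ler_sum => j _; rewrite ler_wpM2r ?(ltW B0)//.
rewrite ler_wpM2l ?modulus_ge0 ?(ltW (rj _))//.
by rewrite lef_pV2 ?posrE ?s0// ler_wsqrtr// ler_nat.
Qed.

Lemma step_increment m (i j : nat) : (0 < m)%N -> (i <= j)%N ->
  `|f (j%:R / m%:R) - f (i%:R / m%:R)| <= (j - i)%:R * c m%:R^-1.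
Proof.
move=> m0 /subnKC <-; rewrite addKn; elim: (j - i)%N => [|n IH].
  by rewrite addn0 subrr normr0 mul0r.
have := fc ((i + n.+1)%:R / m%:R) ((i + n)%:R / m%:R).
have -> : (i + n.+1)%:R / m%:R - (i + n)%:R / m%:R = m%:R^-1 :> R.
  by rewrite -mulrBl -natrB ?leq_add2l// subnDl subSnn mul1r.
rewrite [X in c X]ger0_norm ?invr_ge0// => h.
rewrite (_ : _ - f (i%:R / m%:R) = (f ((i + n.+1)%:R / m%:R) - f ((i + n)%:R / m%:R)) + (f ((i + n)%:R / m%:R) - f (i%:R / m%:R))); last by ring.
by apply: le_trans (ler_normD _ _) _; rewrite -nat1r mulrDl mul1r lerD.
Qed.

(** At scale r^k the modulus of continuity bounds both the error of a step
approximation and, up to the factor r^-k, its variation. The number of steps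
is the integer part of r^-k plus one. *)
Lemma step_approximation k : exists g P, [/\ dominated g P,
  P 1 - P 0 <= 2 / r ^+ k * c (r ^+ k) &
  forall x, 0 <= x -> x <= 1 -> `|f x - g x| <= c (r ^+ k)].
Proof.
have rk : 0 < r ^+ k by rewrite exprn_gt0.
pose m := (Num.truncn (r ^+ k)^-1).+1.
have ik : 0 <= (r ^+ k)^-1 by rewrite invr_ge0 ltW.
have /andP[m1 m2] := truncn_itv ik; rewrite -/m in m2.
have m0 : 0 < m%:R :> R by rewrite ltr0n.
have mr : m%:R^-1 <= r ^+ k by rewrite -[leRHS]invrK lef_pV2 ?posrE ?invr_gt0// ltW.
have cmr : c m%:R^-1 <= c (r ^+ k) by apply: modulus_homo; rewrite ?invr_ge0.
have cm0 : 0 <= c m%:R^-1 by rewrite modulus_ge0// invr_ge0.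
pose n (x : R) := Num.truncn (m%:R * x).
exists (fun x => f ((n x)%:R / m%:R)), (fun x => (n x)%:R * c m%:R^-1); split.
- move=> x y x0 xy y1; have nxy : (n x <= n y)%N by apply: le_truncn; rewrite ler_wpM2l.
  by apply: le_trans (step_increment _ nxy) _ => //; rewrite natrB// mulrBl.
- have n1 : n 1 = m by rewrite /n mulr1 natrK.
  rewrite /n mulr0 truncn0 mul0r subr0 -/(n 1) n1; apply: ler_pM => //.
  have -> : m%:R = (Num.truncn (r ^+ k)^-1)%:R + 1 :> R by rewrite /m natr1.
  apply: (@le_trans _ _ ((r ^+ k)^-1 + (r ^+ k)^-1)).
    by apply: lerD => //; rewrite -[leLHS]invr1 lef_pV2 ?posrE// exprn_ile1// ltW.
  by rewrite -mulr2n -[leLHS]mulr_natl.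
move=> x x0 x1; apply: le_trans (fc _ _) _; apply: le_trans cmr; apply: modulus_homo => //.
have mx : 0 <= m%:R * x by rewrite mulr_ge0// ltW.
have /andP[n1 n2] := truncn_itv mx; rewrite -/(n x) in n1 n2.
have n3 : (n x)%:R / m%:R <= x by rewrite ler_pdivrMr// mulrC.
rewrite ger0_norm ?subr_ge0// lerBlDr.
rewrite (_ : m%:R^-1 + (n x)%:R / m%:R = (n x).+1%:R / m%:R); last by rewrite -nat1r mulrDl mul1r.
by rewrite ler_pdivlMr// mulrC ltW.
Qed.

End ClassL.

Section DynamicalInput.
Variables (R : realType) (mu : probability (I01 R) R) (T : I01 R -> I01 R).
Notation Ex h := (\int[mu]_x (h x : R)).
Hypothesis pres : preserves mu T.
Hypothesis contr : BV_contracting mu T.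

(** What the two regularity classes have in common: at scale r^i, f is close to a
function whose variation is at most 2 r^-i times the error, and the errors
satisfy the summability condition of the subgaussian bound. *)
Definition scale_approximable (f : R -> R) (r : R) (c : nat -> R) : Prop :=
  [/\ forall x y, 0 <= x -> x <= 1 -> 0 <= y -> y <= 1 -> `|f y - f x| <= c 0%N,
      forall i, exists g P, [/\ dominated g P, P 1 - P 0 <= 2 / r ^+ i * c i &
        forall x, 0 <= x -> x <= 1 -> `|f x - g x| <= c i],
      forall i, c i.+1 <= c i, forall i, 0 <= c i &
      exists C, forall n, \sum_(j < n) c j / Num.sqrt j.+1%:R <= C].

Lemma scale_approximable_BV f r : 0 < r -> r < 1 -> bounded_variation 0 1 f ->
  exists c, scale_approximable f r c.
Proof.
move=> r0 r1 /BV_dominated[P [fP _]]; pose V := P 1 - P 0.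
have V0 : 0 <= V by rewrite subr_ge0; exact: (dominated_homo fP).
have rj i : 0 < r ^+ i by rewrite exprn_gt0.
exists (fun i => V * r ^+ i); split.
- by move=> x y *; rewrite expr0 mulr1; exact: (dominated_osc fP).
- move=> i; exists f, P; split => //.
    have -> : 2 / r ^+ i * (V * r ^+ i) = 2 * V by field; rewrite gt_eqF.
    by rewrite -/V mulr_natl mulr2n lerDl.
  by move=> x _ _; rewrite subrr normr0 mulr_ge0// ltW.
- by move=> i; rewrite ler_wpM2l// exprS ger_pMl// ltW.
- by move=> i; rewrite mulr_ge0// ltW.
exists (V * (1 - r)^-1) => n.
apply: (@le_trans _ _ (\sum_(j < n) V * r ^+ j)); last first.
  by rewrite -mulr_sumr ler_wpM2l// geometric_sum_le// ltW.
apply: ler_sum => j _; rewrite ler_pdivrMr ?sqrtr_gt0// ler_peMr ?mulr_ge0 ?(ltW (rj _))//.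
by rewrite -[leLHS]sqrtr1 ler_wsqrtr// ler1n.
Qed.

Lemma scale_approximable_L f r : 0 < r -> r < 1 -> class_L f ->
  exists c, scale_approximable f r c.
Proof.
move=> r0 r1 [c [_ cmono cint fc]].
have rj i : 0 < r ^+ i by rewrite exprn_gt0.
exists (fun i => c (r ^+ i)); split.
- move=> x y x0 x1 y0 y1; apply: le_trans (fc _ _) _; apply: (modulus_homo cmono) => //.
  by rewrite expr0 ler_norml; apply/andP; split; lra.
- by move=> i; exact: (step_approximation cmono fc r0 r1 i).
- by move=> i; apply: (modulus_homo cmono); rewrite ?(ltW (rj _))// exprS ger_pMl// ltW.
- by move=> i; apply: (modulus_ge0 cmono fc); rewrite ltW.
exact: (modulus_sum cmono cint fc r0 r1).
Qed.

(** All that the deviation principle needs from the dynamics. The n-th image of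
phi has size at most a constant times c n: at scale r^n, with r no less than
the contraction rate, the variation of the approximation of f is compensated
by the contraction. *)
Theorem dynamical_input f : bounded_variation 0 1 f \/ class_L f ->
  let phi x := on01 f x - mean mu f in
  bmeas phi /\ exists s2 C : R, [/\ 0 <= s2, 0 < C, approximable mu T phi s2,
    var_partial mu T f N @[N --> \oo] --> s2 &
    forall n l, Ex (fun x => expR (l * birkhoff T phi n x)) <= expR (1 + C * l ^+ 2 * n%:R)].
Proof.
move=> fBL phi; have [mT pT] := pres.
have [K PF [kappa [rho [kappa0 rho01 con]]]] := contr.
have /andP[rho0 rho1] := rho01.
(* The scale must be positive, also when the contraction rate is 0. *)
pose r : R := Num.max rho 2^-1.
have r0 : 0 < r by rewrite lt_max invr_gt0 ltr0n orbT.
have r1 : r < 1 by rewrite gt_max rho1 invf_lt1// ltr1n.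
have rr : rho <= r by rewrite le_max lexx.
have [c [osc appr cm c0 [C sumC]]] : exists c, scale_approximable f r c.
  by case: fBL; [exact: scale_approximable_BV|exact: scale_approximable_L].
have bf : bmeas (on01 f : I01 R -> R).
  have /choice[g gP] : forall n : nat, exists g : R -> R, (exists P, dominated g P) /\
      forall x, 0 <= x -> x <= 1 -> `|f x - g x| <= n.+1%:R^-1.
    move=> n; have e0 : 0 < n.+1%:R^-1 :> R by rewrite invr_gt0.
    have [k ck] := weighted_sum_small sumC e0.
    have [g [P [gP _ fg]]] := appr k; exists g; split; first by exists P.
    by move=> x x0 x1; exact: le_trans (fg x x0 x1) ck.
  apply: (@bmeas_bound _ _ _ _ (`|f 0| + c 0%N)) => [|x].
    apply: (@measurable_fun_cvg _ _ _ setT (fun n => on01 (g n))).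
      by move=> n; have [[P gnP] _] := gP n; exact: (bmeas_dominated gnP).1.
    move=> x _; have [x0 x1] := val01_itv x.
    apply/cvgrPdist_le => eps eps0.
    have [N _ HN] := near_infty_natSinv_lt (PosNum eps0).
    exists N => // n Nn; have [_ h] := gP n.
    by apply: le_trans (h _ x0 x1) _; exact: ltW (HN n Nn).
  have [x0 x1] := val01_itv x; have h := osc 0 (val01 x) (lexx 0) ler01 x0 x1.
  by rewrite -[on01 f x](subrK (f 0)) addrC; apply: le_trans (ler_normD _ _) _; rewrite lerD2l.
have bphi : bmeas phi := bmeasB bf (bmeas_cst _ (mean mu f)).
split => //.
(* 2 c i from the error and kappa r^i (2 / r^i) c i from the variation. *)
pose A := 2 + 2 * kappa; have A1 : 1 <= A by rewrite /A; lra.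
have A0 : 0 <= A by lra.
pose del i := A * c i.
have /choice[u0 u0P] : forall i : nat, exists k : I01 R -> R, PFn mu T i phi k /\ forall x, `|k x| <= del i.
  move=> i; have [g [P [gP PV fg]]] := appr i.
  have feta (x : I01 R) : `|on01 f x - on01 g x| <= c i by have [x0 x1] := val01_itv x; exact: fg.
  have [k kK kle] := centered_image mT pT PF kappa0 rho01 con i bf gP feta.
  exists k; split => // x; apply: le_trans (kle x) _.
  rewrite /del /A [leRHS]mulrDl lerD2l.
  have ri : 0 < r ^+ i by rewrite exprn_gt0.
  have h1 : kappa * rho ^+ i <= kappa * r ^+ i by rewrite ler_wpM2l ?(ltW kappa0)//; apply: lerXn2r; rewrite ?nnegrE// ltW.
  apply: (@le_trans _ _ (kappa * r ^+ i * (2 / r ^+ i * c i))).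
    apply: ler_pM => //; first by rewrite mulr_ge0 ?exprn_ge0// ltW.
    by rewrite subr_ge0; exact: (dominated_homo gP).
  by rewrite le_eqVlt; apply/orP; left; apply/eqP; field; rewrite gt_eqF.
pose u i := if i is 0%N then phi else u0 i.
have uK i : PFn mu T i phi (u i) by case: i => [|i]; [exact: PFn0|have [] := u0P i.+1].
have ule i x : `|u i x| <= del i.
  case: i => [|i]; last by have [_] := u0P i.+1; exact.
  apply: (@le_trans _ _ (c 0%N)); last by rewrite ler_peMl.
  have [x0 x1] := val01_itv x.
  have -> : u 0%N x = Ex (fun y => on01 f x - on01 f y).
    by rewrite (ExB mu (bmeas_cst _ (on01 f x)) bf) Ex_cst.
  apply: Ex_norm_le => [|y]; first exact: bmeasB (bmeas_cst _ _) bf.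
  by have [y0 y1] := val01_itv y; exact: osc.
have del0 i : 0 <= del i by rewrite mulr_ge0.
have delm i : del i.+1 <= del i by rewrite ler_wpM2l.
have delC n : \sum_(j < n) del j / Num.sqrt j.+1%:R <= A * C.
  under eq_bigr do rewrite -mulrA; rewrite -mulr_sumr ler_wpM2l//.
have [e [D [e0 dyad eD]]] := condensation del0 delm delC.
have dec : decaying mu T u del e D by split.
have Bphi : BV_limit mu phi.
  have lim : BV_limit mu (on01 f : I01 R -> R).
    split => // eta eta0; have [k ck] := weighted_sum_small sumC eta0.
    have [g [P [gP _ fg]]] := appr k; exists g, P; split => //.
    apply: aeW => x; have [x0 x1] := val01_itv x.
    exact: le_trans (fg _ x0 x1) ck.
  apply: (BV_limitD lim); exact: (BV_limit_dominated mu (@dominated_cst R (- mean mu f))).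
have Bu i : BV_limit mu (u i) by exact: (BV_limit_image mT pT PF kappa0 rho01 con Bphi (uK i)).
have mix M : exists2 w2, PFn mu T 1 (fun x => partial_g u M x ^+ 2) w2 &
    uniformly_mixing mu T (fun x => w2 x - partial_kg u M x ^+ 2).
  have Bg : BV_limit mu (partial_g u M) by exact: BV_limit_sum.
  have Bkg : BV_limit mu (partial_kg u M) by exact: (BV_limit_sum M (fun i => Bu i.+1)).
  have Bg2 : BV_limit mu (fun x => partial_g u M x ^+ 2) by have := BV_limitM Bg Bg.
  have Bkg2 : BV_limit mu (fun x => - 1 * partial_kg u M x ^+ 2).
    have := BV_limitM (BV_limit_dominated mu (@dominated_cst R (- 1))) (BV_limitM Bkg Bkg); exact.
  have [bg2 _] := Bg2; have [_ [b hb]] := bg2.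
  have [w2 [w2K _ _]] := PFn_exists mT pT PF 1 (normr_ge0 b) bg2 (fun x => le_trans (hb x) (ler_norm _)).
  exists w2 => //.
  have := BV_limit_mixing mT pT PF kappa0 rho01 con (BV_limitD (BV_limit_image mT pT PF kappa0 rho01 con Bg2 w2K) Bkg2).
  by under eq_fun do rewrite mulN1r.
have [s2 [s20 app cv]] := partial_var_cvg mT pT dec mix.
exists s2, (8 * (del 0%N + 1 + D) ^+ 2 + 1); split => //.
- by rewrite ltr_wpDl// mulr_ge0// sqr_ge0.
- have -> : var_partial mu T f = partial_cov mu u.
    apply/funext => N; rewrite /var_partial /partial_cov; congr (_ + 2 * _).
    apply: eq_bigr => k _; have [_ buk E] := uK k.
    have -> : Ex (fun x => u 0%N x * u k x) = Ex (fun x => u k x * on01 f x) - Ex (fun x => u k x) * mean mu f.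
      rewrite mulrC -(ExZ mu (mean mu f) buk) -(ExB mu (bmeasM buk bf) (bmeasZ _ buk)).
      by apply: eq_Ex => x; rewrite /= /phi; ring.
    rewrite (PFn_mean (uK k)) (ExB mu bf (bmeas_cst _ _)) Ex_cst /mean subrr mul0r subr0 E//.
    by apply: eq_Ex => x; rewrite mulrC.
  exact: (partial_cov_cvg dec cv).
move=> n l; apply: le_trans (decaying_subgaussian mT pT n l dec) _.
rewrite ler_expR lerD2l.
have -> : 8 * l ^+ 2 * n%:R * (del 0%N + 1 + D) ^+ 2 = 8 * (del 0%N + 1 + D) ^+ 2 * (l ^+ 2 * n%:R) by ring.
rewrite -[leRHS]mulrA; apply: ler_wpM2r; last by rewrite lerDl.
by rewrite mulr_ge0// sqr_ge0.
Qed.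

End DynamicalInput.

(** * Polygons and Hoelder paths *)

Section Polygon.
Variable R : realType.
Implicit Types (h g z : nat -> R).

Lemma energy_le_id : energy_le 1 (@id R).
Proof.
apply: energy_le_of_integral => //.
  move=> e e0; exists e => // n ab ab01 _; apply: le_lt_trans; apply: ler_sum => i _.
  have [/andP[_ h] _] := ab01 i; by rewrite ger0_norm// subr_ge0.
under eq_integral => u _ do rewrite derive1_id expr1n.
by rewrite integral_cst//= mul1e lebesgue_measure_itv/= lte_fin ltr01 -EFinB subr0.
Qed.

Lemma sum_disjoint_le1 (I : finType) (a b : I -> R) :
  (forall i, 0 <= a i /\ a i <= b i /\ b i <= 1) ->
  trivIset setT (fun i => `]a i, b i[%classic) -> \sum_i (b i - a i) <= 1.
Proof.
move=> ab tab; have := energy_le_id (fun=> 1) ab tab.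
have -> : \sum_i 1 * (b i - a i) = \sum_i (b i - a i) by apply: eq_bigr => i _; rewrite mul1r.
have -> : \sum_i 1 ^+ 2 * (b i - a i) = \sum_i (b i - a i) by apply: eq_bigr => i _; rewrite expr1n mul1r.
rewrite mul1r => h; rewrite leNgt; apply/negP => s1.
have s0 := lt_trans ltr01 s1.
by move: h; rewrite expr2 leNgt => /negP; apply; rewrite ltr_pMr.
Qed.

Variable m : nat.
Hypothesis m0 : (0 < m)%N.
Let mR0 : 0 < m%:R :> R. Proof. by rewrite ltr0n. Qed.

(** The polygon through the points (i / m, z i - z 0). *)
Definition polygon z (t : R) : R :=
  \sum_(i < m) (z i.+1 - z i) * clamp (m%:R * t - i%:R).

Let ramp_le (k : nat) (x : R) : x <= k%:R -> clamp (x - k%:R) = 0.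
Proof. by move=> h; case: (clampP (x - k%:R)) => -[? ->]; lra. Qed.

Let ramp_ge (k : nat) (x : R) : k.+1%:R <= x -> clamp (x - k%:R) = 1.
Proof.
by rewrite -natr1 => h; case: (clampP (x - k%:R)) => -[? ->]; lra.
Qed.

Lemma sum_ramp n (x : R) : 0 <= x -> x <= n%:R -> \sum_(i < n) clamp (x - i%:R) = x.
Proof.
elim: n => [|n IH] x0 xn.
  by rewrite big_ord0; apply/eqP; rewrite eq_le x0.
rewrite big_ord_recr/=; have [h|/ltW h] := leP x n%:R.
  by rewrite IH// ramp_le// addr0.
have -> : \sum_(i < n) clamp (x - i%:R) = n%:R.
  rewrite (eq_bigr (fun=> 1)); last first.
    by move=> i _; rewrite ramp_ge//; apply: le_trans h; rewrite ler_nat.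
  by rewrite sumr_const card_ord.
by rewrite clamp_id; [ring|move: xn h; rewrite -natr1 => *; apply/andP; split; lra].
Qed.

Lemma polygon0 z : polygon z 0 = 0.
Proof. by rewrite /polygon big1// => i _; rewrite mulr0 ramp_le// mulr0. Qed.

(** The increment of the polygon over the j-th interval is the sum of the z i.+1
- z i with weights w i j; these sum to at most 1 over j because the intervals
are disjoint, and to m times the length of the interval over i. *)
Lemma polygon_energy z (beta : R) : m%:R * \sum_(i < m) (z i.+1 - z i) ^+ 2 <= beta ->
  energy_le beta (polygon z).
Proof.
move=> zb I a b c ab tab.
have beta0 : 0 <= beta by apply: le_trans zb; rewrite mulr_ge0 ?sumr_ge0// => i _; rewrite sqr_ge0.
pose w (i : 'I_m) j := clamp (m%:R * b j - i%:R) - clamp (m%:R * a j - i%:R).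
have w0 i j : 0 <= w i j.
  by rewrite subr_ge0 clamp_mono// lerD2r ler_wpM2l ?(ltW mR0)//; have [_ []] := ab j.
have wi j : \sum_i w i j = m%:R * (b j - a j).
  have [a0 [abj b1]] := ab j; rewrite sumrB !sum_ramp ?mulrBr//.
  - by rewrite mulr_ge0// ltW.
  - by rewrite ler_piMr ?(ltW mR0)//; exact: le_trans b1.
  - by rewrite mulr_ge0 ?(ltW mR0)//; exact: le_trans abj.
  - by rewrite ler_piMr ?(ltW mR0).
have wj i : \sum_j w i j <= 1.
  apply: sum_disjoint_le1.
    move=> j; split; first exact: clamp_ge0.
    split; last exact: clamp_le1.
    by rewrite clamp_mono// lerD2r ler_wpM2l ?(ltW mR0)//; have [_ []] := ab j.
  apply/trivIsetP => j k _ _ jk; apply/seteqP; split => // x [/clamp_itv xj /clamp_itv xk].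
  have /trivIsetP/(_ j k Logic.I Logic.I jk)/seteqP[+ _] := tab.
  move=> /(_ ((x + i%:R) / m%:R)); apply; split => /=; rewrite in_itv/=.
    move: xj; rewrite /= in_itv/= => /andP[h1 h2].
    by rewrite ltr_pdivlMr// ltr_pdivrMr// mulrC -ltrBlDr h1 mulrC -ltrBrDr h2.
  move: xk; rewrite /= in_itv/= => /andP[h1 h2].
  by rewrite ltr_pdivlMr// ltr_pdivrMr// mulrC -ltrBlDr h1 mulrC -ltrBrDr h2.
pose D (i : 'I_m) := z i.+1 - z i.
have E : \sum_j c j * (polygon z (b j) - polygon z (a j)) = \sum_j \sum_i w i j * (c j * D i).
  apply: eq_bigr => j _; rewrite /polygon -sumrB mulr_sumr; apply: eq_bigr => i _.
  by rewrite /w /D; ring.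
rewrite E; apply: young_opt => //.
  by apply: sumr_ge0 => j _; rewrite mulr_ge0 ?sqr_ge0// subr_ge0; have [_ []] := ab j.
move=> l l0.
have l20 : 0 < 2 * l by rewrite mulr_gt0.
have term j i : `|w i j * (c j * D i)| <= w i j * (l / (2 * m%:R) * c j ^+ 2 + m%:R / (2 * l) * D i ^+ 2).
  rewrite normrM (ger0_norm (w0 i j)) ler_wpM2l// normrM.
  have := sqr_ge0 (l * `|c j| - m%:R * `|D i|).
  rewrite -(real_normK (num_real (c j))) -(real_normK (num_real (D i))).
  move: (`|c j|) (`|D i|) => x y h.
  rewrite -subr_ge0 (_ : _ - _ = (l * x - m%:R * y) ^+ 2 / (2 * l * m%:R)).
    by rewrite divr_ge0// mulr_ge0// ?(ltW mR0)// ltW.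
  by field; rewrite !gt_eqF.
apply: le_trans (ler_norm_sum _ _ _) _.
apply: (@le_trans _ _ (\sum_j \sum_i w i j * (l / (2 * m%:R) * c j ^+ 2 + m%:R / (2 * l) * D i ^+ 2))).
  by apply: ler_sum => j _; apply: le_trans (ler_norm_sum _ _ _) _; apply: ler_sum => i _; exact: term.
under eq_bigr => j _ do (under eq_bigr => i _ do rewrite mulrDr; rewrite big_split).
rewrite big_split/=; apply: lerD.
  rewrite le_eqVlt; apply/orP; left; apply/eqP; rewrite mulr_sumr; apply: eq_bigr => j _.
  by rewrite -mulr_suml wi; field; rewrite gt_eqF.
rewrite exchange_big/=.
apply: (@le_trans _ _ (\sum_(i < m) m%:R / (2 * l) * D i ^+ 2)).
  apply: ler_sum => i _; rewrite -mulr_suml; apply: ler_piMl; last exact: wj.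
  by apply: mulr_ge0; [apply: divr_ge0; apply: ltW|exact: sqr_ge0].
rewrite -mulr_sumr (_ : m%:R / (2 * l) * _ = (2 * l)^-1 * (m%:R * \sum_(i < m) D i ^+ 2)); last by ring.
by rewrite ler_wpM2l ?invr_ge0 ?(ltW l20).
Qed.

Lemma grid_cell (t : R) : 0 <= t -> t <= 1 -> exists i : nat, [/\ (i < m)%N,
  i%:R / m%:R <= t & t <= i.+1%:R / m%:R].
Proof.
move=> t0 t1; have mt : 0 <= m%:R * t by rewrite mulr_ge0// ltW.
have /andP[h1 h2] := truncn_itv mt.
have [h|h] := ltnP (Num.truncn (m%:R * t)) m.
  exists (Num.truncn (m%:R * t)); split => //.
    by rewrite ler_pdivrMr// [t * _]mulrC.
  by rewrite ler_pdivlMr// [t * _]mulrC ltW.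
have E : t = 1.
  apply/eqP; rewrite eq_le t1 -(ler_pM2l mR0) mulr1; apply: le_trans h1.
  by rewrite ler_nat.
exists m.-1; rewrite prednK//; split => //.
  by rewrite E ler_pdivrMr// mul1r ler_nat leq_pred.
by rewrite E divff// gt_eqF.
Qed.

Lemma polygon_grid z (k : nat) : (k <= m)%N -> polygon z (k%:R / m%:R) = z k - z 0%N.
Proof.
move=> km; have E : m%:R * (k%:R / m%:R) = k%:R :> R by rewrite mulrC divfK// gt_eqF.
rewrite /polygon E -(big_mkord xpredT (fun i => (z i.+1 - z i) * clamp (k%:R - i%:R))).
rewrite (big_cat_nat (n := k))//=.
have -> : \sum_(k <= i < m) (z i.+1 - z i) * clamp (k%:R - i%:R) = 0.
  rewrite big_nat_cond big1// => i /andP[/andP[ki _] _].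
  by rewrite ramp_le ?mulr0// ler_nat.
rewrite addr0 -(telescope_sumr z (leq0n k)); apply: eq_big_nat => i /andP[_ ik].
by rewrite ramp_ge ?mulr1// ler_nat.
Qed.

Lemma polygon_cell z (i : nat) (t : R) : (i < m)%N -> i%:R / m%:R <= t -> t <= i.+1%:R / m%:R ->
  `|polygon z t - (z i - z 0%N)| <= `|z i.+1 - z i|.
Proof.
move=> im it ti; rewrite -(polygon_grid z (ltnW im)) /polygon -sumrB.
have h1 : i%:R <= m%:R * t by rewrite mulrC -ler_pdivrMr.
have h2 : m%:R * t <= i.+1%:R by rewrite mulrC -ler_pdivlMr.
have E0 : m%:R * (i%:R / m%:R) = i%:R :> R by rewrite mulrC divfK// gt_eqF.
rewrite (bigD1 (Ordinal im))//= big1 ?addr0.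
  rewrite E0 subrr -mulrBr normrM; apply: ler_piMr => //.
  rewrite (_ : clamp 0 = 0) ?subr0; last by have := @ramp_le 0 0 (lexx _); rewrite subr0.
  by rewrite ger0_norm ?clamp_ge0// clamp_le1.
move=> k ki; rewrite E0; have [lt|gt] : (k < i)%N \/ (i < k)%N by apply/orP; rewrite -neq_ltn.
  by rewrite !ramp_ge ?subrr// ?ler_nat//; apply: le_trans h1; rewrite ler_nat.
rewrite !ramp_le ?subrr ?ler_nat// 1?ltnW//; apply: le_trans h2 _; by rewrite ler_nat.
Qed.

End Polygon.

Section Paths.
Variable R : realType.
Implicit Types (g : R -> R) (x y : skorohod R).

Definition restrict01 g (t : R) : R := if t \in `[0, 1] then g t else 0.

Definition holder_half (beta : R) g : Prop := forall s t, 0 <= s -> s <= t -> t <= 1 ->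
  (g t - g s) ^+ 2 <= beta * (t - s).

Lemma energy_holder beta g : energy_le beta g -> holder_half beta g.
Proof.
move=> eg s t s0 st t1.
have := eg unit (fun=> s) (fun=> t) (fun=> 1).
rewrite !(big_pred1 tt) => [|[]//|[]//]; rewrite expr1n !mul1r; apply => //.
by apply/trivIsetP => -[] [].
Qed.

Lemma holder_abs beta g s t : holder_half beta g -> 0 <= s <= 1 -> 0 <= t <= 1 ->
  (g t - g s) ^+ 2 <= beta * `|t - s|.
Proof.
move=> hg; wlog st : s t / s <= t => [H|] /andP[s0 s1] /andP[t0 t1].
  have [st|/ltW ts] := leP s t; first by apply: H => //; apply/andP.
  by rewrite -opprB sqrrN distrC; apply: H => //; apply/andP.
by rewrite ger0_norm ?subr_ge0//; exact: hg.
Qed.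

(** A modulus of continuity common to a whole energy level; adding 1 to beta only
serves to divide by it. *)
Lemma holder_modulus beta g (eps : R) : 0 <= beta -> holder_half beta g -> 0 < eps ->
  forall s t, 0 <= s <= 1 -> 0 <= t <= 1 -> `|t - s| <= eps ^+ 2 / (beta + 1) ->
  `|g t - g s| <= eps.
Proof.
move=> b0 hg e0 s t s01 t01 ts; have b1 : 0 < beta + 1 by rewrite ltr_wpDl.
rewrite -(@ler_pXn2r _ 2)// ?nnegrE ?(ltW e0)// real_normK ?num_real//.
apply: le_trans (holder_abs hg s01 t01) _.
apply: (@le_trans _ _ ((beta + 1) * (eps ^+ 2 / (beta + 1)))).
  by apply: ler_pM => //; rewrite lerDl.
by rewrite mulrC divfK// gt_eqF.
Qed.

Lemma restrict01_cadlag beta g : 0 <= beta -> holder_half beta g -> cadlag01 (restrict01 g).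
Proof.
move=> b0 hg; have b1 : 0 < beta + 1 by rewrite ltr_wpDl.
have key (t eps : R) : 0 <= t <= 1 -> 0 < eps -> forall s, 0 <= s <= 1 ->
    `|t - s| <= eps ^+ 2 / (beta + 1) -> `|restrict01 g t - restrict01 g s| <= eps.
  move=> t01 e0 s s01 ts; rewrite /restrict01 !in_itv/= t01 s01.
  by apply: holder_modulus hg e0 _ _ _ _ ts.
have d0 eps : 0 < eps -> 0 < eps ^+ 2 / (beta + 1) by move=> e0; rewrite divr_gt0// exprn_gt0.
split=> t /andP[t0 t1].
  apply/cvgrPdist_le => eps eps0; near=> s.
  have ts : t < s by near: s; exact: nbhs_right_gt.
  have s1 : s < 1 by near: s; exact: nbhs_right_lt.
  apply: key => //; first by rewrite t0 ltW.
    by rewrite (le_trans t0 (ltW ts)) ltW.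
  rewrite distrC ger0_norm ?subr_ge0 ?(ltW ts)// lerBlDl.
  by near: s; apply: nbhs_right_le; rewrite ltrDl d0.
apply: (cvgP (restrict01 g t)); apply/cvgrPdist_le => eps eps0; near=> s.
have st : s < t by near: s; exact: nbhs_left_lt.
have s0 : 0 < s by near: s; exact: nbhs_left_gt.
apply: key => //; first by rewrite t1 ltW.
  by rewrite (ltW s0) (le_trans (ltW st)).
rewrite ger0_norm ?subr_ge0 ?(ltW st)// lerBlDr addrC -lerBlDr.
by near: s; apply: nbhs_left_ge; rewrite ltrBlDr ltrDl d0.
Unshelve. all: by end_near. Qed.

Lemma restrict01_out g t : t \notin `[0, 1] -> restrict01 g t = 0.
Proof. by rewrite /restrict01 => /negbTE ->. Qed.

Definition holder_path beta g (b0 : 0 <= beta) (hg : holder_half beta g) : skorohod R :=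
  Skorohod (restrict01_cadlag b0 hg) (@restrict01_out g).

Lemma skorohod_eq x y : (forall t, x t = y t) -> x = y.
Proof.
case: x => x cx ox; case: y => y cy oy /= xy; have E : x = y by apply/funext.
by subst y; congr Skorohod; exact: Prop_irrelevance.
Qed.

Lemma uniform_ball x y (d e : R) : d < e -> (forall t, 0 <= t <= 1 -> `|x t - y t| <= d) ->
  ball x e y.
Proof.
move=> de xy; exists id, d; split => //.
  by split => //; rewrite image_id.
move=> t; rewrite in_itv/= => t01; have h := xy t t01; split => //.
by rewrite subrr normr0; exact: le_trans h.
Qed.

Lemma energy_le_restrict01 beta g : energy_le beta g -> energy_le beta (restrict01 g).
Proof.
move=> eg I a b c ab tab; have := eg I a b c ab tab.
rewrite (eq_bigr (fun i => c i * (restrict01 g (b i) - restrict01 g (a i))))// => i _.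
have [a0 [abi b1]] := ab i.
by rewrite /restrict01 !in_itv/= a0 b1 (le_trans a0 abi) (le_trans abi b1).
Qed.

Lemma compact_closed_separation (K F : set (skorohod R)) : compact K -> closed F ->
  (forall x, K x -> ~ F x) ->
  exists2 e : R, 0 < e & forall x y, K x -> ball x e y -> ~ F y.
Proof.
move=> cK cF KF.
have := (compact_near_coveringP K).1 cK R (0 : R)^'+ (fun e x => forall y, ball x e y -> ~ F y) _.
case.
  move=> x Kx; have /nbhs_ballP[e /= e0 eF] : nbhs x (~` F).
    by apply: open_nbhs_nbhs; split; [exact: closed_openC|exact: KF].
  exists (ball x (e / 2), [set d | d < e / 2]); first split => /=.
  - by apply: nbhsx_ballx; rewrite divr_gt0.
  - by apply: nbhs_right_lt; rewrite divr_gt0.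
  move=> [x' d] /= [xx' de] y x'y; apply: eF; rewrite (splitr e).
  by apply: ball_triangle xx' _; exact: le_ball (ltW de) _ x'y.
move=> d /= d0 H; exists (d / 2); first by rewrite divr_gt0.
move=> x y Kx xy; apply: (H (d / 2) _ _ x Kx y xy) => /=.
  by rewrite sub0r normrN gtr0_norm ?divr_gt0// ltr_pdivrMr// ltr_pMr// ltr1n.
by rewrite divr_gt0.
Qed.

End Paths.

(** * Compactness of the level sets *)

Section LevelSets.
Variable R : realType.
Implicit Types (x y : skorohod R).

(** Along an ultrafilter paths converge pointwise, and the common modulus of
continuity makes the convergence uniform. *)
Lemma compact_energy (beta : R) : 0 <= beta ->
  compact [set x : skorohod R | x 0 = 0 /\ energy_le beta x].
Proof.
move=> b0; rewrite compact_ultra => F UF FK.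
have b1 : 0 < beta + 1 by rewrite ltr_wpDl.
pose ev (t : R) (x : skorohod R) : R := x t.
have lim (t : R) : exists l : R, 0 <= t <= 1 -> ev t @ F --> l.
  have [t01|] := boolP (0 <= t <= 1); last by exists 0.
  have PFt : ProperFilter (ev t @ F) by exact: fmap_proper_filter.
  pose M := beta + 1.
  have [|l [_ cl]] := @segment_compact R (- M) M (ev t @ F) PFt.
    near_simpl; rewrite /fmap /=; apply: filterS FK => x [x0 ex] /=.
    have /andP[t0 t1] := t01.
    have h := energy_holder ex (lexx 0) t0 t1; rewrite x0 !subr0 in h.
    have h2 : x t ^+ 2 <= M ^+ 2.
      apply: le_trans h _; apply: (@le_trans _ _ (beta * 1)); first by rewrite ler_wpM2l.
      rewrite mulr1 expr2; apply: (@le_trans _ _ M); first by rewrite /M lerDl.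
      by rewrite ler_peMr ?(ltW b1)// /M lerDr.
    by rewrite in_itv/= -ler_norml -(@ler_pXn2r _ 2) ?nnegrE ?(ltW b1)// real_normK ?num_real.
  exists l => _; apply/cvgrPdist_lt => e e0.
  have [//|FC] := in_ultra_setVsetC [set x : skorohod R | `|l - ev t x| < e] UF.
  have [||r [/= [x nx <-] lx]] := cl (ev t @` ~` [set x : skorohod R | `|l - ev t x| < e]) (ball l e).
  - by near_simpl; rewrite /fmap /=; apply: filterS FC => x nx; exists x.
  - exact: nbhsx_ballx.
  by exfalso; apply: nx.
have [h0 hlim] := choice lim; pose h := h0.
have near_h (t : R) (e : R) : 0 <= t <= 1 -> 0 < e -> F [set x | `|h t - x t| <= e].
  by move=> t01 e0; have /cvgrPdist_le := hlim t t01; exact.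
have PF : ProperFilter F by exact: ultra_proper.
(* The dual energy bound only involves finitely many values, so it passes to
   the pointwise limit. *)
have eh : energy_le beta h.
  move=> I a b c ab tab.
  apply/ler_addgt0Pr => e e0.
  pose S (g : R -> R) := \sum_i c i * (g (b i) - g (a i)).
  have cvS : (fun x : skorohod R => S (x : R -> R)) @ F --> S h.
    apply: (@cvg_big _ _ (+%R : R -> R -> R)) => [|i _]; first exact: add_continuous.
    apply: cvgM; first exact: cvg_cst.
    have [a0 [abi b1i]] := ab i.
    apply: cvgB; apply: hlim; first by rewrite (le_trans a0 abi).
    by rewrite a0 (le_trans abi b1i).
  have cvS2 : (fun x : skorohod R => S (x : R -> R) ^+ 2) @ F --> S h ^+ 2.
    by rewrite expr2; apply: cvgM.
  have /cvgrPdist_le/(_ e e0) h1 := cvS2.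
  have [x [h2 [x0 ex]]] := filter_ex (filterI h1 FK).
  have := ex I a b c ab tab; rewrite -/(S x) -/(S h) => h3.
  move: h2; rewrite /= ler_norml => /andP[_]; move: h3.
  by move: (S x ^+ 2) (S h ^+ 2) (beta * _) => u v w *; lra.
have h00 : h 0 = 0.
  have t0 : 0 <= (0 : R) <= 1 by rewrite lexx ler01.
  apply/eqP; rewrite -normr_le0; apply/ler_addgt0Pr => e e0; rewrite add0r.
  have [x [/= h1 [x0 _]]] := filter_ex (filterI (near_h 0 e t0 e0) FK).
  by rewrite x0 subr0 in h1.
have hh := energy_holder eh.
exists (holder_path b0 hh); split.
  split; last exact: energy_le_restrict01.
  by rewrite /= /restrict01 in_itv/= lexx ler01.
apply/cvg_ballP => e e0.
pose e4 := e / 4; have e40 : 0 < e4 by rewrite divr_gt0.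
pose del := e4 ^+ 2 / (beta + 1); have del0 : 0 < del by rewrite divr_gt0// exprn_gt0.
pose m := (Num.truncn del^-1).+1.
have m0 : 0 < m%:R :> R by rewrite ltr0n.
have md : m%:R^-1 <= del.
  have /andP[_ h1] : (Num.truncn del^-1)%:R <= del^-1 < m%:R by apply: truncn_itv; rewrite invr_ge0 ltW.
  by rewrite -[leRHS]invrK lef_pV2 ?posrE ?invr_gt0// ltW.
have grid01 (k : 'I_m.+1) : 0 <= (k%:R / m%:R : R) <= 1.
  by rewrite divr_ge0//= ler_pdivrMr// mul1r ler_nat -ltnS.
have FG : F [set x : skorohod R | forall k : 'I_m.+1, `|h (k%:R / m%:R) - x (k%:R / m%:R)| <= e4].
  by apply: filter_forall => k; exact: near_h.
apply: filterS (filterI FG FK) => x [xG [x0 ex]].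
apply: (@uniform_ball _ _ _ (e4 + e4 + e4)); first by rewrite /e4; lra.
move=> t t01; have /andP[t0 t1] := t01.
have [i [im it ti]] := @grid_cell R m (ltn0Sn _) t t0 t1.
pose k : 'I_m.+1 := Ordinal (leqW im).
have close : `|t - k%:R / m%:R| <= e4 ^+ 2 / (beta + 1).
  rewrite ger0_norm ?subr_ge0//; apply: le_trans md; rewrite lerBlDr.
  by apply: le_trans ti _; rewrite -nat1r mulrDl mul1r.
have h1 : `|h t - h (k%:R / m%:R)| <= e4 := holder_modulus b0 hh e40 (grid01 k) t01 close.
have h2 : `|x t - x (k%:R / m%:R)| <= e4 := holder_modulus b0 (energy_holder ex) e40 (grid01 k) t01 close.
have h3 := xG k.
rewrite /= /restrict01 in_itv/= t01.
have -> : h t - x t = (h t - h (k%:R / m%:R)) + (h (k%:R / m%:R) - x (k%:R / m%:R)) - (x t - x (k%:R / m%:R)) by ring.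
by apply: le_trans (ler_normB _ _) _; apply: lerD => //; apply: le_trans (ler_normD _ _) _; exact: lerD.
Qed.

Lemma rate_ge0 (sigma : R) x : (0 <= rate sigma x)%E.
Proof.
rewrite /rate; case: ifP => [/asboolP[s0 _ _]|_]; last by case: ifP.
by apply: mule_ge0; [rewrite lee_fin invr_ge0 mulr_ge0// sqr_ge0|apply: integral_ge0 => u _; rewrite lee_fin sqr_ge0].
Qed.

Lemma rate0E x : rate 0 x = if `[< x = skorohod0 R >] then 0%E else +oo%E.
Proof.
rewrite /rate; case: ifP => [/asboolP[]|_]; first by rewrite ltxx.
by congr (if _ then _ else _); apply/asboolP/asboolP => [[]|].
Qed.

Lemma compact_rate (sigma alpha : R) : 0 <= sigma ->
  compact [set x : skorohod R | (rate sigma x <= alpha%:E)%E].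
Proof.
move=> s0; have [a0|a0] := ltP alpha 0.
  have -> : [set x : skorohod R | (rate sigma x <= alpha%:E)%E] = set0.
    apply/seteqP; split => // x /= /(le_trans (rate_ge0 sigma x)).
    by rewrite lee_fin leNgt a0.
  exact: compact0.
move: s0; rewrite le_eqVlt => /predU1P[<-|s0].
  have -> : [set x : skorohod R | (rate 0 x <= alpha%:E)%E] = [set skorohod0 R].
    apply/seteqP; split => x /=.
      by rewrite rate0E; case: ifP => [/asboolP//|_]; rewrite leye_eq.
    by move=> ->; rewrite rate0E asboolT// lee_fin.
  exact: compact_set1.
have -> : [set x : skorohod R | (rate sigma x <= alpha%:E)%E] =
    [set x : skorohod R | x 0 = 0 /\ energy_le (2 * sigma ^+ 2 * alpha) x].
  by apply/seteqP; split => x /rate_leP; apply.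
by apply: compact_energy; rewrite mulr_ge0// mulr_ge0// sqr_ge0.
Qed.

End LevelSets.

(** * Tail and maximal inequalities *)

Section Tails.
Context d (Om : measurableType d) (R : realType) (mu : probability Om R).
Implicit Types (A B : set Om) (h : Om -> R).
Notation Ex h := (\int[mu]_x (h x : R)).

Definition Pr A : R := fine (mu A).

Lemma PrE A : measurable A -> mu A = (Pr A)%:E.
Proof. by move=> mA; rewrite /Pr fineK//; exact: fin_num_measure. Qed.

Lemma Pr_le A B : measurable A -> measurable B -> A `<=` B -> Pr A <= Pr B.
Proof. by move=> mA mB AB; rewrite -lee_fin -!PrE// le_measure ?inE. Qed.

Lemma Pr_le1 A : measurable A -> Pr A <= 1.
Proof. by move=> mA; rewrite -lee_fin -PrE//; exact: probability_le1. Qed.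

Lemma PrU A B : measurable A -> measurable B -> Pr (A `|` B) <= Pr A + Pr B.
Proof.
move=> mA mB; rewrite -lee_fin EFinD -!PrE//; last exact: measurableU.
exact: measureU2.
Qed.

Lemma PrC A : measurable A -> Pr (~` A) = 1 - Pr A.
Proof.
move=> mA; have := probability_setC mu mA; rewrite !PrE//; last exact: measurableC.
by rewrite -EFinB => -[].
Qed.

Lemma measurable_ge h (y : R) : bmeas h -> measurable [set x | y <= h x].
Proof.
move=> [mh _]; rewrite -[X in measurable X]setTI.
have := measurable_fun_ler (measurable_cst y) mh measurableT (Y := [set true]).
by move=> /(_ _)/= H; apply: H.
Qed.

Lemma measurable_gt h (y : R) : bmeas h -> measurable [set x | y < h x].
Proof.
move=> [mh _]; rewrite -[X in measurable X]setTI.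
have := measurable_fun_ltr (measurable_cst y) mh measurableT (Y := [set true]).
by move=> /(_ _)/= H; apply: H.
Qed.

Lemma bmeas_indic A : measurable A -> bmeas (\1_A : Om -> R).
Proof.
move=> mA; apply: (@bmeas_bound _ _ _ _ 1); first exact: measurable_indic.
by move=> x; rewrite indicE; case: (_ \in _); rewrite ?normr1 ?normr0.
Qed.

Lemma Pr_Ex A : measurable A -> Pr A = Ex (\1_A : Om -> R).
Proof. by move=> mA; rewrite /Rintegral integral_indic// setIT. Qed.

Lemma chernoff h (y l : R) : bmeas h -> 0 <= l ->
  Pr [set x | y <= h x] <= expR (- (l * y)) * Ex (fun x => expR (l * h x)).
Proof.
move=> bh l0; have mA := measurable_ge y bh; have bA := bmeas_indic mA.
have be := bmeas_exp (bmeasZ l bh).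
rewrite Pr_Ex// -ExZ//; apply: Ex_le => // [|x]; first exact: bmeasZ.
rewrite indicE -expRD; have [xA|_] := boolP (x \in _); last exact: expR_ge0.
rewrite -[leLHS]expR0 ler_expR addrC -mulrBr mulr_ge0// subr_ge0.
by move: xA; rewrite inE.
Qed.

Lemma measurable_bigcup_norm (N : nat) (F : nat -> Om -> R) (x : R) :
  (forall k, bmeas (F k)) -> measurable (\bigcup_(k in `I_N) [set w | x <= `|F k w|]).
Proof.
move=> bF; apply: bigcup_measurable => k _.
exact: (measurable_ge x (bmeas_norm (bF k))).
Qed.

Variables (S : nat -> Om -> R) (C : R).
Hypothesis bS : forall k, bmeas (S k).
Hypothesis C0 : 0 < C.
Hypothesis SG : forall j n l, Ex (fun x => expR (l * (S (j + n)%N x - S j x))) <=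
  expR (1 + C * l ^+ 2 * n%:R).

Lemma increment_tail j n (y : R) : (0 < n)%N -> 0 <= y ->
  Pr [set w | y <= `|S (j + n)%N w - S j w|] <= 2 * expR (1 - y ^+ 2 / (4 * C * n%:R)).
Proof.
move=> n0 y0; have nR : 0 < n%:R :> R by rewrite ltr0n.
pose D w := S (j + n)%N w - S j w; have bD : bmeas D := bmeasB (bS _) (bS _).
have l0 : 0 <= y / (2 * C * n%:R) by rewrite divr_ge0// !mulr_ge0// ltW.
have one (s : R) : s ^+ 2 = 1 -> Pr [set w | y <= s * D w] <= expR (1 - y ^+ 2 / (4 * C * n%:R)).
  move=> s1; apply: le_trans (chernoff y (bmeasZ s bD) l0) _.
  have -> : Ex (fun x => expR (y / (2 * C * n%:R) * (s * D x))) = Ex (fun x => expR (y / (2 * C * n%:R) * s * D x)).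
    by apply: eq_Ex => x; rewrite mulrA.
  apply: le_trans (ler_wpM2l (expR_ge0 _) (SG j n (y / (2 * C * n%:R) * s))) _.
  rewrite -expRD ler_expR exprMn s1 mulr1 le_eqVlt; apply/orP; left; apply/eqP.
  by field; rewrite !gt_eqF.
have m1 (s : R) : measurable [set w | y <= s * D w] := measurable_ge y (bmeasZ s bD).
apply: (@le_trans _ _ (Pr ([set w | y <= 1 * D w] `|` [set w | y <= - 1 * D w]))).
  apply: Pr_le; [exact: (measurable_ge y (bmeas_norm bD))|exact: measurableU|].
  by move=> w /=; rewrite ler_normr => /orP[h|h]; [left|right]; rewrite ?mul1r// mulN1r.
apply: le_trans (PrU (m1 _) (m1 _)) _; rewrite mulr_natl mulr2n.
by apply: lerD; apply: one; rewrite ?sqrrN expr1n.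
Qed.

Definition excursion j N (x : R) : set Om :=
  \bigcup_(k in `I_N.+1) [set w | x <= `|S (j + k)%N w - S j w|].

Lemma measurable_excursion j N x : measurable (excursion j N x).
Proof. by apply: (@measurable_bigcup_norm N.+1 (fun k w => S (j + k)%N w - S j w)) => k; exact: bmeasB. Qed.

Lemma excursion_le j N M x : (N <= M)%N -> excursion j N x `<=` excursion j M x.
Proof. by move=> NM w [k /= kN h]; exists k => //=; apply: (@leq_trans N.+1). Qed.

(** Dyadic doubling: the threshold 7 v splits as 7 (7 v / 8) + 7 v / 8, while the
variance of half an interval is half as large and 2 (7 / 8)^2 > 3 / 2. *)
Lemma maximal_dyadic p j (v : R) : 0 < v -> 4 <= v ^+ 2 / (4 * C * (2 ^ p)%:R) ->
  Pr (excursion j (2 ^ p) (7 * v)) <= 2 * expR 1 * expR (- (v ^+ 2 / (4 * C * (2 ^ p)%:R))).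
Proof.
elim: p j v => [|p IH] j v v0 hu.
  apply: (@le_trans _ _ (Pr [set w | 7 * v <= `|S (j + 1)%N w - S j w|])).
    apply: Pr_le; first exact: measurable_excursion.
      exact: (measurable_ge _ (bmeas_norm (bmeasB (bS _) (bS _)))).
    move=> w [k /= k2]; case: k k2 => [|[|//]] _ //.
    by rewrite addn0 subrr normr0 leNgt mulr_gt0.
  have v70 : 0 <= 7 * v by rewrite mulr_ge0// ltW.
  apply: le_trans (increment_tail j (ltn0Sn 0) v70) _.
  rewrite -(mulrA 2) -expRD ler_wpM2l// ler_expR lerD2l lerN2 expn0.
  rewrite ler_wpM2r ?invr_ge0 ?mulr_ge0 ?(ltW C0)// exprMn ler_peMl ?sqr_ge0//.
  by rewrite exprn_ege1// ler1n.
pose q : R := 7 / 8; have q0 : 0 < q by rewrite divr_gt0.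
have P0 : 0 < (2 ^ p)%:R :> R by rewrite ltr0n expn_gt0.
set u := v ^+ 2 / (4 * C * (2 ^ p.+1)%:R) in hu *.
have uE : (q * v) ^+ 2 / (4 * C * (2 ^ p)%:R) = 49 / 32 * u.
  by rewrite /u /q expnS natrM; field; rewrite !gt_eqF.
have vq0 : 0 < q * v by rewrite mulr_gt0.
have hu' : 4 <= (q * v) ^+ 2 / (4 * C * (2 ^ p)%:R) by rewrite uE; lra.
have h1 := IH j (q * v) vq0 hu'; have h2 := IH (j + 2 ^ p)%N (q * v) vq0 hu'.
have h3 := increment_tail j (expn_gt0 2 p : (0 < 2 ^ p)%N) (ltW vq0).
rewrite uE in h1 h2 h3.
set E1 := excursion j (2 ^ p) (7 * (q * v)) in h1; set E2 := excursion _ _ _ in h2.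
set E3 := [set w | q * v <= _] in h3.
have mE1 : measurable E1 by exact: measurable_excursion.
have mE2 : measurable E2 by exact: measurable_excursion.
have mE3 : measurable E3 by exact: (measurable_ge _ (bmeas_norm (bmeasB (bS _) (bS _)))).
apply: (@le_trans _ _ (Pr (E1 `|` E2 `|` E3))).
  apply: Pr_le; [exact: measurable_excursion|by apply: measurableU => //; exact: measurableU|].
  move=> w [k /= k2 hk].
  have q7 : 7 * (q * v) + q * v = 7 * v by rewrite /q; field.
  have [kp|pk] := leqP k (2 ^ p).
    left; left; exists k => //=; apply: le_trans hk; rewrite -q7 lerDl ltW//.
  have [h|/ltW h] := leP (q * v) `|S (j + 2 ^ p)%N w - S j w|; first by right.
  left; right; exists (k - 2 ^ p)%N => /=.
    by rewrite ltnS leq_subLR addnn -mul2n -expnS -ltnS.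
  rewrite -addnA subnKC ?(ltnW pk)//.
  have := ler_normD (S (j + k)%N w - S (j + 2 ^ p)%N w) (S (j + 2 ^ p)%N w - S j w).
  rewrite addrA subrK; move: hk h; rewrite -q7.
  by move: (`|_|) (`|_|) (`|_|) => a b c *; lra.
apply: le_trans (PrU (measurableU _ _ mE1 mE2) mE3) _.
apply: (@le_trans _ _ ((Pr E1 + Pr E2) + Pr E3)); first by rewrite lerD2r; exact: PrU.
have -> : 2 * expR 1 * expR (- u) = 2 * expR 1 * expR (- u) / 4 + 2 * expR 1 * expR (- u) / 4 + 2 * expR 1 * expR (- u) / 2 by field.
have e2 : expR (- (49 / 32 * u)) <= expR (- u) / 4.
  have : expR (- (49 / 32 * u)) <= expR (- u) * expR (- 2) by rewrite -expRD ler_expR; lra.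
  move=> /le_trans; apply; rewrite ler_wpM2l ?expR_ge0// expRN lef_pV2 ?posrE ?expR_gt0//.
  have := expR_ge1Dx (1 : R); rewrite (_ : (2 : R) = 1 + 1)// expRD => h.
  have : (1 + 1) * (1 + 1) <= expR 1 * expR 1 :> R by apply: ler_pM.
  by lra.
have e1 : 0 <= 2 * expR 1 :> R by rewrite mulr_ge0 ?expR_ge0.
have g1 : 2 * expR 1 * expR (- (49 / 32 * u)) <= 2 * expR 1 * expR (- u) / 4.
  by rewrite -(mulrA (2 * expR 1)); exact: ler_wpM2l.
have h3' : Pr E3 <= 2 * expR 1 * expR (- (49 / 32 * u)) by rewrite -mulrA -expRD.
apply: lerD; first apply: lerD.
- exact: le_trans h1 g1.
- exact: le_trans h2 g1.
apply: le_trans h3' _; apply: le_trans g1 _.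
by have : 0 <= 2 * expR 1 * expR (- u) :> R; [rewrite mulr_ge0 ?expR_ge0|move: (_ * expR (- u)) => z ?; lra].
Qed.

(** Rounding N up to a power of 2 costs a factor 2, and 392 = 2 * 4 * 7^2. *)
Lemma maximal_inequality j N (x : R) : (0 < N)%N -> 0 <= x ->
  Pr (excursion j N x) <= expR (4 - x ^+ 2 / (392 * C * N%:R)).
Proof.
move=> N0 x0; have NR : 0 < N%:R :> R by rewrite ltr0n.
pose p := up_log 2 N.
have Np : (N <= 2 ^ p)%N by exact: up_logP.
have pN : (2 ^ p <= 2 * N)%N.
  rewrite /p; case: (ltnP 1 N) => [N1|N1]; last first.
    have -> : N = 1%N by apply/eqP; rewrite eqn_leq N1.
    by rewrite up_log1.
  have := up_log_gtn (isT : (1 < 2)%N) N1.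
  have : (0 < up_log 2 N)%N by rewrite up_log_gt0.
  by case: (up_log 2 N) => [//|k] _ /= ; rewrite expnS => /ltnW h; rewrite leq_mul2l.
have P0 : 0 < (2 ^ p)%:R :> R by rewrite ltr0n expn_gt0.
have uu : x ^+ 2 / (392 * C * N%:R) <= (x / 7) ^+ 2 / (4 * C * (2 ^ p)%:R).
  have -> : x ^+ 2 / (392 * C * N%:R) = (x / 7) ^+ 2 / (4 * C * (2 * N)%:R) by rewrite natrM; field; rewrite !gt_eqF.
  rewrite ler_wpM2l ?sqr_ge0// lef_pV2 ?posrE ?mulr_gt0//.
  by rewrite ler_wpM2l ?mulr_ge0 ?(ltW C0)// ler_nat.
  by rewrite ltr0n muln_gt0.
apply: (@le_trans _ _ (Pr (excursion j (2 ^ p) x))).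
  by apply: Pr_le; [exact: measurable_excursion|exact: measurable_excursion|exact: excursion_le].
have [u4|u4] := leP 4 ((x / 7) ^+ 2 / (4 * C * (2 ^ p)%:R)); last first.
  apply: le_trans (Pr_le1 (measurable_excursion _ _ _)) _.
  by rewrite -[leLHS]expR0 ler_expR subr_ge0; exact: le_trans uu (ltW u4).
have x70 : 0 < x / 7.
  rewrite divr_gt0// lt_neqAle x0 andbT eq_sym; apply/eqP => xe.
  by move: u4; rewrite xe mul0r expr0n mul0r leNgt ltr0n.
have := maximal_dyadic j x70 u4; rewrite mulrC divfK ?pnatr_eq0// => h.
apply: le_trans h _; rewrite expRD; apply: ler_pM; rewrite ?mulr_ge0 ?expR_ge0//.
  have e1 : 1 + 1 <= expR 1 :> R := expR_ge1Dx 1.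
  have -> : (4 : R) = 1 + (1 + 2) by ring.
  rewrite expRD mulrC ler_wpM2l ?expR_ge0// expRD.
  apply: le_trans (_ : expR 1 * 1 <= _); first by rewrite mulr1.
  by rewrite ler_wpM2l ?expR_ge0// -expR0 ler_expR.
by rewrite ler_expR lerN2.
Qed.

End Tails.

(** * Events on step paths *)

Section StepPathMeasurable.
Context d (Om : measurableType d) (R : realType).
Variables (u : nat -> Om -> R) (n : nat).
Hypothesis meas_u : forall k, measurable_fun setT (u k).

Let F w : skorohod R := step_path (fun k => u k w) n.
Let box (p : {ffun 'I_n.+1 -> rat} * nat) : set Om :=
  \bigcap_(i in [set: 'I_n.+1]) [set w | `|u i w - ratr (p.1 i)| <= p.2.+1%:R^-1].

Let step_close (v v' : nat -> R) (e : R) : (forall i : 'I_n.+1, `|v i - v' i| <= e) ->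
  forall t, 0 <= t <= 1 -> `|step_path v n t - step_path v' n t| <= e.
Proof.
move=> vv t t01; rewrite /= /step_fun in_itv/= t01; have /andP[t0 t1] := t01.
have h : (Num.truncn (n%:R * t) < n.+1)%N.
  rewrite ltnS -(ler_nat R); have /andP[k1 _] := truncn_itv (mulr_ge0 (ler0n R n) t0).
  by apply: le_trans k1 _; rewrite -[leRHS]mulr1 ler_wpM2l.
exact: (vv (Ordinal h)).
Qed.

(** A step path on n steps depends on n + 1 numbers, and uniformly close paths
are close: the preimage of an open set is a countable union of boxes with
rational centres. *)
Lemma measurable_step_path_open (U : set (skorohod R)) : open U -> measurable [set w | U (F w)].
Proof.
move=> oU; pose good (p : {ffun 'I_n.+1 -> rat} * nat) := forall v : nat -> R,
  (forall i : 'I_n.+1, `|v i - ratr (p.1 i)| <= p.2.+1%:R^-1) -> U (step_path v n).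
pose G (p : {ffun 'I_n.+1 -> rat} * nat) := [set w | box p w /\ good p].
have -> : [set w | U (F w)] = \bigcup_p G p.
  apply/seteqP; split => w; last by move=> [p _ [bx gp]]; apply: gp => i; exact: bx.
  rewrite /= => Uw; have /nbhs_ballP[e /= e0 eU] := open_nbhs_nbhs (conj oU Uw).
  pose j := Num.bound (`|4 / e|); pose r : R := j.+1%:R^-1.
  have r0 : 0 < r by rewrite invr_gt0.
  have r4 : 4 * r <= e.
    rewrite /r ler_pdivrMr// mulrC -ler_pdivrMr//.
    apply: le_trans (ler_norm _) _; apply: le_trans (ltW (archi_boundP (normr_ge0 _))) _.
    by rewrite ler_nat.
  have ex (i : 'I_n.+1) : exists q : rat, `|u i w - ratr q| <= r.
    have [|q] := @rat_in_itvoo R (u i w - r) (u i w + r); first by lra.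
    rewrite in_itv/= => /andP[q1 q2]; exists q.
    by rewrite ler_norml; apply/andP; split; lra.
  have /choice[q hq] := ex.
  exists ([ffun i => q i], j) => //; split; first by move=> i _ /=; rewrite ffunE.
  move=> v hv; apply: eU; apply: (@uniform_ball _ _ _ (2 * r)); first by lra.
  apply: step_close => i; have := hv i; rewrite /= ffunE -/r distrC => h1.
  have -> : u i w - v i = (u i w - ratr (q i)) + (ratr (q i) - v i) by ring.
  by apply: le_trans (ler_normD _ _) _; rewrite mulr_natl mulr2n; apply: lerD.
apply: countable_bigcupT_measurable => // p.
have [gp|ngp] := pselect (good p); last first.
  have -> : G p = set0 by apply/seteqP; split => // w [_ /ngp].
  exact: measurable0.
have -> : G p = box p by apply/seteqP; split => [w []//|w ?]; split.
apply: fin_bigcap_measurable => // i _.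
have m1 : measurable_fun setT (fun w => `|u i w - ratr (p.1 i)|).
  by apply: measurableT_comp => //; apply: measurable_funB.
have := m1 measurableT _ (@measurable_itv R `]-oo, p.2.+1%:R^-1]).
by rewrite setTI; congr (measurable _).
Qed.

Lemma measurable_step_path (Gamma : set (skorohod R)) : <<s open >> Gamma ->
  measurable [set w | Gamma (F w)].
Proof.
suff : <<s open >> `<=` image_set_system setT F (@measurable _ Om).
  by move=> h /h; rewrite /image_set_system /= setTI.
apply: smallest_sub; first exact: sigma_algebra_image (sigma_algebra_measurable Om).
by move=> U oU; rewrite /image_set_system /= setTI; exact: measurable_step_path_open.
Qed.

End StepPathMeasurable.

(** * Increments over a grid *)

Section FiniteUnion.
Context d (Om : measurableType d) (R : realType) (mu : probability Om R).

Lemma Pr_exists (J : finType) (F : J -> set Om) (c : J -> R) :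
  (forall j, measurable (F j)) -> (forall j, Pr mu (F j) <= c j) ->
  measurable [set w | exists j, F j w] /\
  Pr mu [set w | exists j, F j w] <= \sum_j c j.
Proof.
move=> mF Fc.
have key (s : seq J) : measurable [set w | exists2 j, j \in s & F j w] /\
    Pr mu [set w | exists2 j, j \in s & F j w] <= \sum_(j <- s) c j.
  elim: s => [|j s [m1 h1]].
    have -> : [set w | exists2 j, j \in [::] & F j w] = set0 by apply/seteqP; split => // w [].
    by rewrite big_nil /Pr measure0.
  have -> : [set w | exists2 k, k \in j :: s & F k w] = F j `|` [set w | exists2 k, k \in s & F k w].
    apply/seteqP; split => w /=.
      by move=> [k]; rewrite inE => /predU1P[->|ks] h; [left|right; exists k].
    by move=> [h|[k ks h]]; [exists j => //; exact: mem_head|exists k => //; rewrite inE ks orbT].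
  split; first exact: measurableU.
  by rewrite big_cons; apply: le_trans (PrU mu (mF j) m1) _; exact: lerD.
have -> : [set w | exists j, F j w] = [set w | exists2 j, j \in enum J & F j w].
  by apply/seteqP; split => w /= [j]; [exists j => //; rewrite mem_enum|move=> _ h; exists j].
by have := key (enum J); rewrite big_enum.
Qed.

End FiniteUnion.

Section Scaling.
Context d (Om : measurableType d) (R : realType) (mu : probability Om R).
Notation Ex h := (\int[mu]_x (h x : R)).
Variables (T : Om -> Om) (phi : Om -> R) (s2 C : R) (a : nat -> R).
Hypothesis mT : measurable_fun setT T.
Hypothesis pT : forall A, measurable A -> mu (T @^-1` A) = mu A.
Hypothesis bphi : bmeas phi.
Hypothesis app : approximable mu T phi s2.
Hypothesis s20 : 0 <= s2.
Hypothesis C0 : 0 < C.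
Hypothesis SG : forall n l, Ex (fun x => expR (l * birkhoff T phi n x)) <=
  expR (1 + C * l ^+ 2 * n%:R).
Hypothesis a0 : forall n, (0 < n)%N -> 0 < a n.
Hypothesis acv : a n @[n --> \oo] --> 0.
Hypothesis nacv : (n%:R * a n) @[n --> \oo] --> +oo.

Let V n := birkhoff T phi n.
Let bV n : bmeas (V n). Proof. exact: bmeas_birkhoff. Qed.

(** Increments are Birkhoff sums along the orbit of a later point, and the
measure is invariant. *)
Lemma birkhoff_increment_subgaussian j n l :
  Ex (fun x => expR (l * (V (j + n)%N x - V j x))) <= expR (1 + C * l ^+ 2 * n%:R).
Proof.
apply: le_trans (SG n l); rewrite -(Ex_iter mT pT j (bmeas_exp (bmeasZ l (bV n)))).
by rewrite le_eqVlt; apply/orP; left; apply/eqP/eq_Ex => x; rewrite /V birkhoffD addrC addKr.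
Qed.

(** The temperature: with the path scaled by a n * inv_scale n, exponential
moments of order (a n)^-1 of the path are exponential moments of order
inv_scale n of the Birkhoff sums, and n * (inv_scale n)^2 = 1 / a n. *)
Definition inv_scale n : R := (Num.sqrt (n%:R * a n))^-1.

Lemma inv_scale_gt0 n : (0 < n)%N -> 0 < inv_scale n.
Proof. by move=> n0; rewrite invr_gt0 sqrtr_gt0 mulr_gt0 ?ltr0n// a0. Qed.

Lemma inv_scale_sqr n : (0 < n)%N -> inv_scale n ^+ 2 * n%:R = (a n)^-1.
Proof.
move=> n0; have an := a0 n0; have nR : 0 < n%:R :> R by rewrite ltr0n.
rewrite exprVn sqr_sqrtr ?mulr_ge0// ?ltW//.
by field; rewrite !gt_eqF.
Qed.

Lemma near_gt0 : \forall n \near \oo, (0 < n)%N.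
Proof. exact: nbhs_infty_gt. Qed.

Lemma near_scale (c eps : R) : 0 < eps -> \forall n \near \oo, c <= (a n)^-1 * eps.
Proof.
move=> e0; pose c' := `|c| + 1; have c'0 : 0 < c' by rewrite ltr_wpDl.
have /cvgrPdist_le/(_ (eps / c') (divr_gt0 e0 c'0)) h := acv.
near=> n; have n0 : (0 < n)%N by near: n; exact: near_gt0.
have an := a0 n0.
have : a n <= eps / c'.
  by have : `|0 - a n| <= eps / c'; [near: n|rewrite sub0r normrN ger0_norm// ltW].
rewrite ler_pdivlMr// => h1.
apply: (@le_trans _ _ c'); first by apply: le_trans (ler_norm c) _; rewrite lerDl.
by rewrite mulrC ler_pdivlMr// mulrC.
Unshelve. all: by end_near. Qed.

Lemma near_inv_scale (l0 : R) : 0 < l0 -> \forall n \near \oo, inv_scale n <= l0.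
Proof.
move=> l00; have /cvgryPge/(_ (l0^-1 ^+ 2)) h := nacv.
near=> n; have n0 : (0 < n)%N by near: n; exact: near_gt0.
rewrite -[leRHS]invrK lef_pV2 ?posrE ?invr_gt0//; last first.
  by rewrite sqrtr_gt0 mulr_gt0 ?ltr0n ?a0.
rewrite -(@ler_pXn2r _ 2)// ?nnegrE ?invr_ge0 ?(ltW l00)//.
rewrite sqr_sqrtr ?mulr_ge0 ?(ltW (a0 n0))//.
by near: n; exact: h.
Unshelve. all: by end_near. Qed.

Lemma near_inv_nat (c eps : R) : 0 < eps -> \forall n \near \oo, c <= n%:R * eps.
Proof.
move=> e0; have h : \forall n \near \oo, (Num.bound (`|c / eps|) <= n)%N by exact: nbhs_infty_ge.
apply: filterS h => n hn; rewrite -ler_pdivrMr//.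
apply: le_trans (ler_norm _) _; apply: le_trans (ltW (archi_boundP (normr_ge0 _))) _.
by rewrite ler_nat.
Qed.

Section Grid.
Variable m : nat.
Hypothesis m0 : (0 < m)%N.
Let mR : 0 < m%:R :> R. Proof. by rewrite ltr0n. Qed.

(** The process is run backwards in time, so that the Birkhoff sums are taken at
the reversed times n - knot n i. *)
Definition knot n i : nat := ((n * i) %/ m)%N.

Lemma knot0 n : knot n 0 = 0%N. Proof. by rewrite /knot muln0 div0n. Qed.
Lemma knotm n : knot n m = n. Proof. by rewrite /knot mulnK. Qed.

Lemma knot_homo n i j : (i <= j)%N -> (knot n i <= knot n j)%N.
Proof. by move=> ij; rewrite leq_div2r// leq_mul2l ij orbT. Qed.

Lemma knot_le n i : (i <= m)%N -> (knot n i <= n)%N.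
Proof. by move=> im; rewrite -[leqRHS](knotm n) knot_homo. Qed.

Lemma knot_itv n i : (knot n i)%:R <= n%:R * i%:R / m%:R :> R /\
  n%:R * i%:R / m%:R < (knot n i)%:R + 1 :> R.
Proof.
split.
  by rewrite ler_pdivlMr// -!natrM ler_nat leq_trunc_div.
by rewrite ltr_pdivrMr// natr1 -!natrM ltr_nat ltn_ceil.
Qed.

Lemma knot_step n i : `|(knot n i.+1 - knot n i)%N%:R - n%:R / m%:R| <= 1 :> R.
Proof.
rewrite natrB ?knot_homo//; have [h1 h2] := knot_itv n i; have [h3 h4] := knot_itv n i.+1.
have E : n%:R * i.+1%:R / m%:R = n%:R * i%:R / m%:R + n%:R / m%:R :> R.
  by rewrite -natr1; field; rewrite gt_eqF.
rewrite E in h3 h4; move: h1 h2 h3 h4; move: (n%:R / m%:R) (n%:R * i%:R / m%:R) => x y *.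
by rewrite ler_norml; apply/andP; split; lra.
Qed.

Definition increment n i w : R :=
  a n * inv_scale n * (V (n - knot n i)%N w - V (n - knot n i.+1)%N w).

Lemma bmeas_increment n i : bmeas (increment n i).
Proof. by apply: bmeasZ; exact: bmeasB. Qed.

Definition rev_knot n j : nat := (n - knot n (m - j))%N.

Lemma rev_knot_mono n j : (rev_knot n j <= rev_knot n j.+1)%N.
Proof. by rewrite leq_sub2l// knot_homo// leq_sub2l. Qed.

Lemma rev_knot_step n (j : 'I_m) : (rev_knot n j.+1 - rev_knot n j)%N =
  (knot n (rev_ord j).+1 - knot n (rev_ord j))%N.
Proof.
rewrite /rev_knot /= subnSK//.
have h1 := knot_le n (leq_subr j m).
have h2 : (knot n (m - j.+1) <= knot n (m - j))%N by rewrite knot_homo// leq_sub2l.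
by rewrite subnBA// addnBAC ?(leq_trans h2 h1)// subnAC addKn.
Qed.

Lemma increment_weighted n (th : nat -> R) w : (0 < n)%N ->
  (a n)^-1 * \sum_(i < m) th i * increment n i w =
  inv_scale n * weighted_birkhoff T phi m (fun j => th (m - j.+1)%N) (rev_knot n) w.
Proof.
move=> n0; have an := a0 n0; rewrite !mulr_sumr (reindex_inj rev_ord_inj)/=.
apply: eq_bigr => j _; rewrite /increment /rev_knot /V subnSK//.
by field; rewrite gt_eqF.
Qed.

Let tau (th : nat -> R) : R := \sum_(i < m) `|th i|.

Lemma rev_bound (th : nat -> R) j : `|th (m - j.+1)%N| <= tau th.
Proof.
have jm : (m - j.+1 < m)%N by rewrite ltn_subrL m0.
by rewrite /tau (bigD1 (Ordinal jm))//= lerDl sumr_ge0.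
Qed.

(** The quadratic form sum (th i)^2 s2 / (2 m) is the Legendre dual of the energy
of the polygon with the given increments. *)
Lemma laplace_grid_upper (th : nat -> R) (eps : R) : 0 < eps -> \forall n \near \oo,
  Ex (fun w => expR ((a n)^-1 * \sum_(i < m) th i * increment n i w)) <=
  expR ((a n)^-1 * (\sum_(i < m) th i ^+ 2 * s2 / (2 * m%:R) + eps)).
Proof.
move=> e0; have e3 : 0 < eps / 3 by rewrite divr_gt0.
have [l0 [K [l00 H]]] := laplace_upper mT pT m bphi app s20 (rev_bound th) e3.
pose Q := \sum_(i < m) (th i ^+ 2 / 2 * s2 + eps / 3).
near=> n.
have n0 : (0 < n)%N by near: n; exact: near_gt0.
have an := a0 n0; have nR : 0 < n%:R :> R by rewrite ltr0n.
have ln : inv_scale n <= l0 by near: n; exact: near_inv_scale.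
have hK : K <= (a n)^-1 * (eps / 3) by near: n; exact: near_scale.
have hQ : Q <= n%:R * (eps / 3) by near: n; exact: near_inv_nat.
have -> : Ex (fun w => expR ((a n)^-1 * \sum_(i < m) th i * increment n i w)) =
    Ex (fun w => expR (inv_scale n * weighted_birkhoff T phi m (fun j => th (m - j.+1)%N) (rev_knot n) w)).
  by apply: eq_Ex => w; rewrite increment_weighted.
apply: le_trans (H _ _ (ltW (inv_scale_gt0 n0)) ln (rev_knot_mono n)) _.
rewrite ler_expR.
have -> : \sum_(i < m) (rev_knot n i.+1 - rev_knot n i)%N%:R * (th (m - i.+1)%N ^+ 2 / 2 * s2 + eps / 3) =
    \sum_(i < m) (knot n i.+1 - knot n i)%N%:R * (th i ^+ 2 / 2 * s2 + eps / 3).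
  rewrite [RHS](reindex_inj rev_ord_inj)/=; apply: eq_bigr => j _.
  by rewrite rev_knot_step.
have q0 i : 0 <= th i ^+ 2 / 2 * s2 + eps / 3.
  by rewrite addr_ge0 ?(ltW e3)// mulr_ge0// divr_ge0// sqr_ge0.
have l2 : 0 <= inv_scale n ^+ 2 by exact: sqr_ge0.
have step : \sum_(i < m) (knot n i.+1 - knot n i)%N%:R * (th i ^+ 2 / 2 * s2 + eps / 3) <=
    (n%:R / m%:R + 1) * Q.
  rewrite /Q mulr_sumr; apply: ler_sum => i _; rewrite ler_wpM2r//.
  by have := knot_step n i; rewrite ler_norml => /andP[_]; rewrite lerBlDr addrC.
apply: (@le_trans _ _ (K + inv_scale n ^+ 2 * ((n%:R / m%:R + 1) * Q))).
  by rewrite lerD2l ler_wpM2l.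
have -> : inv_scale n ^+ 2 * ((n%:R / m%:R + 1) * Q) = (a n)^-1 * (Q / m%:R + Q / n%:R).
  by rewrite -(inv_scale_sqr n0); field; rewrite !gt_eqF.
have -> : Q / m%:R = \sum_(i < m) th i ^+ 2 * s2 / (2 * m%:R) + eps / 3.
  rewrite /Q big_split/= sumr_const card_ord mulrDl -[eps / 3 *+ m]mulr_natr mulfK ?gt_eqF//.
  by congr (_ + _); rewrite mulr_suml; apply: eq_bigr => i _; field; rewrite gt_eqF.
have hQn : Q / n%:R <= eps / 3 by rewrite ler_pdivrMr// mulrC.
have ia : 0 <= (a n)^-1 by rewrite invr_ge0 ltW.
have := ler_wpM2l ia hQn.
rewrite !mulrDr; have -> : (a n)^-1 * eps = (a n)^-1 * (eps / 3) + (a n)^-1 * (eps / 3) + (a n)^-1 * (eps / 3) by field; rewrite gt_eqF.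
move: hK; move: ((a n)^-1 * (eps / 3)) ((a n)^-1 * (Q / _)) ((a n)^-1 * \sum_(i < m) _) => x y z.
by move=> *; lra.
Unshelve. all: by end_near. Qed.

Lemma laplace_grid_lower (th : nat -> R) (eps : R) : 0 < eps -> \forall n \near \oo,
  expR ((a n)^-1 * (\sum_(i < m) th i ^+ 2 * s2 / (2 * m%:R) - eps)) <=
  Ex (fun w => expR ((a n)^-1 * \sum_(i < m) th i * increment n i w)).
Proof.
move=> e0; have e3 : 0 < eps / 3 by rewrite divr_gt0.
have [l0 [K [l00 H]]] := laplace_lower mT pT m bphi app s20 (rev_bound th) e3.
pose Q := \sum_(i < m) (th i ^+ 2 / 2 * s2 + eps / 3).
pose P := \sum_(i < m) (th i ^+ 2 / 2 * s2 - eps / 3).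
near=> n.
have n0 : (0 < n)%N by near: n; exact: near_gt0.
have an := a0 n0; have nR : 0 < n%:R :> R by rewrite ltr0n.
have ln : inv_scale n <= l0 by near: n; exact: near_inv_scale.
have hK : K <= (a n)^-1 * (eps / 3) by near: n; exact: near_scale.
have hQ : Q <= n%:R * (eps / 3) by near: n; exact: near_inv_nat.
have -> : Ex (fun w => expR ((a n)^-1 * \sum_(i < m) th i * increment n i w)) =
    Ex (fun w => expR (inv_scale n * weighted_birkhoff T phi m (fun j => th (m - j.+1)%N) (rev_knot n) w)).
  by apply: eq_Ex => w; rewrite increment_weighted.
apply: le_trans (H _ _ (ltW (inv_scale_gt0 n0)) ln (rev_knot_mono n)).
rewrite ler_expR.
have -> : \sum_(i < m) (rev_knot n i.+1 - rev_knot n i)%N%:R * (th (m - i.+1)%N ^+ 2 / 2 * s2 - eps / 3) =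
    \sum_(i < m) (knot n i.+1 - knot n i)%N%:R * (th i ^+ 2 / 2 * s2 - eps / 3).
  rewrite [RHS](reindex_inj rev_ord_inj)/=; apply: eq_bigr => j _.
  by rewrite rev_knot_step.
have l2 : 0 <= inv_scale n ^+ 2 by exact: sqr_ge0.
have step : n%:R / m%:R * P - Q <= \sum_(i < m) (knot n i.+1 - knot n i)%N%:R * (th i ^+ 2 / 2 * s2 - eps / 3).
  rewrite /P /Q mulr_sumr -sumrB; apply: ler_sum => i _.
  have t0 : 0 <= th i ^+ 2 / 2 * s2 by rewrite mulr_ge0// divr_ge0// sqr_ge0.
  have := knot_step n i; have e3' := e3.
  move: (eps / 3) e3' ((knot n i.+1 - knot n i)%N%:R) (n%:R / m%:R) (th i ^+ 2 / 2 * s2) t0 => ee e3' x y z z0 h.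
  have : `|(y - x) * (z - ee)| <= 1 * (z + ee).
    rewrite normrM; apply: ler_pM => //; first by rewrite distrC.
    by apply: le_trans (ler_normB _ _) _; rewrite !ger0_norm// ltW.
  by rewrite ler_norml mul1r => /andP[_]; rewrite mulrBl; lra.
apply: (@le_trans _ _ (- K + inv_scale n ^+ 2 * (n%:R / m%:R * P - Q))); last first.
  by rewrite lerD2l ler_wpM2l.
have -> : inv_scale n ^+ 2 * (n%:R / m%:R * P - Q) = (a n)^-1 * (P / m%:R - Q / n%:R).
  by rewrite -(inv_scale_sqr n0); field; rewrite !gt_eqF.
have -> : P / m%:R = \sum_(i < m) th i ^+ 2 * s2 / (2 * m%:R) - eps / 3.
  rewrite /P sumrB/= sumr_const card_ord mulrBl -[eps / 3 *+ m]mulr_natr mulfK ?gt_eqF//.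
  by congr (_ - _); rewrite mulr_suml; apply: eq_bigr => i _; field; rewrite gt_eqF.
have hQn : Q / n%:R <= eps / 3 by rewrite ler_pdivrMr// mulrC.
have ia : 0 <= (a n)^-1 by rewrite invr_ge0 ltW.
have := ler_wpM2l ia hQn.
rewrite !mulrBr; have -> : (a n)^-1 * eps = (a n)^-1 * (eps / 3) + (a n)^-1 * (eps / 3) + (a n)^-1 * (eps / 3) by field; rewrite gt_eqF.
move: hK; move: ((a n)^-1 * (eps / 3)) ((a n)^-1 * (Q / _)) ((a n)^-1 * \sum_(i < m) _) => x y z.
by move=> *; lra.
Unshelve. all: by end_near. Qed.

(** The value at time k / n of the process multiplied by the square root of a n. *)
Definition scaled_sum n k w : R := a n * inv_scale n * (V n w - V (n - k)%N w).

Lemma scaled_sum0 n w : scaled_sum n 0 w = 0.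
Proof. by rewrite /scaled_sum subn0 subrr mulr0. Qed.

Lemma increment_scaled_sum n i w :
  increment n i w = scaled_sum n (knot n i.+1) w - scaled_sum n (knot n i) w.
Proof. by rewrite /increment /scaled_sum; ring. Qed.

(** The threshold is halved since the excursions are counted from the right end
of each cell. *)
Definition oscillation n (eps : R) : set Om := [set w | exists i : 'I_m,
  excursion V (n - knot n i.+1) (knot n i.+1 - knot n i) (eps / (2 * (a n * inv_scale n))) w].

(** The factor m in the exponent is what makes the oscillation negligible: a fine
grid beats any given exponential rate. *)
Lemma oscillation_small (eps : R) : 0 < eps -> \forall n \near \oo,
  measurable (oscillation n eps) /\
  Pr mu (oscillation n eps) <= m%:R * expR (4 - (a n)^-1 * (eps ^+ 2 * m%:R / (3136 * C))).
Proof.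
move=> e0; near=> n.
have n0 : (0 < n)%N by near: n; exact: near_gt0.
have an := a0 n0; have nR : 0 < n%:R :> R by rewrite ltr0n.
have ls := inv_scale_gt0 n0.
have nm : (2 * m)%N%:R <= n%:R :> R.
  by rewrite -[leRHS]mulr1; near: n; exact: near_inv_nat.
pose x := eps / (2 * (a n * inv_scale n)); have x0 : 0 < x by rewrite divr_gt0// !mulr_gt0.
have nm2 : 2 <= n%:R / m%:R :> R by rewrite ler_pdivlMr// -natrM.
have Nm (i : 'I_m) : 0 < (knot n i.+1 - knot n i)%N%:R :> R /\ (knot n i.+1 - knot n i)%N%:R <= 2 * (n%:R / m%:R) :> R.
  have := knot_step n i; move: nm2; rewrite ler_norml; move: (n%:R / m%:R) ((knot n i.+1 - knot n i)%N%:R) => y z ? /andP[? ?]; split; lra.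
have := @Pr_exists _ _ _ mu 'I_m (fun i => excursion V (n - knot n i.+1) (knot n i.+1 - knot n i) x)
  (fun=> expR (4 - (a n)^-1 * (eps ^+ 2 * m%:R / (3136 * C)))) _ _.
rewrite sumr_const card_ord -[X in _ <= X]mulr_natl; apply.
  by move=> i; exact: measurable_excursion.
move=> i; have [N0 N2] := Nm i.
have N00 : (0 < knot n i.+1 - knot n i)%N by rewrite -(ltr_nat R).
apply: le_trans (maximal_inequality bV C0 birkhoff_increment_subgaussian _ N00 (ltW x0)) _.
rewrite ler_expR lerD2l lerN2.
apply: (@le_trans _ _ (x ^+ 2 / (392 * C * (2 * (n%:R / m%:R))))).
  have -> : x ^+ 2 / (392 * C * (2 * (n%:R / m%:R))) = (a n)^-1 * (eps ^+ 2 * m%:R / (3136 * C)).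
    have := inv_scale_sqr n0 => E.
    have -> : (a n)^-1 = ((a n) ^+ 2 * (inv_scale n ^+ 2 * n%:R))^-1.
      by rewrite E; field; rewrite gt_eqF.
    by rewrite /x; field; rewrite !gt_eqF.
  by [].
have : 0 < 392 :> R := ltr0Sn R 391.
move: (392 : R) => b b0; have c0 : 0 < b * C := mulr_gt0 b0 C0.
have c1 : 0 < b * C * (knot n i.+1 - knot n i)%N%:R by apply: mulr_gt0.
have c2 : 0 < b * C * (2 * (n%:R / m%:R)).
  by apply: mulr_gt0 => //; apply: mulr_gt0 => //; exact: divr_gt0.
apply: ler_wpM2l; first exact: sqr_ge0.
by rewrite lef_pV2 ?posrE//; apply: ler_wpM2l => //; exact: ltW.
Unshelve. all: by end_near. Qed.

Lemma oscillation_path n (eps : R) w i k : (0 < n)%N -> ~ oscillation n eps w ->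
  (i < m)%N -> (knot n i <= k)%N -> (k <= knot n i.+1)%N ->
  `|scaled_sum n k w - scaled_sum n (knot n i) w| <= eps.
Proof.
move=> n0 nosc im ik ki; have an := a0 n0; have ls := inv_scale_gt0 n0.
have al : 0 < a n * inv_scale n by rewrite mulr_gt0.
set x := eps / (2 * (a n * inv_scale n)).
have kn := knot_le n im.
have near_ k' : (knot n i <= k')%N -> (k' <= knot n i.+1)%N ->
    `|V (n - k')%N w - V (n - knot n i.+1)%N w| <= x.
  move=> h1 h2; rewrite leNgt; apply/negP => h; apply: nosc; exists (Ordinal im).
  exists (knot n i.+1 - k')%N => /=; first by rewrite ltnS leq_sub2l.
  by rewrite addnBA// subnK// ltW.
have h1 := near_ k ik ki; have h2 := near_ (knot n i) (leqnn _) (knot_homo n (leqnSn i)).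
have -> : scaled_sum n k w - scaled_sum n (knot n i) w =
   a n * inv_scale n * ((V (n - knot n i)%N w - V (n - knot n i.+1)%N w) - (V (n - k)%N w - V (n - knot n i.+1)%N w)).
  by rewrite /scaled_sum; ring.
rewrite normrM (gtr0_norm al).
apply: (@le_trans _ _ (a n * inv_scale n * (x + x))).
  by rewrite ler_wpM2l ?(ltW al)//; apply: le_trans (ler_normB _ _) _; exact: lerD.
by rewrite le_eqVlt; apply/orP; left; apply/eqP; rewrite /x; field; rewrite !gt_eqF.
Qed.

Lemma round_to_grid (delta tau0 : R) K x : 0 < delta -> tau0 <= K%:R * delta -> `|x| <= tau0 ->
  exists k : 'I_(K.*2.+1), `|((k : nat)%:R - K%:R) * delta| <= `|x| /\
    `|((k : nat)%:R - K%:R) * delta - x| <= delta.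
Proof.
move=> d0 tK xt; pose q := Num.truncn (`|x| / delta).
have xd : 0 <= `|x| / delta by rewrite divr_ge0// ltW.
have /andP[q1 q2] := truncn_itv xd; rewrite -/q in q1 q2.
have q1' : q%:R * delta <= `|x| by rewrite -ler_pdivlMr.
have q2' : `|x| <= q%:R * delta + delta.
  by have := ltW q2; rewrite ler_pdivrMr// -natr1 mulrDl mul1r.
have qK : (q <= K)%N.
  rewrite -(ler_nat R); apply: le_trans q1 _; rewrite ler_pdivrMr//; exact: le_trans tK.
have qd0 : 0 <= q%:R * delta by rewrite mulr_ge0// ltW.
have [x0|x0] := leP 0 x.
  have h : (K + q < K.*2.+1)%N by rewrite ltnS -addnn leq_add2l.
  exists (Ordinal h); rewrite /= natrD addrAC subrr add0r (ger0_norm qd0).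
  split => //; move: q1' q2'; rewrite (ger0_norm x0) => ? ?.
  by rewrite ler_norml; apply/andP; split; lra.
have h : (K - q < K.*2.+1)%N by rewrite ltnS -addnn; apply: leq_trans (leq_subr _ _) (leq_addr _ _).
exists (Ordinal h); rewrite /= natrB// addrAC subrr add0r mulNr normrN (ger0_norm qd0).
split => //; move: q1' q2'; rewrite (ltr0_norm x0) => ? ?.
by rewrite ler_norml; apply/andP; split; lra.
Qed.

Lemma linear_tail (th : nat -> R) (y eps : R) : 0 < eps -> \forall n \near \oo,
  Pr mu [set w | y <= \sum_(i < m) th i * increment n i w] <=
  expR ((a n)^-1 * (\sum_(i < m) th i ^+ 2 * s2 / (2 * m%:R) + eps - y)).
Proof.
move=> e0; have := laplace_grid_upper th e0; apply: filter_app; near=> n => h.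
have n0 : (0 < n)%N by near: n; exact: near_gt0.
have bs : bmeas (fun w => \sum_(i < m) th i * increment n i w).
  by apply: bmeas_sum => i; apply: bmeasZ; exact: bmeas_increment.
have ia : 0 <= (a n)^-1 by rewrite invr_ge0 ltW// a0.
apply: le_trans (chernoff mu y bs ia) _.
apply: le_trans (ler_wpM2l (expR_ge0 _) h) _.
by rewrite -expRD ler_expR mulrBr addrC.
Unshelve. all: by end_near. Qed.

(** A crude exponential bound, used only to confine the increments to a bounded
set. *)
Lemma single_tail i0 (y : R) : (i0 < m)%N -> \forall n \near \oo,
  Pr mu [set w | y <= `|increment n i0 w|] <= 2 * expR ((a n)^-1 * (s2 / (2 * m%:R) + 1 - y)).
Proof.
move=> im; pose th (s : R) i := if i == i0 then s else 0 : R.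
have sumE (s : R) n w : \sum_(i < m) th s i * increment n i w = s * increment n i0 w.
  rewrite (bigD1 (Ordinal im))//= /th eqxx big1 ?addr0// => i ii.
  by case: eqP => [e|_]; [move: ii; rewrite -val_eqE/= e eqxx|rewrite mul0r].
have sum2 (s : R) : s ^+ 2 = 1 -> \sum_(i < m) th s i ^+ 2 * s2 / (2 * m%:R) = s2 / (2 * m%:R).
  move=> s1; rewrite (bigD1 (Ordinal im))//= /th eqxx big1 ?addr0 ?s1 ?mul1r// => i ii.
  by case: eqP => [e|_]; [move: ii; rewrite -val_eqE/= e eqxx|rewrite expr0n !mul0r].
have h1 := linear_tail (th 1) y ltr01; have h2 := linear_tail (th (- 1)) y ltr01.
apply: filterS2 h1 h2 => n h1 h2.
have mI (s : R) : measurable [set w | y <= s * increment n i0 w].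
  by apply: measurable_ge; apply: bmeasZ; exact: bmeas_increment.
apply: (@le_trans _ _ (Pr mu ([set w | y <= 1 * increment n i0 w] `|` [set w | y <= - 1 * increment n i0 w]))).
  apply: Pr_le; [exact: (measurable_ge y (bmeas_norm (bmeas_increment n i0)))|exact: measurableU|].
  by move=> w /=; rewrite ler_normr => /orP[h|h]; [left|right]; rewrite ?mul1r// mulN1r.
apply: le_trans (PrU mu (mI _) (mI _)) _; rewrite mulr_natl mulr2n; apply: lerD.
  move: h1; rewrite sum2 ?expr1n//; under [X in Pr _ X <= _ -> _]eq_set => w do rewrite sumE.
  by [].
move: h2; rewrite sum2 ?sqrrN ?expr1n//; under [X in Pr _ X <= _ -> _]eq_set => w do rewrite sumE.
by [].
Qed.

(** A point outside the ball of energy 2 sig^2 alpha is separated from it by one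
of finitely many half-spaces, as long as it stays bounded: up to rounding,
the half-space orthogonal to the point itself. *)
Lemma energy_tail (sig alpha eta : R) : 0 < sig -> s2 <= sig ^+ 2 -> 0 <= alpha -> 0 < eta ->
  \forall n \near \oo,
  Pr mu [set w | 2 * sig ^+ 2 * alpha < m%:R * \sum_(i < m) increment n i w ^+ 2] <=
  expR (- ((a n)^-1 * (alpha - eta))).
Proof.
move=> sig0 s2sig al0 eta0; have sg2 : 0 < sig ^+ 2 by rewrite exprn_gt0.
pose beta := 2 * sig ^+ 2 * alpha; have b0 : 0 <= beta by rewrite mulr_ge0// mulr_ge0// ltW.
(* Beyond Rb a single increment has exponential rate alpha. *)
pose Rb := s2 / (2 * m%:R) + 1 + alpha.
have Rb1 : 1 <= Rb by rewrite /Rb -addrA addrCA lerDl addr_ge0// divr_ge0// mulr_ge0.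
have Rb0 : 0 < Rb by lra.
pose delta := eta / (4 * m%:R * Rb); have d0 : 0 < delta by rewrite divr_gt0// !mulr_gt0.
(* All half-spaces that are needed have normals with entries at most tau0;
   delta is the mesh of their discretization. *)
pose tau0 := Num.sqrt (beta * m%:R) / sig ^+ 2.
pose K := Num.bound (`|tau0 / delta|).
have tK : tau0 <= K%:R * delta.
  rewrite -ler_pdivrMr//; apply: le_trans (ler_norm _) _.
  exact: ltW (archi_boundP (normr_ge0 _)).
pose J := {ffun 'I_m -> 'I_(K.*2.+1)}.
pose th (f : J) (i : nat) : R := if insub i is Some j then ((f j : nat)%:R - K%:R) * delta else 0.
have thE f (i : 'I_m) : th f i = ((f i : nat)%:R - K%:R) * delta.
  by rewrite /th valK.
pose q2 f := \sum_(i < m) th f i ^+ 2 * s2 / (2 * m%:R).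
have e4 : 0 < eta / 4 by rewrite divr_gt0.
have H1 : \forall n \near \oo, forall f : J,
    Pr mu [set w | q2 f + alpha - eta / 4 <= \sum_(i < m) th f i * increment n i w] <=
    expR ((a n)^-1 * (q2 f + eta / 4 - (q2 f + alpha - eta / 4))).
  by apply: filter_forall => f; exact: linear_tail.
have H2 : \forall n \near \oo, forall i : 'I_m,
    Pr mu [set w | Rb <= `|increment n i w|] <= 2 * expR ((a n)^-1 * (s2 / (2 * m%:R) + 1 - Rb)).
  by apply: filter_forall => i; exact: single_tail.
pose N : R := #|J|%:R + 2 * m%:R.
near=> n.
have n0 : (0 < n)%N by near: n; exact: near_gt0.
have G1 : forall f : J,
    Pr mu [set w | q2 f + alpha - eta / 4 <= \sum_(i < m) th f i * increment n i w] <=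
    expR ((a n)^-1 * (q2 f + eta / 4 - (q2 f + alpha - eta / 4))) by near: n; exact: H1.
have G2 : forall i : 'I_m,
    Pr mu [set w | Rb <= `|increment n i w|] <= 2 * expR ((a n)^-1 * (s2 / (2 * m%:R) + 1 - Rb)).
  by near: n; exact: H2.
have hN : N <= (a n)^-1 * (eta / 2) by near: n; apply: near_scale; rewrite divr_gt0.
have ia : 0 < (a n)^-1 by rewrite invr_gt0 a0.
have binc i : bmeas (increment n i) by exact: bmeas_increment.
pose E1 (f : J) := [set w | q2 f + alpha - eta / 4 <= \sum_(i < m) th f i * increment n i w].
pose E2 (i : 'I_m) := [set w | Rb <= `|increment n i w|].
have mE1 f : measurable (E1 f).
  by apply: measurable_ge; apply: bmeas_sum => i; exact: bmeasZ.
have mE2 i : measurable (E2 i) by exact: (measurable_ge _ (bmeas_norm (binc i))).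
have [mU1 U1] := Pr_exists mE1 G1; have [mU2 U2] := Pr_exists mE2 G2.
pose c := expR (- ((a n)^-1 * (alpha - eta / 2))).
have U1' : Pr mu [set w | exists f, E1 f w] <= #|J|%:R * c.
  apply: le_trans U1 _; rewrite mulr_natl -sumr_const; apply: ler_sum => f _.
  rewrite /c ler_expR -[leRHS]mulrN; apply: ler_wpM2l; first exact: ltW.
  by rewrite le_eqVlt; apply/orP; left; apply/eqP; field.
have U2' : Pr mu [set w | exists i, E2 i w] <= 2 * m%:R * c.
  apply: le_trans U2 _; rewrite [leRHS]mulrAC [leRHS]mulrC [leRHS]mulr_natl -[X in _ <= _ *+ X]card_ord -sumr_const.
  apply: ler_sum => i _; rewrite ler_wpM2l// /c ler_expR -[leRHS]mulrN.
  apply: ler_wpM2l; first exact: ltW.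
  rewrite /Rb.
  by have h := eta0; move: h; move: (s2 / _) => z h; lra.
apply: (@le_trans _ _ (Pr mu ([set w | exists f, E1 f w] `|` [set w | exists i, E2 i w]))).
  apply: Pr_le; [|exact: measurableU|].
    apply: measurable_gt; apply: bmeasZ; apply: bmeas_sum => i; exact: bmeas_sqr.
  move=> w /= hw.
  have [|nb] := pselect (exists i, E2 i w); first by right.
  left; have small (i : 'I_m) : `|increment n i w| <= Rb.
    by rewrite leNgt; apply/negP => h; apply: nb; exists i; exact: ltW.
  pose x (i : 'I_m) := increment n i w.
  pose Q := m%:R * \sum_(i < m) x i ^+ 2.
  have Qb : beta < Q by [].
  have Q0 : 0 < Q by exact: le_lt_trans Qb.
  pose q := Num.sqrt Q; have q0 : 0 < q by rewrite sqrtr_gt0.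
  have qq : q ^+ 2 = Q by rewrite sqr_sqrtr// ltW.
  pose rb := Num.sqrt beta.
  have rb0 : 0 <= rb by exact: sqrtr_ge0.
  have rbrb : rb ^+ 2 = beta by rewrite sqr_sqrtr.
  have rbq : rb <= q by rewrite ler_wsqrtr// ltW.
  (* The supporting half-space of the ball at its boundary point on the ray
     through x. *)
  pose ts i := rb * m%:R * x i / (q * sig ^+ 2).
  have xm i : `|x i| * Num.sqrt m%:R <= q.
    rewrite -sqrtr_sqr -sqrtrM ?sqr_ge0// ler_wsqrtr// mulrC /Q ler_wpM2l//.
    by rewrite (bigD1 i)//= lerDl sumr_ge0// => j _; rewrite sqr_ge0.
  have tst i : `|ts i| <= tau0.
    have tsE : ts i = x i * (rb * m%:R / (q * sig ^+ 2)) by rewrite /ts; ring.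
    have cf0 : 0 <= rb * m%:R / (q * sig ^+ 2).
      by apply: divr_ge0; [exact: mulr_ge0|exact: ltW (mulr_gt0 q0 sg2)].
    rewrite tsE normrM (ger0_norm cf0).
    have -> : `|x i| * (rb * m%:R / (q * sig ^+ 2)) = rb * m%:R * `|x i| / q / sig ^+ 2.
      by field; rewrite !gt_eqF.
    rewrite ler_wpM2r ?invr_ge0 ?(ltW sg2)// ler_pdivrMr// sqrtrM// -/rb.
    have -> : rb * m%:R * `|x i| = rb * Num.sqrt m%:R * (`|x i| * Num.sqrt m%:R).
      have sm : m%:R = Num.sqrt m%:R * Num.sqrt m%:R :> R by rewrite -expr2 sqr_sqrtr.
      by rewrite [in LHS]sm; ring.
    by rewrite ler_wpM2l// mulr_ge0// sqrtr_ge0.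
  have /choice[f hf] := fun i => round_to_grid d0 tK (tst i).
  exists [ffun i => f i]; rewrite /E1 /=.
  have th1 (i : 'I_m) : `|th [ffun i => f i] i| <= `|ts i| by rewrite thE ffunE; have [] := hf i.
  have th2 (i : 'I_m) : `|th [ffun i => f i] i - ts i| <= delta by rewrite thE ffunE; have [] := hf i.
  have sumts : \sum_i ts i * x i = rb * q / sig ^+ 2.
    transitivity (rb / (q * sig ^+ 2) * Q).
      by rewrite /Q mulrA mulr_sumr; apply: eq_bigr => i _; rewrite /ts; ring.
    by rewrite -qq; field; rewrite !gt_eqF.
  have err : - (eta / 4) <= \sum_(i < m) (th [ffun i => f i] i - ts i) * x i.
    have : `|\sum_(i < m) (th [ffun i => f i] i - ts i) * x i| <= eta / 4.
      apply: le_trans (ler_norm_sum _ _ _) _.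
      apply: (@le_trans _ _ (\sum_(i < m) delta * Rb)).
        by apply: ler_sum => i _; rewrite normrM; apply: ler_pM => //; exact: small.
      rewrite sumr_const card_ord -mulr_natr le_eqVlt; apply/orP; left; apply/eqP.
      by rewrite /delta; field; rewrite !gt_eqF.
    by rewrite ler_norml => /andP[].
  have q2le : q2 [ffun i => f i] <= alpha.
    apply: (@le_trans _ _ (\sum_(i < m) ts i ^+ 2 * sig ^+ 2 / (2 * m%:R))).
      apply: ler_sum => i _; rewrite ler_wpM2r ?invr_ge0 ?mulr_ge0//; apply: ler_pM => //; first exact: sqr_ge0.
      by rewrite -[leLHS]real_normK ?num_real// -[leRHS]real_normK ?num_real// ler_pXn2r ?nnegrE.
    have -> : \sum_(i < m) ts i ^+ 2 * sig ^+ 2 / (2 * m%:R) = rb ^+ 2 / (2 * q ^+ 2 * sig ^+ 2) * Q.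
      rewrite /Q mulrA mulr_sumr; apply: eq_bigr => i _; rewrite /ts.
      by field; rewrite !gt_eqF.
    rewrite qq rbrb /beta le_eqVlt; apply/orP; left; apply/eqP; field.
    by rewrite !gt_eqF.
  have split_ : \sum_(i < m) th [ffun i => f i] i * x i = \sum_(i < m) ts i * x i + \sum_(i < m) (th [ffun i => f i] i - ts i) * x i.
    by rewrite -big_split; apply: eq_bigr => i _ /=; ring.
  rewrite -/(x _) split_ sumts.
  have rq : 2 * alpha <= rb * q / sig ^+ 2.
    rewrite ler_pdivlMr// mulrAC -/beta -rbrb expr2 ler_wpM2l//.
  move: rq err q2le; move: (q2 _) (rb * q / _) (\sum_i _ * x i) => y z t; lra.
apply: le_trans (PrU mu mU1 mU2) _; apply: le_trans (lerD U1' U2') _.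
rewrite -mulrDl -/N.
apply: (@le_trans _ _ (expR ((a n)^-1 * (eta / 2)) * c)).
  rewrite ler_wpM2r ?expR_ge0//; apply: le_trans hN _.
  by apply: le_trans (expR_ge1Dx _); rewrite lerDr.
rewrite /c -expRD ler_expR le_eqVlt; apply/orP; left; apply/eqP; field.
by rewrite gt_eqF// -invr_gt0.
Unshelve. all: by end_near. Qed.

End Grid.

(** * Paths and their polygons *)

Definition walk n w : skorohod R := step_path (fun k => scaled_sum n k w) n.

Lemma walkE n w t : 0 <= t <= 1 -> walk n w t = scaled_sum n (Num.truncn (n%:R * t)) w.
Proof. by move=> t01; rewrite /walk /= /step_fun in_itv/= t01. Qed.

Lemma knot_truncn m n i (t : R) : (0 < m)%N -> i%:R / m%:R <= t -> t <= i.+1%:R / m%:R ->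
  (knot m n i <= Num.truncn (n%:R * t) <= knot m n i.+1)%N.
Proof.
move=> m0 it ti; have mR : 0 < m%:R :> R by rewrite ltr0n.
have nR : 0 <= n%:R :> R by [].
have t0 : 0 <= t by apply: le_trans it; rewrite divr_ge0.
have /andP[k1 k2] := truncn_itv (mulr_ge0 nR t0).
have [h1 _] := knot_itv m0 n i; have [_ h2] := knot_itv m0 n i.+1.
apply/andP; split.
  rewrite -ltnS -(ltr_nat R); apply: le_lt_trans k2; apply: le_trans h1 _.
  by rewrite -mulrA ler_wpM2l.
rewrite -ltnS -(ltr_nat R) -[in ltRHS]natr1; apply: le_lt_trans h2.
by apply: le_trans k1 _; rewrite -mulrA ler_wpM2l.
Qed.

Lemma walk_cell m n (eps : R) w : (0 < m)%N -> (0 < n)%N -> ~ oscillation m n eps w ->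
  forall t, 0 <= t <= 1 -> exists i, [/\ (i < m)%N, i%:R / m%:R <= t, t <= i.+1%:R / m%:R &
    `|walk n w t - scaled_sum n (knot m n i) w| <= eps].
Proof.
move=> m0 n0 nosc t t01; have /andP[t0 t1] := t01.
have [i [im it ti]] := grid_cell m0 t0 t1; exists i; split => //.
have /andP[k1 k2] := knot_truncn n m0 it ti.
by rewrite walkE//; exact: (oscillation_path m0 n0 nosc im).
Qed.

Definition grid_energy m n w : R := m%:R * \sum_(i < m) increment m n i w ^+ 2.

Lemma grid_energyE m n w : grid_energy m n w =
  m%:R * \sum_(i < m) (scaled_sum n (knot m n i.+1) w - scaled_sum n (knot m n i) w) ^+ 2.
Proof. by congr (_ * _); apply: eq_bigr => i _; rewrite increment_scaled_sum. Qed.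

Lemma walk_near_polygon m n (eps beta : R) w : (0 < m)%N -> (0 < n)%N -> 0 <= beta ->
  ~ oscillation m n eps w -> grid_energy m n w <= beta ->
  exists x : skorohod R, [/\ x 0 = 0, energy_le beta x &
    forall t, 0 <= t <= 1 -> `|x t - walk n w t| <= 2 * eps].
Proof.
move=> m0 n0 b0 nosc; rewrite grid_energyE; set z := fun i => scaled_sum n (knot m n i) w => hE.
have pE := polygon_energy m0 (hE : m%:R * \sum_(i < m) (z i.+1 - z i) ^+ 2 <= beta).
exists (holder_path b0 (energy_holder pE)); split.
- by rewrite /= /restrict01 in_itv/= lexx ler01 polygon0.
- exact: energy_le_restrict01.
move=> t t01; rewrite /= /restrict01 in_itv/= t01.
have [i [im it ti h]] := walk_cell m0 n0 nosc t01.
have hp := polygon_cell m0 z im it ti.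
have z0 : z 0%N = 0 by rewrite /z knot0 scaled_sum0.
have hz : `|z i.+1 - z i| <= eps by exact: (oscillation_path m0 n0 nosc im (knot_homo m n (leqnSn i))).
rewrite z0 subr0 in hp; have hp' := le_trans hp hz.
have -> : polygon m z t - walk n w t = (polygon m z t - z i) - (walk n w t - z i) by ring.
by apply: le_trans (ler_normB _ _) _; rewrite mulr_natl mulr2n; apply: lerD.
Qed.

(** For the degenerate rate function: the only path of finite rate is 0. *)
Lemma walk_near_zero m n (eps : R) w : (0 < m)%N -> (0 < n)%N -> 0 <= eps ->
  ~ oscillation m n eps w -> grid_energy m n w <= eps ^+ 2 ->
  forall t, 0 <= t <= 1 -> `|0 - walk n w t| <= 3 * eps.
Proof.
move=> m0 n0 e0 nosc hE t t01.
have [x [x0 /energy_holder xe xz]] := walk_near_polygon m0 n0 (sqr_ge0 eps) nosc hE.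
have xt : `|x t| <= eps.
  rewrite -(@ler_pXn2r _ 2)// ?nnegrE// real_normK ?num_real//.
  have z01 : 0 <= (0 : R) <= 1 by rewrite lexx ler01.
  have := holder_abs xe z01 t01; rewrite x0 !subr0 => h; apply: le_trans h _.
  by have /andP[t0 t1] := t01; rewrite ger0_norm// -[leRHS]mulr1 ler_wpM2l// sqr_ge0.
have -> : 0 - walk n w t = (x t - walk n w t) - x t by ring.
apply: le_trans (ler_normB _ _) _; apply: le_trans (lerD (xz t t01) xt) _.
by rewrite le_eqVlt; apply/orP; left; apply/eqP; ring.
Qed.

Lemma bmeas_scaled_sum n k : bmeas (scaled_sum n k).
Proof. by apply: bmeasZ; exact: bmeasB. Qed.

Lemma measurable_grid_energy m n (y : R) : (0 < m)%N ->
  measurable [set w | y < grid_energy m n w].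
Proof.
move=> m0; apply: measurable_gt; apply: bmeasZ; apply: bmeas_sum => i.
by apply: bmeas_sqr; exact: bmeas_increment.
Qed.

(** * The upper bound *)

(** Constant factors and the loss of eta in the rate are traded for each other
since 1 / a n tends to infinity. *)
Lemma near_absorb (N c eta : R) : 0 < eta -> \forall n \near \oo,
  N * expR (- ((a n)^-1 * c)) <= expR (- ((a n)^-1 * (c - eta))).
Proof.
move=> e0; near=> n.
have h : N <= (a n)^-1 * eta by near: n; exact: near_scale.
have -> : - ((a n)^-1 * (c - eta)) = (a n)^-1 * eta + - ((a n)^-1 * c) by ring.
rewrite expRD; apply: ler_wpM2r; first exact: expR_ge0.
by apply: le_trans h _; apply: le_trans (expR_ge1Dx _); rewrite lerDr.
Unshelve. all: by end_near. Qed.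

Lemma oscillation_negligible (eps c : R) : 0 < eps -> exists2 m0 : nat, (0 < m0)%N &
  forall m, (m0 <= m)%N -> \forall n \near \oo, measurable (oscillation m n eps) /\
    Pr mu (oscillation m n eps) <= m%:R * expR 4 * expR (- ((a n)^-1 * c)).
Proof.
move=> e0; have c3 : 0 < 3136 :> R by rewrite ltr0n.
have q0 : 0 < eps ^+ 2 / (3136 * C).
  exact: divr_gt0 (exprn_gt0 2 e0) (mulr_gt0 c3 C0).
exists (Num.bound (`|c / (eps ^+ 2 / (3136 * C))|)).+1 => // m hm.
have m0 : (0 < m)%N by apply: leq_trans hm.
have cm : c <= eps ^+ 2 * m%:R / (3136 * C).
  rewrite mulrAC mulrC -ler_pdivrMr//; apply: le_trans (ler_norm _) _.
  by apply: le_trans (ltW (archi_boundP (normr_ge0 _))) _; rewrite ler_nat ltnW.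
have := oscillation_small m0 e0; apply: filter_app; near=> n; move=> [mo ho]; split => //.
have n0 : (0 < n)%N by near: n; exact: near_gt0.
apply: le_trans ho _; rewrite -[leRHS]mulrA; apply: ler_wpM2l => //.
rewrite -expRD ler_expR lerD2l lerN2; apply: ler_wpM2l => //.
by rewrite invr_ge0 ltW// a0.
Unshelve. all: by end_near. Qed.

(** Off the oscillation event a path is shadowed by the polygon through its grid
values, which has low energy except on an event of the required size. *)
Lemma walk_upper (sigma alpha eta : R) (Gamma : set (skorohod R)) :
  0 <= sigma -> sigma ^+ 2 = s2 -> 0 <= alpha -> 0 < eta -> <<s open >> Gamma ->
  (forall x, (rate sigma x <= alpha%:E)%E -> ~ closure Gamma x) ->
  \forall n \near \oo, Pr mu [set w | Gamma (walk n w)] <= expR (- ((a n)^-1 * (alpha - eta))).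
Proof.
move=> sig0 sigE al0 eta0 oG sep.
have [e e0 He] := compact_closed_separation (compact_rate sig0) (@closed_closure _ Gamma) sep.
(* The walk is within 2 eps of its polygon, and within 3 eps of 0 in the
   degenerate case. *)
pose eps := e / 4; have eps0 : 0 < eps by rewrite divr_gt0.
have [m m0 /(_ m (leqnn m)) osc] := oscillation_negligible alpha eps0.
have eta2 : 0 < eta / 2 by rewrite divr_gt0.
have [sg [beta [sg0 sgs b0 bE Hb]]] : exists sg beta : R, [/\ 0 < sg, s2 <= sg ^+ 2, 0 <= beta,
    2 * sg ^+ 2 * alpha <= beta &
    \forall n \near \oo, Pr mu [set w | beta < grid_energy m n w] <= expR (- ((a n)^-1 * (alpha - eta / 2))) /\
    forall w, ~ oscillation m n eps w -> grid_energy m n w <= beta -> ~ Gamma (walk n w)].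
  move: sig0; rewrite le_eqVlt => /orP[/eqP s0|sig0].
    have al1 : 0 < 2 * (alpha + 1) by rewrite mulr_gt0// ltr_wpDl.
    have sq : 0 < eps ^+ 2 / (2 * (alpha + 1)) by rewrite divr_gt0// exprn_gt0.
    (* In the degenerate case any positive variance is an upper bound: the one
       for which the ball of level alpha + 1 is that of energy eps^2. *)
    exists (Num.sqrt (eps ^+ 2 / (2 * (alpha + 1)))), (eps ^+ 2).
    have E : 2 * Num.sqrt (eps ^+ 2 / (2 * (alpha + 1))) ^+ 2 * (alpha + 1) = eps ^+ 2.
      by rewrite sqr_sqrtr ?(ltW sq)//; field; rewrite gt_eqF// ltr_wpDl.
    split; [by rewrite sqrtr_gt0|by rewrite -sigE -s0 expr0n sqr_ge0|exact: sqr_ge0| |].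
      by rewrite -[leRHS]E; apply: ler_wpM2l; [apply: mulr_ge0 => //; exact: sqr_ge0|rewrite lerDl].
    have sgt : 0 < Num.sqrt (eps ^+ 2 / (2 * (alpha + 1))) by rewrite sqrtr_gt0.
    have s2le : s2 <= Num.sqrt (eps ^+ 2 / (2 * (alpha + 1))) ^+ 2.
      by rewrite -sigE -s0 expr0n sqr_ge0.
    have al1' : 0 <= alpha + 1 by rewrite addr_ge0.
    have := energy_tail m0 sgt s2le al1' eta2; apply: filter_app; near=> n => h.
    have n0 : (0 < n)%N by near: n; exact: near_gt0.
    split.
      rewrite E in h; apply: le_trans h _; rewrite ler_expR lerN2; apply: ler_wpM2l.
        by rewrite invr_ge0 ltW// a0.
      by rewrite lerD2r lerDl.
    move=> w nosc hE /(@subset_closure _ Gamma).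
    have K0 : (rate sigma (skorohod0 R) <= alpha%:E)%E.
      by rewrite -s0 rate0E; case: asboolP => // _; rewrite lee_fin.
    apply: (He _ _ K0); apply: (@uniform_ball _ _ _ (3 * eps)); first by rewrite /eps; lra.
    exact: (walk_near_zero m0 n0 (ltW eps0) nosc hE).
  exists sigma, (2 * sigma ^+ 2 * alpha).
  have s2le : s2 <= sigma ^+ 2 by rewrite sigE.
  have bb : 0 <= 2 * sigma ^+ 2 * alpha by apply: mulr_ge0 => //; apply: mulr_ge0 => //; exact: sqr_ge0.
  split => //.
  have := energy_tail m0 sig0 s2le al0 eta2; apply: filter_app; near=> n => h.
  have n0 : (0 < n)%N by near: n; exact: near_gt0.
  split; first exact: h.
  move=> w nosc hE /(@subset_closure _ Gamma).
  have [x [x0 xE xw]] := walk_near_polygon m0 n0 bb nosc hE.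
  have Kx : (rate sigma x <= alpha%:E)%E by apply/rate_leP.
  apply: (He _ _ Kx); apply: (@uniform_ball _ _ _ (2 * eps)); first by rewrite /eps; lra.
  exact: xw.
have abs := near_absorb (m%:R * expR 4 + 1) (alpha - eta / 2) eta2.
near=> n.
have n0 : (0 < n)%N by near: n; exact: near_gt0.
have [mo ho] : measurable (oscillation m n eps) /\
    Pr mu (oscillation m n eps) <= m%:R * expR 4 * expR (- ((a n)^-1 * alpha)) by near: n; exact: osc.
have [h1 h2] : Pr mu [set w | beta < grid_energy m n w] <= expR (- ((a n)^-1 * (alpha - eta / 2))) /\
    forall w, ~ oscillation m n eps w -> grid_energy m n w <= beta -> ~ Gamma (walk n w).
  by near: n; exact: Hb.
have h3 : (m%:R * expR 4 + 1) * expR (- ((a n)^-1 * (alpha - eta / 2))) <=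
    expR (- ((a n)^-1 * (alpha - eta / 2 - eta / 2))) by near: n; exact: abs.
have mG : measurable [set w | Gamma (walk n w)].
  by apply: (measurable_step_path n _ oG) => k; have [] := bmeas_scaled_sum n k.
have mE := measurable_grid_energy n beta m0.
apply: (@le_trans _ _ (Pr mu (oscillation m n eps `|` [set w | beta < grid_energy m n w]))).
  apply: Pr_le => //; first exact: measurableU.
  move=> w /= Gw; apply: contrapT => /not_orP[no /negP]; rewrite -leNgt => hE.
  exact: (h2 w no hE).
apply: le_trans (PrU mu mo mE) _.
have -> : alpha - eta = alpha - eta / 2 - eta / 2 by field.
apply: le_trans h3; rewrite [leRHS]mulrDl mul1r; apply: lerD => //.
apply: le_trans ho _; apply: ler_wpM2l; first by apply: mulr_ge0 => //; exact: expR_ge0.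
rewrite ler_expR lerN2; apply: ler_wpM2l; first by rewrite invr_ge0 ltW// a0.
by rewrite gerDl oppr_le0 ltW.
Unshelve. all: by end_near. Qed.

(** The complement of a neighbourhood of the null path has small probability by
the upper bound. *)
Lemma walk_lower_degenerate (eta : R) (Gamma : set (skorohod R)) :
  s2 = 0 -> 0 < eta -> <<s open >> Gamma -> Gamma° (skorohod0 R) ->
  \forall n \near \oo, expR (- ((a n)^-1 * eta)) <= Pr mu [set w | Gamma (walk n w)].
Proof.
move=> s0 eta0 oG iG.
have oG' : <<s open >> (~` Gamma).
  by have [_ hC _] := smallest_sigma_algebra setT (@open (skorohod R)); rewrite -setTD; exact: hC.
have sep x : (rate (0 : R) x <= 1%:E)%E -> ~ closure (~` Gamma) x.
  rewrite rate0E; case: asboolP => [-> _|_]; last by rewrite leye_eq.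
  by move: iG; rewrite -[Gamma in Gamma°]setCK interiorC.
have h0 : (0 : R) ^+ 2 = s2 by rewrite expr0n s0.
have half0 : 0 < 2^-1 :> R by [].
have := walk_upper (lexx 0) h0 ler01 half0 oG' sep; apply: filter_app; near=> n => h.
have n0 : (0 < n)%N by near: n; exact: near_gt0.
have an : 0 < (a n)^-1 by rewrite invr_gt0 a0.
have mG : measurable [set w | Gamma (walk n w)].
  by apply: (measurable_step_path n _ oG) => k; have [] := bmeas_scaled_sum n k.
have := PrC mu mG; rewrite (_ : ~` _ = [set w | (~` Gamma) (walk n w)])// => E.
have exp_half (c : R) : 1 <= c -> expR (- c) <= 2^-1.
  move=> c1; rewrite expRN lef_pV2 ?posrE ?expR_gt0//.
  by apply: le_trans (expR_ge1Dx _); rewrite lerD2l.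
have h1 : expR (- ((a n)^-1 * (1 - 2^-1))) <= 2^-1.
  by apply: exp_half; near: n; apply: near_scale; lra.
have h2 : expR (- ((a n)^-1 * eta)) <= 2^-1.
  by apply: exp_half; near: n; exact: near_scale.
move: h h1 h2; rewrite E; move: (expR _) (expR _) (Pr _ _) => x y z; lra.
Unshelve. all: by end_near. Qed.

(** * The lower bound *)

Section Tilting.
Variables (m : nat) (x : nat -> R).
Hypothesis m0 : (0 < m)%N.
Hypothesis s2p : 0 < s2.
Let mR : 0 < m%:R :> R. Proof. by rewrite ltr0n. Qed.

Let th i : R := m%:R * x i / s2.
Let G : R := m%:R * (\sum_(i < m) x i ^+ 2) / (2 * s2).
Let L : R := \sum_(i < m) `|th i|.
Let q2 (t : nat -> R) : R := \sum_(i < m) t i ^+ 2 * s2 / (2 * m%:R).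
Let tilt i0 (s : R) i : R := th i + (if i == i0 then s else 0).

Definition tube n (delta : R) : set Om :=
  \bigcap_(i in [set: 'I_m]) [set w | `|increment m n i w - x i| <= delta].

Lemma measurable_tube n (delta : R) : measurable (tube n delta).
Proof.
apply: fin_bigcap_measurable => // i _.
have := measurable_ge (- delta) (bmeasZ (-1) (bmeas_norm (bmeasB (bmeas_increment m n i) (bmeas_cst _ (x i))))).
rewrite (_ : [set _ | _ ] = [set w | `|increment m n i w - x i| <= delta])//.
by apply/seteqP; split => w /=; rewrite mulN1r lerN2.
Qed.

Let q2th : q2 th = G.
Proof.
rewrite /q2 /G mulr_sumr mulr_suml; apply: eq_bigr => i _; rewrite /th.
by field; rewrite !gt_eqF.
Qed.

Let thx : \sum_(i < m) th i * x i = 2 * G.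
Proof.
rewrite /G mulrA mulr_sumr mulr_sumr mulr_suml; apply: eq_bigr => i _; rewrite /th.
by field; rewrite !gt_eqF.
Qed.

Let q2tilt (i0 : 'I_m) (s : R) : q2 (tilt i0 s) = G + s * x i0 + s ^+ 2 * s2 / (2 * m%:R).
Proof.
rewrite -q2th /q2 (bigD1 i0)//= [in RHS](bigD1 i0)//= /tilt eqxx.
have -> : \sum_(i < m | i != i0) (th i + (if (i : nat) == i0 then s else 0)) ^+ 2 * s2 / (2 * m%:R) =
    \sum_(i < m | i != i0) th i ^+ 2 * s2 / (2 * m%:R).
  by apply: eq_bigr => i; rewrite -val_eqE /= => /negbTE ->; rewrite addr0.
by move: (\sum_(i < m | _) _) => S; rewrite /th; field; rewrite !gt_eqF.
Qed.

Let sum_tilt (i0 : 'I_m) (s : R) n w : \sum_(i < m) tilt i0 s i * increment m n i w =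
  \sum_(i < m) th i * increment m n i w + s * increment m n i0 w.
Proof.
have -> : \sum_(i < m) tilt i0 s i * increment m n i w =
    \sum_(i < m) (th i * increment m n i w + (if (i : nat) == i0 then s else 0) * increment m n i w).
  by apply: eq_bigr => i _; rewrite -mulrDl.
rewrite big_split/=; congr (_ + _).
rewrite (bigD1 i0)//= eqxx big1 ?addr0// => i; rewrite -val_eqE /= => /negbTE ->.
by rewrite mul0r.
Qed.

(** Weighting by exp (<th, increments> / a n) moves the mean of the increments
to x: under the weighted law the tube has probability near one, by Chernoff
bounds for each coordinate at the optimal shift m delta / s2. *)
Lemma tube_lower (delta : R) : 0 < delta -> \forall n \near \oo,
  expR (- ((a n)^-1 * (G + L * delta + m%:R * delta ^+ 2 / (4 * s2)))) <= Pr mu (tube n delta).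
Proof.
move=> d0; pose ep := m%:R * delta ^+ 2 / (8 * s2).
have ep0 : 0 < ep.
  have p8 : 0 < 8 * s2 by rewrite mulr_gt0.
  exact: divr_gt0 (mulr_gt0 mR (exprn_gt0 2 d0)) p8.
(* The shift of one coordinate at which its Chernoff bound is best. *)
pose s := m%:R * delta / s2.
have sE : s * delta = 8 * ep by rewrite /s /ep; field; rewrite gt_eqF.
have ssE : s ^+ 2 * s2 / (2 * m%:R) = 4 * ep by rewrite /s /ep; field; rewrite !gt_eqF.
have H1 := laplace_grid_lower m0 th ep0.
have H2 (b : bool) : \forall n \near \oo, forall i : 'I_m,
    Ex (fun w => expR ((a n)^-1 * \sum_(j < m) tilt i ((-1) ^+ b * s) j * increment m n j w)) <=
    expR ((a n)^-1 * (q2 (tilt i ((-1) ^+ b * s)) + ep)).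
  by apply: filter_forall => i; exact: laplace_grid_upper.
have H2f := H2 false; have H2t := H2 true.
have eE : m%:R * delta ^+ 2 / (4 * s2) = 2 * ep by rewrite /ep; field; rewrite gt_eqF.
rewrite eE; near=> n.
have n0 : (0 < n)%N by near: n; exact: near_gt0.
have ia : 0 < (a n)^-1 by rewrite invr_gt0 a0.
have G1 : expR ((a n)^-1 * (G - ep)) <=
    Ex (fun w => expR ((a n)^-1 * \sum_(i < m) th i * increment m n i w)).
  by rewrite -q2th; near: n; exact: H1.
have G2 (b : bool) (i : 'I_m) :
    Ex (fun w => expR ((a n)^-1 * \sum_(j < m) tilt i ((-1) ^+ b * s) j * increment m n j w)) <=
    expR ((a n)^-1 * (q2 (tilt i ((-1) ^+ b * s)) + ep)).
  by move: i; case: b; near: n; [exact: H2t|exact: H2f].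
have hN : 4 * m%:R <= (a n)^-1 * ep by near: n; exact: near_scale.
have h2 : 2 <= (a n)^-1 * ep by near: n; exact: near_scale.
pose S w := \sum_(i < m) th i * increment m n i w.
have binc i : bmeas (increment m n i) by exact: bmeas_increment.
have bS : bmeas S by apply: bmeas_sum => i; exact: bmeasZ.
have beS : bmeas (fun w => expR ((a n)^-1 * S w)) by apply: bmeas_exp; exact: bmeasZ.
pose tail (b : bool) (i : 'I_m) w : R :=
  expR (- ((a n)^-1 * ((-1) ^+ b * s * x i + s * delta))) *
  expR ((a n)^-1 * \sum_(j < m) tilt i ((-1) ^+ b * s) j * increment m n j w).
have btail b i : bmeas (tail b i).
  by apply: bmeasZ; apply: bmeas_exp; apply: bmeasZ; apply: bmeas_sum => j; exact: bmeasZ.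
have mt := measurable_tube n delta.
pose top : R := expR ((a n)^-1 * (2 * G + L * delta)).
have s0 : 0 <= s by rewrite divr_ge0 ?mulr_ge0 ?(ltW d0) ?(ltW s2p).
(* Outside the tube some increment deviates by delta upwards or downwards, and
   the weight is below the corresponding shifted weight. *)
have pt w : expR ((a n)^-1 * S w) <= top * \1_(tube n delta) w + \sum_(i < m) (tail false i w + tail true i w).
  have t0 b i : 0 <= tail b i w by rewrite mulr_ge0 ?expR_ge0.
  have ts0 : 0 <= \sum_(i < m) (tail false i w + tail true i w).
    by apply: sumr_ge0 => i _; exact: addr_ge0.
  rewrite indicE; have [/set_mem win|/negP wout] := boolP (w \in tube n delta).
    rewrite mulr1; apply: (@le_trans _ _ top); last by rewrite lerDl.
    rewrite ler_expR; apply: ler_wpM2l; first exact: ltW.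
    rewrite -thx -lerBlDl /S /L mulr_suml -sumrB; apply: ler_sum => i _.
    rewrite -mulrBr; apply: le_trans (ler_norm _) _; rewrite normrM.
    by apply: ler_wpM2l => //; exact: win.
  rewrite mulr0 add0r; have [i wi] : exists i : 'I_m, delta < `|increment m n i w - x i|.
    apply: contrapT => h; apply: wout; apply: mem_set => i _ /=.
    by rewrite leNgt; apply/negP => h'; apply: h; exists i.
  have key (b : bool) : delta <= (-1) ^+ b * (increment m n i w - x i) -> expR ((a n)^-1 * S w) <= tail b i w.
    move=> h; rewrite /tail -expRD ler_expR sum_tilt -/(S w) -mulrN -mulrDr.
    apply: ler_wpM2l; first exact: ltW.
    have := ler_wpM2l s0 h; move: (S w) (increment m n i w) ((-1) ^+ b) => u v sg hh.
    have -> : - (sg * s * x i + s * delta) + (u + sg * s * v) = u + (s * (sg * (v - x i)) - s * delta) by ring.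
    by rewrite lerDl subr_ge0.
  rewrite (bigD1 i)//=; apply: (@le_trans _ _ (tail false i w + tail true i w)); last first.
    by rewrite lerDl; apply: sumr_ge0 => j _; exact: addr_ge0.
  move: wi.
  have [hp|hn] := leP 0 (increment m n i w - x i).
    rewrite ger0_norm// => hh; apply: (@le_trans _ _ (tail false i w)); last by rewrite lerDl.
    by apply: key; rewrite expr0 mul1r ltW.
  rewrite ltr0_norm// => hh; apply: (@le_trans _ _ (tail true i w)); last by rewrite lerDr.
  by apply: key; rewrite expr1 mulN1r ltW.
have tail_le (b : bool) (i : 'I_m) : Ex (tail b i) <= expR ((a n)^-1 * (G - 3 * ep)).
  rewrite /tail ExZ; last by apply: bmeas_exp; apply: bmeasZ; apply: bmeas_sum => j; exact: bmeasZ.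
  apply: le_trans (ler_wpM2l (expR_ge0 _) (G2 b i)) _.
  rewrite -expRD ler_expR q2tilt sE -mulrN -mulrDr; apply: ler_wpM2l; first exact: ltW.
  have -> : ((-1) ^+ b * s) ^+ 2 * s2 / (2 * m%:R) = 4 * ep by rewrite exprMn sqrr_sign mul1r.
  rewrite le_eqVlt; apply/orP; left; apply/eqP; ring.
have main : expR ((a n)^-1 * (G - ep)) <= top * Pr mu (tube n delta) + 2 * m%:R * expR ((a n)^-1 * (G - 3 * ep)).
  apply: le_trans G1 _.
  have bi := bmeas_indic R mt.
  have bst : bmeas (fun w => \sum_(i < m) (tail false i w + tail true i w)).
    by apply: bmeas_sum => i; exact: bmeasD.
  apply: le_trans (@Ex_le _ _ _ mu _ _ beS (bmeasD (bmeasZ top bi) bst) pt) _.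
  rewrite ExD//; last exact: bmeasZ.
  rewrite ExZ// -Pr_Ex// lerD2l Ex_sum; last by move=> i; exact: bmeasD.
  apply: (@le_trans _ _ (\sum_(i < m) (2 * expR ((a n)^-1 * (G - 3 * ep))))).
    apply: ler_sum => i _; rewrite ExD// mulr_natl mulr2n; exact: lerD.
  by rewrite sumr_const card_ord -[leLHS]mulr_natr mulrAC.
have small : 2 * m%:R * expR ((a n)^-1 * (G - 3 * ep)) <= 2^-1 * expR ((a n)^-1 * (G - ep)).
  have -> : (a n)^-1 * (G - ep) = 2 * ((a n)^-1 * ep) + (a n)^-1 * (G - 3 * ep) by ring.
  rewrite expRD [leRHS]mulrA; apply: ler_wpM2r; first exact: expR_ge0.
  have : 2 * ((a n)^-1 * ep) <= expR (2 * ((a n)^-1 * ep)).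
    by apply: le_trans (expR_ge1Dx _); rewrite lerDr.
  have mp := ltW mR; move: mp hN; move: ((a n)^-1 * ep) (expR _) (m%:R : R) => u v t ? ? ?; lra.
have half : 2^-1 * expR ((a n)^-1 * (G - ep)) <= top * Pr mu (tube n delta).
  move: main small; move: (expR _) (top * _) (2 * m%:R * _) => u v t ? ?; lra.
have -> : - ((a n)^-1 * (G + L * delta + 2 * ep)) =
    - ((a n)^-1 * ep) + (a n)^-1 * (G - ep) - (a n)^-1 * (2 * G + L * delta) by ring.
rewrite expRB -/top ler_pdivrMr ?expR_gt0// [leRHS]mulrC; apply: le_trans half.
rewrite expRD; apply: ler_wpM2r; first exact: expR_ge0.
rewrite expRN lef_pV2 ?posrE ?expR_gt0//.
apply: le_trans (expR_ge1Dx _); apply: le_trans h2 _; by rewrite lerDr.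
Unshelve. all: by end_near. Qed.

End Tilting.

(** Errors of the increments add up along the grid. *)
Lemma tube_grid m (x : nat -> R) n (delta : R) w : (0 < m)%N -> 0 <= delta ->
  tube m x n delta w -> forall i, (i <= m)%N ->
  `|scaled_sum n (knot m n i) w - \sum_(0 <= j < i) x j| <= m%:R * delta.
Proof.
move=> m0 d0 ht i im; apply: (@le_trans _ _ (i%:R * delta)); last by apply: ler_wpM2r; rewrite ?ler_nat.
elim: i im => [|i IH] im; first by rewrite big_geq// knot0 scaled_sum0 subrr normr0 mul0r.
rewrite big_nat_recr//=.
have h := ht (Ordinal im) Logic.I; rewrite /= increment_scaled_sum in h.
have -> : scaled_sum n (knot m n i.+1) w - (\sum_(0 <= j < i) x j + x i) =
  (scaled_sum n (knot m n i) w - \sum_(0 <= j < i) x j) +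
  (scaled_sum n (knot m n i.+1) w - scaled_sum n (knot m n i) w - x i) by ring.
apply: le_trans (ler_normD _ _) _; rewrite -natr1 mulrDl mul1r; apply: lerD => //.
exact: IH (ltnW im).
Qed.

(** The energy of the grid values of h bounds the cost of forcing the increments
into a tube around those of h; the grid is fine enough for the oscillations
of h and of the walk to be negligible. *)
Lemma walk_lower (sigma eta J : R) (h : skorohod R) (Gamma : set (skorohod R)) :
  0 < sigma -> sigma ^+ 2 = s2 -> 0 < eta -> 0 <= J -> <<s open >> Gamma -> Gamma° h ->
  (rate sigma h <= J%:E)%E ->
  \forall n \near \oo, expR (- ((a n)^-1 * (J + eta))) <= Pr mu [set w | Gamma (walk n w)].
Proof.
move=> sig0 sigE eta0 J0 oG iG hJ.
have s2p : 0 < s2 by rewrite -sigE exprn_gt0.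
have /(rate_leP h sig0 J0)[h0 hE] := hJ.
pose beta := 2 * sigma ^+ 2 * J.
have b0 : 0 <= beta by apply: mulr_ge0 => //; apply: mulr_ge0 => //; exact: sqr_ge0.
have /nbhs_ballP[e /= e0 He] : nbhs h Gamma by [].
(* The three errors of the comparison of h with the walk add up to 3 eps. *)
pose eps := e / 5; have eps0 : 0 < eps by rewrite divr_gt0.
have [m1 m10 osc] := oscillation_negligible (J + eta) eps0.
pose r := eps ^+ 2 / (beta + 1).
have r0 : 0 < r by rewrite divr_gt0 ?exprn_gt0// ltr_wpDl.
pose m' := (m1 + Num.bound (`|r^-1|))%N; pose m := m'.+1.
have m0 : (0 < m)%N by []. have mR : 0 < m%:R :> R by rewrite ltr0n.
have mr : m%:R^-1 <= r.
  rewrite -[leRHS]invrK lef_pV2 ?posrE ?invr_gt0//.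
  apply: le_trans (ler_norm _) _; apply: le_trans (ltW (archi_boundP (normr_ge0 _))) _.
  by rewrite ler_nat /m /m' -addnS; apply: leq_trans (leq_addl _ _); exact: leqW.
have {}osc := osc m (leq_trans (leq_addr _ _) (leqnSn m')).
pose x i := h (i.+1%:R / m%:R) - h (i%:R / m%:R).
have sumx i : \sum_(0 <= j < i) x j = h (i%:R / m%:R).
  by rewrite /x (telescope_sumr (fun i => h (i%:R / m%:R)))// mul0r h0 subr0.
pose L := \sum_(i < m) `|m%:R * x i / s2|.
have L0 : 0 <= L by apply: sumr_ge0.
pose delta := Num.min (eps / m%:R) (Num.min (eta / (8 * (L + 1))) (Num.sqrt (eta * s2 / (2 * m%:R)))).
have L1 : 0 < 8 * (L + 1) by apply: mulr_gt0 => //; rewrite ltr_wpDl.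
have sq0 : 0 < eta * s2 / (2 * m%:R) by apply: divr_gt0; exact: mulr_gt0.
have d0 : 0 < delta.
  by rewrite !lt_min (divr_gt0 eps0 mR) (divr_gt0 eta0 L1) sqrtr_gt0 sq0.
have d1 : m%:R * delta <= eps by rewrite mulrC -ler_pdivlMr// ge_min lexx.
have d2 : L * delta <= eta / 8.
  apply: (@le_trans _ _ ((L + 1) * (eta / (8 * (L + 1))))).
    apply: ler_pM => //; [exact: ltW|by rewrite lerDl|by rewrite !ge_min lexx orbT].
  rewrite le_eqVlt; apply/orP; left; apply/eqP; field.
  by rewrite gt_eqF// ltr_wpDl.
have d3 : m%:R * delta ^+ 2 / (4 * s2) <= eta / 8.
  have : delta ^+ 2 <= eta * s2 / (2 * m%:R).
    rewrite -[leRHS]sqr_sqrtr ?(ltW sq0)// ler_pXn2r ?nnegrE ?sqrtr_ge0 ?(ltW d0)//.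
    by rewrite !ge_min lexx !orbT.
  have p4 : 0 < 4 * s2 by rewrite mulr_gt0.
  move=> hd; rewrite ler_pdivrMr//; apply: le_trans (ler_wpM2l (ltW mR) hd) _.
  by rewrite le_eqVlt; apply/orP; left; apply/eqP; field; rewrite gt_eqF.
have GJ : m%:R * (\sum_(i < m) x i ^+ 2) / (2 * s2) <= J.
  have p2 : 0 < 2 * s2 by rewrite mulr_gt0.
  rewrite ler_pdivrMr//; apply: le_trans (energy_le_grid m' b0 hE) _.
  by rewrite /beta sigE mulrC.
have tb := tube_lower x m0 s2p d0.
have eta4 : 0 < eta / 4 by rewrite divr_gt0.
have abs := near_absorb (1 + m%:R * expR 4) (J + eta) eta4.
near=> n.
have n0 : (0 < n)%N by near: n; exact: near_gt0.
have ia : 0 < (a n)^-1 by rewrite invr_gt0 a0.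
have [mo ho] : measurable (oscillation m n eps) /\
    Pr mu (oscillation m n eps) <= m%:R * expR 4 * expR (- ((a n)^-1 * (J + eta))).
  by near: n; exact: osc.
have ht : expR (- ((a n)^-1 * (m%:R * (\sum_(i < m) x i ^+ 2) / (2 * s2) + L * delta +
    m%:R * delta ^+ 2 / (4 * s2)))) <= Pr mu (tube m x n delta) by near: n; exact: tb.
have h3 : (1 + m%:R * expR 4) * expR (- ((a n)^-1 * (J + eta))) <=
    expR (- ((a n)^-1 * (J + eta - eta / 4))) by near: n; exact: abs.
have mG : measurable [set w | Gamma (walk n w)].
  by apply: (measurable_step_path n _ oG) => k; have [] := bmeas_scaled_sum n k.
have mt := measurable_tube m x n delta.
have cover : Pr mu (tube m x n delta) <= Pr mu [set w | Gamma (walk n w)] + Pr mu (oscillation m n eps).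
  apply: le_trans (PrU mu mG mo); apply: Pr_le => //; first exact: measurableU.
  move=> w tw; have [ow|now] := pselect (oscillation m n eps w); [by right|left].
  apply: He; apply: (@uniform_ball _ _ _ (3 * eps)); first by rewrite /eps; lra.
  move=> t t01; have [i [im it ti hw]] := walk_cell m0 n0 now t01.
  have hz := tube_grid m0 (ltW d0) tw (ltnW im); rewrite sumx in hz.
  have hz' := le_trans hz d1.
  have i01 : 0 <= (i%:R / m%:R : R) <= 1.
    by rewrite divr_ge0//= ler_pdivrMr// mul1r ler_nat ltnW.
  have hm : `|h t - h (i%:R / m%:R)| <= eps.
    apply: (holder_modulus b0 (energy_holder hE) eps0 i01 t01).
    apply: le_trans mr; rewrite ger0_norm ?subr_ge0// lerBlDr.
    by apply: le_trans ti _; rewrite -natr1 mulrDl mul1r addrC.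
  have -> : h t - walk n w t = (h t - h (i%:R / m%:R)) - (scaled_sum n (knot m n i) w - h (i%:R / m%:R)) -
    (walk n w t - scaled_sum n (knot m n i) w) by ring.
  apply: le_trans (ler_normB _ _) _.
  have -> : 3 * eps = eps + eps + eps by ring.
  apply: lerD => //; apply: le_trans (ler_normB _ _) _; exact: lerD.
have big : expR (- ((a n)^-1 * (J + eta - eta / 4))) <= Pr mu (tube m x n delta).
  apply: le_trans ht; rewrite ler_expR lerN2; apply: ler_wpM2l; first exact: ltW.
  apply: le_trans (lerD (lerD GJ d2) d3) _.
  have e0' := eta0; move: e0'; move: (J) (eta) => u v ?; lra.
move: (le_trans h3 big) cover ho; rewrite mulrDl mul1r.
move: (expR (- _)) (Pr mu _) (Pr mu _) (Pr mu _) => u v t z ? ? ?; lra.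
Unshelve. all: by end_near. Qed.

(** * The moderate deviation principle *)

(** The infimum over the closure may be infinite: the upper bound is then
obtained for every finite level. *)
Lemma lee_of_nonneg_reals (x y : \bar R) : (0 <= y)%E ->
  (forall r : R, 0 <= r -> (r%:E < x)%E -> (r%:E <= y)%E) -> (x <= y)%E.
Proof.
move=> y0 h; rewrite leNgt; apply/negP => yx.
case: y y0 h yx => [y| |]// y0 h yx; last by move: yx; rewrite ltNge leey.
move: y0; rewrite lee_fin => y0.
case: x h yx => [x| |]// h yx.
  move: yx; rewrite lte_fin => yx; have := h ((x + y) / 2).
  rewrite lte_fin lee_fin => h'; have := h' _ _; lra.
have := h (y + 1) (addr_ge0 y0 ler01) (ltry _); rewrite lee_fin; lra.
Qed.

Lemma lne_expR_le (b c P : R) : 0 < b -> P <= expR (- (b^-1 * c)) ->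
  (b%:E * lne P%:E <= (- c)%:E)%E.
Proof.
move=> b0 Pc; rewrite /lne; case: ifPn => [_|]; first by rewrite gt0_muleNy ?lte_fin// leNye.
rewrite -ltNge => P0; rewrite -EFinM lee_fin -ler_pdivlMl//.
by rewrite mulrN -ler_expR lnK.
Qed.

Lemma lne_expR_ge (b c P : R) : 0 < b -> expR (- (b^-1 * c)) <= P ->
  ((- c)%:E <= b%:E * lne P%:E)%E.
Proof.
move=> b0 Pc; have P0 : 0 < P := lt_le_trans (expR_gt0 _) Pc.
rewrite lne_EFin// -EFinM lee_fin -ler_pdivrMl//.
by rewrite mulrN -ler_expR lnK.
Qed.

(** Finite levels below the infimum over the closure give the upper bound, single
paths of the interior the lower bound. *)
Lemma walk_MDP (W : nat -> Om -> skorohod R) (sigma : R) :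
  0 <= sigma -> sigma ^+ 2 = s2 ->
  (forall n w, (0 < n)%N -> skorohod_scale (Num.sqrt (a n)) (W n w) = walk n w) ->
  MDP mu W a (rate sigma).
Proof.
move=> sig0 sigE WE; split; first by move=> alpha; exact: compact_rate.
move=> Gamma oG p.
have pE n : (0 < n)%N -> p n = ((a n)%:E * lne (Pr mu [set w | Gamma (walk n w)])%:E)%E.
  move=> n0; rewrite /p; under eq_set => w do rewrite WE//.
  rewrite PrE//.
  by apply: (measurable_step_path n _ oG) => k; have [] := bmeas_scaled_sum n k.
have upper (c : R) : (\forall n \near \oo, Pr mu [set w | Gamma (walk n w)] <= expR (- ((a n)^-1 * c))) ->
    (limn_esup p <= (- c)%:E)%E.
  move=> h; apply: limn_esup_le; apply: filterS2 near_gt0 h => n n0 h.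
  by rewrite pE//; apply: lne_expR_le => //; exact: a0.
have lower (c : R) : (\forall n \near \oo, expR (- ((a n)^-1 * c)) <= Pr mu [set w | Gamma (walk n w)]) ->
    ((- c)%:E <= limn_einf p)%E.
  move=> h; apply: limn_einf_ge; apply: filterS2 near_gt0 h => n n0 h.
  by rewrite pE//; apply: lne_expR_ge => //; exact: a0.
split; last 2 first.
- exact: limn_einf_sup.
- rewrite leeNr; apply: lee_of_nonneg_reals.
    rewrite leeNr -EFinN; apply: upper; near=> n.
    rewrite mulr0 oppr0 expR0; apply: Pr_le1.
    by apply: (measurable_step_path n _ oG) => k; have [] := bmeas_scaled_sum n k.
  move=> r r0 rb; have sep x : (rate sigma x <= r%:E)%E -> ~ closure Gamma x.
    move=> xr cx; move: rb; rewrite ltNge => /negP; apply; apply: le_trans xr.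
    by apply: ereal_inf_lbound; exists x.
  rewrite leeNr; apply/lee_addgt0Pr => e e0.
  rewrite -EFinN -EFinD (_ : - r + e = - (r - e)); last by ring.
  by apply: upper; exact: (walk_upper sig0 sigE r0 e0 oG sep).
rewrite leeNl; apply: le_ereal_inf_tmp => _ [x ix <-].
have := rate_ge0 sigma x; case E : (rate sigma x) => [J| |]//; last by move=> _; exact: leey.
rewrite lee_fin => J0; apply/lee_addgt0Pr => e e0.
rewrite -EFinD leeNl -EFinN; apply: lower.
move: sig0; rewrite le_eqVlt => /orP[/eqP s0|s0]; last first.
  by apply: (walk_lower s0 sigE e0 J0 oG ix); rewrite E.
move: E; rewrite -s0 rate0E; case: asboolP => // x0 [<-]; rewrite add0r.
apply: walk_lower_degenerate => //; first by rewrite -sigE -s0 expr0n.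
by rewrite -x0.
Unshelve. all: by end_near. Qed.

End Scaling.

(** * Application to the dynamical process *)

Section Reversal.
Context d (Om : measurableType d) (R : realType).
Variables (T : Om -> Om) (phi : Om -> R).

(** The process runs along the orbit backwards from time n. *)
Lemma birkhoff_tail n k x : (k <= n)%N ->
  \sum_(1 <= i < k.+1) phi (iter (n - i).+1 T x) =
  birkhoff T phi n x - birkhoff T phi (n - k) x.
Proof.
elim: k => [|k IH] kn; first by rewrite big_geq// subn0 subrr.
rewrite big_nat_recr//= IH; last exact: ltnW.
rewrite -(subnSK kn) /birkhoff [X in _ - X + _]big_ord_recr/=.
by ring.
Qed.

Lemma scaled_step_path (a : nat -> R) n x : (0 < n)%N -> 0 < a n ->
  skorohod_scale (Num.sqrt (a n)) (step_path (fun m => (Num.sqrt n%:R)^-1 *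
    \sum_(1 <= i < m.+1) phi (iter (n - i).+1 T x)) n) = walk T phi a n x.
Proof.
move=> n0 an; apply: skorohod_eq => t; rewrite /= /step_fun.
case: ifPn => t01; last by rewrite mulr0.
have nR : 0 < n%:R :> R by rewrite ltr0n.
move: t01; rewrite in_itv/= => /andP[t0 t1].
have kn : (Num.truncn (n%:R * t) <= n)%N.
  rewrite -(ler_nat R); have /andP[k1 _] := truncn_itv (mulr_ge0 (ltW nR) t0).
  by apply: le_trans k1 _; rewrite -[leRHS]mulr1 ler_wpM2l// ltW.
rewrite birkhoff_tail// /scaled_sum /inv_scale sqrtrM ?(ltW nR)// mulrA; congr (_ * _).
have sn : 0 < Num.sqrt n%:R :> R by rewrite sqrtr_gt0.
have sa : 0 < Num.sqrt (a n) by rewrite sqrtr_gt0.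
rewrite -[X in _ = X / _](sqr_sqrtr (ltW an)); field.
by rewrite !gt_eqF.
Qed.

End Reversal.

Theorem corollary11 (R : realType) (mu : probability (I01 R) R)
    (T : I01 R -> I01 R) (f : R -> R) :
  preserves mu T -> BV_contracting mu T ->
  bounded_variation 0 1 f \/ class_L f ->
  exists sigma : R,
    [/\ 0 <= sigma,
        var_partial mu T f N @[N --> \oo] --> sigma ^+ 2 &
        forall a : nat -> R,
          (forall n, (0 < n)%N -> 0 < a n) ->
          a n @[n --> \oo] --> 0 ->
          (n%:R * a n) @[n --> \oo] --> +oo ->
          MDP mu (Wproc mu T f) a (rate sigma)].
Proof.
move=> pres contr fBL; have [mT pT] := pres.
have [bphi [s2 [C [s20 C0 app vcv SG]]]] := dynamical_input pres contr fBL.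
have sE : Num.sqrt s2 ^+ 2 = s2 by rewrite sqr_sqrtr.
exists (Num.sqrt s2); split; [exact: sqrtr_ge0|by rewrite sE|].
move=> a a0 acv nacv.
apply: (walk_MDP mT pT bphi app s20 C0 SG a0 acv nacv (sqrtr_ge0 _) sE) => n x n0.
exact: (scaled_step_path T _ x n0 (a0 n n0)).
Qed.
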